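(* Let $s>5/2$. There exist non-decreasing functions $C_1,C_2$ (depending on $h$ and $h_0$) such that the following holds. If $\eta,\beta\in H^{s+1/2}(\mathbb{T})$ satisfy $h-\beta(x)+\eta(x)\ge h_0$ for all $x\in\mathbb{T}$ (with $h_0>0$), if $\gamma\in\mathbb{R}$ and if $\psi\in H^s(\mathbb{T})$, then $$G(\eta,\beta,\gamma)(\psi)=T_\lambda\,\omega-T_{V(\eta,\beta,\gamma)(\psi)}\,\eta_x+\mathcal{R}(\eta,\beta,\gamma,\psi),$$ where $$\omega=\omega(\eta,\beta,\gamma)(\psi)=\psi-T_{B(\eta,\beta,\gamma)(\psi)}\eta\in H^s(\mathbb{T}),$$ $$V(\eta,\beta,\gamma)(\psi)=\psi_x-B(\eta,\beta,\gamma)(\psi)\,\eta_x\in H^{s-1}(\mathbb{T}),\qquad B(\eta,\beta,\gamma)(\psi)=\frac{G(\eta,\beta,\gamma)(\psi)+\eta_x\psi_x}{1+\eta_x^2}\in H^{s-1}(\mathbb{T}),$$ and where the symbol $\lambda=\lambda^{(1)}+\lambda^{(0)}$ does not depend on $\gamma$ and on $\beta$, with $\lambda^{(1)}=|\xi|$ and $\lambda^{(0)}$ a symbol of order $0$. Moreover, the remainder $\mathcal{R}(\eta,\beta,\gamma,\psi)\in H^{s+1/2}(\mathbb{T})$ satisfies $$\|\mathcal{R}(\eta,\beta,\gamma,\psi)\|_{H^{s+1/2}(\mathbb{T})}\le C_1\big(\|\eta\|_{H^{s+1/2}(\mathbb{T})},\|\beta\|_{H^{s+1/2}(\mathbb{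T})}\big)\|\psi\|_{H^s(\mathbb{T})}+|\gamma|\,C_2\big(\|\eta\|_{H^{s+1/2}(\mathbb{T})},\|\beta\|_{H^{s+1/2}(\mathbb{T})}\big).$$
   Context: $\mathbb{T}=\mathbb{R}/(2\pi\mathbb{Z})$; $h>0$ is a fixed depth; $H^s(\mathbb{T})$ is the periodic Sobolev space. For $\eta,\beta:\mathbb{T}\to\mathbb{R}$ put $D_{\eta,\beta}=\{(x,y)\in\mathbb{T}\times\mathbb{R}: -h+\beta(x)<y<\eta(x)\}$. Given $\psi$ and $\gamma$, let $\varphi$ solve $$\Delta\varphi=0 \text{ in } D_{\eta,\beta},\quad \varphi=\psi \text{ at } y=\eta,\quad \gamma\, y\,\beta_x-\varphi_x\beta_x+\varphi_y=0 \text{ at } y=-h+\beta,$$ and set $G(\eta,\beta,\gamma)(\psi)=\nabla\varphi\cdot(-\eta_x,1)^T|_{y=\eta(x)}$. Symbols: for $\varrho\ge0$, $m\in\mathbb{R}$, $\Gamma^m_\varrho(\mathbb{T})$ is the space of functions $a(x,\xi)$ on $\mathbb{T}\times(\mathbb{R}\setminus\{0\})$, $C^\infty$ in $\xi\ne0$, such that for all $\alpha\in\mathbb{N}$ there is $C_\alpha>0$ with $\|\partial_\xi^\alpha a(\cdot,\xi)\|_{W^{\varrho,\infty}(\mathbb{T})}\le C_\alpha(1+|\xi|)^{m-\alpha}$ for all $\xi\neq0$. A symbol of order $m$ is an element of $\Gamma^m_\varrho(\mathbb{T})$ for some $\varrho\ge 0$. Paradifferential operators: fix $0<\varepsilon_1<\varepsilon_2$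 sufficiently small and a function $\chi(\xi_1,\xi_2)$, homogeneous of degree $0$ and $C^\infty$ away from the origin, with $\chi=1$ if $|\xi_1|\le\varepsilon_1|\xi_2|$, $\chi=0$ if $|\xi_1|\ge\varepsilon_2|\xi_2|$, and $\chi(\xi_1,\xi_2)=\chi(-\xi_1,-\xi_2)=\chi(-\xi_1,\xi_2)$. For a symbol $a$, $T_a$ is defined by $$\mathscr{F}(T_au)(\xi)=(2\pi)^{-1}\sum_{k\in\mathbb{Z}}\chi(\xi-k,k)\,(\mathscr{F}a)(\xi-k,k)\,(\mathscr{F}u)(k),$$ where $\mathscr{F}a$ is the Fourier transform of $a$ in its first variable (the term $k=0$ is taken to be zero). For a function $a=a(x)$, $T_a$ is the paraproduct obtained by regarding $a$ as a symbol independent of $\xi$. *)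

(* Defs.v *)
(* Functions on the torus R / 2 pi Z are 2 pi-periodic functions on R.  Periodic
   distributions are identified with their families of Fourier coefficients
   [int -> R[i]]; paradifferential operators act on such families. *)
From HB Require Import structures.
From mathcomp Require Import all_boot all_order all_algebra.
From mathcomp Require Import all_classical all_reals all_analysis.
From mathcomp Require Import complex.
Set Implicit Arguments.
Unset Strict Implicit.
Unset Printing Implicit Defensive.
Import Order.TTheory GRing.Theory Num.Theory.
Import numFieldNormedType.Exports.
Local Open Scope classical_set_scope.
Local Open Scope ring_scope.
Local Open Scope complex_scope.

Section Fourier.
Context {R : realType}.
Implicit Types (u : R -> R[i]) (c : int -> R[i]).

Definition ofreal (f : R -> R) : R -> R[i] := fun x => (f x)%:C.

Definition expi (t : R) : R[i] := cos t +i* sin t.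

Definition integral_torus u : R[i] :=
  (\int[lebesgue_measure]_(x in `[0, 2 * pi]) complex.Re (u x))
  +i* (\int[lebesgue_measure]_(x in `[0, 2 * pi]) complex.Im (u x)).

(* Unnormalised, so that the coefficients of a product are (2 pi)^-1 times the
   convolution of the coefficients. *)
Definition fourier u (k : int) : R[i] :=
  integral_torus (fun x => u x * expi (- (k%:~R * x))).

(* The factor (2 pi)^-1 makes this the squared L^2 norm when [s = 0]. *)
Definition sobolev_sq (s : R) c : \bar R :=
  \esum_(k in [set: int])
    ((2 * pi)^-1 * ((1 + k%:~R ^+ 2) `^ s * Normc.normc (c k) ^+ 2))%:E.

Definition in_sobolev (s : R) c : Prop := (sobolev_sq s c < +oo)%E.

Definition sobolev_norm (s : R) c : R := Num.sqrt (fine (sobolev_sq s c)).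

(* Only meaningful for [s > 1/2], where every element of H^s has a continuous
   representative; [f] is that representative. *)
Definition sobolev_fun (s : R) (f : R -> R) : Prop :=
  [/\ periodic f (2 * pi), continuous f & in_sobolev s (fourier (ofreal f))].

Definition sobolev_fun_norm (s : R) (f : R -> R) : R :=
  sobolev_norm s (fourier (ofreal f)).

End Fourier.

Section Symbols.
Context {R : realType}.

(* [u] belongs to L^oo of the torus, with norm at most [M]. *)
Definition Linf_le (u : R -> R[i]) (M : R) : Prop :=
  [/\ periodic u (2 * pi),
      measurable_fun [set: R] (fun x => complex.Re (u x)),
      measurable_fun [set: R] (fun x => complex.Im (u x)) &
      \forall x \ae (@lebesgue_measure R), Normc.normc (u x) <= M].

Definition weak_derivative (u v : R -> R[i]) : Prop :=
  forall k : int, fourier v k = 'i * (k%:~R * fourier u k).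

(* [u] belongs to W^{rho,oo} of the torus, with norm at most [M]: with
   [n = truncn rho], the weak derivatives up to order [n] are bounded and, if
   [rho] is not an integer, the n-th one is Hoelder of exponent [rho - n].
   The norm is the maximum of the corresponding constants. *)
Definition Winf_le (rho : R) (u : R -> R[i]) (M : R) : Prop :=
  let n := Num.truncn rho in
  let sigma := rho - n%:R in
  exists v : nat -> R -> R[i],
    [/\ v 0%N = u,
        forall j, (j <= n)%N -> Linf_le (v j) M,
        forall j, (j < n)%N -> weak_derivative (v j) (v j.+1) &
        0 < sigma ->
          forall x y, Normc.normc (v n x - v n y) <= M * `|x - y| `^ sigma].

Definition smooth_off0 (f : R -> R) : Prop :=
  forall (n : nat) (xi : R), xi != 0 -> derivable (derive1n n f) xi 1.

Definition dxi (n : nat) (a : R -> R -> R[i]) (x xi : R) : R[i] :=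
  derive1n n (fun t => complex.Re (a x t)) xi
  +i* derive1n n (fun t => complex.Im (a x t)) xi.

(* Values of a symbol at [xi = 0] are irrelevant and unconstrained. *)
Definition Gamma (m rho : R) (a : R -> R -> R[i]) : Prop :=
  (forall x, smooth_off0 (fun t => complex.Re (a x t)) /\
             smooth_off0 (fun t => complex.Im (a x t))) /\
  forall n : nat, exists2 C : R, 0 < C &
    forall xi : R, xi != 0 ->
      Winf_le rho (fun x => dxi n a x xi) (C * (1 + `|xi|) `^ (m - n%:R)).

Definition symbol_of_order (m : R) (a : R -> R -> R[i]) : Prop :=
  exists2 rho : R, 0 <= rho & Gamma m rho a.

End Symbols.

Section Smoothness.
Context {R : realType}.
Implicit Types f : R -> R -> R.

Definition d1 f : R -> R -> R := fun x y => derive1 (fun t => f t y) x.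
Definition d2 f : R -> R -> R := fun x y => derive1 (f x) y.

(* Iterated partial derivative; a word lists the variables, [true] for the
   first one. *)
Definition partials (w : seq bool) f : R -> R -> R :=
  foldr (fun b g => if b then d1 g else d2 g) f w.

(* All iterated partial derivatives up to order [n] exist and are continuous at
   the points of [U] (meant to be open). *)
Definition Ck_on (n : nat) (U : set (R * R)) f : Prop :=
  forall (w : seq bool) (p : R * R), U p ->
    ((size w <= n)%N ->
       {for p, continuous (fun q : R * R => partials w f q.1 q.2)}) /\
    ((size w < n)%N ->
       derivable (fun t => partials w f t p.2) p.1 1 /\
       derivable (partials w f p.1) p.2 1).

End Smoothness.

Section Paradiff.
Context {R : realType}.

(* The origin has to be excluded from every condition: the two support
   conditions contradict each other there. *)
Record cutoff (eps1 eps2 : R) (chi : R -> R -> R) : Prop := Cutoff {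
  cutoff_smooth : forall n, Ck_on n [set p | p != (0, 0)] chi;
  cutoff_homog : forall t x1 x2, 0 < t -> (x1, x2) != (0, 0) ->
    chi (t * x1) (t * x2) = chi x1 x2;
  cutoff_one : forall x1 x2, (x1, x2) != (0, 0) ->
    `|x1| <= eps1 * `|x2| -> chi x1 x2 = 1;
  cutoff_zero : forall x1 x2, (x1, x2) != (0, 0) ->
    eps2 * `|x2| <= `|x1| -> chi x1 x2 = 0;
  cutoff_opp : forall x1 x2, (x1, x2) != (0, 0) ->
    chi x1 x2 = chi (- x1) (- x2);
  cutoff_oppl : forall x1 x2, (x1, x2) != (0, 0) ->
    chi x1 x2 = chi (- x1) x2
}.

(* For a cutoff with [eps2 < 1], chi (n - k, k) vanishes unless
   (1 - eps2) |k| < |n|, so the sum over [k] has finitely many nonzero terms, as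
   required by [\sum_(k \in _)]. *)
Definition paradiff (chi : R -> R -> R) (a : R -> R -> R[i])
    (c : int -> R[i]) (n : int) : R[i] :=
  ((2 * pi)^-1)%:C *
  \sum_(k \in [set k : int | k != 0])
    ((chi (n - k)%:~R k%:~R)%:C * fourier (fun x => a x k%:~R) (n - k) * c k).

Definition paraproduct (chi : R -> R -> R) (f : R -> R) :=
  paradiff chi (fun x _ => (f x)%:C).

End Paradiff.

Section DirichletNeumann.
Context {R : realType}.
Implicit Types eta beta psi : R -> R.

Definition strip (h : R) eta beta : set (R * R) :=
  [set p | - h + beta p.1 < p.2 < eta p.1].

Definition closed_strip (h : R) eta beta : set (R * R) :=
  [set p | - h + beta p.1 <= p.2 <= eta p.1].

(* [phi] is a classical solution, C^2 inside and C^1 up to the boundary;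
   [p] and [q] are the continuous extensions of its x- and y-derivatives to the
   closed strip. *)
Record solves (h : R) eta beta (gamma : R) psi (phi p q : R -> R -> R) : Prop :=
Solves {
  solves_periodic : forall x y, closed_strip h eta beta (x, y) ->
    phi (x + 2 * pi) y = phi x y;
  solves_C2 : Ck_on 2 (strip h eta beta) phi;
  solves_dx : forall x y, strip h eta beta (x, y) -> p x y = d1 phi x y;
  solves_dy : forall x y, strip h eta beta (x, y) -> q x y = d2 phi x y;
  solves_cont :
    {within closed_strip h eta beta, continuous (fun z : R * R => phi z.1 z.2)};
  solves_cont_dx :
    {within closed_strip h eta beta, continuous (fun z : R * R => p z.1 z.2)};
  solves_cont_dy :
    {within closed_strip h eta beta, continuous (fun z : R * R => q z.1 z.2)};
  solves_laplace : forall x y, strip h eta beta (x, y) ->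
    d1 (d1 phi) x y + d2 (d2 phi) x y = 0;
  solves_top : forall x, phi x (eta x) = psi x;
  solves_bottom : forall x, let y := - h + beta x in
    gamma * y * derive1 beta x - p x y * derive1 beta x + q x y = 0
}.

(* [G] is the function G(eta, beta, gamma)(psi). *)
Definition is_DN (h : R) eta beta (gamma : R) psi (G : R -> R) : Prop :=
  exists phi p q, solves h eta beta gamma psi phi p q /\
    forall x, G x = - derive1 eta x * p x (eta x) + q x (eta x).

Definition DN_B eta psi (G : R -> R) : R -> R := fun x =>
  (G x + derive1 eta x * derive1 psi x) / (1 + derive1 eta x ^+ 2).

Definition DN_V eta psi (G : R -> R) : R -> R := fun x =>
  derive1 psi x - DN_B eta psi G x * derive1 eta x.

(* Fourier coefficients of the good unknown omega = psi - T_B eta. *)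
Definition DN_omega (chi : R -> R -> R) eta psi (G : R -> R) (n : int) : R[i] :=
  fourier (ofreal psi) n
  - paraproduct chi (DN_B eta psi G) (fourier (ofreal eta)) n.

End DirichletNeumann.

(* Main.v *)
(** In the fluid [f = phi_x - i phi_y] is holomorphic, and on the surface it is
    [W = V - i B]. A Rellich identity bounds [W] in L^2 and Cauchy's formula then
    bounds [f] below the surface. In collar coordinates [Z t x] the weighted Fourier
    coefficients of [f] solve [w_n' = n w_n + ...]; absorbing the error terms
    bootstraps [W] to H^(s-1) and its positive frequencies to H^(s+1/2), uniformly
    in the bottom. Up to terms of that order the equation thus reduces to an
    identity between paraproducts with [V] and [B] on frequencies of one sign,
    where [|k|] is [k] or [- k]; hence [lambda^(0) = 0] is admissible. *)
Require Import Defs.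
From HB Require Import structures.
From mathcomp Require Import all_boot all_order all_algebra.
From mathcomp Require Import all_classical all_reals all_analysis.
From mathcomp Require Import complex finmap.
From mathcomp Require Import ring lra zify.
Set Implicit Arguments.
Unset Strict Implicit.
Unset Printing Implicit Defensive.
Import Order.TTheory GRing.Theory Num.Theory.
Import numFieldNormedType.Exports.
Local Open Scope classical_set_scope.
Local Open Scope ring_scope.
Local Open Scope complex_scope.

(** All frequency estimates are inequalities between non-negative sequences, closed by one
    principle: if [|x| <= D + M * x] (convolution) with [M] small in a weighted l1 norm, then [x] is
    as good as [D], provided a crude bound on [x] makes the absorption legitimate. Rellich and
    Cauchy supply the crude bound; apart from its distance to the surface, the bottom enters only
    there. Smallness comes from a thin collar. A conformal collar would need [exp (k t)] for
    [k > 0]; a damped profile of the same slope replaces it, and the defect of conformality is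
    [O(d^kap)]. Absorbing sequences that grow like [|n|] needs a weight above 3/2, and the defect
    then costs [5/2 + 2 kap] derivatives of [eta] in l1: this is one place where [s > 5/2] enters.
    Growing modes are unknown at depth [d]; the weights [(d - t)^j] remove that end, each power
    paying for one derivative. Decaying modes start at the surface, where
    [Re (W (1 + i eta_x)) = psi_x] expresses the negative frequencies of [W] through the positive
    ones. *)

Lemma le_of_eq (R : numDomainType) (x y: R) : x = y -> x <= y.
by move=> ->. Qed.

Notation le_via y := (@le_trans _ _ y).
Notation tau := (2 * pi).
Notation minr := Num.min.
Notation unc A := (fun p : _ * _ => A p.1 p.2).
Notation cRe := complex.Re.
Notation cIm := complex.Im.

Hint Extern 0 (is_true (@Order.le _ _ _ (@GRing.exp _ _ (S (S O))))) => exact: sqr_ge0 : core.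
Hint Extern 0 (is_true (@Order.le _ _ _ (@powR _ _ _))) => exact: powR_ge0 : core.
Hint Extern 0 (is_true (@Order.le _ _ _ (@expR _ _))) => exact: expR_ge0 : core.

(** * Sequences on the integers: weighted l1 and l2 bounds, convolution, absorption *)

Section Sequences.
Context {R : realType}.
Implicit Types (x y a b : int -> R) (A B C X Y r c t e d K: R).

Definition asum x : \bar R := \esum_(k in [set: int]) (`|x k|)%:E.

Definition l1 x C : Prop := (asum x <= C%:E)%E.

Definition l2 x C : Prop := 0 <= C /\ (asum (fun k=> x k ^+ 2)%R <= (C ^+ 2)%:E)%E.

(** Convolution of absolute values. [fine] returns 0 on an infinite sum, so upper bounds follow from
    finite partial sums, whereas lower bounds and comparisons with a larger convolution carry a
    summability hypothesis. *)
Definition cv a b (n: int) : R := fine (asum (fun k=> a (n - k) * b k)%R).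

Lemma asum_ge0 x : (0 <= asum x)%E.
by apply: esum_ge0 => k _; rewrite lee_fin. Qed.

Lemma le_asum x y : (forall k, `|x k| <= `|y k|) -> (asum x <= asum y)%E.
by move=> h; apply: le_esum => k _; rewrite lee_fin. Qed.

Lemma asumD x y : (asum (fun k=> x k + y k)%R <= asum x + asum y)%E.
rewrite /asum -esumD => [|k _|k _]; rewrite ?lee_fin//.
by apply: le_esum => k _; rewrite -EFinD lee_fin ler_normD.
Qed.

Lemma asum_fin_le x C :
 (forall F : {fset int}, \sum_(k <- F) `|x k| <= C) -> (asum x <= C%:E)%E.
move=> h; apply: ge_ereal_sup => _ [F [finF _] <-].
rewrite fsbig_finite//= sumEFin lee_fin; exact: h.
Qed.

Lemma asum_fin_ge x C (F : {fset int}) : (asum x <= C%:E)%E ->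
 \sum_(k <- F) `|x k| <= C.
move=> h; rewrite -lee_fin; apply: le_trans h; rewrite -sumEFin.
apply: esum_ge; exists [set` F]; first by split.
by rewrite fsbig_finite//= set_fsetK.
Qed.

Lemma asumZ c x : (asum (fun k=> c * x k)%R) = (`|c|%:E * asum x)%E.
have h (d: R) y : (asum (fun k=> d * y k)%R <= `|d|%:E * asum y)%E.
 have [->|d0] := eqVneq d 0.
 rewrite normr0 mul0e; under [X in asum X]eq_fun do rewrite mul0r.
 by rewrite /asum esum1// => i _; rewrite normr0.
 have [yfin|] := boolP (asum y == +oo%E).
 by rewrite (eqP yfin) mulry gtr0_sg ?normr_gt0// mul1e leey.
 rewrite -ltey => yfin.
 have yE: asum y = (fine (asum y))%:E.
 by rewrite fineK// ge0_fin_numE// asum_ge0.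
 rewrite yE -EFinM; apply: asum_fin_le => F.
 under eq_bigr do rewrite normrM.
 by rewrite -mulr_sumr ler_wpM2l// asum_fin_ge// yE.
apply/eqP; rewrite eq_le h/=.
have [->|c0] := eqVneq c 0; first by rewrite normr0 mul0e asum_ge0.
have := h c^-1 (fun k=> c * x k).
under [X in (asum X <= _)%E -> _]eq_fun do rewrite mulKf//.
rewrite normfV => h1.
apply: (le_via (`|c|%:E * ((`|c|^-1)%:E * asum (fun k=> (c * x k)%R)%R))%E).
 by rewrite lee_wpmul2l// lee_fin.
by rewrite muleA -EFinM divff ?normr_eq0// mul1e.
Qed.

Lemma asum_refl (n: int) x : asum (fun k=> x (n - k))%R = asum x.
rewrite /asum [RHS](@reindex_esum R int int setT setT (fun k=> n - k))//.
split=> [//|k k' _ _ |k _]; first by move=> /addrI /oppr_inj.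
by exists (n - k)=> //; rewrite subKr.
Qed.

Lemma asum_shift (n: int) x : asum (fun k=> x (k - n))%R = asum x.
rewrite /asum [RHS](@reindex_esum R int int setT setT (fun k=> k - n))//.
split=> [//|k k' _ _ |k _]; first by move=> /addIr.
by exists (k + n)=> //; rewrite addrK.
Qed.

Lemma esum_swap (f : int -> int -> \bar R) : (forall i j, (0 <= f i j)%E) ->
 \esum_(i in [set: int]) \esum_(j in [set: int]) f i j =
 \esum_(j in [set: int]) \esum_(i in [set: int]) f i j.
move=> f0; rewrite esum_esum// esum_esum//.
rewrite [RHS](@reindex_esum R _ _ ([set: int] `*`` (fun=> [set: int])) _ (fun p=> (p.2, p.1)))//.
split=> [//|[i j] [i' j'] _ _ |[i j] _] //=; first by move=> [-> ->].
by exists (j, i).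
Qed.

Lemma l1_ge0 x C : l1 x C -> 0 <= C.
by move=> h; rewrite -lee_fin (le_trans (asum_ge0 x)). Qed.

Lemma l1_le x y C : (forall k, `|x k| <= `|y k|) -> l1 y C -> l1 x C.
by move=> h; apply: le_trans; apply: le_asum. Qed.

Lemma l1W x C C' : C <= C' -> l1 x C -> l1 x C'.
by move=> h H; apply: (le_trans H); rewrite lee_fin. Qed.

Lemma l1D x y X Y : l1 x X -> l1 y Y -> l1 (fun k=> x k + y k) (X + Y).
by move=> hx hy; apply: (le_trans (asumD _ _)); rewrite EFinD leeD. Qed.

Lemma l1Z c x X : l1 x X -> l1 (fun k=> c * x k) (`|c| * X).
by move=> hx; rewrite /l1 asumZ EFinM lee_wpmul2l// lee_fin. Qed.

Lemma l1_pt x X k : l1 x X -> `|x k| <= X.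
by move=> /(asum_fin_ge [fset k]%fset); rewrite big_seq_fset1. Qed.

Lemma l2_ge0 x C : l2 x C -> 0 <= C. by case. Qed.

Lemma l2_le x y C : (forall k, `|x k| <= `|y k|) -> l2 y C -> l2 x C.
move=> h [C0 H]; split=> //; apply: le_trans H; apply: le_asum => k.
by rewrite !normrX lerXn2r ?nnegrE.
Qed.

Lemma l2W x C C' : C <= C' -> l2 x C -> l2 x C'.
move=> h [C0 H]; split; first exact: le_trans h.
by apply: (le_trans H); rewrite lee_fin lerXn2r ?nnegrE// (le_trans C0).
Qed.

Lemma l2Z c x X : l2 x X -> l2 (fun k=> c * x k) (`|c| * X).
move=> [X0 hx]; split; first by rewrite mulr_ge0.
under [X in asum X]eq_fun do rewrite exprMn.
by rewrite asumZ exprMn EFinM normrX lee_wpmul2l// lee_fin.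
Qed.

Lemma l2_pt x X k : l2 x X -> `|x k| <= X.
move=> [X0] /(asum_fin_ge [fset k]%fset); rewrite big_seq_fset1 normrX.
by rewrite ler_pXn2r ?nnegrE.
Qed.

Lemma l2_fin x C : 0 <= C ->
 (forall F : {fset int}, \sum_(k <- F) x k ^+ 2 <= C ^+ 2) -> l2 x C.
move=> C0 h; split=> //; apply: asum_fin_le => F.
by under eq_bigr do rewrite ger0_norm//.
Qed.

Lemma l2_finE x C (F : {fset int}) : l2 x C -> \sum_(k <- F) x k ^+ 2 <= C ^+ 2.
move=> [C0] /(asum_fin_ge F).
by under eq_bigr do rewrite ger0_norm//.
Qed.

(** The infimum over [t] is attained at [B / A]. If [A] or [B] vanishes it is only approached, hence
    the margin [e]. *)
Lemma sqr_le_prod X A B : 0 <= X -> 0 <= A -> 0 <= B ->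
 (forall t, 0 < t -> X <= (t * A ^+ 2 + t^-1 * B ^+ 2) / 2) -> X <= A * B.
move=> X0 A0 B0 h; apply/ler_addgt0Pr => e e0.
have [A00|An0] := eqVneq A 0.
 rewrite A00 mul0r add0r.
 (* With [A = 0] the bound is [B ^+ 2 / (2 * t)], which this value of [t] makes smaller than [e]. *)
 have h1: 0 < (B ^+ 2 + 1) / e by rewrite divr_gt0// ltr_wpDl// sqr_ge0.
 have := h _ h1; rewrite A00 expr0n/= mulr0 add0r => /le_trans; apply.
 have T0: 0 < B ^+ 2 + 1 by rewrite ltr_wpDl.
 have -> : ((B ^+ 2 + 1) / e)^-1 * B ^+ 2 / 2 = e * (1 - (B ^+ 2 + 1)^-1) / 2.
 by field; rewrite !gt_eqF.
 have : 0 < (B ^+ 2 + 1)^-1 by rewrite invr_gt0.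
 nra.
have [B00|Bn0] := eqVneq B 0.
 rewrite B00 mulr0 add0r.
 have h1: 0 < e / (A ^+ 2 + 1) by rewrite divr_gt0// ltr_wpDl// sqr_ge0.
 have := h _ h1; rewrite B00 expr0n/= mulr0 addr0 => /le_trans; apply.
 have T0: 0 < A ^+ 2 + 1 by rewrite ltr_wpDl.
 have -> : e / (A ^+ 2 + 1) * A ^+ 2 / 2 = e * (1 - (A ^+ 2 + 1)^-1) / 2.
 by field; rewrite !gt_eqF.
 have : 0 < (A ^+ 2 + 1)^-1 by rewrite invr_gt0.
 nra.
have Ap: 0 < A by rewrite lt0r An0.
have Bp: 0 < B by rewrite lt0r Bn0.
have := h (B / A); rewrite divr_gt0// => /(_ erefl) h1.
apply: (le_trans h1); rewrite invf_div (_ : (_ + _) / 2 = A * B) ?lerDl ?ltW//.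
by field; rewrite An0 Bn0.
Qed.

Lemma cauchy_schwarz x y X Y : l2 x X -> l2 y Y -> l1 (fun k=> x k * y k) (X * Y).
move=> hx hy; have [X0 Y0] := (l2_ge0 hx, l2_ge0 hy).
apply: asum_fin_le => F; apply: sqr_le_prod=> //; first by apply: sumr_ge0.
move=> t t0.
apply: (le_via (\sum_(k <- F) (t * x k ^+ 2 + t^-1 * y k ^+ 2) / 2)).
 apply: ler_sum => k _.
 have := sqr_ge0 (t * `|x k| - `|y k|).
 rewrite sqrrB exprMn !real_normK ?num_real// normrM => h.
 rewrite ler_pdivlMr//.
 have -> : t * x k ^+ 2 + t^-1 * y k ^+ 2 = t^-1 * (t ^+ 2 * x k ^+ 2 + y k ^+ 2).
 by field; rewrite gt_eqF.
 rewrite ler_pdivlMl//; lra.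
rewrite -mulr_suml big_split/= -!mulr_sumr ler_wpM2r//.
by rewrite lerD// ler_wpM2l ?invr_ge0 ?(ltW t0)//; apply: l2_finE.
Qed.

Lemma l2D x y X Y : l2 x X -> l2 y Y -> l2 (fun k=> x k + y k) (X + Y).
move=> hx hy; have [X0 Y0] := (l2_ge0 hx, l2_ge0 hy).
apply: l2_fin => [|F]; first exact: addr_ge0.
under eq_bigr do rewrite sqrrD -mulr_natl.
rewrite !big_split/= sqrrD -mulr_sumr -mulr_natl.
have h1 := l2_finE F hx; have h2 := l2_finE F hy.
have : \sum_(i <- F) x i * y i <= X * Y.
 have := asum_fin_ge F (cauchy_schwarz hx hy); apply: le_trans.
 by apply: ler_sum => k _; rewrite ler_norm.
lra.
Qed.

Lemma l1_l2 x X : l1 x X -> l2 x X.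
move=> hx; have X0 := l1_ge0 hx; apply: l2_fin=> // F.
apply: (le_via (\sum_(k <- F) X * `|x k|)).
 apply: ler_sum => k _; rewrite -(real_normK (num_real (x k))) expr2.
 by rewrite ler_wpM2r// (l1_pt _ hx).
by rewrite -mulr_sumr expr2 ler_wpM2l// (asum_fin_ge _ hx).
Qed.

Lemma asum_finE x : (asum x < +oo)%E -> ((fine (asum x))%:E = asum x)%E.
by move=> h; rewrite fineK// ge0_fin_numE// asum_ge0. Qed.

Lemma fine_asum x : ((fine (asum x))%:E <= asum x)%E.
by have := asum_ge0 x; case: (asum x)=> //= _; rewrite leey.
Qed.

Lemma cv_ge0 a b n : 0 <= cv a b n.
by rewrite fine_ge0// asum_ge0. Qed.

Hint Resolve cv_ge0 : core.

Lemma cvC a b n : cv a b n = cv b a n.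
rewrite /cv -(asum_refl n); congr (fine (asum _)); apply/funext => k.
by rewrite subKr mulrC.
Qed.

Lemma cv_fin_le a b n X :
 (forall F : {fset int}, \sum_(k <- F) `|a (n - k) * b k| <= X) -> cv a b n <= X.
by move=> h; rewrite -lee_fin (le_trans (fine_asum _))//; apply: asum_fin_le.
Qed.

Lemma l1l2_summable a b A B n : l2 a A -> l2 b B ->
 (asum (fun k=> a (n - k) * b k)%R < +oo)%E.
move=> ha hb; apply: (@le_lt_trans _ _ (A * B)%:E); last exact: ltey.
have ha': l2 (fun k=> a (n - k)) A.
 case: ha => A0 ha; split=> //.
 by rewrite (asum_refl n (fun k=> a k ^+ 2)).
exact: cauchy_schwarz ha' hb.
Qed.

Lemma cv_mono a b a' b' n :
 (asum (fun k=> a' (n - k) * b' k)%R < +oo)%E ->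
 (forall k, `|a k| <= `|a' k|) -> (forall k, `|b k| <= `|b' k|) ->
 cv a b n <= cv a' b' n.
move=> fin ha hb; rewrite -lee_fin [X in (_ <= X)%E]asum_finE//.
apply: (le_trans (fine_asum _)); apply: le_asum => k.
by rewrite !normrM ler_pM.
Qed.

Lemma cv_ge_fin a b n (F : {fset int}) :
 (asum (fun k=> a (n - k) * b k)%R < +oo)%E ->
 \sum_(k <- F) `|a (n - k) * b k| <= cv a b n.
by move=> fin; apply: asum_fin_ge; rewrite /cv asum_finE. Qed.

Lemma young1 a b A B : l1 a A -> l1 b B -> l1 (cv a b) (A * B).
move=> ha hb.
apply: (le_via (\esum_(n in [set: int]) \esum_(k in [set: int]) (`|a (n - k) * b k|)%:E)).
 by apply: le_esum => n _; rewrite ger0_norm// fine_asum.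
rewrite esum_swap => [|i j]; last by rewrite lee_fin.
have A0 := l1_ge0 ha.
rewrite EFinM; apply: (le_via (A%:E * asum b)%E); last first.
 by rewrite lee_wpmul2l ?lee_fin.
rewrite -[A in (A%:E)](ger0_norm A0) -asumZ; apply: le_esum => k _.
have := asumZ (b k) (fun n=> a (n - k)).
rewrite asum_shift /asum => h.
under eq_esum do rewrite mulrC.
by rewrite h normrM mulrC (ger0_norm A0) EFinM lee_wpmul2l ?lee_fin.
Qed.

(** Cauchy-Schwarz with [|a|] written as the square of its root: one root is paired with [b], the
    other has l2 norm at most [sqrt A]. The second alternative is the case in which [fine] would
    hide an infinite sum. *)
Lemma cv_sqr a b A n : l1 a A ->
 cv a b n ^+ 2 <= A * fine (asum (fun k=> `|a (n - k)| * b k ^+ 2)%R) \/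
 (asum (fun k=> `|a (n - k)| * b k ^+ 2)%R = +oo)%E.
move=> ha; have A0 := l1_ge0 ha.
have [fin|] := boolP (asum (fun k=> `|a (n - k)| * b k ^+ 2)%R == +oo)%E.
 by right; apply/eqP.
rewrite -ltey => fin; left; set T := fine _.
have T0: 0 <= T by rewrite fine_ge0// asum_ge0.
have h1: l2 (fun k=> Num.sqrt `|a (n - k)|) (Num.sqrt A).
 split; rewrite ?sqrtr_ge0// sqr_sqrtr//.
 apply: le_trans ha; rewrite -(asum_refl n); apply: le_asum => k.
 by rewrite subKr sqr_sqrtr// normr_id.
have h2: l2 (fun k=> Num.sqrt `|a (n - k)| * b k) (Num.sqrt T).
 split; rewrite ?sqrtr_ge0// sqr_sqrtr//.
 rewrite asum_finE//; apply: le_asum => k.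
 by rewrite exprMn sqr_sqrtr.
have := cauchy_schwarz h1 h2.
rewrite -sqrtrM// => h3.
rewrite -(sqr_sqrtr (mulr_ge0 A0 T0)) lerXn2r ?nnegrE ?sqrtr_ge0//.
rewrite -lee_fin (le_trans (fine_asum _))//; apply: le_trans h3.
apply: le_asum => k; rewrite mulrA -expr2 sqr_sqrtr//.
by rewrite !normrM normr_id.
Qed.

(** [cv_sqr] reduces the claim to [young1] for [a] and [b ^+ 2]. *)
Lemma young2 a b A B : l1 a A -> l2 b B -> l2 (cv a b) (A * B).
move=> ha hb; have [A0 B0] := (l1_ge0 ha, l2_ge0 hb).
split; first exact: mulr_ge0.
have hb2: l1 (fun k=> b k ^+ 2) (B ^+ 2) by case: hb.
have hy := young1 ha hb2.
have fin n : (asum (fun k=> a (n - k) * b k ^+ 2)%R < +oo)%E.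
 apply: (@le_lt_trans _ _ (A * B ^+ 2)%:E); last exact: ltey.
 apply: (le_via (asum (fun k=> A * b k ^+ 2)%R)).
 by apply: le_asum => k; rewrite !normrM ler_wpM2r// (le_trans (l1_pt _ ha))// ler_norm.
 by rewrite asumZ ger0_norm// EFinM lee_wpmul2l ?lee_fin.
apply: (le_via (asum (fun n=> A * cv a (fun k=> b k ^+ 2) n)%R)).
 apply: le_asum => n; rewrite !ger0_norm ?mulr_ge0//.
 have finn := fin n.
 have E: asum (fun k=> a (n - k) * b k ^+ 2)%R = asum (fun k=> `|a (n - k)| * b k ^+ 2)%R.
 by apply: eq_esum => k _; rewrite !normrM normr_id.
 have [|] := cv_sqr b n ha; first by rewrite /cv E.
 by rewrite -E => h; rewrite h in finn.
rewrite asumZ (ger0_norm A0) exprMn expr2 -mulrA EFinM.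
by rewrite lee_wpmul2l ?lee_fin.
Qed.

Lemma cv_pt a b A B n : l1 a A -> (forall k, `|b k| <= B) -> cv a b n <= A * B.
move=> ha hb; have A0 := l1_ge0 ha.
apply: cv_fin_le => F.
apply: (le_via (\sum_(k <- F) `|a (n - k)| * B)).
 by apply: ler_sum => k _; rewrite normrM ler_wpM2l.
have B0: 0 <= B by rewrite (le_trans _ (hb 0)).
rewrite -mulr_suml ler_wpM2r//.
have : (asum (fun k=> a (n - k))%R <= A%:E)%E by rewrite asum_refl.
exact: asum_fin_ge.
Qed.

Lemma l1_bdd_summable a b A B n : l1 a A -> (forall k, `|b k| <= B) ->
 (asum (fun k=> a (n - k) * b k)%R < +oo)%E.
move=> ha hb; apply: (@le_lt_trans _ _ (A * B)%:E); last exact: ltey.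
apply: asum_fin_le => F.
apply: (le_via (\sum_(k <- F) `|a (n - k)| * B)).
 by apply: ler_sum => k _; rewrite normrM ler_wpM2l.
have B0: 0 <= B by rewrite (le_trans _ (hb 0)).
rewrite -mulr_suml ler_wpM2r//.
have : (asum (fun k=> a (n - k))%R <= A%:E)%E by rewrite asum_refl.
exact: asum_fin_ge.
Qed.

Lemma l2_small x X : 0 <= X -> (forall e, 0 < e -> l2 x (X + e)) -> l2 x X.
move=> X0 h; apply: l2_fin=> // F.
have S0: 0 <= \sum_(k <- F) x k ^+ 2 by apply: sumr_ge0 => k _; exact: sqr_ge0.
rewrite -(sqr_sqrtr S0) ler_pXn2r ?nnegrE ?sqrtr_ge0//.
apply/ler_addgt0Pr => e e0.
have /h/(l2_finE F) : 0 < e by [].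
by rewrite -{1}(sqr_sqrtr S0) ler_pXn2r ?nnegrE ?sqrtr_ge0// addr_ge0// ltW.
Qed.

(** Iterating [Y -> d + Y / 2] from [X] converges to the fixed point [2 * d]. Of [X] only the
    finiteness matters; its size leaves no trace in the result. *)
Lemma l2_absorb x d X : 0 <= d -> l2 x X ->
 (forall Y, l2 x Y -> l2 x (d + Y / 2)) -> l2 x (2 * d).
move=> d0 hx H.
have X0 := l2_ge0 hx.
have it n : l2 x (2 * d + X / 2 ^+ n).
 elim: n => [|n /H]; first by rewrite expr0 divr1; apply: l2W hx; lra.
 by apply: l2W; rewrite exprS invfM mulrDl [2^-1 * _]mulrC mulrA; lra.
apply: l2_small => [|e e0]; first by rewrite mulr_ge0.
have [n hn] : exists n, X / 2 ^+ n <= e.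
 exists (Num.truncn (X / e)).+1; rewrite ler_pdivrMr ?exprn_gt0//.
 have h1: X / e < (Num.truncn (X / e)).+1%:R by rewrite truncnS_gt ?divr_ge0// ltW.
 rewrite mulrC -ler_pdivrMr// ltW// (lt_le_trans h1)//.
 by rewrite -natrX ler_nat ltnW// ltn_expl.
by apply: l2W (it n); rewrite lerD2l.
Qed.

Lemma cv_le1 a b n C a1 b1 : 0 < C ->
 (forall k, C * `|a (n - k) * b k| <= `|a1 (n - k) * b1 k|) ->
 (asum (fun k=> a1 (n - k) * b1 k)%R < +oo)%E ->
 C * cv a b n <= cv a1 b1 n.
move=> C0 h fin; rewrite -ler_pdivlMl//; apply: cv_fin_le => F.
rewrite ler_pdivlMl// mulr_sumr; apply: le_trans (cv_ge_fin F fin).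
by apply: ler_sum => k _.
Qed.

Lemma cv_le2 a b n C a1 b1 a2 b2 : 0 < C ->
 (forall k, C * `|a (n - k) * b k| <=
 `|a1 (n - k) * b1 k| + `|a2 (n - k) * b2 k|) ->
 (asum (fun k=> a1 (n - k) * b1 k)%R < +oo)%E ->
 (asum (fun k=> a2 (n - k) * b2 k)%R < +oo)%E ->
 C * cv a b n <= cv a1 b1 n + cv a2 b2 n.
move=> C0 h fin1 fin2; rewrite -ler_pdivlMl//; apply: cv_fin_le => F.
rewrite ler_pdivlMl// mulr_sumr.
apply: le_trans (lerD (cv_ge_fin F fin1) (cv_ge_fin F fin2)).
by rewrite -big_split/=; apply: ler_sum => k _.
Qed.

(** With [1 + |k|] instead of the root of [1 + k^2], the bracket of [n = (n - k) + k] is bounded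
    both by the sum and by the product of the two brackets, with constant 1. *)
Definition jb (k: int) : R := 1 + `|k%:~R|.

Definition jbp (r: R) (k: int) : R := jb k `^ r.

Definition hn (r: R) x X : Prop := l2 (fun k=> jbp r k * x k) X.

Lemma jb_ge1 k : 1 <= jb k. by rewrite lerDl. Qed.

Lemma jb_gt0 k : 0 < jb k. exact: lt_le_trans (jb_ge1 k). Qed.

Hint Resolve jb_ge1 jb_gt0 : core.

Lemma jbN k : jb (- k) = jb k.
by rewrite /jb mulrNz normrN. Qed.

Lemma jb_sub n k : jb n <= jb (n - k) + jb k.
rewrite /jb; have -> : n%:~R = (n - k)%:~R + k%:~R :> R by rewrite -intrD subrK.
by have := ler_normD (n - k)%:~R (k%:~R : R); lra.
Qed.

Lemma jb_subM n k : jb n <= jb (n - k) * jb k.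
rewrite /jb; have -> : n%:~R = (n - k)%:~R + k%:~R :> R by rewrite -intrD subrK.
have := ler_normD (n - k)%:~R (k%:~R : R).
have : 0 <= `|(n - k)%:~R : R| by []. have : 0 <= `|k%:~R : R| by [].
nra.
Qed.

Lemma jbp_gt0 r k : 0 < jbp r k.
by rewrite powR_gt0. Qed.

Lemma jbp_ge0 r k : 0 <= jbp r k. exact: ltW (jbp_gt0 r k). Qed.

Hint Resolve jbp_gt0 jbp_ge0 : core.

Lemma jbp0 k : jbp 0 k = 1. by rewrite /jbp powRr0. Qed.

Lemma jbp1 k : jbp 1 k = jb k. by rewrite /jbp powRr1// ltW. Qed.

Lemma jbpD r t k : jbp (r + t) k = jbp r k * jbp t k.
by rewrite /jbp powRD// (gt_eqF (jb_gt0 k)) implybT. Qed.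

Lemma jbpN r k : jbp (- r) k = (jbp r k)^-1.
by rewrite /jbp powRN. Qed.

Lemma jbp_le r t k : r <= t -> jbp r k <= jbp t k.
by move=> h; apply: ler_powR. Qed.

Lemma jbp_ge1 r k : 0 <= r -> 1 <= jbp r k.
by move=> h; rewrite -(jbp0 k); apply: jbp_le. Qed.

Lemma powR_mono (r: R) (u v: R) : 0 <= r -> 0 <= u -> u <= v -> u `^ r <= v `^ r.
by move=> r0 u0 uv; apply: ge0_ler_powR; rewrite ?nnegrE// (le_trans u0). Qed.

Lemma powR_tame (r: R) (u v w: R) : 0 <= r -> 0 <= u -> 0 <= v -> 0 <= w ->
 w <= u + v -> w `^ r <= 2 `^ r * (u `^ r + v `^ r).
move=> r0 u0 v0 w0 h.
have aux u' v' : 0 <= u' -> 0 <= v' -> w <= u' + v' -> u' <= v' ->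
 w `^ r <= 2 `^ r * (u' `^ r + v' `^ r).
 move=> u'0 v'0 h' uv; apply: (le_via ((2 * v') `^ r)).
 by apply: powR_mono=> //; lra.
 by rewrite powRM// ler_wpM2l// lerDr powR_ge0.
have [uv|vu] := leP u v; first exact: aux.
by rewrite [X in _ * X]addrC; apply: aux=> //; rewrite 1?addrC// ltW.
Qed.

Lemma jbp_sub r n k : 0 <= r -> jbp r n <= jbp r (n - k) * jbp r k.
move=> r0; rewrite /jbp -powRM; [|exact: ltW|exact: ltW].
by apply: powR_mono=> //; [exact: ltW|exact: jb_subM].
Qed.

Lemma jbp_tame r n k : 0 <= r -> jbp r n <= 2 `^ r * (jbp r (n - k) + jbp r k).
by move=> r0; apply: powR_tame=> //; [exact: ltW..|exact: jb_sub]. Qed.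

Lemma hn0 x X : hn 0 x X <-> l2 x X.
by rewrite /hn; under eq_fun do rewrite jbp0 mul1r. Qed.

Lemma hn_le r x y X : (forall k, `|x k| <= `|y k|) -> hn r y X -> hn r x X.
by move=> h; apply: l2_le => k; rewrite !normrM ler_wpM2l. Qed.

Lemma hnW r t x X X' : t <= r -> X <= X' -> hn r x X -> hn t x X'.
move=> tr XX /(l2W XX); apply: l2_le => k.
by rewrite !normrM ler_wpM2r// !ger0_norm// jbp_le.
Qed.

Lemma hnD r x y X Y : hn r x X -> hn r y Y -> hn r (fun k=> x k + y k) (X + Y).
by move=> hx hy; have := l2D hx hy; apply: l2_le => k; rewrite mulrDr. Qed.

Lemma hnZ r c x X : hn r x X -> hn r (fun k=> c * x k) (`|c| * X).
by move=> /(l2Z c); apply: l2_le => k; rewrite mulrCA. Qed.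

Lemma hn_pt r x X k : 0 <= r -> hn r x X -> `|x k| <= X.
move=> r0 /(l2_pt k); apply: le_trans; rewrite normrM ger0_norm//.
by rewrite ler_peMl// jbp_ge1.
Qed.

Lemma nat_esum_le (g : nat -> R) C : (forall n, 0 <= g n) ->
 (forall N, \sum_(0 <= i < N) g i <= C) ->
 (\esum_(i in [set: nat]) (g i)%:E <= C%:E)%E.
move=> g0 h; rewrite -nneseries_esumT => [|n]; last by rewrite lee_fin.
apply: lime_le; first by apply: is_cvg_nneseries => n _ _; rewrite lee_fin.
by apply: nearW => N; rewrite sumEFin lee_fin.
Qed.

Lemma int_esum (f : int -> \bar R) : (forall k, (0 <= f k)%E) ->
 \esum_(k in [set: int]) f k =
 (\esum_(n in [set: nat]) f n%:Z + \esum_(n in [set: nat]) f (Negz n))%E.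
move=> f0; rewrite (esumID (range Posz))//; congr (_ + _)%E.
 rewrite setTI esum_image// => i j _ _; by case.
have -> : [set: int] `&` ~` range Posz = range Negz.
 apply/seteqP; split => [[n|n]|k] /=; first by move=> [_ []]; exists n.
 by move=> _; exists n.
 by move=> [n _ <-]; split=> // -[].
by rewrite esum_image// => i j _ _ [].
Qed.

(** In place of an integral test, [(1 + n)^(-1 - q)] is compared with telescoping differences of
    [(1 + n)^(-q)], using [exp x >= 1 + x] and [ln (1 + x) <= x]; here [q = 2 c - 1]. *)
Lemma jbp_summable c : 1 / 2 < c -> exists K, l2 (jbp (- c)) K.
move=> hc; pose q := c + c - 1.
have q0: 0 < q by rewrite /q; lra.
pose g (n: nat) : R := (1 + n%:R) `^ (- (1 + q)).
pose H (n: nat) : R := (1 + n%:R) `^ (- q).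
have np (n: nat) : 0 < 1 + n%:R :> R by rewrite ltr_pwDl.
have tel n : q * g n.+1 <= H n - H n.+1.
 have -> : H n = H n.+1 * expR (q * ln ((1 + n.+1%:R) / (1 + n%:R))).
 rewrite /H /powR !gt_eqF// -expRD ln_div ?posrE//; congr expR; lra.
 have -> : g n.+1 = H n.+1 * (1 + n.+1%:R)^-1.
 rewrite /g /H -powR_inv1; last exact: ltW.
 rewrite -powRD; first by congr (_ `^ _); rewrite opprD addrC.
 by rewrite (gt_eqF (np n.+1)) implybT.
 rewrite mulrCA -[X in _ <= _ - X]mulr1 -mulrBr ler_wpM2l ?powR_ge0//.
 rewrite lerBrDr addrC; apply: le_trans (expR_ge1Dx _).
 rewrite lerD2l ler_wpM2l ?(ltW q0)//.
 have -> : (1 + n.+1%:R) / (1 + n%:R) = (1 - (1 + n.+1%:R)^-1)^-1 :> R.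
 have := np n; have := np n.+1; rewrite -natr1 => h1 h2.
 field; rewrite ?gt_eqF//=; lra.
 have h3: (1 + n.+1%:R : R)^-1 < 1 by rewrite invf_lt1// ltrDl ltr0Sn.
 rewrite lnV ?posrE ?subr_gt0// lerNr.
 by apply: (@le_ln1Dx R (- _)); rewrite ltrN2.
have g0 n : 0 <= g n by exact: powR_ge0.
have sg N : \sum_(0 <= i < N) g i <= 1 + q^-1.
 case: N => [|N]; first by rewrite big_geq// addr_ge0// invr_ge0 ltW.
 rewrite big_nat_recl// {1}/g addr0 powR1 lerD2l.
 rewrite -(ler_pM2l q0) divff ?gt_eqF// mulr_sumr.
 apply: (le_via (\sum_(0 <= i < N) (H i - H i.+1))).
 by apply: ler_sum => i _.
 rewrite (@telescope_sumr_eq R 0 N (fun i=> - H i) _ (leq0n N)); last first.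
 by move=> k _; rewrite opprK addrC.
 rewrite opprK addrC lerBlDr {1}/H addr0 (congr1 (@^~ (- q)) (@powR1 R)) /H.
 by rewrite lerDl powR_ge0.
exists (Num.sqrt (2 * (1 + q^-1))); split; first exact: sqrtr_ge0.
rewrite sqr_sqrtr; last by rewrite mulr_ge0// addr_ge0// invr_ge0 ltW.
rewrite /asum int_esum => [|k]; last by rewrite lee_fin.
have E (k: int) (n: nat) : `|k%:~R| = n%:R :> R ->
 `|jbp (- c) k ^+ 2| = g n.
 move=> h; rewrite ger0_norm// expr2 -jbpD /jbp /jb h /g; congr (_ `^ _).
 by rewrite /q; lra.
rewrite mulrDl mul1r EFinD; apply: leeD.
 have E1 (n: nat) : `|(Posz n)%:~R| = n%:R :> R by exact: normr_nat.
 under eq_esum do rewrite (E _ _ (E1 _)).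
 exact: nat_esum_le.
have E2 n : `|(Negz n)%:~R| = n.+1%:R :> R by rewrite NegzE mulrNz normrN normr_nat.
under eq_esum do rewrite (E _ _ (E2 _)).
apply: nat_esum_le=> // N.
apply: le_trans (sg N.+1); rewrite big_nat_recl// lerDr//.
Qed.

Lemma hn_l1 c : 1 / 2 < c -> exists2 K, 0 <= K &
 forall x X, hn c x X -> l1 x (K * X).
move=> /jbp_summable[K hK]; exists K; first exact: l2_ge0 hK.
move=> x X hx; have := cauchy_schwarz hK hx; apply: l1_le => k.
by rewrite mulrA jbpN mulVf ?mul1r// gt_eqF.
Qed.

Lemma hn_l1w c r : 1 / 2 < c - r -> exists2 K, 0 <= K &
 forall x X, hn c x X -> l1 (fun k=> jbp r k * x k) (K * X).
move=> /hn_l1[K K0 hK]; exists K=> // x X hx; apply: hK.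
by apply: l2_le hx => k; rewrite mulrA -jbpD subrK.
Qed.

Lemma l1_summable a b A n : l1 a A -> (exists B, forall k, `|b k| <= B) ->
 (asum (fun k=> a (n - k) * b k)%R < +oo)%E.
by move=> ha [B hb]; exact: l1_bdd_summable ha hb. Qed.

Lemma l2_bdd x X : l2 x X -> exists B, forall k, `|x k| <= B.
by move=> hx; exists X => k; exact: l2_pt hx. Qed.

Lemma summableC a b n : (asum (fun k=> a (n - k) * b k)%R < +oo)%E ->
 (asum (fun k=> b (n - k) * a k)%R < +oo)%E.
rewrite -(asum_refl n); under [X in asum X]eq_fun do rewrite subKr mulrC.
by [].
Qed.

(** The output weight falls on one factor at a time, so each high norm is multiplied only by an l1
    norm of the other factor. *)
Lemma cv_tame r a b A A' B B' : 0 <= r -> l1 a A -> hn r a A' ->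
 l1 b B -> hn r b B' -> hn r (cv a b) (2 `^ r * (A' * B + A * B')).
move=> r0 ha ha' hb hb'.
have h1 := young2 hb ha'; have h2 := young2 ha hb'.
have := l2Z (2 `^ r) (l2D h1 h2).
rewrite ger0_norm// [B * A']mulrC; apply: l2_le => n.
rewrite !ger0_norm ?mulr_ge0 ?addr_ge0//.
rewrite -ler_pdivrMl ?powR_gt0// mulrA [cv b _ _]cvC.
apply: cv_le2; first by rewrite mulr_gt0 ?invr_gt0 ?powR_gt0.
- move=> k; rewrite !normrM !(ger0_norm (jbp_ge0 _ _)).
 rewrite -[(2 `^ r)^-1 * _ * _]mulrA ler_pdivrMl ?powR_gt0//.
 have := jbp_tame n k r0; have : 0 <= `|a (n - k)| * `|b k| by rewrite mulr_ge0.
 nra.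
- by apply: (@summableC b (fun k=> jbp r k * a k)); apply: l1_summable hb (l2_bdd ha').
- by apply: l1_summable ha (l2_bdd hb').
Qed.

Lemma cv_algebra r : 1 / 2 < r -> exists2 K, 0 <= K &
 forall a b A B, hn r a A -> hn r b B -> hn r (cv a b) (K * (A * B)).
move=> hr; have [K K0 hK] := hn_l1 hr.
have r0: 0 <= r by lra.
exists (2 `^ r * (2 * K)); first by rewrite !mulr_ge0.
move=> a b A B ha hb; have := cv_tame r0 (hK _ _ ha) ha (hK _ _ hb) hb.
by congr hn; ring.
Qed.

(** Common core of the absorption lemmas: [p] distributes over a convolution at the price of [w],
    and [M] is small in the weight [w], so [l2_absorb] applies to the [p]-norm as soon as that norm
    is finite. *)
Lemma absorb_w (p w x D M : int -> R) d X :
 (forall n, 0 <= p n) -> (forall n k, p n <= w (n - k) * p k) ->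
 l1 (fun k=> w k * M k) (1 / 2) -> (forall n, 0 < w n) ->
 l2 (fun k=> p k * D k) d -> l2 (fun k=> p k * x k) X ->
 (forall n, 0 <= D n) -> (forall n, `|x n| <= D n + cv M x n) ->
 l2 (fun k=> p k * x k) (2 * d).
move=> p0 pw hM w0 hD hx D0 h; apply: (l2_absorb (l2_ge0 hD) hx) => Y hY.
have := l2D hD (young2 hM hY); rewrite mul1r [2^-1 * Y]mulrC.
apply: l2_le => n.
have c0 := cv_ge0 (fun k=> w k * M k) (fun k=> p k * x k) n.
rewrite [X in _ <= X]ger0_norm; last by rewrite addr_ge0// mulr_ge0.
 rewrite normrM (ger0_norm (p0 n)); apply: (le_via (p n * (D n + cv M x n))).
 by rewrite ler_wpM2l.
 rewrite mulrDr lerD2l; have [->|pn0] := eqVneq (p n) 0; first by rewrite mul0r.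
 apply: cv_le1; first by rewrite lt0r pn0 p0.
 move=> k; rewrite !normrM (ger0_norm (ltW (w0 _))) (ger0_norm (p0 _)).
 have := pw n k; have : 0 <= `|M (n - k)| * `|x k| by rewrite mulr_ge0.
 nra.
 by apply: l1_summable hM (l2_bdd hY).
Qed.

(** On a finite set of frequencies the truncated weight equals the full one once [N] is large, and
    an l2 norm is a supremum over finite sets. *)
Lemma trunc_lim r x C (p : R -> int -> R) : 0 <= C ->
 (forall N k, jb k <= N -> p N k = jbp r k) ->
 (forall N, 1 <= N -> l2 (fun k=> p N k * x k) C) -> hn r x C.
move=> C0 hp h; apply: l2_fin=> // F.
pose N := \sum_(k <- F) jb k + 1.
have N1: 1 <= N by rewrite lerDr sumr_ge0// => k _; exact: ltW.
have := l2_finE F (h N N1); apply: le_trans; rewrite le_eqVlt; apply/orP; left.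
apply/eqP; apply: eq_big_seq => k kF; rewrite hp//.
rewrite /N (big_rem k)//= -addrA lerDl addr_ge0// sumr_ge0// => i _; exact: ltW.
Qed.

(** Capping the bracket at [N] makes the weighted norm of an l2 sequence finite and preserves
    submultiplicativity; the absorbed bound does not see [N]. *)
Lemma absorb_up c x D M d X : 0 <= c -> l2 x X ->
 l1 (fun k=> jbp c k * M k) (1 / 2) -> hn c D d ->
 (forall n, 0 <= D n) -> (forall n, `|x n| <= D n + cv M x n) -> hn c x (2 * d).
move=> c0 hx hM hD D0 h.
pose p (N: R) (k: int) := (minr (jb k) N) `^ c.
apply: (@trunc_lim c x (2 * d) p).
- by rewrite mulr_ge0// (l2_ge0 hD).
- by move=> N k hN; rewrite /p min_l.
move=> N N1; have N0: 0 < N by apply: lt_le_trans N1.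
have m0 k : 0 <= minr (jb k) N by rewrite le_min !ltW.
apply: (@absorb_w (p N) (jbp c) x D M d (N `^ c * X)); [ | |exact: hM| | | |exact: D0|exact: h].
- by move=> n; exact: powR_ge0.
- move=> n k; rewrite /p /jbp -powRM//; last exact: ltW.
 apply: powR_mono=> //; rewrite minr_pMr ?mulr1; last exact: ltW.
 rewrite le_min !ge_min jb_subM/= orbC ler_peMl ?jb_ge1// ltW//.
- by move=> k; exact: jbp_gt0.
- apply: l2_le hD => k; rewrite !normrM ler_wpM2r// !ger0_norm ?powR_ge0//.
 by apply: powR_mono=> //; rewrite ge_min lexx.
- have := l2Z (N `^ c) hx; rewrite (ger0_norm (powR_ge0 _ _)) => hz; apply: l2_le hz => k.
 rewrite !normrM ler_wpM2r// !ger0_norm ?powR_ge0//.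
 by apply: powR_mono=> //; rewrite ge_min lexx orbT.
Qed.

Lemma min_add (u v w N: R) : 0 <= u -> 0 <= v -> 0 <= N -> w <= u + v ->
 minr w N <= minr u N + minr v N.
by move=> u0 v0 N0 h; rewrite !minEle; do 3 case: ifPn;
 rewrite -?ltNge => *; lra.
Qed.

(** Smallness of [M] is asked in l1 only. Its high norm [A'], possibly large, meets the l1 norm of
    [x]. *)
Lemma absorb_tame r x D M d X X1 A A' : 0 <= r -> l2 x X -> l1 x X1 ->
 l1 M A -> 2 `^ r * A <= 1 / 2 -> hn r M A' -> hn r D d ->
 (forall n, 0 <= D n) -> (forall n, `|x n| <= D n + cv M x n) ->
 hn r x (2 * (d + 2 `^ r * (A' * X1))).
move=> r0 hx hx1 hM hA hM' hD D0 h.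
have [d0 A'0 X10] := And3 (l2_ge0 hD) (l2_ge0 hM') (l1_ge0 hx1).
pose p (N: R) (k: int) := (minr (jb k) N) `^ r.
have C0: 0 <= d + 2 `^ r * (A' * X1) by rewrite addr_ge0 ?mulr_ge0.
apply: (@trunc_lim r x _ p); first by rewrite mulr_ge0.
- by move=> N k hN; rewrite /p min_l.
move=> N N1; have N0: 0 < N by apply: lt_le_trans N1.
have m0 k : 0 <= minr (jb k) N by rewrite le_min !ltW.
have p0 k : 0 <= p N k by exact: powR_ge0.
have pjb k : p N k <= jbp r k by apply: powR_mono=> //; rewrite ge_min lexx.
have hX0: l2 (fun k=> p N k * x k) (N `^ r * X).
 have := l2Z (N `^ r) hx; rewrite (ger0_norm (powR_ge0 _ _)) => hz; apply: l2_le hz => k.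
 rewrite !normrM ler_wpM2r// !ger0_norm ?powR_ge0//.
 by apply: powR_mono=> //; rewrite ge_min lexx orbT.
apply: (l2_absorb C0 hX0) => Y hY.
have hpM: l2 (fun k=> p N k * M k) A'.
 by apply: l2_le hM' => k; rewrite !normrM ler_wpM2r// !ger0_norm.
have hpD: l2 (fun k=> p N k * D k) d.
 by apply: l2_le hD => k; rewrite !normrM ler_wpM2r// !ger0_norm.
have hL := l2D hpD (l2Z (2 `^ r) (l2D (young2 hx1 hpM) (young2 hM hY))).
have Y0 := l2_ge0 hY.
apply: (l2W _ (l2_le _ hL)) => [|n].
 rewrite ger0_norm// mulrDr addrA [X1 * _]mulrC lerD2l mulrA.
 by rewrite [Y / 2]mulrC ler_wpM2r// -div1r.
have c1 := cv_ge0 x (fun k=> p N k * M k) n.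
have c2 := cv_ge0 M (fun k=> p N k * x k) n.
set c12 := _ + cv M _ n.
have c120: 0 <= c12 by rewrite addr_ge0.
rewrite [X in _ <= X]ger0_norm; last by rewrite addr_ge0// mulr_ge0.
rewrite normrM (ger0_norm (p0 n)).
apply: (le_via (p N n * (D n + cv M x n))); first by rewrite ler_wpM2l.
rewrite mulrDr lerD2l -ler_pdivrMl ?powR_gt0// mulrA.
have [->|pn0] := eqVneq (p N n) 0; first by rewrite mulr0 mul0r.
rewrite /c12 [cv x _ _]cvC.
apply: cv_le2; first by rewrite mulr_gt0 ?invr_gt0 ?powR_gt0// lt_min jb_gt0.
- move=> k; rewrite !normrM !(ger0_norm (p0 _)).
 rewrite -[(2 `^ r)^-1 * _ * _]mulrA ler_pdivrMl ?powR_gt0//.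
 have : p N n <= 2 `^ r * (p N (n - k) + p N k).
 apply: powR_tame=> //; apply: min_add; rewrite ?(ltW N0) ?(ltW (jb_gt0 _)) ?jb_sub//.
 have : 0 <= `|M (n - k)| * `|x k| by rewrite mulr_ge0.
 nra.
- by apply: (@summableC x (fun k=> p N k * M k)); apply: l1_summable hx1 (l2_bdd hpM).
- by apply: l1_summable hM (l2_bdd hY).
Qed.

(** Two passes: [absorb_up] at the low exponent [c > 1/2] puts [x] in l1, then [absorb_tame] reaches
    [r]. Thus smallness is required at exponent [c] and in l1, not at exponent [r]. *)
Lemma absorb_full c r : 1 / 2 < c -> c <= r -> exists2 K, 0 <= K &
 forall x D M d X A A', l2 x X -> l1 (fun k=> jbp c k * M k) (1 / 2) ->
 l1 M A -> 2 `^ r * A <= 1 / 2 -> hn r M A' -> hn r D d ->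
 (forall n, 0 <= D n) -> (forall n, `|x n| <= D n + cv M x n) ->
 hn r x (K * ((1 + A') * d)).
move=> hc cr; have [K K0 hK] := hn_l1 hc.
have K20: 0 <= 2 `^ r by exact: powR_ge0.
exists (2 * (1 + 2 `^ r * K * 2)); first by rewrite mulr_ge0// addr_ge0// !mulr_ge0.
move=> x D M d X A A' hx hMc hM hA hM' hD D0 h.
have c0: 0 <= c by lra.
have r0: 0 <= r by lra.
have hcx := absorb_up c0 hx hMc (hnW cr (lexx d) hD) D0 h.
have := absorb_tame r0 hx (hK _ _ hcx) hM hA hM' hD D0 h.
have A0 := l2_ge0 hM'; have d0 := l2_ge0 hD.
apply: l2W; rewrite -[X in _ <= X]mulrA ler_wpM2l//.
have KK: 0 <= 2 `^ r * K by rewrite mulr_ge0.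
have AA: 0 <= A' * d by rewrite mulr_ge0.
have : 0 <= 2 `^ r * K * 2 * d by rewrite !mulr_ge0.
lra.
Qed.

End Sequences.

Hint Extern 0 (is_true (@Order.lt _ _ _ (@jb _ _))) => exact: jb_gt0 : core.
Hint Extern 0 (is_true (@Order.le _ _ _ (@jb _ _))) => exact: jb_ge1 : core.
Hint Extern 0 (is_true (@Order.lt _ _ _ (@jbp _ _ _))) => exact: jbp_gt0 : core.
Hint Extern 0 (is_true (@Order.le _ _ _ (@jbp _ _ _))) => exact: jbp_ge0 : core.
Hint Extern 0 (is_true (@Order.le _ _ _ (@cv _ _ _ _))) => exact: cv_ge0 : core.

Notation cj := conjc.

(** * Complex numbers: modulus, real and imaginary parts, the unit circle *)

Section ComplexBasics.
Context {R : realType}.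
Implicit Types (z w : R[i]).

Definition nc z : R := Normc.normc z.

Lemma ncE z : nc z = Num.sqrt (cRe z ^+ 2 + cIm z ^+ 2).
by case: z. Qed.

Lemma nc_ge0 z : 0 <= nc z. by rewrite ncE sqrtr_ge0. Qed.

Hint Resolve nc_ge0 : core.

Lemma nc_sqr z : nc z ^+ 2 = cRe z ^+ 2 + cIm z ^+ 2.
by rewrite ncE sqr_sqrtr// addr_ge0// sqr_ge0. Qed.

Lemma ncM z w : nc (z * w) = nc z * nc w. exact: Normc.normcM. Qed.

Lemma ncD z w : nc (z + w) <= nc z + nc w. exact: le_normcD. Qed.

Lemma ncN z : nc (- z) = nc z. exact: normcN. Qed.

Lemma ncB z w : nc (z - w) <= nc z + nc w. by rewrite -(ncN w) ncD. Qed.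

Lemma nc_distC z w : nc (z - w) = nc (w - z). by rewrite -ncN opprB. Qed.

Lemma ncV z : nc z^-1 = (nc z)^-1. exact: Normc.normcV. Qed.

Lemma nc0 : nc 0 = 0 :> R. exact: Normc.normc0. Qed.

Lemma nc1 : nc 1 = 1 :> R. exact: Normc.normc1. Qed.

Lemma nc_real (r: R) : nc r%:C = `|r|.
by rewrite ncE/= expr0n/= addr0 sqrtr_sqr. Qed.

Lemma nc_i : nc 'i = 1 :> R.
by rewrite ncE/= expr0n/= add0r expr1n sqrtr1. Qed.

Lemma nc_int (k: int) : nc k%:~R = `|k%:~R : R|.
by rewrite -nc_real rmorph_int.
Qed.

Lemma ncJ z : nc (cj z) = nc z.
by case: z => a b; rewrite !ncE/= sqrrN. Qed.

Lemma nc_eq0 z : (nc z == 0) = (z == 0).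
by apply/eqP/eqP => [/Normc.eq0_normc//|->]; rewrite nc0.
Qed.

Lemma nc_gt0 z : z != 0 -> 0 < nc z.
by rewrite lt0r nc_eq0 nc_ge0 andbT. Qed.

Lemma nc_sum (I : Type) (s : seq I) (F : I -> R[i]) :
 nc (\sum_(i <- s) F i) <= \sum_(i <- s) nc (F i).
elim: s => [|i s IH]; first by rewrite !big_nil nc0.
by rewrite !big_cons (le_trans (ncD _ _))// lerD2l.
Qed.

Lemma Re_le_nc z : `|cRe z| <= nc z.
rewrite -(@ler_pXn2r _ 2)// ?nnegrE// nc_sqr real_normK ?num_real//.
by rewrite lerDl sqr_ge0.
Qed.

Lemma Im_le_nc z : `|cIm z| <= nc z.
rewrite -(@ler_pXn2r _ 2)// ?nnegrE// nc_sqr real_normK ?num_real//.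
by rewrite lerDr sqr_ge0.
Qed.

Lemma nc_le_ReIm z : nc z <= `|cRe z| + `|cIm z|.
rewrite -(@ler_pXn2r _ 2)// ?nnegrE ?addr_ge0// nc_sqr sqrrD.
rewrite !real_normK ?num_real// lerD2r lerDl.
by rewrite mulrn_wge0// mulr_ge0.
Qed.

Lemma ReD z w : cRe (z + w) = cRe z + cRe w.
by case: z; case: w. Qed.
Lemma ImD z w : cIm (z + w) = cIm z + cIm w.
by case: z; case: w. Qed.
Lemma ReN z : cRe (- z) = - cRe z. by case: z. Qed.
Lemma ImN z : cIm (- z) = - cIm z. by case: z. Qed.
Lemma ReM z w :
 cRe (z * w) = cRe z * cRe w - cIm z * cIm w.
by case: z; case: w. Qed.
Lemma ImM z w :
 cIm (z * w) = cRe z * cIm w + cIm z * cRe w.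
by case: z; case: w => a b c d; rewrite /= addrC [c * _]mulrC. Qed.
Lemma ReJ z : cRe (cj z) = cRe z. by case: z. Qed.
Lemma ImJ z : cIm (cj z) = - cIm z. by case: z. Qed.
Lemma ReV z : cRe z^-1 = cRe z / nc z ^+ 2.
by rewrite nc_sqr; case: z. Qed.
Lemma ImV z : cIm z^-1 = - (cIm z / nc z ^+ 2).
by rewrite nc_sqr; case: z. Qed.

Lemma cext z w : cRe z = cRe w ->
 cIm z = cIm w -> z = w.
by case: z; case: w => a b c d /= -> ->. Qed.

Lemma mulJ z : z * (cj z) = (nc z ^+ 2)%:C.
by apply: cext; rewrite ?ReM ?ImM ReJ ImJ ?nc_sqr/=; ring.
Qed.

Lemma cJM z w : (cj (z * w)) = (cj z) * (cj w).
by apply: cext; rewrite !(ReM, ImM, ReJ, ImJ); ring. Qed.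

Lemma cJD z w : (cj (z + w)) = (cj z) + (cj w).
by apply: cext; rewrite !(ReD, ImD, ReJ, ImJ)// opprD. Qed.

Lemma cJsum (I : Type) (s : seq I) (F : I -> R[i]) :
 (cj (\sum_(i <- s) F i)) = \sum_(i <- s) (cj (F i)).
elim: s => [|i s IH]; first by rewrite !big_nil; apply: cext; rewrite /= ?oppr0.
by rewrite !big_cons cJD IH.
Qed.

Lemma RCM (r t: R) : (r * t)%:C = r%:C * t%:C :> R[i].
by apply: cext; rewrite ?ReM ?ImM/=; ring. Qed.

Lemma RCV (r: R) : (r^-1)%:C = (r%:C)^-1 :> R[i].
exact: fmorphV. Qed.

Lemma mulii : 'i * 'i = -1 :> R[i]. by rewrite -expr2 sqr_i. Qed.

Lemma expi0 : expi 0 = 1 :> R[i]. by rewrite /expi cos0 sin0. Qed.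

Lemma expiD (a b: R) : expi (a + b) = expi a * expi b.
by rewrite /expi cosD sinD; apply: cext => /=; ring. Qed.

Lemma expiN (a: R) : expi (- a) = (cj (expi a)).
by rewrite /expi cosN sinN. Qed.

Lemma nc_expi (a: R) : nc (expi a) = 1.
by rewrite ncE/= cos2Dsin2 sqrtr1. Qed.

Lemma expi_2pi (k: int) : expi (k%:~R * (2 * pi)) = 1 :> R[i].
have aux (n: nat) : expi (n%:R * (2 * pi)) = 1 :> R[i].
 have -> : n%:R * (2 * pi) = 0 + (pi *+ 2) *+ n :> R.
 by rewrite add0r -[RHS]mulr_natl -[pi *+ 2]mulr_natl.
 by rewrite /expi (periodicn (@cosD2pi R)) (periodicn (@sinD2pi R)) cos0 sin0.
case: k => n; first exact: aux.
by rewrite NegzE mulrNz mulNr expiN aux; apply: cext; rewrite /= ?oppr0.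
Qed.

Lemma expi_per (k: int) (x: R) :
 expi (k%:~R * (x + 2 * pi)) = expi (k%:~R * x).
by rewrite mulrDr expiD expi_2pi mulr1. Qed.

End ComplexBasics.

Notation reim := (ReD, ReM, ReN, ImD, ImM, ImN).

Hint Extern 0 (is_true (@Order.le _ _ _ (@nc _ _))) => exact: nc_ge0 : core.

(** * Continuity and derivatives of complex-valued functions *)

Section ComplexCalculus.
Context {R : realType}.

Definition ccont (T : topologicalType) (u : T -> R[i]) : Prop :=
 continuous (fun x=> cRe (u x)) /\ continuous (fun x=> cIm (u x)).

Section Cont.
Context {T : topologicalType}.

Section RealCont.
Implicit Types f g : T -> R.

Lemma contM f g : continuous f -> continuous g -> continuous (fun x=> f x * g x).
by move=> hf hg x; have := continuousM (hf x) (hg x). Qed.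

Lemma contD f g : continuous f -> continuous g -> continuous (fun x=> f x + g x).
by move=> hf hg x; have := continuousD (hf x) (hg x). Qed.

Lemma contN f : continuous f -> continuous (fun x=> - f x).
by move=> hf x; have := continuousN (hf x). Qed.

Lemma contB f g : continuous f -> continuous g -> continuous (fun x=> f x - g x).
by move=> hf hg; apply: contD=> //; exact: contN. Qed.

Lemma contC (c: R) : continuous (fun _ : T => c).
by move=> x; exact: cst_continuous. Qed.

Lemma contX f n : continuous f -> continuous (fun x=> f x ^+ n).
move=> hf; elim: n => [|n IH]; first exact: contC.
rewrite (_ : (fun x=> _) = (fun x=> f x * f x ^+ n)); first exact: contM.
by apply/funext => x; rewrite exprS.
Qed.

Lemma contV f : (forall x, f x != 0) -> continuous f -> continuous (fun x=> (f x)^-1).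
by move=> f0 hf x; apply: (@continuousV _ _ f); [exact: f0|exact: hf]. Qed.

End RealCont.
Implicit Types u v : T -> R[i].

Lemma ccontD u v : ccont u -> ccont v -> ccont (fun x=> u x + v x).
move=> [u1 u2] [v1 v2]; split => x.
 rewrite (_ : (fun x=> _) = (fun x=> cRe (u x)) + (fun x=> cRe (v x))).
 by apply: continuousD; [exact: u1|exact: v1].
 by apply/funext => y; rewrite ReD.
rewrite (_ : (fun x=> _) = (fun x=> cIm (u x)) + (fun x=> cIm (v x))).
 by apply: continuousD; [exact: u2|exact: v2].
by apply/funext => y; rewrite ImD.
Qed.

Lemma ccontM u v : ccont u -> ccont v -> ccont (fun x=> u x * v x).
move=> [u1 u2] [v1 v2]; split => x.
 rewrite (_ : (fun x=> _) = (fun x=> cRe (u x)) \* (fun x=> cRe (v x))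
 - (fun x=> cIm (u x)) \* (fun x=> cIm (v x))).
 by apply: continuousB; apply: continuousM; [exact: u1|exact: v1|exact: u2|exact: v2].
 by apply/funext => y; rewrite ReM.
rewrite (_ : (fun x=> _) = (fun x=> cRe (u x)) \* (fun x=> cIm (v x))
 + (fun x=> cIm (u x)) \* (fun x=> cRe (v x))).
 by apply: continuousD; apply: continuousM; [exact: u1|exact: v2|exact: u2|exact: v1].
by apply/funext => y; rewrite ImM.
Qed.

Lemma ccontN u : ccont u -> ccont (fun x=> - u x).
move=> [u1 u2]; split => x.
 rewrite (_ : (fun x=> _) = - (fun x=> cRe (u x))).
 by apply: continuousN; exact: u1.
 by apply/funext => y; rewrite ReN.
rewrite (_ : (fun x=> _) = - (fun x=> cIm (u x))).
 by apply: continuousN; exact: u2.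
by apply/funext => y; rewrite ImN.
Qed.

Lemma ccontB u v : ccont u -> ccont v -> ccont (fun x=> u x - v x).
by move=> hu hv; apply: ccontD=> //; exact: ccontN. Qed.

Lemma ccontC (z : R[i]) : ccont (fun _ : T => z).
by split => x; exact: cst_continuous. Qed.

Lemma ccontJ u : ccont u -> ccont (fun x=> (cj (u x))).
move=> [u1 u2]; split => x.
 by under eq_fun do rewrite ReJ; exact: u1.
under eq_fun do rewrite ImJ; apply: continuousN; exact: u2.
Qed.

Lemma contnc u : ccont u -> continuous (fun x=> nc (u x)).
move=> [u1 u2] x; under eq_fun do rewrite ncE.
apply: (@continuous_comp _ _ _ (fun x=> cRe (u x) ^+ 2 + cIm (u x) ^+ 2) Num.sqrt).
 have := @continuousD _ _ _ _ _ x (continuousM (u1 x) (u1 x)) (continuousM (u2 x) (u2 x)).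
 by under [X in _ -> {for _, continuous X}]eq_fun do rewrite !expr2.
exact: sqrt_continuous.
Qed.

Lemma ccontV u : (forall x, u x != 0) -> ccont u -> ccont (fun x=> (u x)^-1).
move=> u0 hu; have hn := contnc hu; case: (hu) => [u1 u2].
have hnV: continuous (fun x=> (nc (u x) ^+ 2)^-1).
 by apply: contV; [move=> x; rewrite expf_neq0// nc_eq0|exact: contX].
split.
 rewrite (_ : (fun x=> _) = (fun x=> cRe (u x) / nc (u x) ^+ 2)).
 exact: contM.
 by apply/funext => x; rewrite ReV.
rewrite (_ : (fun x=> _) = (fun x=> - (cIm (u x) / nc (u x) ^+ 2))).
 exact/contN/contM.
by apply/funext => x; rewrite ImV.
Qed.

Lemma ccontR (f : T -> R) : continuous f -> ccont (fun x=> (f x)%:C).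
by move=> hf; split=> //= x; exact: cst_continuous. Qed.

Lemma ccont_sum (I : Type) (s : seq I) (F : I -> T -> R[i]) :
 (forall i, ccont (F i)) -> ccont (fun x=> \sum_(i <- s) F i x).
move=> h; elim: s => [|i s IH].
 by under eq_fun do rewrite big_nil; exact: ccontC.
by under eq_fun do rewrite big_cons; exact: ccontD.
Qed.

Lemma ccont_expi (f : T -> R) : continuous f -> ccont (fun x=> expi (f x)).
move=> hf; split => x /=.
 by apply: (@continuous_comp _ _ _ f); [exact: hf|exact: continuous_cos].
by apply: (@continuous_comp _ _ _ f); [exact: hf|exact: continuous_sin].
Qed.

End Cont.

Lemma ccont_expik (k: int) : ccont (fun x : R => expi (k%:~R * x)).
apply: ccont_expi => x; apply: continuousM; first exact: cst_continuous.
by move=> ?.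
Qed.

Definition cder (u : R -> R[i]) (x: R) (d : R[i]) : Prop :=
 is_derive x 1 (fun t=> cRe (u t)) (cRe d) /\
 is_derive x 1 (fun t=> cIm (u t)) (cIm d).

Lemma is_dext (f g : R -> R) (x a b: R) : f = g -> a = b ->
 is_derive x 1 f a -> is_derive x 1 g b.
by move=> -> ->. Qed.

Lemma is_dM (f g : R -> R) (x a b: R) :
 is_derive x 1 f a -> is_derive x 1 g b ->
 is_derive x 1 (fun t=> f t * g t) (a * g x + f x * b).
move=> hf hg; apply: is_dext (is_deriveM hf hg); first exact/funext.
by rewrite /GRing.scale/= addrC [g x * _]mulrC.
Qed.

Lemma is_dD (f g : R -> R) (x a b: R) :
 is_derive x 1 f a -> is_derive x 1 g b ->
 is_derive x 1 (fun t=> f t + g t) (a + b).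
by move=> hf hg; apply: is_dext (is_deriveD hf hg). Qed.

Lemma is_dN (f : R -> R) (x a: R) :
 is_derive x 1 f a -> is_derive x 1 (fun t=> - f t) (- a).
by move=> hf; apply: is_dext (is_deriveN hf). Qed.

Lemma is_dV (f : R -> R) (x a: R) : f x != 0 ->
 is_derive x 1 f a -> is_derive x 1 (fun t=> (f t)^-1) (- a / f x ^+ 2).
move=> f0 hf; apply: is_dext (is_deriveV f0 hf)=> //.
by rewrite /GRing.scale/= mulrC mulrN mulNr.
Qed.

Lemma is_dB (f g : R -> R) (x a b: R) :
 is_derive x 1 f a -> is_derive x 1 g b ->
 is_derive x 1 (fun t=> f t - g t) (a - b).
by move=> hf hg; apply: is_dext (is_deriveB hf hg). Qed.

Lemma is_dC (c x: R) : is_derive x 1 (fun _ : R => c) 0.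
exact: is_derive_cst. Qed.

Lemma is_dI (x: R) : is_derive x 1 (fun t : R => t) 1.
exact: is_derive_id. Qed.

Lemma is_dcomp (f g : R -> R) (x a b: R) :
 is_derive (g x) 1 f a -> is_derive x 1 g b ->
 is_derive x 1 (fun t=> f (g t)) (a * b).
by move=> hf hg; exact: is_derive1_comp. Qed.

Lemma is_dcont (f : R -> R) (x a: R) :
 is_derive x 1 f a -> {for x, continuous f}.
by case=> h _; apply: differentiable_continuous; apply/derivable1_diffP.
Qed.

Lemma cderM u v x a b : cder u x a -> cder v x b ->
 cder (fun t=> u t * v t) x (a * v x + u x * b).
move=> [u1 u2] [v1 v2]; split.
 apply: is_dext (is_dB (is_dM u1 v1) (is_dM u2 v2)).
 by apply/funext => t; rewrite ReM.
 by rewrite ReD !ReM; ring.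
apply: is_dext (is_dD (is_dM u1 v2) (is_dM u2 v1)).
 by apply/funext => t; rewrite ImM.
by rewrite ImD !ImM; ring.
Qed.

Lemma cderD u v x a b : cder u x a -> cder v x b ->
 cder (fun t=> u t + v t) x (a + b).
move=> [u1 u2] [v1 v2]; split.
 by apply: is_dext (is_dD u1 v1); [apply/funext => t|]; rewrite ReD.
by apply: is_dext (is_dD u2 v2); [apply/funext => t|]; rewrite ImD.
Qed.

Lemma cderC z x : cder (fun _=> z) x 0.
by split; exact: is_dC. Qed.

Lemma cderZ c u x a : cder u x a -> cder (fun t=> c * u t) x (c * a).
by move=> hu; have := cderM (cderC c x) hu; rewrite mul0r add0r.
Qed.

Lemma cderN u x a : cder u x a -> cder (fun t=> - u t) x (- a).
move=> /(cderZ (-1)); rewrite mulN1r.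
by under [X in cder X]eq_fun do rewrite mulN1r.
Qed.

Lemma cderB u v x a b : cder u x a -> cder v x b ->
 cder (fun t=> u t - v t) x (a - b).
by move=> hu hv; apply: cderD=> //; exact: cderN. Qed.

Lemma cderR (f : R -> R) (x a: R) : is_derive x 1 f a -> cder (fun t=> (f t)%:C) x a%:C.
by move=> hf; split=> //=; exact: is_dC. Qed.

Lemma cder_expi (f : R -> R) (x a: R) : is_derive x 1 f a ->
 cder (fun t=> expi (f t)) x ('i * a%:C * expi (f x)).
move=> hf; split => /=.
 apply: is_dext (is_dcomp (is_derive_cos (f x)) hf)=> //=; ring.
apply: is_dext (is_dcomp (is_derive_sin (f x)) hf)=> //=; ring.
Qed.

Lemma cder_eq u x a b : a = b -> cder u x a -> cder u x b.
by move=> ->. Qed.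

Lemma cder_cont u x a : cder u x a ->
 {for x, continuous (fun t=> cRe (u t))} /\
 {for x, continuous (fun t=> cIm (u t))}.
by move=> [h1 h2]; split; apply: is_dcont; eassumption. Qed.

Lemma cder_expik (k: int) x :
 cder (fun t=> expi (k%:~R * t)) x ('i * k%:~R * expi (k%:~R * x)).
apply: cder_eq (cder_expi (is_dM (is_dC k%:~R x) (is_dI x))).
by rewrite mul0r add0r mulr1 rmorph_int.
Qed.

Lemma cder_inv u x a : u x != 0 -> cder u x a ->
 cder (fun t=> (u t)^-1) x (- a / (u x) ^+ 2).
move=> u0 hu.
have [u1 u2] := hu.
pose N t := cRe (u t) ^+ 2 + cIm (u t) ^+ 2.
have N0: N x != 0 by rewrite /N -nc_sqr expf_neq0// nc_eq0.
have hN: is_derive x 1 N (2 * (cRe (u x) * cRe a + cIm (u x) * cIm a)).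
 apply: is_dext (is_dD (is_dM u1 u1) (is_dM u2 u2)).
 by apply/funext => t; rewrite /N !expr2.
 ring.
have hNV := is_dV N0 hN.
have Nx: N x = cRe (u x) ^+ 2 + cIm (u x) ^+ 2 by [].
move: u0 N0 Nx hNV; case Eu: (u x) (a) u1 u2 => [p q] [d e] /= u1 u2 u0 N0 Nx hNV.
have E: (- (Complex d e)) / (Complex p q) ^+ 2 =
 Complex (d / N x - p * (2 * (p * d + q * e)) / N x ^+ 2)
 (- (e / N x - q * (2 * (p * d + q * e)) / N x ^+ 2)).
 apply: (mulIf (expf_neq0 2 u0)); rewrite mulfVK ?expf_neq0// expr2.
 apply: cext; rewrite ?reim/=; field: (Nx); by rewrite -?Nx.
rewrite E; split => /=.
 apply: is_dext (is_dM u1 hNV)=> //=; last by rewrite Eu /=; ring.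
 by apply/funext => t; rewrite ReV nc_sqr.
apply: is_dext (is_dN (is_dM u2 hNV))=> //=; last by rewrite Eu /=; ring.
by apply/funext => t; rewrite ImV nc_sqr.
Qed.

Lemma der_cont (f f' : R -> R) : (forall x : R, is_derive x 1 f (f' x)) -> continuous f.
by move=> h x; exact: is_dcont (h x). Qed.

Lemma mvt_ex (p p' : R -> R) (y z: R) : y < z -> (forall w : R, y <= w <= z -> is_derive w 1 p (p' w)) ->
 exists2 w, y <= w <= z & p z - p y = p' w * (z - y).
move=> yz hp; have hi (w: R) : w \in `]y, z[ -> y <= w <= z by rewrite in_itv/= => /andP[/ltW -> /ltW ->].
have cp: {within `[y, z], continuous p}.
 by apply: derivable_within_continuous => w; rewrite in_itv/= => /hp[].
by have [w /hi hw E] := MVT yz (fun (w: R) h => hp w (hi w h)) cp; exists w.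
Qed.

Lemma mvt_lip (p p' : R -> R) (L y z: R) :
 (forall w : R, minr y z <= w <= Num.max y z -> is_derive w 1 p (p' w)) ->
 (forall w : R, minr y z <= w <= Num.max y z -> `|p' w| <= L) ->
 `|p z - p y| <= L * `|z - y|.
wlog yz : y z / y <= z => [hw hp hL|].
 have [|/ltW zy] := leP y z; first by move/hw; apply.
 by rewrite distrC (distrC z); apply: hw=> //; rewrite minC maxC.
rewrite min_l// max_r// => hp hL; move: yz; rewrite le_eqVlt => /orP[/eqP ->|yz].
 by rewrite !subrr normr0 mulr0.
by have [w hw ->] := mvt_ex yz hp; rewrite normrM ler_wpM2r//; exact: hL.
Qed.

End ComplexCalculus.

(** * Integrals over a period, Fourier coefficients, Bessel's inequality *)

Section Integrals.
Context {R : realType}.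
Implicit Types (f g : R -> R) (u v : R -> R[i]) (K x: R).

Definition itor f : R := \int[lebesgue_measure]_(x in `[0, 2 * pi]) f x.

Lemma twopi_gt0 : 0 < tau :> R.
by rewrite mulr_gt0// pi_gt0. Qed.

Hint Resolve twopi_gt0 : core.

Lemma twopi_ge0 : 0 <= tau :> R. exact: ltW. Qed.

Lemma mitv : measurable (`[0, tau] : set R). exact: measurable_itv. Qed.

Hint Resolve mitv twopi_ge0 : core.

Lemma cont_integrable f (a b: R) : continuous f ->
 (@lebesgue_measure R).-integrable `[a, b] (EFin \o f).
move=> hf; apply: continuous_compact_integrable; first exact: segment_compact.
exact: continuous_subspaceT.
Qed.

Lemma itorD f g : continuous f -> continuous g ->
 itor (fun x=> f x + g x) = itor f + itor g.
by move=> hf hg; rewrite /itor RintegralD//; exact: cont_integrable. Qed.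

Lemma itorZ c f : continuous f -> itor (fun x=> c * f x) = c * itor f.
by move=> hf; rewrite /itor RintegralZl//; exact: cont_integrable. Qed.

Lemma itorN f : continuous f -> itor (fun x=> - f x) = - itor f.
move=> hf; rewrite -mulN1r -itorZ//; congr itor.
by apply/funext => x; rewrite mulN1r.
Qed.

Lemma itorB f g : continuous f -> continuous g ->
 itor (fun x=> f x - g x) = itor f - itor g.
move=> hf hg; rewrite itorD ?itorN// => x.
by apply: continuousN; exact: hg.
Qed.

Lemma itor_cst c : itor (fun _=> c) = tau * c.
rewrite /itor Rintegral_cst//= lebesgue_measure_itv/= lte_fin twopi_gt0.
by rewrite -EFinD/= subr0 mulrC.
Qed.

Lemma le_itor f g : continuous f -> continuous g ->
 (forall x, 0 <= x <= tau -> f x <= g x) -> itor f <= itor g.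
move=> hf hg h; apply: le_Rintegral; rewrite ?mitv//; try exact: cont_integrable.
Qed.

Lemma itor_ge0 f : (forall x, 0 <= f x) -> 0 <= itor f.
by move=> h; apply: Rintegral_ge0. Qed.

Lemma itor_FTC (F f : R -> R) : continuous f ->
 (forall x : R, is_derive x 1 F (f x)) -> itor f = F tau - F 0.
move=> hf hF; rewrite /itor /Rintegral.
rewrite (@continuous_FTC2 R f F 0 tau)//.
- exact: continuous_subspaceT.
- have hc x : {for x, continuous F} by exact: is_dcont (hF x).
 split.
 + by move=> x _; case: (hF x).
 + exact/cvg_at_right_filter/hc.
 + exact/cvg_at_left_filter/hc.
- by move=> x _; rewrite derive1E; exact: derive_val.
Qed.

Lemma cont_bddP f : continuous f ->
 exists K : R, forall x : R, 0 <= x <= tau -> `|f x| <= K.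
move=> hf; have hn: {within `[0, tau], continuous (fun x=> `|f x|)}.
 apply: continuous_subspaceT => x.
 by apply: (@continuous_comp _ _ _ f); [exact: hf|exact: norm_continuous].
have [c _ hc] := EVT_max twopi_ge0 hn.
by exists `|f c| => x hx; apply: hc; rewrite in_itv.
Qed.

Definition citor u : R[i] := integral_torus u.

Lemma Re_citor u : cRe (citor u) = itor (fun x=> cRe (u x)).
by []. Qed.
Lemma Im_citor u : cIm (citor u) = itor (fun x=> cIm (u x)).
by []. Qed.

Lemma citorD u v : ccont u -> ccont v ->
 citor (fun x=> u x + v x) = citor u + citor v.
move=> [u1 u2] [v1 v2]; apply: cext; rewrite ?ReD ?ImD !(Re_citor, Im_citor).
 by under [X in itor X]eq_fun do rewrite ReD; exact: itorD.
by under [X in itor X]eq_fun do rewrite ImD; exact: itorD.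
Qed.

Lemma citorZ c u : ccont u -> citor (fun x=> c * u x) = c * citor u.
move=> [u1 u2]; have hz d f : continuous f -> continuous (fun x=> d * f x).
 by move=> hf x; apply: continuousM; [exact: cst_continuous|exact: hf].
apply: cext; rewrite ?ReM ?ImM !(Re_citor, Im_citor).
 under [X in itor X]eq_fun do rewrite ReM.
 by rewrite itorB ?itorZ//; exact: hz.
under [X in itor X]eq_fun do rewrite ImM.
by rewrite itorD ?itorZ//; exact: hz.
Qed.

Lemma citorN u : ccont u -> citor (fun x=> - u x) = - citor u.
move=> hu; rewrite -mulN1r -citorZ//; congr citor.
by apply/funext => x; rewrite mulN1r.
Qed.

Lemma citorB u v : ccont u -> ccont v ->
 citor (fun x=> u x - v x) = citor u - citor v.
by move=> hu hv; rewrite citorD ?citorN//; exact: ccontN. Qed.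

Lemma citorJ u : ccont u -> citor (fun x=> (cj (u x))) = (cj (citor u)).
move=> [u1 u2]; apply: cext; rewrite ?ReJ ?ImJ !(Re_citor, Im_citor).
 by congr itor; apply/funext => x; rewrite ReJ.
by rewrite -itorN//; congr itor; apply/funext => x; rewrite ImJ.
Qed.

Lemma citor_sum (I : Type) (s : seq I) (F : I -> R -> R[i]) :
 (forall i, ccont (F i)) ->
 citor (fun x=> \sum_(i <- s) F i x) = \sum_(i <- s) citor (F i).
move=> h; elim: s => [|i s IH].
 rewrite big_nil; under [X in citor X]eq_fun do rewrite big_nil.
 by apply: cext; rewrite !(Re_citor, Im_citor) itor_cst mulr0.
rewrite big_cons; under [X in citor X]eq_fun do rewrite big_cons.
by rewrite citorD ?IH//; exact: ccont_sum.
Qed.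

Lemma citor_cst z : citor (fun _=> z) = tau%:C * z.
apply: cext; rewrite ?ReM ?ImM !(Re_citor, Im_citor) itor_cst/=; ring.
Qed.

Lemma citor_FTC (F f : R -> R[i]) : ccont f ->
 (forall x, cder F x (f x)) -> citor f = F tau - F 0.
move=> [f1 f2] h; apply: cext; rewrite ?ReD ?ReN ?ImD ?ImN !(Re_citor, Im_citor).
 by apply: (@itor_FTC (fun x=> cRe (F x)))=> // x; case: (h x).
by apply: (@itor_FTC (fun x=> cIm (F x)))=> // x; case: (h x).
Qed.

(* Multiplying by the conjugate of the integral makes it real. *)
Lemma nc_citor u : ccont u -> nc (citor u) <= itor (fun x=> nc (u x)).
move=> hu; have hn := contnc hu.
have [->|z0] := eqVneq (citor u) 0.
 by rewrite nc0 itor_ge0// => x; exact: nc_ge0.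
rewrite -(ler_pM2l (nc_gt0 z0)) -expr2 -itorZ//.
have -> : nc (citor u) ^+ 2 = itor (fun x=> cRe ((cj (citor u)) * u x)).
 by rewrite -Re_citor citorZ// mulrC mulJ.
have [c1 _] := ccontM (ccontC (cj (citor u)) (T := R)) hu.
apply: le_itor=> //.
 by apply: contM=> //; exact: contC.
move=> x _; apply: (le_trans (ler_norm _)); apply: (le_trans (Re_le_nc _)).
by rewrite ncM ncJ.
Qed.

Lemma nc_citor_bdd u K : ccont u -> (forall x, 0 <= x <= tau -> nc (u x) <= K) ->
 nc (citor u) <= tau * K.
move=> hu h; apply: (le_trans (nc_citor hu)); rewrite -itor_cst.
by apply: le_itor=> //; [exact: contnc|move=> x; exact: cst_continuous].
Qed.

Lemma fourierE u k : fourier u k = citor (fun x=> u x * expi (- (k%:~R * x))).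
by []. Qed.

Lemma ccont_four u k : ccont u -> ccont (fun x=> u x * expi (- (k%:~R * x))).
move=> hu; apply: ccontM=> //; apply: ccont_expi; apply: contN; apply: contM; [exact: contC|by move=> ?].
Qed.

Lemma fourierD u v k : ccont u -> ccont v ->
 fourier (fun x=> u x + v x) k = fourier u k + fourier v k.
move=> hu hv; rewrite !fourierE -citorD; [|exact: ccont_four..].
by congr citor; apply/funext => x; rewrite mulrDl.
Qed.

Lemma fourierZ c u k : ccont u -> fourier (fun x=> c * u x) k = c * fourier u k.
move=> hu; rewrite !fourierE -citorZ; last exact: ccont_four.
by congr citor; apply/funext => x; rewrite mulrA.
Qed.

Lemma fourierN u k : ccont u -> fourier (fun x=> - u x) k = - fourier u k.
move=> hu; rewrite -mulN1r -fourierZ//; congr (fourier _ k).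
by apply/funext => x; rewrite mulN1r.
Qed.

Lemma fourierB u v k : ccont u -> ccont v ->
 fourier (fun x=> u x - v x) k = fourier u k - fourier v k.
by move=> hu hv; rewrite fourierD ?fourierN//; exact: ccontN. Qed.

Lemma fourierJ u k : ccont u -> fourier (fun x=> (cj (u x))) k = (cj (fourier u (- k))).
move=> hu; rewrite !fourierE -citorJ; last exact: ccont_four.
congr citor; apply/funext => x; rewrite cJM -expiN.
by rewrite mulrNz mulNr opprK.
Qed.

Lemma fourier_sum (I : Type) (s : seq I) (F : I -> R -> R[i]) k :
 (forall i, ccont (F i)) ->
 fourier (fun x=> \sum_(i <- s) F i x) k = \sum_(i <- s) fourier (F i) k.
move=> h; rewrite fourierE; under [X in citor X]eq_fun do rewrite mulr_suml.
by rewrite citor_sum// => i; exact: ccont_four.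
Qed.

Lemma nc_fourier u k K : ccont u -> (forall x, 0 <= x <= tau -> nc (u x) <= K) ->
 nc (fourier u k) <= tau * K.
move=> hu h; apply: nc_citor_bdd; first exact: ccont_four.
by move=> x hx; rewrite ncM nc_expi mulr1 h.
Qed.

Lemma fourier_mulE u j k :
 fourier (fun x=> u x * expi (j%:~R * x)) k = fourier u (k - j).
rewrite !fourierE; congr citor; apply/funext => x.
by rewrite -mulrA -expiD; congr (_ * expi _); rewrite mulrzDr mulrNz; ring.
Qed.

Lemma fourier_expi j k :
 fourier (fun x=> expi (j%:~R * x)) k = if k == j then tau%:C else 0 :> R[i].
have -> : fourier (fun x=> expi (j%:~R * x)) k = citor (fun x=> expi ((j - k)%:~R * x)).
 rewrite fourierE; congr citor; apply/funext => x.
 by rewrite -expiD; congr expi; rewrite mulrzDr mulrNz; ring.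
have [->|kj] := eqVneq k j.
 rewrite subrr; under [X in citor X]eq_fun do rewrite mul0r expi0.
 by rewrite citor_cst mulr1.
have jk0: (j - k)%:~R != 0 :> R[i] by rewrite intr_eq0 subr_eq0 eq_sym.
have i0: 'i != 0 :> R[i] by rewrite -nc_eq0 nc_i oner_eq0.
have F (x: R) : cder (fun t=> ('i * (j - k)%:~R)^-1 * expi ((j - k)%:~R * t)) x
 (expi ((j - k)%:~R * x)).
 apply: cder_eq (cderZ _ (cder_expik (j - k) x)).
 by rewrite mulKf// mulf_neq0.
rewrite (citor_FTC _ F); last exact: ccont_expik.
by rewrite expi_2pi mulr0 expi0 subrr.
Qed.

Lemma fourier_der u u' k : ccont u' -> (forall x, cder u x (u' x)) ->
 u tau = u 0 -> fourier u' k = 'i * (k%:~R * fourier u k).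
move=> hu' hu uper.
have cu: ccont u.
 by split => x; have [h1 h2] := cder_cont (hu x).
pose e x : R[i] := expi (- (k%:~R * x)).
have he x : cder e x (- ('i * k%:~R) * e x).
 apply: cder_eq (cder_expi (is_dN (is_dM (is_dC k%:~R x) (is_dI x)))).
 by rewrite mul0r add0r mulr1 rmorphN/= rmorph_int mulrN.
have F x := cderM (hu x) (he x).
have ce: ccont e.
 by apply: ccont_expi; apply: contN; apply: contM; [exact: contC|by move=> ?].
have := citor_FTC _ F; rewrite /e uper mulr0 oppr0 expi0.
rewrite expiN expi_2pi conjc1 subrr => h.
have {}h : citor (fun x=> u' x * e x + u x * (- ('i * k%:~R) * e x)) = 0.
 apply: h; apply: ccontD; apply: ccontM=> //; exact: ccontM (ccontC _) ce.
rewrite !fourierE -/e; apply/eqP; rewrite -subr_eq0 mulrA -h citorD.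
- rewrite -citorZ; last by apply: ccontM.
 rewrite -citorN; last by apply: ccontM; [exact: ccontC|exact: ccontM].
 apply/eqP; congr (_ + citor _); apply/funext => x; rewrite /e; ring.
- exact: ccontM.
- by apply: ccontM=> //; exact: ccontM (ccontC _) ce.
Qed.

Lemma fourier_fsum (F : {fset int}) (c : int -> R[i]) k :
 fourier (fun x=> \sum_(j <- F) c j * expi (j%:~R * x)) k = if k \in F then tau%:C * c k else 0.
rewrite fourier_sum; last by move=> j; apply: ccontM; [exact: ccontC|exact: ccont_expik].
have E j : fourier (fun x=> c j * expi (j%:~R * x)) k = if k == j then tau%:C * c j else 0.
 rewrite fourierZ; last exact: ccont_expik.
 by rewrite fourier_expi mulrC; case: ifP; rewrite ?mul0r.
case: ifPn => kF; last first.
 by rewrite big1_seq// => j /andP[_ jF]; rewrite E; case: eqVneq=> // e; rewrite e jF in kF.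
rewrite (bigD1_seq k kF (fset_uniq F)) big1 /= ?E ?eqxx ?addr0// => j jk.
by rewrite E eq_sym (negbTE jk).
Qed.

Lemma bessel u (F : {fset int}) : ccont u ->
 \sum_(k <- F) nc (fourier u k) ^+ 2 <= tau * itor (fun x=> nc (u x) ^+ 2).
move=> hu; pose c k := fourier u k / tau%:C.
pose S x := \sum_(k <- F) c k * expi (k%:~R * x).
have p0: tau%:C != 0 :> R[i] by rewrite -nc_eq0 nc_real gt_eqF// normr_gt0 gt_eqF.
have cS: ccont S.
 by apply: ccont_sum => k; apply: ccontM; [exact: ccontC|exact: ccont_expik].
set B := \sum_(k <- F) _.
have cont2 v : ccont v -> continuous (fun x : R => nc (v x) ^+ 2).
 by move=> hv; apply: contX; exact: contnc.
have E v : ccont v -> (forall k, k \in F -> fourier v k = fourier u k) ->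
 cRe (citor (fun x=> v x * (cj (S x)))) = B / tau.
 move=> cv' hv; suff -> : citor (fun x=> v x * (cj (S x))) = (B / tau)%:C by [].
 rewrite (_ : (fun x=> _) = (fun x=> \sum_(k <- F) (cj (c k)) * (v x * expi (- (k%:~R * x))))); last first.
 apply/funext => x; rewrite cJsum mulr_sumr; apply: eq_bigr => k _.
 by rewrite cJM -expiN; ring.
 rewrite citor_sum; last by move=> k; apply: ccontM; [exact: ccontC|exact: ccont_four].
 rewrite /B mulr_suml rmorph_sum; apply: eq_big_seq => k kF.
 rewrite citorZ; last exact: ccont_four.
 rewrite -fourierE hv// /c cJM mulrAC [cj _ * _]mulrC mulJ.
 by rewrite conjc_inv conjc_real -[RHS]/((_ / _)%:C) [RHS]RCM RCV.
have E1 := E _ hu (fun _ _ => erefl).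
have E2: cRe (citor (fun x=> S x * (cj (S x)))) = B / tau.
 by apply: E=> // k kF; rewrite fourier_fsum kF /c mulrCA divff ?mulr1.
have h0: 0 <= itor (fun x=> nc (u x - S x) ^+ 2).
 by apply: itor_ge0 => x; exact: sqr_ge0.
have Ex x : nc (u x - S x) ^+ 2 =
 nc (u x) ^+ 2 - 2 * cRe (u x * (cj (S x))) + cRe (S x * (cj (S x))).
 rewrite !nc_sqr !ReM ReJ ImJ ReD ImD ReN ImN; ring.
rewrite (funext Ex) in h0.
have [r1 _] := ccontM hu (ccontJ cS).
have [r2 _] := ccontM cS (ccontJ cS).
have z1: continuous (fun x=> 2 * cRe (u x * (cj (S x)))).
 by apply: contM=> //; exact: contC.
rewrite itorD// ?itorB ?itorZ -?Re_citor ?E1 ?E2/= in h0; [|by []|exact: cont2|by []|]; last first.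
 exact: contB (cont2 _ _) z1.
rewrite mulrC -ler_pdivrMr//; lra.
Qed.

End Integrals.

Hint Extern 0 (is_true (@Order.lt _ _ _ (@GRing.mul _ _ (@pi _)))) => exact: twopi_gt0 : core.
Hint Extern 0 (is_true (@Order.le _ _ _ (@GRing.mul _ _ (@pi _)))) => exact: twopi_ge0 : core.

(** * A continuous periodic function is determined by its Fourier coefficients *)

Section Uniqueness.
Context {R : realType}.
Implicit Types (f g : R -> R) (u v : R -> R[i]) (x: R).

Lemma contI : continuous (fun x : R => x). by move=> ?. Qed.

Lemma itor_ge_sub f (a b c: R) : continuous f -> 0 <= a -> a <= b -> b <= tau ->
 0 <= c -> (forall x, 0 <= x <= tau -> 0 <= f x) -> (forall x, a <= x <= b -> c <= f x) ->
 c * (b - a) <= itor f.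
move=> hf a0 ab b2 c0 f0 fc.
have sub: `[a, b] `<=` (`[0, tau] : set R).
 move=> x /=; rewrite !in_itv/= => /andP[h1 h2].
 by rewrite (le_trans a0 h1) (le_trans h2 b2).
have mab: measurable (`[a, b] : set R) by exact: measurable_itv.
apply: (le_via (\int[lebesgue_measure]_(x in `[a, b]) f x)).
 have -> : c * (b - a) = \int[lebesgue_measure]_(x in `[a, b]) c.
 rewrite Rintegral_cst//= lebesgue_measure_itv/= lte_fin.
 case: ltP => [|ba]; first by rewrite -EFinD.
 by have -> : a = b; [apply/eqP; rewrite eq_le ab|rewrite subrr].
 apply: le_Rintegral=> //; try exact: cont_integrable.
 by apply: (@cont_integrable _ (fun _=> c)); exact: contC.
have hi := cont_integrable 0 tau hf; have hi2 := cont_integrable a b hf.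
rewrite /itor /Rintegral fine_le//; [exact: integrable_fin_num| |].
 by apply: integrable_fin_num=> //; exact: mitv.
apply: (ge0_subset_integral lebesgue_measure mab (@mitv R))=> //.
by case/integrableP: hi.
Qed.

Definition allzero f : Prop := forall k, fourier (ofreal f) k = 0.

(** Multiplying by [cos (x - x0)] only shifts frequencies by one in each direction. *)
Lemma allzero_step f x0 : continuous f -> allzero f ->
 allzero (fun x=> f x * (1 + cos (x - x0))).
move=> hf h k.
have cf: ccont (ofreal f) by exact: ccontR.
pose w (j: int) x : R[i] := ofreal f x * expi (j%:~R * x).
have cw j : ccont (w j) by apply: ccontM=> //; exact: ccont_expik.
have -> : (ofreal (fun x=> f x * (1 + cos (x - x0)))) =
 (fun x=> ofreal f x + ((2^-1)%:C * expi (- x0) * w 1 x + (2^-1)%:C * expi x0 * w (-1) x)).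
 apply/funext => x; rewrite /w mulr1z mulrNz mulr1z mulN1r mul1r /ofreal cosB.
 by apply: cext; rewrite !reim/= !(cosN, sinN); field.
rewrite fourierD ?fourierD ?fourierZ //; last first.
- by apply: ccontD; apply: ccontM=> //; exact: ccontC.
- by apply: ccontM=> //; exact: ccontC.
- by apply: ccontM=> //; exact: ccontC.
by rewrite !fourier_mulE !h !mulr0 !addr0.
Qed.

Lemma allzero_itor f : continuous f -> allzero f -> itor f = 0.
move=> hf /(_ 0); rewrite fourierE.
under [X in citor X]eq_fun do rewrite mul0r oppr0 expi0 mulr1.
by move/(congr1 (@cRe R)); rewrite Re_citor.
Qed.

Lemma cos_le_arc (r t: R) : 0 <= r <= pi -> r <= `|t| -> `|t| <= tau - r -> cos t <= cos r.
move=> /andP[r0 rpi] h1 h2.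
have -> : cos t = cos `|t| by case: (ler0P t) => _ //; rewrite cosN.
have mono (x y: R) : 0 <= x -> x <= y -> y <= pi -> cos y <= cos x.
 move=> x0 xy ypi; rewrite leNgt; apply/negP; rewrite ltr_cos ?in_itv/=.
 - by rewrite ltNge xy.
 - by apply/andP; split=> //; exact: le_trans xy.
 - by apply/andP; split=> //; exact: le_trans ypi.
have [tp|tp] := leP `|t| pi; first exact: mono.
have -> : cos `|t| = cos (tau - `|t|).
 rewrite cosB (_ : tau = pi *+ 2) ?mulr_natl// cos2pi sin2pi; ring.
by apply: mono=> //; lra.
Qed.

Lemma cos_lt_half (r: R) : 0 < r <= pi -> cos r < cos (r / 2).
by move=> /andP[r0 rpi]; rewrite ltr_cos ?in_itv/=; [|lra..]; lra.
Qed.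

Lemma pow_unbounded (q K: R) : 1 < q -> exists N : nat, K < q ^+ N.
move=> q1; exists (Num.truncn (K / (q - 1))).+1.
have d0: 0 < q - 1 by lra.
have h n : 1 + n%:R * (q - 1) <= q ^+ n.
 elim: n => [|n IH]; first by rewrite mul0r addr0 expr0.
 rewrite exprS -natr1; have : 0 <= n%:R * (q - 1) by rewrite mulr_ge0// ltW.
 nra.
apply: lt_le_trans (h _).
have [K0|K0] := leP 0 K.
 have := @truncnS_gt _ (K / (q - 1)); rewrite ltr_pdivrMr//; lra.
by rewrite (lt_le_trans K0)// addr_ge0// mulr_ge0// ltW.
Qed.

(** The powers of [1 + cos (x - x0)] concentrate at [x0]. If [f x0 > 0], their integrals against [f]
    are dominated by a neighbourhood of [x0], where the factor is at least [q'], against at most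
    [q < q'] outside a larger one; but all these integrals are zero. *)
Lemma allzero_pos f x0 : continuous f -> allzero f -> 0 < x0 < tau -> f x0 <= 0.
move=> hf hz /andP[x00 x02]; rewrite leNgt; apply/negP => fx0.
have [K hK] := cont_bddP hf.
have : \forall x \near x0, `|f x0 - f x| < f x0 / 2.
 by have := hf x0; move/cvgrPdist_lt; apply; rewrite divr_gt0.
move=> [e /= e0 he0].
have he x : `|x0 - x| < e -> f x0 / 2 < f x.
 by move=> /he0; rewrite ltr_norml => /andP[_]; lra.
pose r := minr (minr e pi) (minr x0 (tau - x0)) / 2.
have pi0: 0 < pi :> R by exact: pi_gt0.
have r0: 0 < r by rewrite divr_gt0// !lt_min e0 pi0 x00/=; lra.
have [re rpi rx rx2] : [/\ 2 * r <= e, 2 * r <= pi, 2 * r <= x0 & 2 * r <= tau - x0].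
 have -> : 2 * r = minr (minr e pi) (minr x0 (tau - x0)) by rewrite /r; lra.
 by rewrite !ge_min !lexx ?orbT.
pose q := 1 + cos r; pose q' := 1 + cos (r / 2).
have qq': q < q' by rewrite ltrD2l cos_lt_half//; apply/andP; split; lra.
have q0: 0 < q.
 have : cos pi < cos r by rewrite ltr_cos ?in_itv/=; lra.
 by rewrite cospi /q; lra.
have q'0: 0 < q' by exact: lt_trans qq'.
have K0: 0 <= K by apply: le_trans (hK 0 _); rewrite ?normr_ge0// lexx twopi_ge0.
pose g N x := f x * (1 + cos (x - x0)) ^+ N.
have cg N : continuous (g N).
 apply: contM=> //; apply: contX; apply: contD; first exact: contC.
 move=> x; apply: (@continuous_comp _ _ _ (fun x=> x - x0) cos); last exact: continuous_cos.
 by apply: contB; [exact: contI|exact: contC].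
have zg N : allzero (g N).
 elim: N => [|N IH]; first by rewrite /g; under eq_fun do rewrite expr0 mulr1.
 have := allzero_step x0 (cg N) IH; congr allzero.
 by apply/funext => x; rewrite /g exprSr mulrA.
(* The constant [K * q ^+ N] compensates for the negative values of the integrand outside the arc of
   radius [r]; what remains dominates the integral over the arc of radius [r / 2]. *)
have key N : f x0 / 2 * q' ^+ N * r <= tau * (K * q ^+ N).
 have -> : tau * (K * q ^+ N) = itor (fun x=> g N x + K * q ^+ N).
 by rewrite itorD ?(allzero_itor (cg N))// ?itor_cst ?add0r//; exact: contC.
 have -> : f x0 / 2 * q' ^+ N * r = f x0 / 2 * q' ^+ N * ((x0 + r / 2) - (x0 - r / 2)) by congr (_ * _); lra.
 have T0 x : 0 <= 1 + cos (x - x0) by have := cos_geN1 (x - x0); lra.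
 have Kq: 0 <= K * q ^+ N by rewrite mulr_ge0// exprn_ge0// ltW.
 apply: itor_ge_sub; [|lra|lra|lra| | |].
 - by apply: contD=> //; exact: contC.
 - by rewrite mulr_ge0 ?exprn_ge0//; [lra|exact: ltW].
 - move=> x /andP[x1 x2]; have [xr|xr] := ltP `|x - x0| r.
 rewrite addr_ge0// mulr_ge0// ?exprn_ge0//.
 have /ltW : f x0 / 2 < f x by apply: he; rewrite distrC; lra.
 lra.
 rewrite -lerBlDr sub0r -mulrN; apply: (le_via (- `|f x| * (1 + cos (x - x0)) ^+ N)).
 rewrite mulNr mulrN lerN2; apply: ler_pM=> //; rewrite ?exprn_ge0// ?hK ?x1//.
 apply: lerXn2r; rewrite ?nnegrE ?(ltW q0) ?T0//.
 rewrite lerD2l; apply: cos_le_arc=> //; first by apply/andP; split; lra.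
 by rewrite ler_norml; lra.
 by rewrite ler_wpM2r ?exprn_ge0// lerNl ler_normr lexx orbT.
 - move=> x /andP[x1 x2].
 have xr: `|x - x0| <= r / 2 by rewrite ler_norml; lra.
 apply: (le_via (g N x)); last by rewrite lerDl.
 apply: ler_pM; rewrite ?exprn_ge0 ?(ltW q'0)//; first lra.
 by apply/ltW/he; rewrite distrC; lra.
 rewrite lerXn2r ?nnegrE ?(ltW q'0)// lerD2l.
 have -> : cos (x - x0) = cos `|x - x0| by case: (ler0P (x - x0)) => _ //; rewrite cosN.
 have := normr_ge0 (x - x0).
 move: xr; rewrite le_eqVlt => /predU1P[->//|xr n0].
 by apply/ltW; rewrite ltr_cos ?in_itv/=; lra.
have [N hN] := pow_unbounded (tau * K / (f x0 / 2 * r)) (ltac:(by rewrite ltr_pdivlMr ?mul1r) : 1 < q' / q).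
have := key N; apply/negP; rewrite -ltNge.
have fr0: 0 < f x0 / 2 * r by rewrite mulr_gt0//; lra.
move: hN; rewrite ltr_pdivrMr// expr_div_n [X in _ < X]mulrAC ltr_pdivlMr ?exprn_gt0//.
have -> : f x0 / 2 * q' ^+ N * r = q' ^+ N * (f x0 / 2 * r) by ring.
by rewrite [tau * (K * _)]mulrA.
Qed.

Lemma allzero_eq0 f x : continuous f -> allzero f -> 0 < x < tau -> f x = 0.
move=> hf hz hx; apply/eqP; rewrite eq_le allzero_pos//= -oppr_le0.
apply: (@allzero_pos (fun x=> - f x) x)=> //; first exact: contN.
move=> k; rewrite (_ : ofreal _ = (fun x=> - ofreal f x)); last first.
 by apply/funext => y; apply: cext; rewrite /= ?oppr0.
by rewrite fourierN ?hz ?oppr0//; exact: ccontR.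
Qed.

Lemma per_reduce (x: R) : exists k : int, 0 <= x + k%:~R * tau <= tau.
exists (- Num.floor (x / tau)).
have h1 := floor_le (x / tau).
have h2 := lt_succ_floor (x / tau).
have {}h1 : (Num.floor (x / tau))%:~R * tau <= x by rewrite -ler_pdivlMr ?twopi_gt0.
have {}h2 : x < ((Num.floor (x / tau))%:~R + 1) * tau.
 by rewrite -ltr_pdivrMr ?twopi_gt0// -[1]/(1%:~R) -intrD.
rewrite mulrNz.
by apply/andP; split; lra.
Qed.

Lemma periodic_int (V : zmodType) (f : R -> V) : periodic f tau ->
 forall (k: int) x, f (x + k%:~R * tau) = f x.
move=> hf; have hn (n: nat) x : f (x + n%:R * tau) = f x.
 by rewrite mulr_natl (periodicn hf).
case=> n x; first exact: hn.
by rewrite NegzE mulrNz mulNr -(hn n.+1 (x - _)) subrK.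
Qed.

Lemma ofreal_Re u k : ccont u -> fourier (ofreal (fun x=> cRe (u x))) k =
 (2^-1)%:C * (fourier u k + cj (fourier u (- k))).
move=> hu; rewrite -fourierJ// -fourierD//; last exact: ccontJ.
rewrite -fourierZ; last by apply: ccontD=> //; exact: ccontJ.
congr (fourier _ k); apply/funext => x; rewrite /ofreal.
by apply: cext; rewrite !(ReM, ImM, ReD, ImD, ReJ, ImJ)/=; field.
Qed.

Lemma ofreal_Im u k : ccont u -> fourier (ofreal (fun x=> cIm (u x))) k =
 - 'i * (2^-1)%:C * (fourier u k - cj (fourier u (- k))).
move=> hu; rewrite -fourierJ// -fourierB//; last exact: ccontJ.
rewrite -fourierZ; last by apply: ccontB=> //; exact: ccontJ.
congr (fourier _ k); apply/funext => x; rewrite /ofreal.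
by apply: cext; rewrite !(ReM, ImM, ReD, ImD, ReN, ImN, ReJ, ImJ)/=; field.
Qed.

Lemma cont_eq0_closed f : continuous f ->
 (forall x, 0 < x < tau -> f x = 0) -> forall x, 0 <= x <= tau -> f x = 0.
move=> hf h x hx; apply/eqP; rewrite -normr_le0; apply/ler_addgt0Pr => e e0; rewrite add0r.
have : \forall y \near x, `|f x - f y| < e.
 by have := hf x; move/cvgrPdist_lt; apply.
move=> [d /= d0 hd].
have pi0: 0 < pi :> R by exact: pi_gt0.
pose m := minr d pi / 2.
have m0: 0 < m by rewrite divr_gt0// lt_min d0 pi0.
have [md mp] : 2 * m <= d /\ 2 * m <= pi.
 have -> : 2 * m = minr d pi by rewrite /m; lra.
 by rewrite !ge_min !lexx orbT.
have [xp|xp] := leP x pi.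
 have := hd (x + m); rewrite /ball_/= opprD addNKr normrN gtr0_norm// (h (x + m)); last lra.
 by rewrite subr0 => hh; apply/ltW/hh; lra.
have := hd (x - m); rewrite /ball_/= opprB addrCA subrr addr0 gtr0_norm// (h (x - m)); last lra.
by rewrite subr0 => hh; apply/ltW/hh; lra.
Qed.

Lemma fourier_inj u : ccont u -> periodic u tau ->
 (forall k, fourier u k = 0) -> forall x, u x = 0.
move=> hu uper h x; have [u1 u2] := hu.
have [k hk] := per_reduce x; rewrite -(periodic_int uper k).
apply: cext; rewrite /=.
 apply: (cont_eq0_closed u1 _ hk) => y hy; apply: (allzero_eq0 u1 _ hy) => j.
 by rewrite ofreal_Re// !h conjc0 addr0 mulr0.
apply: (cont_eq0_closed u2 _ hk) => y hy; apply: (allzero_eq0 u2 _ hy) => j.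
by rewrite ofreal_Im// !h conjc0 subr0 mulr0.
Qed.

End Uniqueness.

(** * Absolutely convergent sums over the integers *)

Section ComplexSums.
Context {R : realType}.
Implicit Types (x y b : int -> R) (C e: R) (F G : {fset int}) (c d : int -> R[i]).

Lemma fsum_split F G (f : int -> R) :
 \sum_(k <- (F `|` G)%fset) f k = \sum_(k <- F) f k + \sum_(k <- (G `\` F)%fset) f k.
rewrite (@big_fsetID _ _ _ _ (mem F)) /=; congr (_ + _).
 by apply: eq_fbigl => k; rewrite !inE; case: (k \in F); rewrite ?andbF.
by apply: eq_fbigl => k; rewrite !inE; case: (k \in F); rewrite ?andbF ?andbT.
Qed.

(** One finite set serves all [y] dominated by [b]; this uniformity becomes the uniform convergence
    of trigonometric series. *)
Lemma l1_tail b C : (forall k, 0 <= b k) -> l1 b C -> forall e, 0 < e ->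
 exists F0 : {fset int}, forall F y, (F0 `<=` F)%fset ->
 (forall k, 0 <= y k <= b k) -> (asum y <= (\sum_(k <- F) y k + e)%:E)%E.
move=> b0 hb e e0.
have fin: asum b \is a fin_num.
 by rewrite ge0_fin_numE ?asum_ge0// (le_lt_trans hb)// ltey.
have [_ [F0 [finF0 _] <-] hF0] := ub_ereal_sup_adherent e0 fin.
rewrite fsbig_finite//= sumEFin in hF0.
exists (fset_set F0) => F y FF hy; apply: asum_fin_le => G.
under eq_bigr do rewrite ger0_norm ?(andP (hy _)).1//.
have yb G' : \sum_(k <- G') y k <= \sum_(k <- G') b k.
 by apply: ler_sum => k _; case/andP: (hy k).
have y0 G' : 0 <= \sum_(k <- G') y k by apply: sumr_ge0 => k _; case/andP: (hy k).
apply: (le_via (\sum_(k <- (F `|` G)%fset) y k)).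
 by rewrite fsetUC fsum_split lerDl.
rewrite fsum_split lerD2l; apply: (le_trans (yb _)).
rewrite -(lerD2l (\sum_(k <- F) b k)) -fsum_split.
have h1: \sum_(k <- (F `|` G)%fset) b k <= fine (asum b).
 apply: le_trans (asum_fin_ge (F `|` G)%fset (_ : (asum b <= (fine (asum b))%:E)%E)).
 by apply: ler_sum => k _; exact: ler_norm.
 by rewrite fineK.
have h2: fine (asum b) < \sum_(k <- fset_set F0) b k + e.
 rewrite -ltrBlDr -lte_fin EFinB fineK//; apply: lt_le_trans hF0 _.
 by rewrite lee_fin; apply: ler_sum => k _; rewrite ger0_norm.
have h3: \sum_(k <- fset_set F0) b k <= \sum_(k <- F) b k.
 by rewrite -(fsetUidPr _ _ FF) fsum_split lerDl sumr_ge0.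
lra.
Qed.

(** Unordered sums of the positive and of the negative part; meaningful under absolute summability,
    which the lemmas below ensure by a majorant. *)
Definition rsum x : R :=
 fine (asum (fun k=> Num.max (x k) 0)) - fine (asum (fun k=> Num.max (- x k) 0)).

Definition csum c : R[i] :=
 rsum (fun k=> cRe (c k)) +i* rsum (fun k=> cIm (c k)).

Lemma rsum_tail b C : (forall k, 0 <= b k) -> l1 b C -> forall e, 0 < e ->
 exists F0 : {fset int}, forall F x, (F0 `<=` F)%fset ->
 (forall k, `|x k| <= b k) -> `|rsum x - \sum_(k <- F) x k| <= e.
move=> b0 hb e e0; have [F0 hF0] := l1_tail b0 hb e0.
exists F0 => F x FF hx.
have bnd y : (forall k, 0 <= y k <= b k) ->
 \sum_(k <- F) y k <= fine (asum y) <= \sum_(k <- F) y k + e.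
 move=> hy; have ay: (asum y < +oo)%E.
 apply: (@le_lt_trans _ _ C%:E); last exact: ltey.
 apply: (@l1_le _ y b) hb => k; have /andP[h1 h2] := hy k.
 by rewrite !ger0_norm.
 apply/andP; split.
 apply: le_trans (asum_fin_ge F (_ : (asum y <= (fine (asum y))%:E)%E)).
 by apply: ler_sum => k _; exact: ler_norm.
 by rewrite asum_finE.
 by rewrite -lee_fin asum_finE// hF0.
have h1: forall k, 0 <= Num.max (x k) 0 <= b k.
 move=> k; rewrite le_max lexx orbT/= ge_max b0 andbT.
 exact: le_trans (ler_norm _) (hx k).
have h2: forall k, 0 <= Num.max (- x k) 0 <= b k.
 move=> k; rewrite le_max lexx orbT/= ge_max b0 andbT.
 by apply: le_trans (ler_norm _) _; rewrite normrN.
have E: \sum_(k <- F) x k = \sum_(k <- F) Num.max (x k) 0 - \sum_(k <- F) Num.max (- x k) 0.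
 rewrite -sumrB; apply: eq_bigr => k _; case: (leP (x k) 0) => h; case: leP => h'; lra.
have := bnd _ h1; have := bnd _ h2; rewrite /rsum E => /andP[h3 h4] /andP[h5 h6].
by rewrite ler_norml; apply/andP; split; lra.
Qed.

Lemma Re_sum (I : Type) (s : seq I) (f : I -> R[i]) :
 cRe (\sum_(i <- s) f i) = \sum_(i <- s) cRe (f i).
by elim: s => [|i s IH]; rewrite ?big_nil// !big_cons ReD IH. Qed.

Lemma Im_sum (I : Type) (s : seq I) (f : I -> R[i]) :
 cIm (\sum_(i <- s) f i) = \sum_(i <- s) cIm (f i).
by elim: s => [|i s IH]; rewrite ?big_nil// !big_cons ImD IH. Qed.

Lemma csum_tail b C : (forall k, 0 <= b k) -> l1 b C -> forall e, 0 < e ->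
 exists F0 : {fset int}, forall F c, (F0 `<=` F)%fset ->
 (forall k, nc (c k) <= b k) -> nc (csum c - \sum_(k <- F) c k) <= e.
move=> b0 hb e e0; have e20: 0 < e / 2 by rewrite divr_gt0.
have [F0 hF0] := rsum_tail b0 hb e20.
exists F0 => F c FF hc; apply: (le_trans (nc_le_ReIm _)).
rewrite ReD ImD ReN ImN Re_sum Im_sum.
have := hF0 F (fun k=> cRe (c k)) FF (fun k=> le_trans (Re_le_nc _) (hc k)).
have := hF0 F (fun k=> cIm (c k)) FF (fun k=> le_trans (Im_le_nc _) (hc k)).
rewrite /=; lra.
Qed.

Lemma csum_bd b C c : (forall k, 0 <= b k) -> l1 b C ->
 (forall k, nc (c k) <= b k) -> nc (csum c) <= C.
move=> b0 hb hc; apply/ler_addgt0Pr => e e0.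
have [F0 hF0] := csum_tail b0 hb e0.
have h1 := hF0 F0 c (fsubset_refl _) hc.
rewrite -(subrK (\sum_(k <- F0) c k) (csum c)) addrC.
apply: (le_trans (ncD _ _)); apply: lerD=> //.
apply: (le_trans (nc_sum _ _)); apply: le_trans (asum_fin_ge F0 hb).
by apply: ler_sum => k _; apply: (le_trans (hc k)); exact: ler_norm.
Qed.

Lemma nc_small (z : R[i]) : (forall e, 0 < e -> nc z <= e) -> z = 0.
move=> h; apply/eqP; rewrite -nc_eq0 eq_le nc_ge0 andbT.
by apply/ler_addgt0Pr => e e0; rewrite add0r h.
Qed.

Lemma csum_lin b C (a : R[i]) c d : (forall k, 0 <= b k) -> l1 b C ->
 (forall k, nc (c k) <= b k) -> (forall k, nc (d k) <= b k) ->
 csum (fun k=> c k + a * d k) = csum c + a * csum d.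
move=> b0 hb hc hd; apply/eqP; rewrite -subr_eq0; apply/eqP/nc_small => e e0.
set A := 1 + nc a; have A0: 0 < A by rewrite ltr_pwDl// nc_ge0.
have e30: 0 < e / (3 * A) by rewrite divr_gt0// mulr_gt0.
have hb': l1 (fun k=> A * b k) (`|A| * C) by exact: l1Z.
have b0' k : 0 <= A * b k by rewrite mulr_ge0// ltW.
have [F1 h1] := csum_tail b0 hb e30; have [F2 h2] := csum_tail b0' hb' e30.
pose F := (F1 `|` F2)%fset.
have := h1 F c (fsubsetUl _ _) hc; have := h1 F d (fsubsetUl _ _) hd.
have hcd k : nc (c k + a * d k) <= A * b k.
 rewrite (le_trans (ncD _ _))// ncM /A mulrDl mul1r lerD// ler_wpM2l//.
have := h2 F (fun k=> c k + a * d k) (fsubsetUr _ _) hcd.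
rewrite big_split/= -mulr_sumr.
set S := csum _; set Sc := csum c; set Sd := csum d; set sc := \sum_(k <- F) c k.
set sd := \sum_(k <- F) d k => H1 H2 H3.
have -> : S - (Sc + a * Sd) = (S - (sc + a * sd)) - ((Sc - sc) + a * (Sd - sd)) by ring.
apply: (le_trans (ncB _ _)); apply: (le_trans (lerD H1 (ncD _ _))).
rewrite ncM; have na0 := nc_ge0 a.
have E: e / (3 * A) * (3 * A) = e by rewrite divfK// gt_eqF// mulr_gt0.
have : nc a * nc (Sd - sd) <= nc a * (e / (3 * A)) by rewrite ler_wpM2l.
have A1: 1 <= A by rewrite lerDl.
have q0 := ltW e30.
have : nc a * (e / (3 * A)) <= A * (e / (3 * A)) by rewrite ler_wpM2r// /A; lra.
have : 1 * (e / (3 * A)) <= A * (e / (3 * A)) by rewrite ler_wpM2r.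
lra.
Qed.

End ComplexSums.

(** * Trigonometric series: continuity, inversion, differentiation, products *)

Section TrigSeries.
Context {R : realType}.
Implicit Types (x t C e B: R) (b : int -> R) (F : {fset int}) (c d : int -> R[i]) (u v : R -> R[i]).

Definition fc u k : R[i] := (tau^-1)%:C * fourier u k.

Definition ts c x : R[i] := csum (fun k=> c k * expi (k%:~R * x)).

Lemma nc_2piV (z : R[i]) : nc ((tau^-1)%:C * z) = tau^-1 * nc z.
by rewrite ncM nc_real ger0_norm// invr_ge0 ltW. Qed.

Lemma fourier_fc u k : fourier u k = tau%:C * fc u k.
rewrite /fc mulrA -RCM divff ?mul1r// gt_eqF//.
Qed.

Lemma nc_fc u k C : ccont u -> (forall x, 0 <= x <= tau -> nc (u x) <= C) ->
 nc (fc u k) <= C.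
move=> hu h; rewrite nc_2piV ler_pdivrMl//; exact: nc_fourier.
Qed.

Lemma nc_ts_tail b C : (forall k, 0 <= b k) -> l1 b C -> forall e, 0 < e ->
 exists F0 : {fset int}, forall F c x, (F0 `<=` F)%fset ->
 (forall k, nc (c k) <= b k) ->
 nc (ts c x - \sum_(k <- F) c k * expi (k%:~R * x)) <= e.
move=> b0 hb e e0; have [F0 h] := csum_tail b0 hb e0.
exists F0 => F c x FF hc; apply: h=> // k.
by rewrite ncM nc_expi mulr1.
Qed.

Lemma ccont_unif (T : topologicalType) (u : T -> R[i]) :
 (forall e, 0 < e -> exists2 v : T -> R[i], ccont v & forall y, nc (u y - v y) <= e) ->
 ccont u.
move=> h; split=> x; apply/cvgrPdist_lt => e e0.
 have e30: 0 < e / 4 by rewrite divr_gt0.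
 have [v [v1 _] hv] := h _ e30.
 have := v1 x; move/cvgrPdist_lt => /(_ _ e30); apply: filterS => y hy.
 have := le_trans (Re_le_nc _) (hv x); have := le_trans (Re_le_nc _) (hv y).
 by rewrite !ReD !ReN !ler_norml; move: hy; rewrite !ltr_norml; lra.
have e30: 0 < e / 4 by rewrite divr_gt0.
have [v [_ v1] hv] := h _ e30.
have := v1 x; move/cvgrPdist_lt => /(_ _ e30); apply: filterS => y hy.
have := le_trans (Im_le_nc _) (hv x); have := le_trans (Im_le_nc _) (hv y).
by rewrite !ImD !ImN !ler_norml; move: hy; rewrite !ltr_norml; lra.
Qed.

Lemma ccont_tsum F c : ccont (fun x=> \sum_(k <- F) c k * expi (k%:~R * x)).
by apply: ccont_sum => k; apply: ccontM; [exact: ccontC|exact: ccont_expik].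
Qed.

Lemma ccont_ts b C c : (forall k, 0 <= b k) -> l1 b C ->
 (forall k, nc (c k) <= b k) -> ccont (ts c).
move=> b0 hb hc; apply: ccont_unif => e e0.
have [F0 h] := nc_ts_tail b0 hb e0.
exists (fun x=> \sum_(k <- F0) c k * expi (k%:~R * x)); first exact: ccont_tsum.
by move=> x; apply: h=> //; exact: fsubset_refl.
Qed.

Lemma ts_per c : periodic (ts c) tau.
by move=> x; congr csum; apply/funext => k; rewrite expi_per. Qed.

Lemma fc_fsum F c k :
 fc (fun x=> \sum_(j <- F) c j * expi (j%:~R * x)) k = if k \in F then c k else 0.
rewrite /fc fourier_fsum; case: ifP => _; last by rewrite mulr0.
by rewrite mulrA -RCM mulVf ?mul1r// gt_eqF.
Qed.

Lemma fc_tsum F c k : k \in F ->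
 fc (fun x=> \sum_(j <- F) c j * expi (j%:~R * x)) k = c k.
by move=> kF; rewrite fc_fsum kF. Qed.

Lemma fcB u v k : ccont u -> ccont v -> fc (fun x=> u x - v x) k = fc u k - fc v k.
by move=> hu hv; rewrite /fc fourierB// mulrBr. Qed.

Lemma fc_ts b C c k : (forall k, 0 <= b k) -> l1 b C ->
 (forall k, nc (c k) <= b k) -> fc (ts c) k = c k.
move=> b0 hb hc; apply/eqP; rewrite -subr_eq0; apply/eqP/nc_small => e e0.
have [F0 h] := nc_ts_tail b0 hb e0.
pose F := (k |` F0)%fset.
have kF: k \in F by rewrite !inE eqxx.
rewrite -[X in _ - X](fc_tsum c kF) -fcB; [|exact: (ccont_ts b0 hb hc)|exact: ccont_tsum].
apply: nc_fc; first by apply: ccontB; [exact: (ccont_ts b0 hb hc)|exact: ccont_tsum].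
by move=> x _; apply: h=> //; exact: fsubsetU1.
Qed.

Lemma fc_inversion b C u : (forall k, 0 <= b k) -> l1 b C ->
 (forall k, nc (fc u k) <= b k) -> ccont u -> periodic u tau ->
 forall x, u x = ts (fc u) x.
move=> b0 hb hc cu pu x; apply/eqP; rewrite -subr_eq0; apply/eqP.
have ct := ccont_ts b0 hb hc.
apply: (@fourier_inj _ (fun x=> u x - ts (fc u) x)).
- exact: ccontB.
- by move=> y; rewrite pu ts_per.
move=> k; rewrite fourierB// !fourier_fc (fc_ts _ b0 hb hc) subrr//.
Qed.

Lemma cder_quad u (t: R) (d : R[i]) B :
 (forall h : R, nc (u (t + h) - u t - h%:C * d) <= B * h ^+ 2) -> cder u t d.
move=> H; have B0: 0 <= B by have := le_trans (nc_ge0 _) (H 1); rewrite expr1n mulr1.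
have aux (f : R -> R) (a: R) : (forall h, `|f (t + h) - f t - h * a| <= B * h ^+ 2) ->
 is_derive t 1 f a.
 move=> hf.
 have cv: (h^-1 *: (f (h *: 1 + t) - f t)) @[h --> 0^'] --> a.
 apply/cvgrPdist_le => e e0; near=> h.
 have h0: h != 0 by near: h; exact: nbhs_dnbhs_neq.
 rewrite /GRing.scale/= mulr1 [h + t]addrC distrC.
 have -> : h^-1 * (f (t + h) - f t) - a = h^-1 * (f (t + h) - f t - h * a).
 by rewrite [RHS]mulrBr mulKf.
 rewrite normrM normfV ler_pdivrMl ?normr_gt0//; apply: (le_trans (hf h)).
 rewrite -real_normK ?num_real// expr2 mulrA mulrC ler_wpM2l//.
 rewrite -(ler_pM2l (_ : 0 < (1 + B)^-1)) ?invr_gt0 ?ltr_pwDl//.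
 apply: (le_via `|h|).
 by rewrite mulrA ler_piMl// mulrC ler_pdivrMr ?ltr_pwDl// mul1r lerDr.
 have : ball_ Num.norm 0 ((1 + B)^-1 * e) h.
 near: h; exists ((1 + B)^-1 * e)=> //=; first by rewrite mulr_gt0// invr_gt0 ltr_pwDl.
 by rewrite /ball_/= sub0r normrN => /ltW.
 have hd: derivable f t 1 by apply/cvg_ex; exists a.
 by apply: DeriveDef=> //; exact: cvg_lim.
split; apply: aux => h.
 have := le_trans (Re_le_nc _) (H h).
 by rewrite !ReD !ReN ReM/= mul0r subr0.
have := le_trans (Im_le_nc _) (H h).
by rewrite !ImD !ImN ImM/= mul0r addr0.
Unshelve. all: end_near. Qed.

Lemma ts_lin b C (a : R[i]) c d x : (forall k, 0 <= b k) -> l1 b C ->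
 (forall k, nc (c k) <= b k) -> (forall k, nc (d k) <= b k) ->
 ts (fun k=> c k + a * d k) x = ts c x + a * ts d x.
move=> b0 hb hc hd; rewrite /ts -(csum_lin _ b0 hb).
- by congr csum; apply/funext => k; ring.
- by move=> k; rewrite ncM nc_expi mulr1.
- by move=> k; rewrite ncM nc_expi mulr1.
Qed.

Lemma nc_ts b C c x : (forall k, 0 <= b k) -> l1 b C ->
 (forall k, nc (c k) <= b k) -> nc (ts c x) <= C.
by move=> b0 hb hc; apply: (csum_bd b0 hb) => k; rewrite ncM nc_expi mulr1.
Qed.

(* The coefficients depend on a parameter; [b2] bounds their second order
 Taylor remainder. *)
Lemma ts_taylor b C b2 C2 (c : R -> int -> R[i]) (c' : int -> R[i]) (t x: R) :
 (forall k, 0 <= b k) -> l1 b C -> (forall k, 0 <= b2 k) -> l1 b2 C2 ->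
 (forall s k, nc (c s k) <= b k) -> (forall k, nc (c' k) <= b k) ->
 (forall h k, nc (c (t + h) k - c t k - h%:C * c' k) <= h ^+ 2 * b2 k) ->
 cder (fun s=> ts (c s) x) t (ts c' x).
move=> b0 hb b20 hb2 hc hc' H; apply: (@cder_quad _ t _ C2) => h.
have E: ts (fun k=> c (t + h) k - c t k - h%:C * c' k) x =
 ts (c (t + h)) x - ts (c t) x - h%:C * ts c' x.
 pose b3 k := 2 * b k.
 have b30 k : 0 <= b3 k by rewrite mulr_ge0.
 have hb3: l1 b3 (`|2| * C) by exact: l1Z.
 have bb3 k : b k <= b3 k by rewrite /b3; have := b0 k; lra.
 have -> : (fun k=> c (t + h) k - c t k - h%:C * c' k) =
 (fun k=> (c (t + h) k + (-1) * c t k) + (- h%:C) * c' k).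
 by apply/funext => k; ring.
 rewrite (ts_lin _ _ b30 hb3); last first.
 - by move=> k; exact: le_trans (bb3 k).
 - move=> k; rewrite mulN1r (le_trans (ncB _ _))// /b3 mulr2n mulrDl mul1r lerD//.
 rewrite (ts_lin _ _ b0 hb)//; ring.
rewrite -E mulrC; have hb4: l1 (fun k=> h ^+ 2 * b2 k) (h ^+ 2 * C2).
 by rewrite -{2}(ger0_norm (sqr_ge0 h)); exact: l1Z.
apply: (nc_ts _ _ hb4)=> // k; by rewrite mulr_ge0// sqr_ge0.
Qed.

Lemma cos_taylor (a h: R) : `|cos (a + h) - cos a + h * sin a| <= 2 * h ^+ 2 /\
 `|sin (a + h) - sin a - h * cos a| <= 2 * h ^+ 2.
have mvt (f g g' : R -> R) : (forall y : R, is_derive y 1 f (g y)) ->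
 (forall y : R, is_derive y 1 g (g' y)) -> (forall y, `|g' y| <= 1) ->
 `|f (a + h) - f a - h * g a| <= h ^+ 2.
 move=> hf hg hg'.
 pose p w := f w - w * g a.
 have hp (w: R) : is_derive w 1 p (g w - g a).
 apply: is_dext (is_dB (hf w) (is_dM (is_dI w) (is_dC (g a) w)))=> //.
 by rewrite mulr0 addr0 mul1r.
 have := @mvt_lip R p _ `|h| a (a + h) (fun w _ => hp w).
 have -> : p (a + h) - p a = f (a + h) - f a - h * g a by rewrite /p; ring.
 have -> : a + h - a = h by ring.
 rewrite -expr2 real_normK ?num_real//; apply => w hw.
 apply: (le_trans (@mvt_lip R g g' 1 a w (fun w _ => hg w) (fun w _ => hg' w))).
 rewrite mul1r; move: hw; case: (leP a (a + h)) => hh /andP[h1 h2].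
 by rewrite !ger0_norm; lra.
 by rewrite !ler0_norm; lra.
have h2: 0 <= h ^+ 2 by exact: sqr_ge0.
split.
 have := mvt cos (fun y=> - sin y) (fun y=> - cos y) (fun y=> is_derive_cos y)
 (fun y=> is_dN (is_derive_sin y)).
 rewrite mulrN opprK => H; apply: (le_trans (H _)); last lra.
 by move=> y; rewrite normrN ler_norml cos_geN1 cos_le1.
have := mvt sin cos (fun y=> - sin y) (fun y=> is_derive_sin y) (fun y=> is_derive_cos y).
move=> H; apply: (le_trans (H _)); last lra.
by move=> y; rewrite normrN ler_norml sin_geN1 sin_le1.
Qed.

Lemma expi_taylor (a h: R) : nc (expi (a + h) - expi a - h%:C * ('i * expi a)) <= 4 * h ^+ 2.
have [h1 h2] := cos_taylor a h; apply: (le_trans (nc_le_ReIm _)).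
have -> : cRe (expi (a + h) - expi a - h%:C * ('i * expi a)) =
 cos (a + h) - cos a + h * sin a by rewrite !reim/=; ring.
have -> : cIm (expi (a + h) - expi a - h%:C * ('i * expi a)) =
 sin (a + h) - sin a - h * cos a by rewrite !reim/=; ring.
lra.
Qed.

Lemma ts_der c C x : l1 (fun k=> jb k ^+ 2 * nc (c k)) C ->
 cder (ts c) x (ts (fun k=> 'i * k%:~R * c k) x).
move=> hC; pose b (k: int) : R := jb k ^+ 2 * nc (c k).
have b0 (k: int) : 0 <= b k by rewrite mulr_ge0.
have jk (k: int) : `|k%:~R : R| <= jb k by rewrite /jb lerDr.
have j1 (k: int) : 1 <= jb k ^+ 2 :> R by rewrite exprn_ege1.
have jj (k: int) : jb k <= jb k ^+ 2 :> R by rewrite expr2 ler_peMl// (ltW (jb_gt0 k)).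
(* Moving the point amounts to multiplying the coefficients by phases at the fixed point [x], so the
   parametric lemma applies. *)
have E: ts c = (fun s=> ts (fun k=> c k * expi (k%:~R * (s - x))) x).
 apply/funext => s; congr csum; apply/funext => k.
 by rewrite -mulrA -expiD; congr (_ * expi _); ring.
rewrite E; apply: (@ts_taylor b C (fun k=> 4 * b k) (4 * C))=> //.
- by move=> k; rewrite mulr_ge0.
- by rewrite -{2}(ger0_norm (_ : 0 <= 4 :> R))//; exact: l1Z.
- by move=> s k; rewrite ncM nc_expi mulr1 /b ler_peMl ?nc_ge0.
- move=> k; rewrite !ncM nc_i mul1r nc_int ler_wpM2r//.
 by apply: (le_trans (jk k)).
move=> h k; rewrite (addrAC x h) !subrr add0r mulr0 expi0 mulr1.
have := expi_taylor 0 (k%:~R * h); rewrite add0r expi0 mulr1.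
have -> : c k * expi (k%:~R * h) - c k - h%:C * ('i * k%:~R * c k) =
 c k * (expi (k%:~R * h) - 1 - (k%:~R * h)%:C * 'i).
 by rewrite RCM rmorph_int; ring.
move=> H; rewrite ncM; apply: (le_trans (ler_wpM2l (nc_ge0 _) H)).
rewrite exprMn /b.
have : k%:~R ^+ 2 <= jb k ^+ 2 :> R by rewrite -(real_normK (num_real _)) lerXn2r ?nnegrE// (ltW (jb_gt0 k)).
have := nc_ge0 (c k); have := sqr_ge0 h => p1 p2 p3.
have : nc (c k) * h ^+ 2 * k%:~R ^+ 2 <= nc (c k) * h ^+ 2 * jb k ^+ 2.
 by rewrite ler_wpM2l// mulr_ge0.
lra.
Qed.

(** [u] is replaced by a partial sum of its series, for which the coefficients of the product are a
    finite convolution. The error is uniformly small because [v] is bounded, so [v] may have a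
    divergent series. *)
Lemma mul_maj (a b : int -> R) A B u v n : (forall k, 0 <= a k) -> l1 a A ->
 ccont u -> periodic u tau -> ccont v ->
 (forall k, nc (fc u k) <= a k) -> (forall k, nc (fc v k) <= b k) ->
 (forall k, b k <= B) -> nc (fc (fun x=> u x * v x) n) <= cv a b n.
move=> a0 ha cu pu cv' hu hv hB.
have b0 k : 0 <= b k by exact: le_trans (nc_ge0 _) (hv k).
have hbB k : `|b k| <= B by rewrite ger0_norm.
have [K hK] := cont_bddP (contnc cv').
have K0: 0 <= K.
 by apply: le_trans (hK 0 _); rewrite ?normr_ge0// lexx ltW.
apply/ler_addgt0Pr => e e0.
have e1: 0 < e / (K + 1) by rewrite divr_gt0// ltr_wpDl.
have [F h] := nc_ts_tail a0 ha e1.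
pose S x := \sum_(k <- F) fc u k * expi (k%:~R * x).
have cS: ccont S by exact: ccont_tsum.
have uS x : nc (u x - S x) <= e / (K + 1).
 by rewrite (fc_inversion a0 ha hu)//; apply: h=> //; exact: fsubset_refl.
have cuv: ccont (fun x=> u x * v x) by exact: ccontM.
have cSv: ccont (fun x=> S x * v x) by exact: ccontM.
rewrite -(subrK (fc (fun x=> S x * v x) n) (fc _ n)) addrC.
apply: (le_trans (ncD _ _)); apply: lerD; last first.
 rewrite -fcB//; apply: nc_fc; first exact: ccontB.
 move=> x hx; rewrite -mulrBl ncM.
 apply: (le_via (e / (K + 1) * K)).
 by apply: ler_pM; rewrite ?nc_ge0//; apply: le_trans (hK x hx); exact: ler_norm.
 by rewrite -mulrA ler_piMr ?(ltW e0)// mulrC ler_pdivrMr ?ltr_wpDl// mul1r lerDl.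
have -> : fc (fun x=> S x * v x) n = \sum_(k <- F) fc u k * fc v (n - k).
 rewrite /fc (_ : (fun x=> _) = (fun x=> \sum_(k <- F) fc u k * (v x * expi (k%:~R * x)))); last first.
 by apply/funext => x; rewrite /S mulr_suml; apply: eq_bigr => k _; ring.
 have cvk (k: int) : ccont (fun x=> v x * expi (k%:~R * x)).
 by apply: ccontM=> //; exact: ccont_expik.
 rewrite fourier_sum; last by move=> k; apply: ccontM=> //; exact: ccontC.
 rewrite mulr_sumr; apply: eq_bigr => k _.
 by rewrite fourierZ// fourier_mulE mulrCA.
apply: (le_trans (nc_sum _ _)); rewrite cvC.
apply: le_trans (cv_ge_fin F _); last first.
 apply: (@summableC _ a b); exact: l1_bdd_summable ha hbB.
apply: ler_sum => k _; rewrite ncM mulrC !ger0_norm ?mulr_ge0//.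
by apply: ler_pM; rewrite ?nc_ge0.
Qed.

End TrigSeries.

(** * Calculus in the plane: chain rules, mixed derivatives, parametric integrals *)

Section PlaneCalculus.
Context {R : realType}.
Implicit Types (e r: R) (z w : R[i]).

Definition ccat (T : topologicalType) (u : T -> R[i]) (t : T) : Prop :=
 {for t, continuous (fun s=> cRe (u s))} /\
 {for t, continuous (fun s=> cIm (u s))}.

Lemma ccontP (T : topologicalType) (u : T -> R[i]) : (forall t, ccat u t) -> ccont u.
by move=> h; split => t; case: (h t). Qed.

Lemma ccont_at (T : topologicalType) (u : T -> R[i]) t : ccont u -> ccat u t.
by move=> [h1 h2]; split; [exact: h1|exact: h2]. Qed.

Section Pointwise.
Context {T : topologicalType}.
Implicit Types (f g : T -> R) (u v : T -> R[i]) (s : T).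

Lemma cfD f g s : {for s, continuous f} -> {for s, continuous g} ->
 {for s, continuous (fun x=> f x + g x)}.
exact: continuousD. Qed.
Lemma cfM f g s : {for s, continuous f} -> {for s, continuous g} ->
 {for s, continuous (fun x=> f x * g x)}.
exact: continuousM. Qed.
Lemma cfN f s : {for s, continuous f} -> {for s, continuous (fun x=> - f x)}.
exact: continuousN. Qed.
Lemma cfB f g s : {for s, continuous f} -> {for s, continuous g} ->
 {for s, continuous (fun x=> f x - g x)}.
by move=> hf hg; apply: cfD=> //; exact: cfN. Qed.

Lemma cf_ext f g s : f = g -> {for s, continuous f} -> {for s, continuous g}.
by move=> ->. Qed.

Lemma ccatC z s : ccat (fun _ : T => z) s.
by split; exact: cst_continuous. Qed.

Lemma ccatD u v s : ccat u s -> ccat v s -> ccat (fun x=> u x + v x) s.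
move=> [u1 u2] [v1 v2]; split; [move: (cfD u1 v1)|move: (cfD u2 v2)];
 by apply: cf_ext; apply/funext => y; rewrite ?ReD ?ImD.
Qed.

Lemma ccatM u v s : ccat u s -> ccat v s -> ccat (fun x=> u x * v x) s.
move=> [u1 u2] [v1 v2]; split.
 move: (cfB (cfM u1 v1) (cfM u2 v2)).
 by apply: cf_ext; apply/funext => y; rewrite ReM.
move: (cfD (cfM u1 v2) (cfM u2 v1)).
by apply: cf_ext; apply/funext => y; rewrite ImM.
Qed.

Lemma ccatN u s : ccat u s -> ccat (fun x=> - u x) s.
move=> [u1 u2]; split; [move: (cfN u1)|move: (cfN u2)];
 by apply: cf_ext; apply/funext => y; rewrite ?ReN ?ImN.
Qed.

Lemma ccatB u v s : ccat u s -> ccat v s -> ccat (fun x=> u x - v x) s.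
by move=> hu hv; apply: ccatD=> //; exact: ccatN. Qed.

Lemma ccat_nc u s : ccat u s -> {for s, continuous (fun x=> nc (u x))}.
move=> [u1 u2].
have h := cfD (cfM u1 u1) (cfM u2 u2).
apply: (@cf_ext (fun x=> Num.sqrt (cRe (u x) * cRe (u x) +
 cIm (u x) * cIm (u x)))).
 by apply/funext => x; rewrite ncE !expr2.
apply: (@continuous_comp _ _ _ (fun x=> cRe (u x) * cRe (u x) +
 cIm (u x) * cIm (u x)) Num.sqrt)=> //.
exact: sqrt_continuous.
Qed.

Lemma ccatV u s : u s != 0 -> ccat u s -> ccat (fun x=> (u x)^-1) s.
move=> u0 hu; have hn := ccat_nc hu; case: (hu) => [u1 u2].
have hV: {for s, continuous (fun x=> (nc (u x) * nc (u x))^-1)}.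
 apply: (@continuousV _ _ (fun x=> nc (u x) * nc (u x))); last exact: cfM.
 by rewrite mulf_neq0// nc_eq0.
split.
 by move: (cfM u1 hV); apply: cf_ext; apply/funext => x; rewrite ReV expr2.
by move: (cfN (cfM u2 hV)); apply: cf_ext; apply/funext => x; rewrite ImV expr2.
Qed.

Lemma ccat_eps u s : ccat u s <->
 forall e, 0 < e -> \forall x \near s, nc (u x - u s) < e.
split=> [[u1 u2] e e0|h].
 have e20: 0 < e / 2 by rewrite divr_gt0.
 move/cvgrPdist_lt: u1 => /(_ _ e20) h1; move/cvgrPdist_lt: u2 => /(_ _ e20) h2.
 near=> x; apply: (le_lt_trans (nc_le_ReIm _)).
 have : `|cRe (u s) - cRe (u x)| < e / 2 by near: x.
 have : `|cIm (u s) - cIm (u x)| < e / 2 by near: x.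
 rewrite ReD ImD ReN ImN (distrC (cRe (u s))) (distrC (cIm (u s))); lra.
split; apply/cvgrPdist_lt => e e0; have := h e e0; apply: filterS => x hx.
 by rewrite distrC -ReN -ReD (le_lt_trans (Re_le_nc _)).
by rewrite distrC -ImN -ImD (le_lt_trans (Im_le_nc _)).
Unshelve. all: end_near. Qed.

End Pointwise.

Definition cat (f : R[i] -> R[i]) z : Prop :=
 forall e, 0 < e -> exists2 d : R, 0 < d & forall w, nc (w - z) < d -> nc (f w - f z) < e.

Lemma ccat_comp (T : topologicalType) (u : T -> R[i]) f s :
 ccat u s -> cat f (u s) -> ccat (fun x=> f (u x)) s.
move=> /ccat_eps hu hf; apply/ccat_eps => e e0.
have [d d0 hd] := hf e e0; have := hu d d0; apply: filterS => x; exact: hd.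
Qed.

Lemma ccatR (T : topologicalType) (f : T -> R) s :
 {for s, continuous f} -> ccat (fun x=> (f x)%:C) s.
by move=> hf; split=> //=; exact: cst_continuous. Qed.

Lemma cont2_eps (g : R -> R -> R) (x y: R) :
 {for (x, y), continuous (unc g)} ->
 forall e, 0 < e -> exists2 d : R, 0 < d &
 forall x' y', `|x' - x| < d -> `|y' - y| < d -> `|g x' y' - g x y| < e.
move=> /cvgrPdist_lt h e e0; have := h e e0.
move=> /nbhs_ballP[d /= d0 hd]; exists d=> // x' y' h1 h2.
rewrite distrC; apply: (hd (x', y')); split => /=; rewrite /ball/= distrC//.
Qed.

Lemma is_derive_eps (f : R -> R) (t a: R) : is_derive t 1 f a <->
 forall e, 0 < e -> exists2 d : R, 0 < d &
 forall h : R, `|h| < d -> `|f (t + h) - f t - h * a| <= e * `|h|.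
have E (h: R) : h != 0 ->
 `|a - h^-1 * (f (h * 1 + t) - f t)| = `|h|^-1 * `|f (t + h) - f t - h * a|.
 move=> h0; rewrite distrC -normfV -normrM mulr1 [h + t]addrC; congr `|_|.
 by rewrite [RHS]mulrBr mulKf.
split.
 move=> [dF dE] e e0.
 have hl: (h^-1 *: (f (h *: 1 + t) - f t)) @[h --> 0^'] --> a.
 by move: dF; rewrite /derivable => dF; move: dE; rewrite /derive => <-; exact: dF.
 move/cvgrPdist_le: hl => /(_ e e0)[d /= d0 hd]; exists d=> // h hh.
 have [->|h0] := eqVneq h 0; first by rewrite addr0 mul0r subr0 subrr normr0 mulr0.
 have := hd h; rewrite /ball_/= sub0r normrN => /(_ hh h0).
 move=> H; have : `|h|^-1 * `|f (t + h) - f t - h * a| <= e by rewrite -E.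
 by rewrite ler_pdivrMl ?normr_gt0// (mulrC e).
move=> H.
have cv: (h^-1 *: (f (h *: 1 + t) - f t)) @[h --> 0^'] --> a.
 apply/cvgrPdist_le => e e0; have [d d0 hd] := H e e0; exists d=> // h hh h0.
 have : `|h|^-1 * `|f (t + h) - f t - h * a| <= e.
 rewrite ler_pdivrMl ?normr_gt0// (mulrC _ e).
 by apply: hd; move: hh; rewrite /ball_/= sub0r normrN.
 by rewrite -E.
have hd: derivable f t 1 by apply/cvg_ex; exists a.
by apply: DeriveDef=> //; exact: cvg_lim.
Qed.

Lemma between_close (x0 x w r: R) : `|x - x0| < r ->
 minr x0 x <= w <= Num.max x0 x -> `|w - x0| < r.
rewrite !ltr_norml => /andP[h1 h2]; rewrite minEle maxEle.
by case: ifP => _ /andP[h3 h4]; apply/andP; split; lra.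
Qed.

Lemma diff2 (g gx gy : R -> R -> R) (x0 y0 r: R) : 0 < r ->
 (forall x y, `|x - x0| < r -> `|y - y0| < r ->
 is_derive x 1 (fun t=> g t y) (gx x y) /\ is_derive y 1 (g x) (gy x y)) ->
 {for (x0, y0), continuous (unc gx)} ->
 {for (x0, y0), continuous (unc gy)} ->
 forall e, 0 < e -> exists2 d : R, 0 < d &
 forall x y, `|x - x0| < d -> `|y - y0| < d ->
 `|g x y - g x0 y0 - (x - x0) * gx x0 y0 - (y - y0) * gy x0 y0| <=
 e * (`|x - x0| + `|y - y0|).
move=> r0 hg /cont2_eps cx /cont2_eps cy e e0.
have [d1 d10 h1] := cx e e0; have [d2 d20 h2] := cy e e0.
pose d := minr r (minr d1 d2).
have d0: 0 < d by rewrite !lt_min r0 d10 d20.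
exists d=> // x y; rewrite !lt_min => /and3P[xr x1 x2] /and3P[yr y1 y2].
pose p t := g t y - t * gx x0 y0.
pose q t := g x0 t - t * gy x0 y0.
have hp: `|p x - p x0| <= e * `|x - x0|.
 apply: (@mvt_lip R p (fun t=> gx t y - gx x0 y0)) => w hw.
 have wr := between_close xr hw.
 have [hd _] := hg w y wr yr.
 apply: is_dext (is_dB hd (is_dM (is_dI w) (is_dC (gx x0 y0) w)))=> //.
 by rewrite mulr0 addr0 mul1r.
 by apply/ltW/h1=> //; exact: between_close hw.
have hq: `|q y - q y0| <= e * `|y - y0|.
 apply: (@mvt_lip R q (fun t=> gy x0 t - gy x0 y0)) => w hw.
 have wr := between_close yr hw.
 have [_ hd] := hg x0 w ltac:(by rewrite subrr normr0) wr.
 apply: is_dext (is_dB hd (is_dM (is_dI w) (is_dC (gy x0 y0) w)))=> //.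
 by rewrite mulr0 addr0 mul1r.
 apply/ltW/h2=> //; first by rewrite subrr normr0.
 exact: between_close hw.
have -> : g x y - g x0 y0 - (x - x0) * gx x0 y0 - (y - y0) * gy x0 y0 =
 (p x - p x0) + (q y - q y0) by rewrite /p /q; ring.
by apply: (le_trans (ler_normD _ _)); rewrite mulrDr lerD.
Qed.

Lemma cder_eps (u : R -> R[i]) (t: R) (d : R[i]) : cder u t d <->
 forall e, 0 < e -> exists2 r : R, 0 < r &
 forall h : R, `|h| < r -> nc (u (t + h) - u t - h%:C * d) <= e * `|h|.
split=> [[/is_derive_eps h1 /is_derive_eps h2] e e0|H].
 have e20: 0 < e / 2 by rewrite divr_gt0.
 have [r1 r10 k1] := h1 _ e20; have [r2 r20 k2] := h2 _ e20.
 exists (minr r1 r2); first by rewrite lt_min r10.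
 move=> h; rewrite lt_min => /andP[/k1 a1 /k2 a2].
 apply: (le_trans (nc_le_ReIm _)); rewrite !reim/= !mul0r subr0 addr0.
 by have := lerD a1 a2; rewrite -mulrDl -splitr.
split; apply/is_derive_eps => e e0; have [r r0 hr] := H e e0; exists r=> // h /hr.
 apply: le_trans; apply: le_trans (Re_le_nc _).
 by rewrite !reim/= !mul0r subr0.
apply: le_trans; apply: le_trans (Im_le_nc _).
by rewrite !reim/= !mul0r addr0.
Qed.

Definition cdiff (g : R[i] -> R[i]) (a z : R[i]) : Prop :=
 forall e, 0 < e -> exists2 r : R, 0 < r &
 forall w, nc (w - z) < r -> nc (g w - g z - a * (w - z)) <= e * nc (w - z).

Lemma cder_chain g a (Z : R -> R[i]) (t: R) d : cder Z t d -> cdiff g a (Z t) ->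
 cder (fun s=> g (Z s)) t (a * d).
move=> /cder_eps hZ hg; apply/cder_eps => e e0.
have nd := nc_ge0 d; have na := nc_ge0 a.
have [r r0 hr] := hg (e / (2 * (nc d + 1))) ltac:(by rewrite divr_gt0// mulr_gt0// ltr_wpDl).
pose e1 := minr 1 (e / (2 * (nc a + 1))).
have e10: 0 < e1 by rewrite lt_min ltr01/= divr_gt0// mulr_gt0// ltr_wpDl.
have [e11 e1a] : e1 <= 1 /\ e1 * nc a <= e / 2.
 split; first by rewrite ge_min lexx.
 apply: (le_via (e / (2 * (nc a + 1)) * nc a)).
 by rewrite ler_wpM2r// ge_min lexx orbT.
 rewrite invfM mulrA -mulrA ler_piMr//; first by rewrite divr_ge0// ltW.
 by rewrite ler_pdivrMl ?ltr_wpDl// mulr1 lerDl.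
have [r1 r10 hr1] := hZ e1 e10.
exists (minr r1 (r / (nc d + 1))).
 by rewrite lt_min r10 divr_gt0// ltr_wpDl.
move=> h; rewrite lt_min ltr_pdivlMr ?ltr_wpDl// => /andP[/hr1 k1 k2].
have nh := normr_ge0 h.
have b1: nc (Z (t + h) - Z t) <= `|h| * (nc d + 1).
 rewrite -[X in nc X](subrK (h%:C * d)); apply: (le_trans (ncD _ _)).
 rewrite ncM nc_real mulrDr mulr1 addrC lerD2l (le_trans k1)// ler_piMl//.
have := hr (Z (t + h)) (le_lt_trans b1 k2) => k3.
have -> : g (Z (t + h)) - g (Z t) - h%:C * (a * d) =
 (g (Z (t + h)) - g (Z t) - a * (Z (t + h) - Z t)) + a * (Z (t + h) - Z t - h%:C * d) by ring.
apply: (le_trans (ncD _ _)); rewrite ncM.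
have k4: nc a * nc (Z (t + h) - Z t - h%:C * d) <= e / 2 * `|h|.
 apply: (le_trans (ler_wpM2l na k1)); rewrite mulrA ler_wpM2r// mulrC//.
have k5: nc (g (Z (t + h)) - g (Z t) - a * (Z (t + h) - Z t)) <= e / 2 * `|h|.
 apply: (le_trans k3).
 apply: (le_via (e / (2 * (nc d + 1)) * (`|h| * (nc d + 1)))).
 by rewrite ler_wpM2l// divr_ge0 ?(ltW e0)// mulr_ge0// addr_ge0.
 apply: le_of_eq; field.
 by rewrite gt_eqF// ltr_wpDl.
by have := lerD k5 k4; rewrite -mulrDl -splitr.
Qed.

Lemma cdiff_CR (u ux uy v vx vy : R -> R -> R) z (r: R) : 0 < r ->
 let x0 := cRe z in let y0 := cIm z in
 (forall x y, `|x - x0| < r -> `|y - y0| < r ->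
 (is_derive x 1 (fun t=> u t y) (ux x y) /\ is_derive y 1 (u x) (uy x y)) /\
 (is_derive x 1 (fun t=> v t y) (vx x y) /\ is_derive y 1 (v x) (vy x y))) ->
 {for (x0, y0), continuous (unc ux)} ->
 {for (x0, y0), continuous (unc uy)} ->
 {for (x0, y0), continuous (unc vx)} ->
 {for (x0, y0), continuous (unc vy)} ->
 uy x0 y0 = - vx x0 y0 -> vy x0 y0 = ux x0 y0 ->
 cdiff (fun w=> u (cRe w) (cIm w) +i* v (cRe w) (cIm w))
 (ux x0 y0 +i* vx x0 y0) z.
move=> r0 x0 y0 h c1 c2 c3 c4 CR1 CR2 e e0.
have e40: 0 < e / 4 by rewrite divr_gt0.
have [d1 d10 h1] := diff2 r0 (fun x y a b => (h x y a b).1) c1 c2 e40.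
have [d2 d20 h2] := diff2 r0 (fun x y a b => (h x y a b).2) c3 c4 e40.
exists (minr d1 d2); first by rewrite lt_min d10.
move=> w; rewrite lt_min => /andP[w1 w2].
have bR: `|cRe w - x0| <= nc (w - z) by rewrite -ReN -ReD Re_le_nc.
have bI: `|cIm w - y0| <= nc (w - z) by rewrite -ImN -ImD Im_le_nc.
have k1 := h1 _ _ (le_lt_trans bR w1) (le_lt_trans bI w1).
have k2 := h2 _ _ (le_lt_trans bR w2) (le_lt_trans bI w2).
apply: (le_trans (nc_le_ReIm _)); rewrite !reim/=.
rewrite -/x0 -/y0.
rewrite CR1 in k1; rewrite CR2 in k2.
set a := cRe w in k1 k2 bR *; set b := cIm w in k1 k2 bI *.
have -> : u a b - u x0 y0 - (ux x0 y0 * (a - x0) - vx x0 y0 * (b - y0)) =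
 u a b - u x0 y0 - (a - x0) * ux x0 y0 - (b - y0) * - vx x0 y0 by ring.
have -> : v a b - v x0 y0 - (ux x0 y0 * (b - y0) + vx x0 y0 * (a - x0)) =
 v a b - v x0 y0 - (a - x0) * vx x0 y0 - (b - y0) * ux x0 y0 by ring.
have : e / 4 * (`|a - x0| + `|b - y0|) <= e / 4 * (2 * nc (w - z)).
 by rewrite ler_wpM2l ?(ltW e40)//; lra.
lra.
Qed.

(** The mean value theorem is used twice: in [x] for the increment in [y], then in [y]. Exchanging
    the variables represents the same second difference by the other mixed derivative. *)
Lemma mixed_difference (g gx gxy : R -> R -> R) (x0 y0 h: R) : 0 < h ->
 (forall x y, x0 <= x <= x0 + h -> y0 <= y <= y0 + h ->
 is_derive x 1 (fun t=> g t y) (gx x y) /\ is_derive y 1 (gx x) (gxy x y)) ->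
 exists x y, [/\ x0 <= x <= x0 + h, y0 <= y <= y0 + h &
 g (x0 + h) (y0 + h) - g (x0 + h) y0 - g x0 (y0 + h) + g x0 y0 = gxy x y * (h * h)].
move=> h0 H; have lt0 (t: R) : t < t + h by rewrite ltrDl.
have e1 (t: R) : t <= t <= t + h by rewrite lexx ltW.
have e2 (t: R) : t <= t + h <= t + h by rewrite lexx ltW.
have [x hx E] := mvt_ex (p := fun t=> g t (y0 + h) - g t y0) (p' := fun t=> gx t (y0 + h) - gx t y0) (lt0 x0)
 (fun (w: R) hw => is_dB (H w _ hw (e2 y0)).1 (H w _ hw (e1 y0)).1).
have [y hy F] := mvt_ex (lt0 y0) (fun (w: R) hw => (H x w hx hw).2).
exists x, y; split=> //; have -> : h * h = (y0 + h - y0) * (x0 + h - x0) by ring.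
by rewrite mulrA -F -E; ring.
Qed.

Lemma schwarz (g gx gy gxy gyx : R -> R -> R) (x0 y0 r: R) : 0 < r ->
 (forall x y, `|x - x0| < r -> `|y - y0| < r ->
 [/\ is_derive x 1 (fun t=> g t y) (gx x y), is_derive y 1 (g x) (gy x y),
 is_derive y 1 (gx x) (gxy x y) & is_derive x 1 (fun t=> gy t y) (gyx x y)]) ->
 {for (x0, y0), continuous (unc gxy)} ->
 {for (x0, y0), continuous (unc gyx)} ->
 gxy x0 y0 = gyx x0 y0.
move=> r0 H c2 c3; apply/eqP; rewrite -subr_eq0 -normr_le0; apply/ler_addgt0Pr => e e0; rewrite add0r.
have e20: 0 < e / 2 by rewrite divr_gt0.
have [d1 d10 h1] := cont2_eps c2 e20; have [d2 d20 h2] := cont2_eps c3 e20.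
pose h := minr r (minr d1 d2) / 2.
have m0: 0 < minr r (minr d1 d2) by rewrite !lt_min r0 d10.
have h0: 0 < h by rewrite divr_gt0.
have : h < minr r (minr d1 d2) by rewrite /h ltr_pdivrMr// ltr_pMr ?ltr1n.
rewrite !lt_min => /and3P[hr hd1 hd2].
have cl (t w d: R) : h < d -> t <= w <= t + h -> `|w - t| < d.
 by move=> hd /andP[a b]; rewrite ger0_norm; lra.
have [x [y [hx hy E]]] := mixed_difference (g := g) (gx := gx) (gxy := gxy) h0
 (fun x y hx hy => let: And4 k _ k' _ := H x y (cl _ _ _ hr hx) (cl _ _ _ hr hy) in conj k k').
have [y' [x' [hy' hx' E']]] := mixed_difference (g := fun y x => g x y) (gx := fun y x => gy x y) (gxy := fun y x => gyx x y) h0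
 (fun y x hy hx => let: And4 _ k _ k' := H x y (cl _ _ _ hr hx) (cl _ _ _ hr hy) in conj k k').
have E2: gxy x y = gyx x' y'.
 apply: (@mulIf _ (h * h)); first by rewrite mulf_neq0 ?gt_eqF.
 by rewrite -E -E'; ring.
have := h1 _ _ (cl _ _ _ hd1 hx) (cl _ _ _ hd1 hy); have := h2 _ _ (cl _ _ _ hd2 hx') (cl _ _ _ hd2 hy').
by rewrite E2 !ltr_norml ler_norml => /andP[a b] /andP[a' b']; apply/andP; split; lra.
Qed.

Lemma cmvt_lip (p p' : R -> R[i]) (L y z: R) :
 (forall w : R, minr y z <= w <= Num.max y z -> cder p w (p' w)) ->
 (forall w : R, minr y z <= w <= Num.max y z -> nc (p' w) <= L) ->
 nc (p z - p y) <= 2 * L * `|z - y|.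
move=> hp hL; apply: (le_trans (nc_le_ReIm _)).
rewrite !reim -mulrA mulr2n mulrDl mul1r; apply: lerD.
 apply: (@mvt_lip R (fun t=> cRe (p t)) (fun t=> cRe (p' t))) => w hw.
 by case: (hp w hw).
 exact: le_trans (Re_le_nc _) (hL w hw).
apply: (@mvt_lip R (fun t=> cIm (p t)) (fun t=> cIm (p' t))) => w hw.
 by case: (hp w hw).
exact: le_trans (Im_le_nc _) (hL w hw).
Qed.

(** Compactness of the period makes continuity at the points [(t0, x)] uniform in [x], as limits
    under the integral sign require. *)
Lemma tube (u : R -> R -> R[i]) (t0: R) :
 (forall x, ccat (unc u) (t0, x)) -> forall e, 0 < e ->
 exists2 d : R, 0 < d & forall t x, `|t - t0| < d -> 0 <= x <= tau ->
 nc (u t x - u t0 x) <= e.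
move=> hu e e0; have e20: 0 < e / 2 by rewrite divr_gt0.
have cK := @segment_compact R 0 tau.
have /compact_near_coveringP := cK.
move=> /(_ R (nbhs t0) (fun t x => nc (u t x - u t0 x) <= e) _)[].
 move=> x _.
 have := (ccat_eps _ _).1 (hu x) _ e20 => /= -[[P Q] /= [hP hQ] hPQ].
 exists (Q, P); first by split.
 move=> -[a b] [/= Qa Pb].
 have k1 := hPQ (b, a) (conj Pb Qa).
 have k2 := hPQ (t0, a) (conj (nbhs_singleton hP) Qa).
 rewrite /= in k1 k2.
 rewrite -[X in nc X](subrKA (u t0 x)) -[u t0 x - _]opprB; apply: (le_trans (ncB _ _)).
 by have := ltrD k1 k2; rewrite -splitr => /ltW.
move=> d /= d0 hd; exists d=> // t x ht hx.
have ht': ball_ [eta Num.Def.normr] t0 d t by rewrite /ball_/= distrC.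
by apply: (hd t ht' x); rewrite /= in_itv.
Qed.

Section Parametric.
Variables A D : R -> R -> R[i].

Lemma ccat_citor (t0: R) : (forall x, ccat (unc A) (t0, x)) ->
 (forall t, ccont (A t)) -> ccat (fun t=> citor (A t)) t0.
move=> hA cA; apply/ccat_eps => e e0.
have tp := @twopi_gt0 R.
have [d d0 hd] := tube hA (e := e / tau / 2) ltac:(by rewrite !divr_gt0).
exists d=> // t; rewrite /ball_ -[X in X < d -> _]/(`|t0 - t|) distrC => ht.
rewrite -citorB//; apply: (@le_lt_trans _ _ (tau * (e / tau / 2))).
 apply: nc_citor_bdd; first exact: ccontB.
 by move=> x hx; apply: hd.
by rewrite mulrA mulrCA mulfV ?gt_eqF// mulr1 ltr_pdivrMr// ltr_pMr// ltr1n.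
Qed.

Lemma cder_citor (t r: R) : 0 < r ->
 (forall s x, `|s - t| < r -> cder (A^~ x) s (D s x)) ->
 (forall x, ccat (unc D) (t, x)) ->
 (forall s, `|s - t| < r -> ccont (A s)) -> ccont (D t) ->
 cder (fun s=> citor (A s)) t (citor (D t)).
move=> r0 hA hD cA cD; apply/cder_eps => e e0.
have tp := @twopi_gt0 R.
have [d d0 hd] := tube hD (e := e / tau / 2) ltac:(by rewrite !divr_gt0).
exists (minr r d); first by rewrite lt_min r0.
move=> h; rewrite lt_min => /andP[hr hhd].
have tr: `|t + h - t| < r by rewrite addrAC subrr add0r.
have thd: `|t + h - t| < d by rewrite addrAC subrr add0r.
have cth := cA _ tr.
have ct: ccont (A t) by apply: cA; rewrite subrr normr0.
have chD: ccont (fun x=> h%:C * D t x) by apply: ccontM=> //; exact: ccontC.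
rewrite -citorB// -citorZ// -citorB//; last exact: ccontB.
apply: (le_via (tau * (2 * (e / tau / 2) * `|h|))); last first.
 have gen (P E H: R) : 0 < P -> P * (2 * (E / P / 2) * H) = E * H.
 by move=> P0; field; rewrite gt_eqF.
 by rewrite gen.
apply: nc_citor_bdd; first by apply: ccontB=> //; exact: ccontB.
move=> x hx.
pose p s := A s x - s%:C * D t x.
have -> : A (t + h) x - A t x - h%:C * D t x = p (t + h) - p t.
 by rewrite /p rmorphD/=; ring.
have E: `|h| = `|t + h - t| by rewrite addrAC subrr add0r.
rewrite E; apply: (@cmvt_lip p (fun s=> D s x - D t x)) => w hw.
 apply: cderB; first by apply: hA; exact: between_close hw.
 have := cderM (cderR (is_dI w)) (cderC (D t x) w).
 by apply: cder_eq; rewrite mul1r mulr0 addr0.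
by apply: hd=> //; exact: between_close hw.
Qed.

End Parametric.

(* [A_t = B_x] with [B] periodic in [x]: the integral of [A] does not depend on [t]. *)
Lemma contour_inv (a b: R) (A B D : R -> R -> R[i]) : a < b ->
 (forall t x, ccat (unc A) (t, x)) -> (forall t, ccont (A t)) ->
 (forall t, a < t < b -> [/\ forall x, cder (A^~ x) t (D t x),
 forall x, ccat (unc D) (t, x),
 forall x, cder (B t) x (D t x), ccont (D t) & periodic (B t) tau]) ->
 citor (A a) = citor (A b).
move=> ab hA cA H.
have cI (t: R) := @ccat_citor A t (hA t) cA.
have dI (t: R) : t \in `]a, b[ -> cder (fun s=> citor (A s)) t 0.
 rewrite in_itv/= => /andP[a1 b1]; have [_ h2 h3 h4 h5] := H t ltac:(by rewrite a1).
 have -> : 0 = citor (D t).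
 by rewrite (citor_FTC h4 h3) -(add0r tau) h5 subrr.
 apply: (@cder_citor A D t (minr (t - a) (b - t)))=> //.
 by rewrite lt_min !subr_gt0 a1.
 move=> s x; rewrite lt_min !ltr_norml => /andP[/andP[k1 k2] /andP[k3 k4]].
 by have [h1 _ _ _ _] := H s ltac:(by apply/andP; split; lra); apply: h1.
apply: cext.
 have cR: {within `[a, b], continuous (fun s=> cRe (citor (A s)))}.
 by apply: continuous_subspaceT => t; case: (cI t).
 have [w _ /eqP] := MVT ab (fun (t: R) h => (dI t h).1) cR.
 by rewrite mul0r subr_eq0 => /eqP.
have cR: {within `[a, b], continuous (fun s=> cIm (citor (A s)))}.
 by apply: continuous_subspaceT => t; case: (cI t).
have [w _ /eqP] := MVT ab (fun (t: R) h => (dI t h).2) cR.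
by rewrite mul0r subr_eq0 => /eqP.
Qed.

End PlaneCalculus.

(** * From a solution of the boundary value problem to a holomorphic function *)

Section Package.
Context {R : realType}.
Implicit Types (e r: R) (z w : R[i]).

Lemma is_derive_near (f g : R -> R) (t r a: R) : 0 < r ->
 (forall s, `|s - t| < r -> f s = g s) -> is_derive t 1 f a -> is_derive t 1 g a.
move=> r0 fg /is_derive_eps h; apply/is_derive_eps => e e0.
have [d d0 hd] := h e e0; exists (minr r d); first by rewrite lt_min r0.
move=> k; rewrite lt_min => /andP[kr /hd].
by rewrite !fg// ?subrr ?normr0// addrAC subrr add0r.
Qed.

Lemma cdiff_near (f g : R[i] -> R[i]) a z r : 0 < r ->
 (forall w, nc (w - z) < r -> f w = g w) -> cdiff f a z -> cdiff g a z.
move=> r0 fg h e e0; have [d d0 hd] := h e e0.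
exists (minr r d); first by rewrite lt_min r0.
move=> w; rewrite lt_min => /andP[wr /hd].
by rewrite !fg// subrr nc0.
Qed.

Lemma cat_cont2 (u v : R -> R -> R) z :
 (forall e, 0 < e -> exists2 d : R, 0 < d & forall x y,
 `|x - cRe z| < d -> `|y - cIm z| < d ->
 `|u x y - u (cRe z) (cIm z)| < e) ->
 (forall e, 0 < e -> exists2 d : R, 0 < d & forall x y,
 `|x - cRe z| < d -> `|y - cIm z| < d ->
 `|v x y - v (cRe z) (cIm z)| < e) ->
 cat (fun w=> u (cRe w) (cIm w) +i* v (cRe w) (cIm w)) z.
move=> hu hv e e0; have e20: 0 < e / 2 by rewrite divr_gt0.
have [d1 d10 h1] := hu _ e20; have [d2 d20 h2] := hv _ e20.
exists (minr d1 d2); first by rewrite lt_min d10.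
move=> w; rewrite lt_min => /andP[w1 w2].
have bR: `|cRe w - cRe z| <= nc (w - z) by rewrite -ReN -ReD Re_le_nc.
have bI: `|cIm w - cIm z| <= nc (w - z) by rewrite -ImN -ImD Im_le_nc.
have k1 := h1 _ _ (le_lt_trans bR w1) (le_lt_trans bI w1).
have k2 := h2 _ _ (le_lt_trans bR w2) (le_lt_trans bI w2).
apply: (le_lt_trans (nc_le_ReIm _)); rewrite !reim/=.
by have := ltrD k1 k2; rewrite -splitr.
Qed.

Definition clamp (a c y: R) : R := Num.max a (minr c y).

Lemma clamp_in (a c y: R) : a <= c -> a <= clamp a c y <= c.
by move=> ac; rewrite /clamp le_max lexx/= ge_max ac ge_min lexx. Qed.

Lemma clamp_id (a c y: R) : a <= y <= c -> clamp a c y = y.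
by move=> /andP[h1 h2]; rewrite /clamp min_r// max_r. Qed.

Lemma clamp_lip (a c y a' c' y' d: R) : `|a - a'| <= d -> `|c - c'| <= d -> `|y - y'| <= d ->
 `|clamp a c y - clamp a' c' y'| <= d.
have H (u v w u' v' w': R) : `|u - u'| <= d -> `|v - v'| <= d -> `|w - w'| <= d ->
 clamp u v w <= clamp u' v' w' + d.
 rewrite !ler_norml => /andP[_ h1] /andP[_ h2] /andP[_ h3].
 rewrite /clamp -[X in _ <= X]addrC -lerBlDl lerBlDl ge_max; apply/andP; split.
 rewrite -lerBlDl le_max; apply/orP; left; lra.
 rewrite -lerBlDl le_max; apply/orP; right; rewrite le_min; apply/andP; split.
 have : minr v w <= v by rewrite ge_min lexx.
 lra.
 have : minr v w <= w by rewrite ge_min lexx orbT.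
 lra.
move=> h1 h2 h3; rewrite ler_norml; have k1 := H _ _ _ _ _ _ h1 h2 h3.
rewrite distrC in h1; rewrite distrC in h2; rewrite distrC in h3.
by have k2 := H _ _ _ _ _ _ h1 h2 h3; apply/andP; split; lra.
Qed.

Definition instrip (b e : R -> R) z := b (cRe z) < cIm z < e (cRe z).

(** Continuity and periodicity are stated on the whole plane: values can be frozen along verticals
    outside the closed strip. Homotopies are then continuous for every real parameter, and only
    holomorphy is restricted to the open strip. *)
Record hstrip (b e : R -> R) (f f1 : R[i] -> R[i]) : Prop := Hstrip {
 hs_cat : forall z, cat f z;
 hs_per : forall z, f (z + tau%:C) = f z;
 hs_diff : forall z, instrip b e z -> cdiff f (f1 z) z;
 hs_cat1 : forall z, instrip b e z -> cat f1 z }.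

Lemma cont_eps (g : R -> R) (x: R) : continuous g -> forall e, 0 < e ->
 exists2 d : R, 0 < d & forall x' : R, `|x' - x| < d -> `|g x' - g x| < e.
move=> /(_ x)/cvgrPdist_lt h e e0; have [d /= d0 hd] := h e e0.
by exists d=> // x' hx; rewrite distrC; apply: hd; rewrite /ball_/= distrC.
Qed.

(** The increment is split into a horizontal step at the new height, handled by the mean value
    theorem, and a vertical step at fixed abscissa, handled by the chain rule. *)
Lemma chain_graph (g gx : R -> R -> R) (Y : R -> R) (t r a b: R) : 0 < r -> continuous Y ->
 (forall x y, `|x - t| < r -> `|y - Y t| < r -> is_derive x 1 (g^~ y) (gx x y)) ->
 {for (t, Y t), continuous (unc gx)} ->
 is_derive (Y t) 1 (g t) a -> is_derive t 1 Y b ->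
 is_derive t 1 (fun s=> g s (Y s)) (gx t (Y t) + a * b).
move=> r0 cY hg /cont2_eps cx ha hb; apply/is_derive_eps => e e0.
have e20: 0 < e / 2 by rewrite divr_gt0.
have [d1 d10 h1] := (is_derive_eps _ _ _).1 (is_dcomp ha hb) _ e20.
have [d2 d20 h2] := cx _ e20.
have [d3 d30 h3] := @cont_eps _ t cY (minr r d2) ltac:(by rewrite lt_min r0).
exists (minr (minr r d1) (minr d2 d3)) => [|h]; first by rewrite !lt_min r0 d10 d20.
rewrite !lt_min => /andP[/andP[hr hd1] /andP[hd2 hd3]].
have hh: t + h - t = h by rewrite addrAC subrr add0r.
have := h3 (t + h); rewrite hh lt_min => /(_ hd3)/andP[y1 y2].
have K: `|g (t + h) (Y (t + h)) - (t + h) * gx t (Y t) - (g t (Y (t + h)) - t * gx t (Y t))| <=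
 e / 2 * `|h|.
 have := @mvt_lip R (fun w : R => g w (Y (t + h)) - w * gx t (Y t))
 (fun w : R => gx w (Y (t + h)) - gx t (Y t)) (e / 2) t (t + h); rewrite hh; apply=> w hw.
 have wr: `|w - t| < r by apply: between_close hw; rewrite hh.
 apply: is_dext (is_dB (hg w _ wr y1) (is_dM (is_dI w)
 (is_dC (gx t (Y t)) w)))=> //.
 by rewrite mulr0 addr0 mul1r.
 by apply/ltW/h2=> //; apply: between_close hw; rewrite hh.
have := le_trans (ler_normD _ _) (lerD K (h1 h hd1)); rewrite -mulrDl -splitr.
by apply: le_trans; apply: le_of_eq; congr `|_|; ring.
Qed.

Lemma ccat_comp2 (T : topologicalType) (r : R * T) (u : T -> R[i]) : ccont u ->
 ccat (fun r : R * T => u r.2) r.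
move=> [u1 u2]; split.
 by apply: (@continuous_comp _ _ _ snd (fun x=> cRe (u x))); [exact: cvg_snd|exact: u1].
by apply: (@continuous_comp _ _ _ snd (fun x=> cIm (u x))); [exact: cvg_snd|exact: u2].
Qed.

Lemma ccat_fst (r : R * R) : ccat (fun r : R * R => (r.1)%:C : R[i]) r.
by split => /=; [exact: cvg_fst|exact: cst_continuous]. Qed.

Lemma ccat_sec (T U : topologicalType) (u : T * U -> R[i]) (t : T) :
 (forall p : T * U, ccat u p) -> ccont (fun x=> u (t, x)).
move=> hu; apply: ccontP => x; apply/ccat_eps => e e0.
have [[P Q] /= [hP hQ] hPQ] := (ccat_eps _ _).1 (hu (t, x)) e e0.
apply: filterS hQ => y Qy; apply: (hPQ (t, y)); split=> //=.
exact: nbhs_singleton hP.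
Qed.

Section Strip.
Variables (b e : R -> R).
Hypothesis (cb : continuous b) (ce : continuous e).

Lemma strip_open (x y: R) : b x < y < e x -> exists2 r : R, 0 < r & forall x' y' : R,
 `|x' - x| < r -> `|y' - y| < r -> b x' < y' < e x'.
move=> /andP[h1 h2].
pose m := minr (y - b x) (e x - y) / 2.
have m0: 0 < m by rewrite divr_gt0// lt_min !subr_gt0 h1.
have [m1 m2] : 2 * m <= y - b x /\ 2 * m <= e x - y.
 by rewrite /m mulrC divfK// !ge_min !lexx orbT.
have [d1 d10 k1] := cont_eps x cb m0; have [d2 d20 k2] := cont_eps x ce m0.
exists (minr m (minr d1 d2)); first by rewrite !lt_min m0 d10.
move=> x' y'; rewrite !lt_min => /and3P[_ /k1 a1 /k2 a2] /andP[a3 _].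
by move: a1 a2 a3; rewrite !ltr_norml => /andP[? ?] /andP[? ?] /andP[? ?]; apply/andP; split; lra.
Qed.

Lemma within_eps (g : R -> R -> R) (x y: R) :
 {within [set p : R * R | b p.1 <= p.2 <= e p.1], continuous (unc g)} ->
 b x <= y <= e x -> forall eps : R, 0 < eps -> exists2 d : R, 0 < d & forall x' y' : R,
 b x' <= y' <= e x' -> `|x' - x| < d -> `|y' - y| < d -> `|g x' y' - g x y| < eps.
move=> /subspace_continuousP h hxy eps eps0.
have /cvgrPdist_lt/(_ _ eps0) := h (x, y) hxy.
move=> [[P Q] /= [/nbhs_ballP[d1 /= d10 h1] /nbhs_ballP[d2 /= d20 h2]] hPQ].
exists (minr d1 d2); first by rewrite lt_min d10.
move=> x' y' hin; rewrite !lt_min => /andP[a1 _] /andP[_ a2].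
rewrite distrC; apply: (hPQ (x', y'))=> //; split => /=.
 by apply: h1; rewrite /ball/= distrC.
by apply: h2; rewrite /ball/= distrC.
Qed.

Hypothesis be : forall x, b x < e x.

Lemma clamp_eps (g : R -> R -> R) (x y: R) :
 {within [set p : R * R | b p.1 <= p.2 <= e p.1], continuous (unc g)} ->
 forall eps : R, 0 < eps -> exists2 d : R, 0 < d & forall x' y' : R,
 `|x' - x| < d -> `|y' - y| < d ->
 `|g x' (clamp (b x') (e x') y') - g x (clamp (b x) (e x) y)| < eps.
move=> h eps eps0; have [d d0 hd] := within_eps h (clamp_in y (ltW (be x))) eps0.
have d20: 0 < d / 2 by rewrite divr_gt0.
have [d1 d10 k1] := cont_eps x cb d20; have [d2 d20' k2] := cont_eps x ce d20.
exists (minr (d / 2) (minr d1 d2)); first by rewrite !lt_min d20 d10.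
move=> x' y'; rewrite !lt_min => /and3P[a1 /k1 a2 /k2 a3] /andP[a4 _].
have dd: d / 2 < d by rewrite ltr_pdivrMr// ltr_pMr// ltr1n.
apply: hd; first exact: clamp_in (ltW (be x')).
 exact: lt_trans a1 dd.
by apply: le_lt_trans dd; apply: clamp_lip; exact: ltW.
Qed.

End Strip.

Lemma derive1_is (f : R -> R) (x: R) : derivable f x 1 -> is_derive x 1 f (derive1 f x).
by move=> h; rewrite derive1E; exact: derivableP. Qed.

Lemma is_derive_shift (f : R -> R) (x c a: R) : is_derive (x + c) 1 f a ->
 is_derive x 1 (fun t=> f (t + c)) a.
move=> /is_derive_eps h; apply/is_derive_eps => e e0; have [d d0 hd] := h e e0.
by exists d=> // k /hd; rewrite (addrAC x k).
Qed.

Lemma is_derive_uniq (f : R -> R) (x a b: R) : is_derive x 1 f a -> is_derive x 1 f b -> a = b.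
by move=> h1 h2; rewrite -(@derive_val _ _ _ x 1 f a h1) -(@derive_val _ _ _ x 1 f b h2). Qed.

Section Solution.
Variables (h gamma: R) (eta beta psi : R -> R) (phi p q : R -> R -> R).
Hypothesis sol : solves h eta beta gamma psi phi p q.
Hypothesis (ceta : continuous eta) (cbeta : continuous beta).
Hypothesis (peta : periodic eta tau) (pbeta : periodic beta tau).
Hypothesis gap : forall x, - h + beta x < eta x.
Let b := fun x=> - h + beta x.

Lemma sol_cb : continuous b.
by apply: contD=> //; exact: contC. Qed.

(** [phi_x - i phi_y], frozen along vertical lines outside the closed strip. *)
Let F z : R[i] := p (cRe z) (clamp (b (cRe z)) (eta (cRe z)) (cIm z)) +i*
 - q (cRe z) (clamp (b (cRe z)) (eta (cRe z)) (cIm z)).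
Let F1 z : R[i] := d1 (d1 phi) (cRe z) (cIm z) +i*
 - d1 (d2 phi) (cRe z) (cIm z).

Lemma sol_ders (x y: R) : b x < y < eta x ->
 [/\ is_derive x 1 (fun t=> phi t y) (p x y), is_derive y 1 (phi x) (q x y),
 is_derive x 1 (fun t=> d1 phi t y) (d1 (d1 phi) x y) /\
 is_derive y 1 (d1 phi x) (d2 (d1 phi) x y) &
 is_derive x 1 (fun t=> d2 phi t y) (d1 (d2 phi) x y) /\
 is_derive y 1 (d2 phi x) (d2 (d2 phi) x y)].
move=> hxy; have hS: strip h eta beta (x, y) by [].
have [_ /(_ isT)[a1 a2]] := solves_C2 sol [::] hS.
have [_ /(_ isT)[b1 b2]] := solves_C2 sol [:: true] hS.
have [_ /(_ isT)[c1 c2]] := solves_C2 sol [:: false] hS.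
rewrite (solves_dx sol hS) (solves_dy sol hS).
split; [exact: (derive1_is a1)|exact: (derive1_is a2)| |].
 by split; [exact: (derive1_is b1)|exact: (derive1_is b2)].
by split; [exact: (derive1_is c1)|exact: (derive1_is c2)].
Qed.

Lemma sol_cont2 (w : seq bool) (x y: R) : size w = 2 -> b x < y < eta x ->
 {for (x, y), continuous (fun r : R * R => partials w phi r.1 r.2)}.
move=> hw hxy; have hS: strip h eta beta (x, y) by [].
by have [k _] := solves_C2 sol w hS; apply: k; rewrite hw.
Qed.

Lemma sol_schwarz (x y: R) : b x < y < eta x -> d2 (d1 phi) x y = d1 (d2 phi) x y.
move=> hxy; have [r r0 hr] := strip_open sol_cb ceta hxy.
apply: (@schwarz R phi (d1 phi) (d2 phi) (d2 (d1 phi)) (d1 (d2 phi)) x y r r0) => [x' y' h1 h2||].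
- have hin := hr x' y' h1 h2; have [k1 k2 [_ k3] [k4 _]] := sol_ders hin.
 have hS: strip h eta beta (x', y') by [].
 by split=> //; rewrite -?(solves_dx sol hS) -?(solves_dy sol hS).
- exact: (@sol_cont2 [:: false; true]).
exact: (@sol_cont2 [:: true; false]).
Qed.

Lemma sol_trace (x y: R) : b x <= y <= eta x -> F (x +i* y) = p x y +i* - q x y.
by move=> hxy; rewrite /F/= clamp_id. Qed.

Lemma cat_F z : cat F z.
have H (g : R -> R -> R) := @clamp_eps _ _ sol_cb ceta gap g (cRe z) (cIm z).
apply: (@cat_cont2 (fun x y => p x (clamp (b x) (eta x) y)) (fun x y => - q x (clamp (b x) (eta x) y))).
 exact: (H p (solves_cont_dx sol)).
move=> e /(H q (solves_cont_dy sol))[d d0 hd]; exists d=> // x y h1 h2.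
by rewrite -opprD normrN; exact: hd.
Qed.

Lemma per_phi (x y: R) : b x <= y <= eta x -> phi (x + tau) y = phi x y.
by move=> hxy; apply: (solves_periodic sol). Qed.

Lemma bper : periodic b tau.
by move=> x; rewrite /b pbeta. Qed.

Lemma per_in (x y: R) : b x < y < eta x ->
 p (x + tau) y = p x y /\ q (x + tau) y = q x y.
move=> hxy; have [k1 k2 _ _] := sol_ders hxy.
have hxy': b (x + tau) < y < eta (x + tau) by rewrite bper peta.
have [l1 l2 _ _] := sol_ders hxy'.
have [r r0 hr] := strip_open sol_cb ceta hxy.
have wk (s t: R) : b s < t < eta s -> b s <= t <= eta s by move=> /andP[/ltW -> /ltW ->].
split.
 apply: is_derive_uniq (k1); apply: (is_derive_near r0 _ (is_derive_shift l1)) => s hs.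
 by apply/per_phi/wk/(hr s y hs); rewrite subrr normr0.
apply: is_derive_uniq (k2); apply: (is_derive_near r0 _ l2) => s hs.
by apply/per_phi/wk/(hr x s _ hs); rewrite subrr normr0.
Qed.

(** Periodicity is given for [phi] alone. It passes to the derivatives in the open strip, and to the
    boundary by continuity. *)
Lemma per_F z : F (z + tau%:C) = F z.
case: z => x y; rewrite /F/= addr0 bper peta.
set y' := clamp _ _ _.
have hy': b x <= y' <= eta x by apply: clamp_in; apply: ltW; exact: gap.
have hy2: b (x + tau) <= y' <= eta (x + tau) by rewrite bper peta.
rewrite -(sol_trace hy') -(sol_trace hy2).
apply/eqP; rewrite -subr_eq0; apply/eqP/nc_small => e e0.
have e20: 0 < e / 2 by rewrite divr_gt0.
have [d1 d10 h1] := cat_F ((x + tau) +i* y') e20.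
have [d2 d20 h2] := cat_F (x +i* y') e20.
pose m := (b x + eta x) / 2.
have [m1 m2] : b x < m /\ m < eta x by have := gap x; rewrite -/(b x) /m; lra.
(* The point moves by the fraction [t] towards the middle [m] of its vertical segment: into the open
   strip, but by less than both moduli of continuity. *)
pose t := minr (1 / 2) (minr d1 d2 / (2 * (`|m - y'| + 1))).
have M0: 0 < `|m - y'| + 1 by rewrite ltr_wpDl.
have d120: 0 < minr d1 d2 by rewrite lt_min d10.
have t0: 0 < t by rewrite lt_min !divr_gt0// mulr_gt0.
have t1: t <= 1 / 2 by rewrite ge_min lexx.
pose y1 := y' + t * (m - y').
have y1in: b x < y1 < eta x.
 have /andP[a1 a2] := hy'.
 have E: y1 = (1 - t) * y' + t * m by rewrite /y1; ring.
 have t1': 0 <= 1 - t by lra.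
 have := ler_wpM2l t1' a1; have := ler_wpM2l t1' a2.
 have : t * b x < t * m by rewrite ltr_pM2l.
 have : t * m < t * eta x by rewrite ltr_pM2l.
 by rewrite E; move=> *; apply/andP; split; lra.
have tm: `|t * (m - y')| < minr d1 d2.
 rewrite normrM gtr0_norm//; apply: (@le_lt_trans _ _ (minr d1 d2 / 2)).
 apply: (le_via (minr d1 d2 / (2 * (`|m - y'| + 1)) * `|m - y'|)).
 by rewrite ler_wpM2r// ge_min lexx orbT.
 rewrite invfM mulrA -mulrA ler_piMr//; first by rewrite divr_ge0// ltW.
 by rewrite mulrC ler_pdivrMr// mul1r lerDl.
 by rewrite ltr_pdivrMr// ltr_pMr// ltr1n.
have dist (a: R) : nc ((a +i* y1) - (a +i* y')) = `|t * (m - y')|.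
 rewrite (_ : _ - _ = 0 +i* (t * (m - y'))); last by apply: cext; rewrite ?ReD ?ImD ?ReN ?ImN/= /y1; ring.
 by rewrite ncE/= expr0n/= add0r sqrtr_sqr.
move: tm; rewrite lt_min => /andP[tm1 tm2].
have k1 := h1 ((x + tau) +i* y1); rewrite dist in k1; have {}k1 := k1 tm1.
have k2 := h2 (x +i* y1); rewrite dist in k2; have {}k2 := k2 tm2.
have E: F ((x + tau) +i* y1) = F (x +i* y1).
 have wk (s: R) : b s < y1 < eta s -> b s <= y1 <= eta s by move=> /andP[/ltW -> /ltW ->].
 have y2in: b (x + tau) < y1 < eta (x + tau) by rewrite bper peta.
 rewrite (sol_trace (wk _ y1in)) (sol_trace (wk _ y2in)).
 by have [-> ->] := per_in y1in.
rewrite E in k1.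
rewrite -(subrKA (F (x +i* y1))) -[X in X + _]opprB; apply: (le_trans (ncD _ _)).
by rewrite ncN; have := ltrD k1 k2; rewrite -splitr => /ltW.
Qed.

Lemma solves_hstrip : hstrip b eta F F1.
split; [exact: cat_F|exact: per_F| |] => -[x y] hxy; rewrite /instrip/= in hxy.
 have [r r0 hr] := strip_open sol_cb ceta hxy.
 pose G z : R[i] := d1 phi (cRe z) (cIm z) +i* - d2 phi (cRe z) (cIm z).
 apply: (@cdiff_near G F _ _ r r0).
 move=> w wr.
 have bR: `|cRe w - x| < r by apply: le_lt_trans wr; rewrite -[x]/(cRe (x +i* y)) -ReN -ReD Re_le_nc.
 have bI: `|cIm w - y| < r by apply: le_lt_trans wr; rewrite -[y]/(cIm (x +i* y)) -ImN -ImD Im_le_nc.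
 have hw := hr _ _ bR bI.
 have hS: strip h eta beta (cRe w, cIm w) by [].
 rewrite /F clamp_id; last by move/andP: hw => [/ltW -> /ltW ->].
 by rewrite (solves_dx sol hS) (solves_dy sol hS).
 apply: (@cdiff_CR R (d1 phi) (d1 (d1 phi)) (d2 (d1 phi)) (fun x y => - d2 phi x y)
 (fun x y => - d1 (d2 phi) x y) (fun x y => - d2 (d2 phi) x y) (x +i* y) r r0) => /=.
 - move=> x' y' k1 k2; have [_ _ [a1 a2] [a3 a4]] := sol_ders (hr _ _ k1 k2).
 by split; split; [exact: a1|exact: a2|exact: (is_dN a3)|exact: (is_dN a4)].
 - exact: (@sol_cont2 [:: true; true]).
 - exact: (@sol_cont2 [:: false; true]).
 - by apply: cfN; exact: (@sol_cont2 [:: true; false]).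
 - by apply: cfN; exact: (@sol_cont2 [:: false; false]).
 - by rewrite opprK sol_schwarz.
 - have hS: strip h eta beta (x, y) by [].
 by apply/eqP; rewrite eq_sym -subr_eq0 opprK; apply/eqP; exact: (solves_laplace sol hS).
apply: (@cat_cont2 (d1 (d1 phi)) (fun x y => - d1 (d2 phi) x y)) => /= e e0.
 by apply: cont2_eps=> //; exact: (@sol_cont2 [:: true; true]).
have := cont2_eps (@sol_cont2 [:: true; false] x y erefl hxy) e0 => -[d d0 hd].
by exists d=> // x' y' k1 k2; rewrite -opprD normrN; exact: hd.
Qed.

(* The curves [y = eta x - t] lie in the strip; the derivative of the trace on
 them converges locally uniformly as [t] tends to 0. *)
Lemma sol_top (eta' psi' : R -> R) : (forall x : R, is_derive x 1 eta (eta' x)) -> continuous eta' ->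
 (forall x : R, is_derive x 1 psi (psi' x)) -> forall x, psi' x = p x (eta x) + q x (eta x) * eta' x.
move=> deta ceta' dpsi x; apply: is_derive_uniq (dpsi x) _; set L := p _ _ + _.
pose Z (r : R * R) : R[i] := (r.2)%:C + 'i * ((eta r.2)%:C - (r.1)%:C).
have cid: ccont (fun x : R => x%:C : R[i]) by apply: ccontR; exact: contI.
have cZ (r : R * R) : ccat Z r.
 apply: ccatD; first exact: (ccat_comp2 r cid).
 apply: ccatM; first exact: ccatC.
 apply: ccatB; last exact: ccat_fst.
 exact: (ccat_comp2 r (ccontR ceta)).
pose a (t s: R) := cRe (F (Z (t, s)) * (1 + 'i * (eta' s)%:C)).
have ca: {for (0, x), continuous (unc a)}.
 have [cA _] : ccat (fun r : R * R => F (Z r) * (1 + 'i * (eta' r.2)%:C)) (0, x).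
 apply: ccatM; first by apply: ccat_comp; [exact: cZ|exact: cat_F].
 apply: ccatD; first exact: ccatC.
 by apply: ccatM; [exact: ccatC|exact: (ccat_comp2 _ (ccontR ceta'))].
 by apply: cf_ext cA; apply/funext => -[].
have aE t s : b s <= eta s - t <= eta s -> a t s = p s (eta s - t) + q s (eta s - t) * eta' s.
 have -> : a t s = p s (clamp (b s) (eta s) (eta s - t)) + q s (clamp (b s) (eta s) (eta s - t)) * eta' s.
 by rewrite /a /F /Z !reim/= !(mul0r, mulr0, mul1r, addr0, add0r, subr0, oppr0); ring.
 by move=> /clamp_id ->.
have bt s : b s <= eta s <= eta s by rewrite lexx andbT; apply: ltW; exact: gap.
have aL: a 0 x = L by rewrite aE subr0.
apply/is_derive_eps => e e0; have [dA d10 h1] := cont2_eps ca e0.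
have cg: continuous (fun s=> eta s - b s) by apply: contB=> //; exact: sol_cb.
have g0: 0 < (eta x - b x) / 2 by rewrite divr_gt0// subr_gt0; exact: gap.
have [dB d20 h2] := cont_eps x cg g0.
exists (minr dA dB) => [|u]; first by rewrite lt_min d10.
rewrite lt_min => /andP[hh1 hh2]; apply/ler_addgt0Pr => e' e'0.
have lim (s: R) : exists2 r : R, 0 < r & forall t, 0 < t < r -> `|phi s (eta s - t) - psi s| < e' / 2.
 have [r r0 hr] := @clamp_eps _ _ sol_cb ceta gap phi s (eta s) (solves_cont sol) (e' / 2) ltac:(by rewrite divr_gt0).
 exists (minr r (eta s - b s)) => [|t]; first by rewrite lt_min r0 subr_gt0; exact: gap.
 rewrite lt_min => /and3P[t0 tr tb]; have := hr s (eta s - t).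
 rewrite subrr normr0 addrAC subrr sub0r normrN gtr0_norm// (clamp_id (bt s)) clamp_id.
 by rewrite (solves_top sol); apply.
 by apply/andP; split; lra.
have [r1 r10 l1] := lim (x + u); have [r2 r20 l2] := lim x.
have m0: 0 < minr (minr r1 r2) (minr dA ((eta x - b x) / 2)) by rewrite !lt_min r10 r20 d10.
pose t := minr (minr r1 r2) (minr dA ((eta x - b x) / 2)) / 2.
have t0: 0 < t by rewrite divr_gt0.
have : t < minr (minr r1 r2) (minr dA ((eta x - b x) / 2)) by rewrite ltr_pdivrMr// ltr_pMr// ltr1n.
rewrite !lt_min => /andP[/andP[tr1 tr2] /andP[td tg]].
have key: `|(phi (x + u) (eta (x + u) - t) - (x + u) * L) - (phi x (eta x - t) - x * L)| <= e * `|u|.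
 rewrite -[in leRHS](addKr x u) [- x + _]addrC.
 have cl (w: R) : minr x (x + u) <= w <= Num.max x (x + u) ->
 [/\ `|w - x| < dA, `|w - x| < dB & b w < eta w - t < eta w].
 move=> hw; have hx: `|x + u - x| = `|u| by rewrite addrAC subrr add0r.
 have w1: `|w - x| < dA by apply: between_close hw; rewrite hx.
 have w2: `|w - x| < dB by apply: between_close hw; rewrite hx.
 by split=> //; have := h2 _ w2; rewrite ltr_norml => /andP[k1 _]; apply/andP; split; lra.
 apply: (mvt_lip (p := fun s=> phi s (eta s - t) - s * L) (p' := fun s=> a t s - L)) => w /cl[w1 w2 w3].
 have [r r0 hr] := strip_open sol_cb ceta w3.
 have hS: strip h eta beta (w, eta w - t) by [].
 have [_ j2 _ _] := sol_ders hS.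
 have H := chain_graph (g := phi) (gx := d1 phi) r0 _ _ ((solves_C2 sol [:: true] hS).1 isT) j2
 (is_dB (deta w) (is_dC t w)).
 apply: is_dext (is_dB (H _ _) (is_dM (is_dI w) (is_dC L w)))=> //.
 + rewrite aE; last by case/andP: w3 => /ltW -> /ltW ->.
 by rewrite (solves_dx sol hS); ring.
 + by move=> v; apply: cvgB; [exact: ceta|exact: cvg_cst].
 + move=> x' y' k1 k2; have hin := hr x' y' k1 k2; have [j1 _ _ _] := sol_ders hin.
 by rewrite -(solves_dx sol (y := y')).
 rewrite -aL; apply/ltW/h1=> //; by rewrite subr0 gtr0_norm.
have := l1 t ltac:(by rewrite t0); have := l2 t ltac:(by rewrite t0).
move: key; rewrite !ltr_norml !ler_norml => /andP[k1 k2] /andP[k3 k4] /andP[k5 k6].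
by apply/andP; split; lra.
Qed.

End Solution.

End Package.

(** * Cauchy theory in a periodic strip: Rellich identity and interior bound *)

Section Cauchy.
Context {R : realType}.
Implicit Types (z w : R[i]).

Lemma cat_ccat (f : R[i] -> R[i]) z :
 ccat (fun r : R * R => f (r.1 +i* r.2)) (cRe z, cIm z) <-> cat f z.
split=> [/ccat_eps h|h].
 move=> e e0; have [[P Q] /= [/nbhs_ballP[d1 /= d10 h1] /nbhs_ballP[d2 /= d20 h2]] hPQ] := h e e0.
 exists (minr d1 d2); first by rewrite lt_min d10.
 move=> w; rewrite lt_min => /andP[a1 a2].
 have := hPQ (cRe w, cIm w); rewrite /=.
 case: w a1 a2 => a b; case: z {h hPQ} h1 h2 => c d /= h1 h2 a1 a2; apply; split => /=.
 apply: h1; rewrite /ball/= distrC; apply: le_lt_trans a1.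
 by have := @Re_le_nc R ((a +i* b) - (c +i* d)); rewrite ReD ReN.
 apply: h2; rewrite /ball/= distrC; apply: le_lt_trans a2.
 by have := @Im_le_nc R ((a +i* b) - (c +i* d)); rewrite ImD ImN.
apply/ccat_eps => e e0; have [d d0 hd] := h e e0.
have d20: 0 < d / 2 by rewrite divr_gt0.
exists (ball (cRe z) (d / 2), ball (cIm z) (d / 2)).
 by split; exact: nbhsx_ballx.
move=> -[a b] [] /=; rewrite /ball/= => h1 h2.
have E: cRe z +i* cIm z = z by case: (z).
rewrite E; apply: hd; apply: (le_lt_trans (nc_le_ReIm _)).
by rewrite ReD ImD ReN ImN/= distrC (distrC b) [d]splitr ltrD.
Qed.

Lemma catD f g z : cat f z -> cat g z -> cat (fun w : R[i] => f w + g w) z.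
by move=> /cat_ccat h1 /cat_ccat h2; apply/cat_ccat; exact: ccatD. Qed.

Lemma catM f g z : cat f z -> cat g z -> cat (fun w : R[i] => f w * g w) z.
by move=> /cat_ccat h1 /cat_ccat h2; apply/cat_ccat; exact: ccatM. Qed.

Lemma catC (c : R[i]) z : cat (fun _=> c) z.
by apply/cat_ccat; exact: ccatC. Qed.

Lemma catB f g z : cat f z -> cat g z -> cat (fun w : R[i] => f w - g w) z.
by move=> /cat_ccat h1 /cat_ccat h2; apply/cat_ccat; exact: ccatB. Qed.

Lemma catV f z : f z != 0 -> cat f z -> cat (fun w : R[i] => (f w)^-1) z.
move=> f0 /cat_ccat h; apply/cat_ccat; apply: ccatV=> //=.
by case: z f0 {h}.
Qed.

Lemma cat_near (f g : R[i] -> R[i]) z (r: R) : 0 < r ->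
 (forall w, nc (w - z) < r -> f w = g w) -> cat f z -> cat g z.
move=> r0 fg h e e0; have [d d0 hd] := h e e0.
exists (minr r d); first by rewrite lt_min r0.
by move=> w; rewrite lt_min => /andP[wr /hd]; rewrite !fg// subrr nc0.
Qed.

Lemma cder_near (f g : R -> R[i]) (t r: R) a : 0 < r ->
 (forall s, `|s - t| < r -> f s = g s) -> cder f t a -> cder g t a.
move=> r0 fg [h1 h2]; split.
 by apply: (is_derive_near r0 _ h1) => s /fg ->.
by apply: (is_derive_near r0 _ h2) => s /fg ->.
Qed.

(** Product rule with a merely continuous second factor, possible because the first factor vanishes
    at [t]. It differentiates through removable singularities. *)
Lemma cder_vanish (u v : R -> R[i]) (t: R) a : cder u t a -> u t = 0 -> ccat v t ->
 cder (fun s=> u s * v s) t (a * v t).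
move=> /cder_eps hu u0 /ccat_eps hv; apply/cder_eps => e e0.
have nv := nc_ge0 (v t); have na := nc_ge0 a.
pose e1 := minr 1 (e / (2 * (nc (v t) + 1))).
have e10: 0 < e1 by rewrite lt_min ltr01/= divr_gt0// mulr_gt0// ltr_wpDl.
have [d1 d10 h1] := hu e1 e10.
pose e2 := minr 1 (e / (2 * (nc a + 1))).
have e20: 0 < e2 by rewrite lt_min ltr01/= divr_gt0// mulr_gt0// ltr_wpDl.
have [d2 /= d20 h2] := hv e2 e20.
exists (minr d1 d2); first by rewrite lt_min d10.
move=> h; rewrite lt_min => /andP[/h1 k1 hd].
have k2: nc (v (t + h) - v t) < e2.
 by apply: h2; rewrite /ball_/= opprD addNKr normrN.
rewrite u0 subr0 in k1; rewrite u0 mul0r subr0.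
have -> : u (t + h) * v (t + h) - h%:C * (a * v t) =
 (u (t + h) - h%:C * a) * v (t + h) + h%:C * a * (v (t + h) - v t) by ring.
have nh := normr_ge0 h.
have bv: nc (v (t + h)) <= nc (v t) + 1.
 rewrite -[v (t + h)](subrK (v t)) addrC; apply: (le_trans (ncD _ _)).
 by rewrite lerD2l (le_trans (ltW k2))// ge_min lexx.
apply: (le_trans (ncD _ _)); rewrite !ncM nc_real.
have m1: nc (u (t + h) - h%:C * a) * nc (v (t + h)) <= e / 2 * `|h|.
 apply: (le_via (e / (2 * (nc (v t) + 1)) * `|h| * (nc (v t) + 1))).
 apply: ler_pM; rewrite ?nc_ge0//; apply: (le_trans k1).
 by rewrite ler_wpM2r// ge_min lexx orbT.
 apply: le_of_eq; field.
 by rewrite gt_eqF// ltr_wpDl.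
have m2: `|h| * nc a * nc (v (t + h) - v t) <= e / 2 * `|h|.
 apply: (le_via (`|h| * (nc a + 1) * (e / (2 * (nc a + 1))))).
 apply: ler_pM; rewrite ?mulr_ge0//.
 by rewrite ler_wpM2l// lerDl.
 by apply: (le_trans (ltW k2)); rewrite ge_min lexx orbT.
 apply: le_of_eq; field.
 by rewrite gt_eqF// ltr_wpDl.
by have := lerD m1 m2; rewrite -mulrDl -splitr.
Qed.

(* [e^{iw}] *)
Definition cE w : R[i] := (expR (- cIm w) * cos (cRe w)) +i*
 (expR (- cIm w) * sin (cRe w)).

Lemma cE_split w : cE w = (expR (- cIm w))%:C * expi (cRe w).
by apply: cext; rewrite ?ReM ?ImM/= mul0r ?subr0 ?addr0. Qed.

Lemma nc_cE w : nc (cE w) = expR (- cIm w).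
by rewrite cE_split ncM nc_expi nc_real mulr1 ger0_norm// expR_ge0. Qed.

Lemma cE_per w (k: int) : cE (w + (k%:~R * tau)%:C) = cE w.
by rewrite !cE_split ReD ImD/= addr0 expiD expi_2pi mulr1. Qed.

Lemma cdiff_cE w : cdiff cE ('i * cE w) w.
pose u (x y: R) := expR (- y) * cos x; pose v (x y: R) := expR (- y) * sin x.
have dE (y: R) : is_derive y 1 (fun y : R => expR (- y)) (- expR (- y)).
 have := @is_dcomp _ expR (fun y : R => - y) y _ _ (is_derive_expR (- y)) (is_dN (is_dI y)).
 by apply: is_dext=> //; ring.
have ce: continuous (fun q : R * R => expR (- q.2)).
 move=> q; apply: (@continuous_comp _ _ _ (fun q : R * R => - q.2) expR); last exact: continuous_expR.
 by apply: cvgN; exact: cvg_snd.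
have cc: continuous (fun q : R * R => cos q.1).
 by move=> q; apply: (@continuous_comp _ _ _ fst cos); [exact: cvg_fst|exact: continuous_cos].
have cs: continuous (fun q : R * R => sin q.1).
 by move=> q; apply: (@continuous_comp _ _ _ fst sin); [exact: cvg_fst|exact: continuous_sin].
have := @cdiff_CR R u (fun x y => - v x y) (fun x y => - u x y) v u (fun x y => - v x y) w 1 ltr01.
have -> : 'i * cE w = - v (cRe w) (cIm w) +i* u (cRe w) (cIm w).
 by apply: cext; rewrite ?ReM ?ImM/= /u /v; ring.
apply.
- move=> x y _ _; split; split.
 + have := is_dM (is_dC (expR (- y)) x) (is_derive_cos x).
 by apply: is_dext=> //; rewrite /v; ring.
 + have := is_dM (dE y) (is_dC (cos x) y).
 by apply: is_dext=> //; rewrite /u; ring.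
 + have := is_dM (is_dC (expR (- y)) x) (is_derive_sin x).
 by apply: is_dext=> //; rewrite /u; ring.
 + have := is_dM (dE y) (is_dC (sin x) y).
 by apply: is_dext=> //; rewrite /v; ring.
- by apply: cfN; apply: cfM; [exact: ce|exact: cs].
- by apply: cfN; apply: cfM; [exact: ce|exact: cc].
- by apply: cfM; [exact: ce|exact: cc].
- by apply: cfN; apply: cfM; [exact: ce|exact: cs].
- by [].
- by [].
Qed.

Lemma ccat_sec2 (A : R -> R -> R[i]) (t: R) :
 (forall p : R * R, ccat (unc A) p) -> ccont (A t).
by move=> h; have := ccat_sec t h. Qed.

Lemma cdiff_cat (f : R[i] -> R[i]) a z : cdiff f a z -> cat f z.
move=> h e e0; have [d d0 hd] := h 1 ltr01; have na := nc_ge0 a.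
have M0: 0 < nc a + 1 by rewrite ltr_wpDl.
exists (minr d (e / (nc a + 1))); first by rewrite lt_min d0 divr_gt0.
move=> w; rewrite lt_min ltr_pdivlMr// => /andP[/hd k1 k2].
apply: le_lt_trans k2; rewrite -(subrK (a * (w - z)) (f w - f z)).
apply: (le_trans (ncD _ _)); rewrite mul1r in k1.
by rewrite ncM [leRHS]mulrDr mulr1 addrC (mulrC (nc a)) lerD2l.
Qed.

Lemma cE_eq1 w : cE w = 1 -> exists k : int, w = (k%:~R * tau)%:C.
move=> h; have hI: cIm w = 0.
 have := nc_cE w; rewrite h nc1 -(@expR0 R) => /expR_inj/esym/eqP.
 by rewrite oppr_eq0 => /eqP.
have [k hk] := per_reduce (cRe w).
have hc: cos (cRe w + k%:~R * tau) = 1.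
 have := cE_per w k; rewrite h cE_split ReD ImD/= addr0 hI oppr0 expR0 mul1r.
 by move=> /(congr1 (@cRe _)).
set t := _ + _ in hk hc.
have cpos (r: R) : 0 < r -> r <= pi -> cos r < 1.
 move=> r0 rp; apply: (lt_le_trans (@cos_lt_half R r _)); first by rewrite r0.
 exact: cos_le1.
have : t = 0 \/ t = tau.
 move/andP: hk => [t0 t1].
 have [tp|tp] := leP t pi.
 left; apply/eqP; rewrite eq_le t0 andbT leNgt; apply/negP => tpos.
 by have := cpos t tpos tp; rewrite hc ltxx.
 right; apply/eqP; rewrite eq_le t1 leNgt; apply/negP => tneg.
 have := cpos (tau - t); rewrite subr_gt0 => /(_ tneg).
 have -> : cos (tau - t) = 1.
 by rewrite -[RHS]hc -(cosN t) -(cosD2pi (- t)) (addrC (- t)) -(mulr_natl pi).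
 have k1: tau - t <= pi by lra.
 by move=> /(_ k1); rewrite ltxx.
have RI: w = (cRe w)%:C by apply: cext.
rewrite RI; move=> [] ht; [exists (- k)|exists (1 - k)]; congr _%:C; move: ht; rewrite /t.
 by rewrite rmorphN/= mulNr; lra.
by rewrite rmorphB/= mulrBl mul1r; lra.
Qed.

(** Lower bounds for the denominator of the periodic Cauchy kernel: it controls the chord of the
    real part and, on a bounded range, the imaginary part. *)
Lemma nc_1subE w (H: R) : `|cIm w| <= H ->
 nc (1 - expi (cRe w)) <= 2 * nc (1 - cE w) /\
 `|cIm w| <= expR H * nc (1 - cE w).
move=> hH; set b := cIm w in hH *.
have r1: `|1 - expR (- b)| <= nc (1 - cE w).
 rewrite -(nc_cE w) -{1}(@nc1 R) ler_norml; apply/andP; split.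
 have := ncD (1 - cE w) (- 1).
 rewrite [X in nc X]addrAC subrr sub0r !ncN; lra.
 by have := ncD (1 - cE w) (cE w); rewrite subrK; lra.
split.
 rewrite -[X in nc X](subrKA (cE w)); apply: (le_trans (ncD _ _)).
 have -> : nc (cE w - expi (cRe w)) = `|1 - expR (- b)|.
 rewrite cE_split -{2}[expi _]mul1r -mulrBl ncM nc_expi mulr1 distrC.
 by rewrite -nc_real rmorphB.
 by lra.
have n0 := nc_ge0 (1 - cE w).
have eH: 1 <= expR H by rewrite -expR0 ler_expR (le_trans _ hH).
have [b0|b0] := leP 0 b.
 have bH: b <= H by move: hH; rewrite ger0_norm.
 have k1: b * expR (- b) <= 1 - expR (- b).
 have := expR_ge1Dx b; rewrite -(ler_pM2r (expR_gt0 (- b))) mulrDl mul1r -expRD subrr expR0.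
 lra.
 rewrite (ger0_norm b0); apply: (le_via (expR H * (b * expR (- b)))).
 rewrite mulrCA ler_peMr// -expRD -expR0 ler_expR; lra.
 rewrite ler_wpM2l// (le_trans k1)//; apply: le_trans r1; exact: ler_norm.
rewrite (ltr0_norm b0).
have k1: - b <= `|1 - expR (- b)|.
 have := expR_ge1Dx (- b); rewrite distrC => k; apply: le_trans (ler_norm _); lra.
by apply: (le_trans k1); apply: (le_trans r1); rewrite ler_peMl.
Qed.

(** The height of the graph over [z] is at most the variation of [g] from [x] to [Re z] plus the
    vertical offset at [x], and [nc_1subE] controls both. A lower bound on the height thus bounds
    the kernel along the whole graph. *)
Lemma graph_kernel (g : R -> R) (L H x: R) z :
 `|g x - g (cRe z)| <= L * nc (1 - expi (x - cRe z)) ->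
 0 <= L -> `|g x - cIm z| <= H ->
 `|g (cRe z) - cIm z| <=
 (2 * L + expR H) * nc (1 - cE (x +i* g x - z)).
move=> hL L0 hH.
have [] := @nc_1subE (x +i* g x - z) H; rewrite ImD ImN/=//.
rewrite ReD ReN/= => k1 k2.
have -> : g (cRe z) - cIm z = (g (cRe z) - g x) + (g x - cIm z) by ring.
apply: (le_trans (ler_normD _ _)); rewrite mulrDl distrC lerD//.
by apply: (le_trans hL); rewrite -mulrA mulrCA ler_wpM2l.
Qed.

(** The graphs [(1 - t) b + t e] join the two boundaries. Holomorphy enters only through the chain
    rule [hF], which leaves room for functions whose derivative is computed by hand. *)
Lemma contour_graph (b e b' e' : R -> R) (F F1 : R[i] -> R[i]) :
 (forall x : R, is_derive x 1 b (b' x)) -> (forall x : R, is_derive x 1 e (e' x)) ->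
 continuous b' -> continuous e' -> periodic b tau -> periodic e tau ->
 (forall x, b x < e x) -> (forall z, cat F z) -> (forall z, F (z + tau%:C) = F z) ->
 (forall z, instrip b e z -> cat F1 z) ->
 (forall (Z : R -> R[i]) (s: R) d, cder Z s d -> instrip b e (Z s) ->
 cder (fun t=> F (Z t)) s (F1 (Z s) * d)) ->
 citor (fun x=> F (x +i* b x) * (1 +i* b' x)) = citor (fun x=> F (x +i* e x) * (1 +i* e' x)).
move=> db de cb' ce' pb pe be cF pF cF1 hF.
have cb := der_cont db.
have ce := der_cont de.
have cid: ccont (fun x : R => x%:C : R[i]) by apply: ccontR; exact: contI.
have C1: ccont (fun _ : R => 1 : R[i]) by exact: ccontC.
pose bC := fun x=> (b x)%:C : R[i]; pose eC := fun x=> (e x)%:C : R[i].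
pose b'C := fun x=> (b' x)%:C : R[i]; pose e'C := fun x=> (e' x)%:C : R[i].
have cbC: ccont bC by exact: ccontR.
have ceC: ccont eC by exact: ccontR.
have cb'C: ccont b'C by exact: ccontR.
have ce'C: ccont e'C by exact: ccontR.
pose Z (t x: R) : R[i] := x%:C + 'i * (bC x + t%:C * (eC x - bC x)).
pose Zx (t x: R) : R[i] := 1 + 'i * (b'C x + t%:C * (e'C x - b'C x)).
pose Zt (x: R) : R[i] := 'i * (eC x - bC x).
pose Ztx (x: R) : R[i] := 'i * (e'C x - b'C x).
have ReZ t x : cRe (Z t x) = x by rewrite /Z !reim/=; ring.
have ImZ t x : cIm (Z t x) = b x + t * (e x - b x).
 by rewrite /Z !reim/=; ring.
have cZ (p : R * R) : ccat (unc Z) p.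
 apply: ccatD; first exact: (ccat_comp2 p cid).
 apply: ccatM; first exact: ccatC.
 apply: ccatD; first exact: (ccat_comp2 p cbC).
 apply: ccatM; first exact: ccat_fst.
 by apply: ccatB; [exact: (ccat_comp2 p ceC)|exact: (ccat_comp2 p cbC)].
have cZx (p : R * R) : ccat (unc Zx) p.
 apply: ccatD; first exact: ccatC.
 apply: ccatM; first exact: ccatC.
 apply: ccatD; first exact: (ccat_comp2 p cb'C).
 apply: ccatM; first exact: ccat_fst.
 by apply: ccatB; [exact: (ccat_comp2 p ce'C)|exact: (ccat_comp2 p cb'C)].
have cZt: ccont Zt by apply: ccontM; [exact: ccontC|exact: ccontB].
have cZtx: ccont Ztx by apply: ccontM; [exact: ccontC|exact: ccontB].
pose A t x := F (Z t x) * Zx t x.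
pose B t x := F (Z t x) * Zt x.
pose D t x := (F1 (Z t x) * Zt x) * Zx t x + F (Z t x) * Ztx x.
have cA (p : R * R) : ccat (unc A) p.
 apply: ccatM; last exact: cZx.
 by apply: ccat_comp; [exact: cZ|exact: cF].
have -> : (fun x=> F (x +i* b x) * (1 +i* b' x)) = A 0.
 apply/funext => x; congr (F _ * _); apply: cext; rewrite ?ReZ ?ImZ//= /Zx ?reim/=; ring.
have -> : (fun x=> F (x +i* e x) * (1 +i* e' x)) = A 1.
 apply/funext => x; congr (F _ * _); apply: cext; rewrite ?ReZ ?ImZ//= /Zx ?reim/=; ring.
apply: (@contour_inv R 0 1 A B D).
- exact: ltr01.
- by move=> t x; exact: cA.
- by move=> t; apply: ccat_sec2 => p; exact: cA.
move=> t /andP[t0 t1].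
have inS x : instrip b e (Z t x).
 rewrite /instrip ReZ ImZ; have := be x; rewrite -subr_gt0 => d0.
 have : 0 < t * (e x - b x) by rewrite mulr_gt0.
 have : 0 < (1 - t) * (e x - b x) by rewrite mulr_gt0// subr_gt0.
 by move=> *; apply/andP; split; lra.
have cD (x: R) : ccat (unc D) (t, x).
 apply: ccatD.
 apply: ccatM; last exact: cZx.
 apply: ccatM; last exact: (ccat_comp2 _ cZt).
 by apply: ccat_comp; [exact: cZ|apply: cF1; exact: inS].
 by apply: ccatM; [apply: ccat_comp; [exact: cZ|exact: cF]|exact: (ccat_comp2 _ cZtx)].
split.
- move=> x.
 have dZ: cder (Z^~ x) t (Zt x).
 have := cderD (cderC x%:C t) (cderZ 'i (cderD (cderC (bC x) t)
 (cderM (cderR (is_dI t)) (cderC (eC x - bC x) t)))).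
 by apply: cder_eq; rewrite /Zt; ring.
 have dZx: cder (Zx^~ x) t (Ztx x).
 have := cderD (cderC 1 t) (cderZ 'i (cderD (cderC (b'C x) t)
 (cderM (cderR (is_dI t)) (cderC (e'C x - b'C x) t)))).
 by apply: cder_eq; rewrite /Ztx; ring.
 exact: cderM (hF _ _ _ dZ (inS x)) dZx.
- by move=> x; exact: cD.
- move=> x.
 have dbC := cderR (db x); have deC := cderR (de x).
 have dZ: cder (Z t) x (Zx t x).
 have := cderD (cderR (is_dI x)) (cderZ 'i (cderD dbC
 (cderZ t%:C (cderB deC dbC)))).
 by apply: cder_eq.
 have dZt: cder Zt x (Ztx x) := cderZ 'i (cderB deC dbC).
 have := cderM (hF _ _ _ dZ (inS x)) dZt.
 by apply: cder_eq; rewrite /D; ring.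
- apply: ccontP => x; have := cD x => /ccat_eps h; apply/ccat_eps => e1 e10.
 have [[P Q] /= [hP hQ] hPQ] := h e1 e10.
 apply: filterS hQ => y Qy; apply: (hPQ (t, y)); split=> //=.
 exact: nbhs_singleton hP.
move=> x; rewrite /B /Zt /eC /bC pb pe.
have -> : Z t (x + tau) = Z t x + tau%:C by rewrite /Z /bC /eC pb pe rmorphD/=; ring.
by rewrite pF.
Qed.

Section Kernel.
Variables (g g' : R -> R) (z : R[i]).
Hypothesis (dg : forall x : R, is_derive x 1 g (g' x)) (cg' : continuous g').
Hypothesis (pg : periodic g tau).

(** Periodic Cauchy kernel on the graph moved by [sg * t ^+ 2]. The square keeps the moved graph on
    its side of [z] for every real [t], so no singularity is met. *)
Let K (sg t x: R) : R[i] := (1 - cE (x +i* (g x + sg * t ^+ 2) - z))^-1 * (1 +i* g' x).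

Lemma kernel_nonsing (sg: R) : 0 < sg * (g (cRe z) - cIm z) ->
 `|sg| = 1 -> forall t x : R, 1 - cE (x +i* (g x + sg * t ^+ 2) - z) != 0.
move=> sg0 sg1 t x; apply/eqP => /eqP; rewrite subr_eq0 eq_sym => /eqP/cE_eq1[k hk].
have := congr1 (@cIm _) hk; have := congr1 (@cRe _) hk.
rewrite !reim/= => h1 h2.
have hx: x = cRe z + k%:~R * tau by rewrite -h1; ring.
have hg: g x = g (cRe z) by rewrite hx (periodic_int pg).
have E: sg * sg = 1 by rewrite -expr2 -(real_normK (num_real sg)) sg1 expr1n.
have : sg * (g (cRe z) - cIm z) + (sg * sg) * t ^+ 2 = 0.
 by rewrite -hg -mulrA -mulrDr addrAC h2 mulr0.
by rewrite E mul1r => H; have := sqr_ge0 t; lra.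
Qed.

Lemma kernel_shift (sg: R) : 0 < sg * (g (cRe z) - cIm z) -> `|sg| = 1 ->
 forall T : R, 0 < T -> citor (K sg 0) = citor (K sg T).
move=> sg0 sg1 T T0; have ns := kernel_nonsing sg0 sg1.
have cg := der_cont dg.
have cid: ccont (fun x : R => x%:C : R[i]) by apply: ccontR; exact: contI.
pose Z (t x: R) : R[i] := (x%:C + 'i * (g x)%:C) + ('i * sg%:C) * (t%:C * t%:C) - z.
have ZE t x : x +i* (g x + sg * t ^+ 2) - z = Z t x.
 by apply: cext; rewrite /Z !reim/= ?expr2; ring.
pose Zx (x: R) : R[i] := 1 + 'i * (g' x)%:C.
pose Zt (t: R) : R[i] := ('i * sg%:C) * (1 * t%:C + t%:C * 1).
pose k w := (1 - cE w)^-1.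
have KE t x : K sg t x = k (Z t x) * Zx x.
 by rewrite /K ZE; congr (_ * _); apply: cext; rewrite /Zx !reim/=; ring.
have ns' t x : 1 - cE (Z t x) != 0 by rewrite -ZE.
pose D t x := ('i * cE (Z t x) * (k (Z t x) * k (Z t x)) * Zt t) * Zx x.
have cZ (p : R * R) : ccat (unc Z) p.
 apply: ccatB; last exact: ccatC.
 apply: ccatD.
 apply: (@ccat_comp2 R R p (fun x=> x%:C + 'i * (g x)%:C)); apply: ccontD=> //.
 by apply: ccontM; [exact: ccontC|exact: ccontR].
 apply: ccatM; first exact: ccatC.
 by apply: ccatM; exact: ccat_fst.
have cZx: ccont Zx.
 by apply: ccontD; [exact: ccontC|apply: ccontM; [exact: ccontC|exact: ccontR]].
have cEZ (p : R * R) : ccat (fun p : R * R => cE (Z p.1 p.2)) p.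
 by apply: ccat_comp; [exact: cZ|apply: cdiff_cat; exact: cdiff_cE].
have ck (p : R * R) : ccat (fun p : R * R => k (Z p.1 p.2)) p.
 by apply: ccatV; [exact: ns'|apply: ccatB; [exact: ccatC|exact: cEZ]].
have cA (p : R * R) : ccat (fun p : R * R => K sg p.1 p.2) p.
 have -> : (fun p : R * R => K sg p.1 p.2) = (fun p : R * R => k (Z p.1 p.2) * Zx p.2).
 by apply/funext => -[t x]; rewrite KE.
 by apply: ccatM; [exact: ck|exact: (ccat_comp2 p cZx)].
have cD (p : R * R) : ccat (unc D) p.
 apply: ccatM; last exact: (ccat_comp2 p cZx).
 apply: ccatM.
 apply: ccatM; first by apply: ccatM; [exact: ccatC|exact: cEZ].
 by apply: ccatM; exact: ck.
 apply: ccatM; first exact: ccatC.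
 by apply: ccatD; apply: ccatM; by [exact: ccatC|exact: ccat_fst].
have dk (u : R -> R[i]) (s: R) d : cder u s d -> 1 - cE (u s) != 0 ->
 cder (fun s=> k (u s)) s ('i * cE (u s) * (k (u s) * k (u s)) * d).
 move=> du nz; have dE := cder_chain du (cdiff_cE (u s)).
 have := cder_inv nz (cderB (cderC 1 s) dE).
 by apply: cder_eq; rewrite /k; field.
apply: (@contour_inv R 0 T (K sg) (fun t x => k (Z t x) * Zt t) D T0).
- by move=> t x; exact: cA.
- by move=> t; apply: ccat_sec2 => p; exact: cA.
move=> t _; split.
- move=> x; have dZ: cder (Z^~ x) t (Zt t).
 have := cderB (cderD (cderC (x%:C + 'i * (g x)%:C) t) (cderZ ('i * sg%:C)
 (cderM (cderR (is_dI t)) (cderR (is_dI t))))) (cderC z t).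
 by apply: cder_eq; rewrite /Zt; ring.
 have -> : (K sg)^~ x = (fun t=> k (Z t x) * Zx x) by apply/funext => s; rewrite KE.
 have := cderM (dk _ _ _ dZ (ns' t x)) (cderC (Zx x) t).
 by apply: cder_eq; rewrite /D; ring.
- by move=> x; exact: cD.
- move=> x; have dZ: cder (Z t) x (Zx x).
 have := cderB (cderD (cderD (cderR (is_dI x)) (cderZ 'i (cderR (dg x))))
 (cderC (('i * sg%:C) * (t%:C * t%:C)) x)) (cderC z x).
 by apply: cder_eq; rewrite /Zx; ring.
 have := cderM (dk _ _ _ dZ (ns' t x)) (cderC (Zt t) x).
 by apply: cder_eq; rewrite /D; ring.
- by apply: ccat_sec2 => p; exact: cD.
move=> x; congr (_ * _); rewrite /k.
have -> : Z t (x + tau) = Z t x + (1%:~R * tau)%:C.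
 by rewrite /Z pg mul1r rmorphD/=; ring.
by rewrite cE_per.
Qed.

Lemma kernel_lim (sg c: R) : 0 < sg * (g (cRe z) - cIm z) -> `|sg| = 1 ->
 (forall e : R, 0 < e -> exists2 T : R, 0 < T & forall x, 0 <= x <= tau ->
 nc (K sg T x - c%:C * (1 +i* g' x)) <= e) ->
 citor (K sg 0) = (tau * c)%:C.
move=> sg0 sg1 H.
have cg := der_cont dg.
have cone: ccont (fun x=> 1 +i* g' x).
 by split => /=; [exact: cst_continuous|exact: cg'].
have cK T : ccont (K sg T).
 apply: ccontM=> //; apply: ccontV; first by move=> x; exact: kernel_nonsing.
 apply: ccontB; first exact: ccontC.
 apply: ccontP => x; apply: (@ccat_comp _ _ (fun x=> x +i* (g x + sg * T ^+ 2) - z)).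
 apply: ccatB; last exact: ccatC.
 split => /=; first exact: contI.
 by apply: contD=> //; exact: contC.
 by apply: cdiff_cat; exact: cdiff_cE.
have i1: citor (fun x=> c%:C * (1 +i* g' x)) = (tau * c)%:C.
 rewrite citorZ//.
 rewrite (@citor_FTC _ (fun x=> x%:C + 'i * (g x)%:C)) => [|//|x]; last first.
 have := cderD (cderR (is_dI x)) (cderZ 'i (cderR (dg x))).
 by apply: cder_eq; apply: cext; rewrite !reim/=; ring.
 rewrite -{2}[tau]add0r pg.
 by apply: cext; rewrite !reim/=; ring.
apply/eqP; rewrite -subr_eq0; apply/eqP/nc_small => e e0.
have [T T0 hT] := H (e / tau) ltac:(by rewrite divr_gt0).
rewrite (kernel_shift sg0 sg1 T0) -i1 -citorB//; last first.
 by apply: ccontM=> //; exact: ccontC.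
have -> : e = tau * (e / tau) by rewrite mulrC divfK// gt_eqF.
apply: nc_citor_bdd=> //; apply: ccontB=> //.
by apply: ccontM=> //; exact: ccontC.
Qed.

(** The graph is pushed upwards, away from [z]: [cE] tends to 0 and the kernel to 1, uniformly over
    a period. *)
Lemma kernel_top : cIm z < g (cRe z) ->
 citor (fun x=> (1 - cE (x +i* g x - z))^-1 * (1 +i* g' x)) = tau%:C.
move=> hz; have cg := der_cont dg.
have [M hM] := cont_bddP cg; have [M' hM'] := cont_bddP cg'.
have M0: 0 <= M by apply: le_trans (hM 0 _); rewrite ?normr_ge0// lexx ltW.
have M'0: 0 <= M' by apply: le_trans (hM' 0 _); rewrite ?normr_ge0// lexx ltW.
rewrite -[tau]mulr1 -(@kernel_lim 1 1) ?normr1 ?mul1r ?subr_gt0//.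
 by congr citor; apply/funext => x; rewrite /K expr0n/= mulr0 addr0.
move=> e e0.
(* Chosen so that [2 * (1 + M') / (1 + N) <= e]; the factor 2 bounds the inverse of [1 - E]. *)
pose N := 2 * (1 + M') / e + 1.
have N1: 1 <= N by rewrite lerDr divr_ge0 ?(ltW e0)// mulr_ge0// addr_ge0.
exists (1 + M + `|cIm z| + N).
 by rewrite ltr_wpDl ?addr_ge0// (lt_le_trans ltr01).
set T := 1 + M + _ + _; move=> x hx.
have T1: 1 <= T.
 rewrite /T; have := normr_ge0 (cIm z); lra.
have nE: nc (cE (x +i* (g x + 1 * T ^+ 2) - z)) <= (1 + N)^-1.
 rewrite nc_cE ImD ImN/= mul1r expRN lef_pV2 ?posrE ?expR_gt0//; last by lra.
 apply: le_trans (expR_ge1Dx _); rewrite lerD2l.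
 have : T <= T ^+ 2 by rewrite expr2 ler_peMl// (le_trans ler01).
 have := hM x hx; rewrite ler_norml => /andP[k1 _]; have := ler_norm (cIm z).
 rewrite /T; lra.
rewrite /K; set E := cE _ in nE *.
have nE2: nc E <= 2^-1.
 apply: (le_trans nE); rewrite lef_pV2 ?posrE//; lra.
have n1E: 2^-1 <= nc (1 - E).
 by have := ncD (1 - E) E; rewrite subrK nc1; lra.
have E1: 1 - E != 0 by rewrite -nc_eq0 gt_eqF// (lt_le_trans _ n1E)// invr_gt0.
have -> : (1 - E)^-1 * (1 +i* g' x) - 1%:C * (1 +i* g' x) = E * (1 - E)^-1 * (1 +i* g' x) by field.
rewrite !ncM ncV.
have b1: nc (1 +i* g' x) <= 1 + M'.
 by apply: (le_trans (nc_le_ReIm _)) => /=; rewrite normr1 lerD2l hM'.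
have b2: (nc (1 - E))^-1 <= 2.
 by rewrite -[2]invrK lef_pV2 ?posrE ?invr_gt0// (lt_le_trans _ n1E)// invr_gt0.
apply: (le_via ((1 + N)^-1 * 2 * (1 + M'))).
 by apply: ler_pM; rewrite ?mulr_ge0 ?invr_ge0//; apply: ler_pM; rewrite ?invr_ge0 ?nc_ge0.
rewrite -mulrA ler_pdivrMl; last by lra.
have : e * N = 2 * (1 + M') + e by rewrite /N; field; rewrite gt_eqF.
lra.
Qed.

(** Now the graph is pushed downwards, [cE] blows up and the kernel tends to 0. *)
Lemma kernel_bottom : g (cRe z) < cIm z ->
 citor (fun x=> (1 - cE (x +i* g x - z))^-1 * (1 +i* g' x)) = 0.
move=> hz; have cg := der_cont dg.
have [M hM] := cont_bddP cg; have [M' hM'] := cont_bddP cg'.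
have M0: 0 <= M by apply: le_trans (hM 0 _); rewrite ?normr_ge0// lexx ltW.
have M'0: 0 <= M' by apply: le_trans (hM' 0 _); rewrite ?normr_ge0// lexx ltW.
have -> : 0 = (tau * 0)%:C :> R[i] by rewrite mulr0.
rewrite -(@kernel_lim (- 1) 0) ?normrN ?normr1 ?mulN1r ?oppr_gt0 ?subr_lt0//.
 by congr citor; apply/funext => x; rewrite /K expr0n/= mulr0 addr0.
move=> e e0.
pose N := (1 + M') / e + 1.
have N1: 1 <= N by rewrite lerDr divr_ge0 ?(ltW e0)// addr_ge0.
exists (1 + M + `|cIm z| + N).
 by rewrite ltr_wpDl ?addr_ge0// (lt_le_trans ltr01).
set T := 1 + M + _ + _; move=> x hx.
have T1: 1 <= T.
 rewrite /T; have := normr_ge0 (cIm z); lra.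
have nE: 1 + N <= nc (cE (x +i* (g x + -1 * T ^+ 2) - z)).
 rewrite nc_cE ImD ImN/=; apply: le_trans (expR_ge1Dx _); rewrite lerD2l mulN1r.
 have : T <= T ^+ 2 by rewrite expr2 ler_peMl// (le_trans ler01).
 have := hM x hx; rewrite ler_norml => /andP[_ k1].
 have := ler_norm (- cIm z); rewrite normrN.
 rewrite /T; lra.
rewrite /K mul0r subr0; set E := cE _ in nE *.
have n1E: N <= nc (1 - E).
 by have := ncD (E - 1) 1; rewrite subrK nc1 (nc_distC E); lra.
rewrite ncM ncV.
have b1: nc (1 +i* g' x) <= 1 + M'.
 by apply: (le_trans (nc_le_ReIm _)) => /=; rewrite normr1 lerD2l hM'.
apply: (le_via (N^-1 * (1 + M'))).
 apply: ler_pM; rewrite ?invr_ge0// lef_pV2 ?posrE ?(lt_le_trans ltr01)//.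
 exact: le_trans N1 n1E.
rewrite ler_pdivrMl; last by lra.
have : e * N = (1 + M') + e by rewrite /N; field; rewrite gt_eqF.
lra.
Qed.

End Kernel.

Section Pointwise.
Variables (b e b' e' : R -> R) (f f1 : R[i] -> R[i]).
Hypothesis (hf : hstrip b e f f1).
Hypothesis (db : forall x : R, is_derive x 1 b (b' x)) (de : forall x : R, is_derive x 1 e (e' x)).
Hypothesis (cb' : continuous b') (ce' : continuous e').
Hypothesis (pb : periodic b tau) (pe : periodic e tau).
Hypothesis (be : forall x, b x < e x).

Lemma contour_sq :
 citor (fun x=> f (x +i* b x) ^+ 2 * (1 +i* b' x)) =
 citor (fun x=> f (x +i* e x) ^+ 2 * (1 +i* e' x)).
apply: (@contour_graph b e b' e' (fun z=> f z ^+ 2) (fun z=> 2 * f z * f1 z))=> //.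
- by move=> z; apply: catM; exact: hs_cat hf z.
- by move=> z; rewrite (hs_per hf).
- move=> z hz; apply: catM; last exact: hs_cat1 hf z hz.
 by apply: catM; [exact: catC|exact: hs_cat hf z].
move=> Z s d dZ hZ; have h := cder_chain dZ (hs_diff hf hZ).
have := cderM h h; apply: cder_eq; ring.
Qed.

(** [(1 + a^2) Re (w^2 (1 + i a)) = T^2 - N^2 - 2 a T N]: tangential and normal parts have opposite
    signs, and completing a square removes the cross term in favour of either of them. *)
Lemma rellich_pt (w : R[i]) (a T N L: R) : `|a| <= L -> w * (1 +i* a) = T +i* - N ->
 [/\ N ^+ 2 / (2 * (1 + L ^+ 2)) - 2 * T ^+ 2 <= - cRe (w ^+ 2 * (1 +i* a)),
 T ^+ 2 / (2 * (1 + L ^+ 2)) - 2 * N ^+ 2 <= cRe (w ^+ 2 * (1 +i* a)) &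
 nc w ^+ 2 <= T ^+ 2 + N ^+ 2].
move=> aL; case: w => u v h.
have := congr1 (@cRe _) h; have := congr1 (@cIm _) h.
move=> hN hT; rewrite /= in hN hT.
have ET: T = u - v * a by rewrite -hT; ring.
have EN: N = - (u * a + v) by rewrite -[N]opprK -hN; ring.
have a2: 0 <= a ^+ 2 by exact: sqr_ge0.
have L2: a ^+ 2 <= L ^+ 2.
 by rewrite -(real_normK (num_real a)) lerXn2r// nnegrE// (le_trans _ aL).
have p1: 0 < 1 + a ^+ 2 by lra.
have pL: 0 < 1 + L ^+ 2 by lra.
set r := cRe _.
have Er: r * (1 + a ^+ 2) = T ^+ 2 - N ^+ 2 - 2 * T * N * a.
 by rewrite /r ET EN expr2 !ReM !ImM/=; ring.
have key (X Y q: R) : X ^+ 2 / 2 - (1 + 2 * a ^+ 2) * Y ^+ 2 <= q * (1 + a ^+ 2) ->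
 X ^+ 2 / (2 * (1 + L ^+ 2)) - 2 * Y ^+ 2 <= q.
 move=> hq; rewrite -(ler_pM2r p1); apply: le_trans hq; rewrite mulrBl; apply: lerB.
 have -> : X ^+ 2 / (2 * (1 + L ^+ 2)) * (1 + a ^+ 2) = X ^+ 2 / 2 * ((1 + a ^+ 2) / (1 + L ^+ 2)).
 by field; rewrite gt_eqF.
 by rewrite ler_piMr ?divr_ge0// ler_pdivrMr// mul1r lerD2l.
 have : 0 <= Y ^+ 2 by exact: sqr_ge0.
 have -> : 2 * Y ^+ 2 * (1 + a ^+ 2) = (2 + 2 * a ^+ 2) * Y ^+ 2 by ring.
 by move=> Y0; rewrite ler_wpM2r//; lra.
split.
- apply: key; rewrite mulNr Er -subr_ge0.
 have -> : - (T ^+ 2 - N ^+ 2 - 2 * T * N * a) - (N ^+ 2 / 2 - (1 + 2 * a ^+ 2) * T ^+ 2) =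
 (N + 2 * a * T) ^+ 2 / 2 by field.
 by rewrite divr_ge0.
- apply: key; rewrite Er -subr_ge0.
 have -> : T ^+ 2 - N ^+ 2 - 2 * T * N * a - (T ^+ 2 / 2 - (1 + 2 * a ^+ 2) * N ^+ 2) =
 (T - 2 * a * N) ^+ 2 / 2 by field.
 by rewrite divr_ge0.
rewrite nc_sqr/=; have -> : T ^+ 2 + N ^+ 2 = (u ^+ 2 + v ^+ 2) * (1 + a ^+ 2) by rewrite ET EN; ring.
by rewrite ler_peMr ?addr_ge0//; lra.
Qed.

(** By [contour_sq] the real part of the integral of [f^2 dz] is the same on both boundaries. On the
    top it bounds [N] by [T], on the bottom [t] by [n], with signs that let the two inequalities add
    up. With [P = 2 (1 + L^2)] the constant is [1 + 2 P]. *)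
Lemma rellich (L: R) (T N t n : R -> R) : continuous T -> continuous N -> continuous t -> continuous n ->
 (forall x, `|e' x| <= L) -> (forall x, `|b' x| <= L) ->
 (forall x, f (x +i* e x) * (1 +i* e' x) = T x +i* - N x) ->
 (forall x, f (x +i* b x) * (1 +i* b' x) = t x +i* - n x) ->
 itor (fun x=> nc (f (x +i* b x)) ^+ 2) + itor (fun x=> nc (f (x +i* e x)) ^+ 2) <=
 (5 + 4 * L ^+ 2) * (itor (fun x=> T x ^+ 2) + itor (fun x=> n x ^+ 2)).
move=> cT cN ct cn eL bL he hb.
have cb := der_cont db.
have ce := der_cont de.
have curve (g g' : R -> R) : continuous g -> continuous g' ->
 ccont (fun x=> f (x +i* g x)) /\ ccont (fun x=> f (x +i* g x) ^+ 2 * (1 +i* g' x)).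
 move=> cg cg'; have c1: ccont (fun x=> f (x +i* g x)).
 apply: ccontP => x; apply: (@ccat_comp _ _ (fun x : R => x +i* g x)).
 by split => /=; [exact: contI|exact: cg].
 exact: hs_cat hf _.
 split=> //; apply: ccontM; first exact: ccontM.
 by split => /=; [exact: cst_continuous|exact: cg'].
have [c1 [c2 _]] := curve e e' ce ce'; have [c3 [c4 _]] := curve b b' cb cb'.
have He x := rellich_pt (eL x) (he x); have Hb x := rellich_pt (bL x) (hb x).
have := congr1 (@cRe _) contour_sq; rewrite !Re_citor => Hc.
set P := 2 * (1 + L ^+ 2) in He Hb.
have P0: 0 < P by rewrite mulr_gt0//; have := sqr_ge0 L; lra.
have sq (u : R -> R) : continuous u -> continuous (fun x=> u x ^+ 2) by move=> cu; exact: contX.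
have lin (u v : R -> R) : continuous u -> continuous v ->
 continuous (fun x=> P^-1 * u x ^+ 2 - 2 * v x ^+ 2) /\
 itor (fun x=> P^-1 * u x ^+ 2 - 2 * v x ^+ 2) = P^-1 * itor (fun x=> u x ^+ 2) - 2 * itor (fun x=> v x ^+ 2).
 move=> cu cv'.
 have k1: continuous (fun x=> P^-1 * u x ^+ 2) by apply: contM; [exact: contC|exact: sq].
 have k2: continuous (fun x=> 2 * v x ^+ 2) by apply: contM; [exact: contC|exact: sq].
 split; first exact: contB.
 by rewrite itorB// !itorZ//; exact: sq.
have [l1 E1] := lin N T cN cT; have [l2 E2] := lin t n ct cn.
have i1: P^-1 * itor (fun x=> N x ^+ 2) - 2 * itor (fun x=> T x ^+ 2) <=
 - itor (fun x=> cRe (f (x +i* e x) ^+ 2 * (1 +i* e' x))).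
 rewrite -E1 -itorN//; apply: le_itor=> //; first exact: contN.
 by move=> x _; have [k1 _ _] := He x; rewrite mulrC.
have i2: P^-1 * itor (fun x=> t x ^+ 2) - 2 * itor (fun x=> n x ^+ 2) <=
 itor (fun x=> cRe (f (x +i* b x) ^+ 2 * (1 +i* b' x))).
 rewrite -E2; apply: le_itor=> //.
 by move=> x _; have [_ k1 _] := Hb x; rewrite mulrC.
have cn1 := contnc c1; have cn3 := contnc c3.
have i3: itor (fun x=> nc (f (x +i* e x)) ^+ 2) <= itor (fun x=> T x ^+ 2) + itor (fun x=> N x ^+ 2).
 rewrite -itorD; [|exact: sq|exact: sq]; apply: le_itor; first exact: sq.
 by apply: contD; exact: sq.
 by move=> x _; have [_ _ k1] := He x.
have i4: itor (fun x=> nc (f (x +i* b x)) ^+ 2) <= itor (fun x=> t x ^+ 2) + itor (fun x=> n x ^+ 2).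
 rewrite -itorD; [|exact: sq|exact: sq]; apply: le_itor; first exact: sq.
 by apply: contD; exact: sq.
 by move=> x _; have [_ _ k1] := Hb x.
rewrite Hc in i2.
have : P^-1 * (itor (fun x=> N x ^+ 2) + itor (fun x=> t x ^+ 2)) <=
 2 * (itor (fun x=> T x ^+ 2) + itor (fun x=> n x ^+ 2)) by lra.
rewrite ler_pdivrMl// /P => i5; lra.
Qed.

Variable z0 : R[i].
Hypothesis hz0 : instrip b e z0.

(* The singularity of the kernel at [z0] is removed by subtracting [f z0]; a
 second factor [f - f z0] makes the product continuously differentiable. *)
Let Q z : R[i] := if cE (z - z0) == 1 then 'i * f1 z else (f z - f z0) / (1 - cE (z - z0)).
Let F2 z : R[i] := (f z - f z0) * Q z.
Let F21 z : R[i] := 2 * f1 z * Q z + 'i * cE (z - z0) * (Q z * Q z).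

(** The zeros of [1 - cE (z - z0)] are the translates of [z0], where the numerator of [Q] vanishes
    by periodicity; so every singularity of [Q] is removable. *)
Lemma translate z : cE (z - z0) = 1 -> instrip b e z /\ f z = f z0.
move=> /cE_eq1[k hk]; have -> : z = z0 + (k%:~R * tau)%:C by rewrite -hk; ring.
split; first by rewrite /instrip ReD ImD/= addr0 (periodic_int pb) (periodic_int pe).
have := @periodic_int _ _ (fun t : R => f (z0 + t%:C)) _ k 0.
rewrite add0r addr0; apply => t.
by rewrite rmorphD/= addrA (hs_per hf).
Qed.

Lemma cat_cEB (w : R[i]) : cat (fun z=> cE (z - z0)) w.
move=> ep ep0; have [d d0 hd] := cdiff_cat (cdiff_cE (w - z0)) ep0.
exists d=> // v hv; apply: hd.
by have -> : v - z0 - (w - z0) = v - w by ring.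
Qed.

Lemma cE_near z : cE (z - z0) != 1 -> exists2 r : R, 0 < r &
 forall w, nc (w - z) < r -> cE (w - z0) != 1.
move=> h; have n0: 0 < nc (cE (z - z0) - 1) by apply: nc_gt0; rewrite subr_eq0.
have [r r0 hr] := cat_cEB z n0; exists r=> // w /hr; apply: contraTneq => ->.
by rewrite nc_distC ltxx.
Qed.

Lemma cat_Q z : cat Q z.
have [E|E] := eqVneq (cE (z - z0)) 1; last first.
 have [r r0 hr] := cE_near E.
 apply: (@cat_near (fun z=> (f z - f z0) / (1 - cE (z - z0))) Q z r r0).
 by move=> w /hr/negPf h; rewrite /Q h.
 apply: catM; first by apply: catB; [exact: hs_cat hf z|exact: catC].
 apply: catV; first by rewrite subr_eq0 eq_sym.
 by apply: catB; [exact: catC|exact: cat_cEB].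
have [hz fz] := translate E; have hd := hs_diff hf hz.
have hE := cdiff_cE (z - z0); rewrite E mulr1 in hE.
move=> ep ep0; set N := nc (f1 z); have N0: 0 <= N by exact: nc_ge0.
(* The bound 1/2 keeps [1 - E1] at least half as large as [d]; the other bound leaves a total error
   of at most [ep / 2]. *)
pose e1 := minr (1 / 2) (ep / (4 * (1 + N))).
have N1: 0 < 1 + N by lra.
have e10: 0 < e1 by rewrite lt_min divr_gt0//= divr_gt0// mulr_gt0.
have [e11 e1N] : e1 <= 1 / 2 /\ e1 * (4 * (1 + N)) <= ep.
 split; first by rewrite ge_min lexx.
 by rewrite -ler_pdivlMr ?mulr_gt0// ge_min lexx orbT.
have [r1 r10 h1] := hs_cat1 hf hz ep0.
have [r2 r20 h2] := hd _ e10; have [r3 r30 h3] := hE _ e10.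
exists (minr r1 (minr r2 r3)); first by rewrite !lt_min r10 r20.
move=> w; rewrite !lt_min => /and3P[/h1 k1 /h2 k2 wr3].
have := h3 (w - z0); have -> : w - z0 - (z - z0) = w - z by ring.
move=> /(_ wr3); rewrite E => k3.
rewrite [Q z]/Q E eqxx /Q; case: ifPn => Ew; first by rewrite -mulrBr ncM nc_i mul1r.
set d := w - z in k2 k3 *; set E1 := cE (w - z0) in Ew k3 *.
have nd := nc_ge0 d.
have E10: 1 - E1 != 0 by rewrite subr_eq0 eq_sym.
have n1E: nc d / 2 <= nc (1 - E1).
 have : nc d <= nc (1 - E1) + e1 * nc d.
 have {1}-> : nc d = nc ((E1 - 1) - (E1 - 1 - 'i * d)).
 have -> : (E1 - 1) - (E1 - 1 - 'i * d) = 'i * d by ring.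
 by rewrite ncM nc_i mul1r.
 by apply: (le_trans (ncB _ _)); rewrite (nc_distC E1) lerD2l.
 have : e1 * nc d <= 1 / 2 * nc d by rewrite ler_wpM2r.
 lra.
have -> : (f w - f z0) / (1 - E1) - 'i * f1 z =
 ((f w - f z - f1 z * d) + 'i * f1 z * (E1 - 1 - 'i * d)) / (1 - E1).
 have ii := @mulii R.
 have -> : 'i * f1 z * (E1 - 1 - 'i * d) = 'i * f1 z * (E1 - 1) - ('i * 'i) * f1 z * d by ring.
 rewrite ii fz; field; exact: E10.
have n1E0 := nc_gt0 E10.
rewrite ncM ncV ltr_pdivrMr//.
have b1: nc ((f w - f z - f1 z * d) + 'i * f1 z * (E1 - 1 - 'i * d)) <= e1 * (1 + N) * nc d.
 apply: (le_trans (ncD _ _)); rewrite !ncM nc_i mul1r -/N.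
 have : N * nc (E1 - 1 - 'i * d) <= N * (e1 * nc d) by rewrite ler_wpM2l.
 lra.
apply: (le_lt_trans b1).
have : ep / 4 * nc d <= ep / 4 * (2 * nc (1 - E1)) by rewrite ler_wpM2l ?divr_ge0 ?(ltW ep0)//; lra.
have : e1 * (1 + N) * nc d <= ep / 4 * nc d by rewrite ler_wpM2r//; lra.
have : 0 < ep * nc (1 - E1) by rewrite mulr_gt0.
lra.
Qed.

Lemma contour_F2 : citor (fun x=> F2 (x +i* b x) * (1 +i* b' x)) =
 citor (fun x=> F2 (x +i* e x) * (1 +i* e' x)).
apply: (@contour_graph b e b' e' F2 F21)=> //.
- move=> z; apply: catM; last exact: cat_Q.
 by apply: catB; [exact: hs_cat hf z|exact: catC].
- move=> z; have E: cE (z + tau%:C - z0) = cE (z - z0).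
 rewrite -(cE_per (z - z0) 1) mul1r; congr cE; ring.
 rewrite /F2 /Q E (hs_per hf); case: ifP=> // /eqP/translate[_ ->].
 by rewrite subrr !mul0r.
- move=> z hz; apply: catD.
 apply: catM; last exact: cat_Q.
 by apply: catM; [exact: catC|exact: hs_cat1 hf z hz].
 apply: catM; first by apply: catM; [exact: catC|exact: cat_cEB].
 by apply: catM; exact: cat_Q.
move=> Y s d dY hY; have dfY := cder_chain dY (hs_diff hf hY).
have dfB := cderB dfY (cderC (f z0) s); rewrite subr0 in dfB.
have cY: ccat Y s by have [k1 k2] := cder_cont dY; split.
(* On a translate of [z0] the factor [Q] is only known to be continuous and [cder_vanish] applies;
   elsewhere the quotient rule does. *)
have [E|E] := eqVneq (cE (Y s - z0)) 1.
 have [_ fz] := translate E.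
 have := cder_vanish dfB; rewrite fz subrr => /(_ (fun t=> Q (Y t)) erefl).
 move=> /(_ (ccat_comp cY (cat_Q (Y s)))); apply: cder_eq.
 rewrite /F21 /Q E eqxx.
 have ii := @mulii R.
 have -> : (2 * f1 (Y s) * ('i * f1 (Y s)) + 'i * 1 * ('i * f1 (Y s) * ('i * f1 (Y s)))) * d =
 'i * f1 (Y s) * f1 (Y s) * d * (2 + 'i * 'i) by ring.
 rewrite ii; ring.
have [r r0 hr] := cE_near E.
have [rr rr0 hrr] : exists2 rr : R, 0 < rr & forall t, `|t - s| < rr -> nc (Y t - Y s) < r.
 have [rr /= rr0 hrr] := (ccat_eps _ _).1 cY r r0.
 by exists rr=> // t ht; apply: hrr; rewrite /ball_/= distrC.
apply: (@cder_near (fun t=> (f (Y t) - f z0) * ((f (Y t) - f z0) / (1 - cE (Y t - z0)))) _ s rr _ rr0).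
 by move=> t /hrr/hr/negPf h; rewrite /F2 /Q h.
have E1: 1 - cE (Y s - z0) != 0 by rewrite subr_eq0 eq_sym.
have dY0: cder (fun t=> Y t - z0) s d.
 by have := cderB dY (cderC z0 s); rewrite subr0.
have dE := cder_inv E1 (cderB (cderC 1 s) (cder_chain dY0 (cdiff_cE (Y s - z0)))).
have := cderM dfB (cderM dfB dE); apply: cder_eq.
rewrite /F21 /Q (negPf E); field; exact: E1.
Qed.

Variables (S k: R).
Hypothesis (S0 : 0 < S) (k1 : 1 <= k).
Hypothesis hS : itor (fun x=> nc (f (x +i* b x)) ^+ 2) + itor (fun x=> nc (f (x +i* e x)) ^+ 2) <= S ^+ 2.
Hypothesis hkb : forall x, nc ((1 - cE (x +i* b x - z0))^-1 * (1 +i* b' x)) <= k.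
Hypothesis hke : forall x, nc ((1 - cE (x +i* e x - z0))^-1 * (1 +i* e' x)) <= k.

Lemma ccont_curve (g : R -> R) : continuous g -> ccont (fun x=> f (x +i* g x)).
move=> cg; apply: ccontP => x; apply: (@ccat_comp _ _ (fun x : R => x +i* g x)).
 by split => /=; [exact: contI|exact: cg].
exact: hs_cat hf _.
Qed.

(** Expansion of the square in [F2] along a boundary curve. The linear term is bounded through
    [2 |f| <= |f|^2 / S + S], so only the L2 norm of the trace is used. *)
Lemma point_expand (g g' : R -> R) (c: R) : continuous g -> continuous g' ->
 (forall x, 1 - cE (x +i* g x - z0) != 0) ->
 (forall x, nc ((1 - cE (x +i* g x - z0))^-1 * (1 +i* g' x)) <= k) ->
 citor (fun x=> (1 - cE (x +i* g x - z0))^-1 * (1 +i* g' x)) = c%:C ->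
 let I := itor (fun x=> nc (f (x +i* g x)) ^+ 2) in
 exists I1 I2 : R[i], [/\ citor (fun x=> F2 (x +i* g x) * (1 +i* g' x)) = I2 - 2 * f z0 * I1 + c%:C * f z0 ^+ 2,
 nc I2 <= k * I & nc I1 <= k * ((I / S + tau * S) / 2)].
move=> cg cg' ns hk hc I; pose u x := (1 - cE (x +i* g x - z0))^-1 * (1 +i* g' x).
pose F x := f (x +i* g x).
have cF: ccont F by exact: ccont_curve.
have cu: ccont u.
 apply: ccontM; last by split => /=; [exact: cst_continuous|exact: cg'].
 apply: ccontV=> //; apply: ccontB; first exact: ccontC.
 apply: ccontP => x; apply: (@ccat_comp _ _ (fun x : R => x +i* g x) (fun z=> cE (z - z0))).
 by split => /=; [exact: contI|exact: cg].
 exact: cat_cEB.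
have cFu: ccont (fun x=> F x * u x) by exact: ccontM.
have cFFu: ccont (fun x=> F x ^+ 2 * u x) by apply: ccontM=> //; exact: ccontM.
have cn := contnc cF.
have cn2: continuous (fun x=> nc (F x) ^+ 2) by exact: contX.
exists (citor (fun x=> F x * u x)), (citor (fun x=> F x ^+ 2 * u x)); split.
- rewrite -hc -/u -!citorZ//.
 have -> : (fun x=> F2 (x +i* g x) * (1 +i* g' x)) =
 (fun x=> (F x ^+ 2 * u x + (- (2 * f z0)) * (F x * u x)) + f z0 ^+ 2 * u x).
 apply/funext => x; rewrite /F2 /Q; have := ns x; rewrite subr_eq0 eq_sym => /negPf h.
 by rewrite h /u /F; field; rewrite subr_eq0 eq_sym h.
 rewrite citorD//.
 + rewrite citorD// ?citorZ//; last by apply: ccontM=> //; exact: ccontC.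
 by rewrite mulNr [X in _ + X = _]mulrC.
 + by apply: ccontD=> //; apply: ccontM=> //; exact: ccontC.
 + by apply: ccontM=> //; exact: ccontC.
- apply: (le_trans (nc_citor cFFu)); rewrite -itorZ//; apply: le_itor.
 + exact: contnc.
 + by apply: contM=> //; exact: contC.
 move=> x _; have hkx := hk x; rewrite ncM in hkx.
 rewrite [F x ^+ 2]expr2 !ncM [leRHS]mulrC expr2 -/(F x).
 by rewrite ler_wpM2l// ?mulr_ge0.
apply: (le_trans (nc_citor cFu)).
have -> : k * ((I / S + tau * S) / 2) = itor (fun x=> k / (2 * S) * nc (F x) ^+ 2 + k * S / 2 * 1).
 rewrite itorD; [|by apply: contM=> //; exact: contC|exact: contC].
 rewrite itorZ// itor_cst -/F -/I.
 have gen (p i: R) : k * ((i / S + 2 * p * S) / 2) = k / (2 * S) * i + 2 * p * (k * S / 2 * 1).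
 by field; rewrite gt_eqF.
 exact: gen.
apply: le_itor; first exact: contnc.
 by apply: contD; [apply: contM=> //; exact: contC|exact: contC].
move=> x _; rewrite ncM mulr1.
have n0 := nc_ge0 (F x).
apply: (le_via (nc (F x) * k)); first by rewrite ler_wpM2l//; exact: hk.
rewrite -subr_ge0.
have -> : k / (2 * S) * nc (F x) ^+ 2 + k * S / 2 - nc (F x) * k = k / (2 * S) * (nc (F x) - S) ^+ 2.
 by field; rewrite gt_eqF.
by rewrite mulr_ge0// divr_ge0 ?mulr_ge0// ?(ltW S0)//; apply: le_trans k1.
Qed.

(** The kernel integrates to [tau] on the top and to 0 on the bottom, so the difference of the two
    expansions isolates [tau * f z0 ^+ 2]: a quadratic inequality for [|f z0|]. *)
Lemma point_bound : nc (f z0) <= k * S * (1 + tau).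
have /andP[zb ze] := hz0.
have cb := der_cont db.
have ce := der_cont de.
have nsb x : 1 - cE (x +i* b x - z0) != 0.
 have := @kernel_nonsing b z0 pb (-1) _ _ 0 x; rewrite expr0n/= mulr0 addr0; apply.
 by rewrite mulN1r oppr_gt0 subr_lt0.
 by rewrite normrN normr1.
have nse x : 1 - cE (x +i* e x - z0) != 0.
 have := @kernel_nonsing e z0 pe 1 _ _ 0 x; rewrite expr0n/= mulr0 addr0; apply.
 by rewrite mul1r subr_gt0.
 by rewrite normr1.
have [A1 [A2 [EA nA2 nA1]]] := point_expand cb cb' nsb hkb (kernel_bottom db cb' pb zb).
have [B1 [B2 [EB nB2 nB1]]] := point_expand ce ce' nse hke (kernel_top de ce' pe ze).
have := contour_F2; rewrite EA EB mul0r addr0 => /eqP.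
rewrite -subr_eq0 => /eqP H.
have {}H : tau%:C * f z0 ^+ 2 = (A2 - B2) - 2 * f z0 * (A1 - B1).
 by apply/eqP; rewrite -subr_eq0 -oppr_eq0 -H; apply/eqP; ring.
have := congr1 (@nc R) H; rewrite ncM nc_real gtr0_norm// expr2 ncM => H2.
set X := nc (f z0) in H2 *; have X0: 0 <= X by exact: nc_ge0.
have b1: tau * (X * X) <= k * S ^+ 2 + 2 * X * (k * (S * (1 + 4 * pi) / 2)).
 rewrite H2; apply: (le_trans (ncB _ _)); apply: lerD.
 apply: (le_trans (ncB _ _)); apply: (le_trans (lerD nA2 nB2)).
 by rewrite -mulrDr ler_wpM2l// (le_trans ler01).
 rewrite !ncM -/X.
 have E2: (2 : R[i]) = (2: R)%:C by rewrite rmorph_nat.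
 have -> : nc 2 = 2 :> R by rewrite E2 nc_real ger0_norm.
 apply: ler_wpM2l; first by rewrite mulr_ge0.
 apply: (le_trans (ncB _ _)); apply: (le_trans (lerD nA1 nB1)).
 rewrite -mulrDr ler_wpM2l ?(le_trans ler01)//.
 have : (itor (fun x=> nc (f (x +i* b x)) ^+ 2) + itor (fun x=> nc (f (x +i* e x)) ^+ 2)) / S <= S.
 by rewrite ler_pdivrMr// -expr2.
 by rewrite mulrDl; lra.
(* If [X] exceeded [k * S * (1 + P)], the right-hand side would be at most [3 * X ^+ 2], which is
   less than [P * X ^+ 2]. *)
have p4: 4 <= tau :> R by have := @pi_ge2 R; lra.
have {}b1 : tau * (X * X) <= k * S ^+ 2 + X * (k * S * (1 + 2 * tau)).
 by apply: (le_trans b1); rewrite lerD2l; lra.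
move: (tau: R) p4 b1 => P p4 b1; have kp: 0 < k := lt_le_trans ltr01 k1.
have kS: 0 < k * S by rewrite mulr_gt0.
rewrite leNgt; apply/negP => Xk; set T := k * S * (1 + P) in Xk.
have T0: 0 < T by rewrite mulr_gt0//; lra.
have h1: X * (k * S * (1 + 2 * P)) <= 2 * (X * X).
 have : k * S * (1 + 2 * P) <= 2 * T by rewrite /T [leRHS]mulrCA ler_wpM2l ?(ltW kS)//; lra.
 move=> h0; have := ler_wpM2l X0 h0; have := ler_wpM2l X0 (ltW Xk); lra.
have h2: k * S ^+ 2 <= X * X.
 apply: (le_via (T * T)); last by rewrite ler_pM// ltW.
 apply: (le_via ((k * S) * (k * S))).
 have -> : k * S * (k * S) = k * S ^+ 2 * k by ring.
 by rewrite ler_peMr// mulr_ge0// ltW.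
 by rewrite /T ler_pM ?ltW// ltr_pMr//; lra.
have h3: 4 * (X * X) <= P * (X * X) by rewrite ler_wpM2r// mulr_ge0.
have : 0 < X * X by rewrite mulr_gt0// (lt_trans T0).
lra.
Qed.

End Pointwise.

End Cauchy.

Section Shift.
Context {R : realType}.

Lemma ts_shift (c : int -> R[i]) (x h: R) :
 ts (fun k=> c k * expi (k%:~R * h)) x = ts c (x + h).
congr csum; apply/funext => k; rewrite -mulrA -expiD; congr (_ * expi _); ring.
Qed.

End Shift.

Local Opaque ts csum nc.

(** * The collar below the surface: linear equations, profiles, geometry of [Z] *)

Section Collar.
Context {R : realType}.
Implicit Types (k n: int) (z w : R[i]).

Lemma ccat_continuous (T : topologicalType) (u : T -> R[i]) : (forall t, ccat u t) ->
 continuous (fun t=> cRe (u t)) /\ continuous (fun t=> cIm (u t)).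
by move=> h; split => t; case: (h t). Qed.

Lemma RCB (r t: R) : (r - t)%:C = r%:C - t%:C :> R[i]. by rewrite rmorphB. Qed.

Lemma RCint k : (k%:~R : R)%:C = k%:~R :> R[i]. by rewrite rmorph_int. Qed.

(** Both [B / l * exp (l s) + y] and [B / l * exp (l s) - y] have a non-negative derivative. *)
Lemma expgrow (y : R -> R) (g : R -> R) (l B d t: R) : 0 < l -> 0 <= B -> 0 < t -> t <= d ->
 continuous y ->
 (forall s, 0 < s < d -> is_derive s 1 y (g s) /\ `|g s| <= B * expR (l * s)) ->
 `|y t - y 0| <= B / l * (expR (l * t) - 1).
move=> l0 B0 t0 td cy hy.
have ce: continuous (fun s : R => B / l * expR (l * s)).
 apply: contM; first exact: contC.
 move=> s; apply: (@continuous_comp _ _ _ (fun s=> l * s) expR); last exact: continuous_expR.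
 by apply: contM; [exact: contC|exact: contI].
have de (s: R) : is_derive s 1 (fun s=> B / l * expR (l * s)) (B * expR (l * s)).
 have h1 := is_dM (is_dC l s) (is_dI s).
 have h2 := is_dcomp (is_derive_expR (l * s)) h1.
 have := is_dM (is_dC (B / l) s) h2.
 by apply: is_dext=> //; field; rewrite gt_eqF.
have E: B / l * (expR (l * t) - 1) = B / l * expR (l * t) - B / l * expR (l * 0).
 by rewrite mulr0 expR0; ring.
have mono (sg: R) : `|sg| = 1 -> 0 <= (B / l * expR (l * t) - B / l * expR (l * 0)) + sg * (y t - y 0).
 move=> sg1; pose F s := B / l * expR (l * s) + sg * y s.
 have -> : (B / l * expR (l * t) - B / l * expR (l * 0)) + sg * (y t - y 0) = F t - F 0 by rewrite /F; ring.
 have cF: {within `[0, t], continuous F}.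
 by apply: continuous_subspaceT; apply: contD=> //; apply: contM=> //; exact: contC.
 have dF (s: R) : s \in `]0, t[ -> is_derive s 1 F (B * expR (l * s) + sg * g s).
 rewrite in_itv/= => /andP[s0 st].
 have [h1 _] := hy s ltac:(by rewrite s0 (lt_le_trans st td)).
 have := is_dD (de s) (is_dM (is_dC sg s) h1).
 by apply: is_dext=> //; ring.
 have [s hs ->] := MVT t0 dF cF.
 move: hs; rewrite in_itv/= => /andP[s0 st].
 have [_ h2] := hy s ltac:(by rewrite s0 (lt_le_trans st td)).
 rewrite subr0 mulr_ge0 ?(ltW t0)//.
 have : `|sg * g s| <= B * expR (l * s) by rewrite normrM sg1 mul1r.
 by rewrite ler_norml => /andP[]; lra.
rewrite E ler_norml.
have := mono 1 (normr1 _); have := mono (-1); rewrite normrN normr1 => /(_ erefl).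
by move=> h1 h2; apply/andP; split; lra.
Qed.

(** Integrating factor [exp (l t)]; the factor 2 comes from treating real and imaginary parts apart.
    The inequality is stated for [l * nc (y t)] since [l] will be [|n|] and [|n| w_n] is the
    quantity to estimate. *)
Lemma ode_decay (y r : R -> R[i]) (l B d: R) : 0 < l -> 0 <= B ->
 (forall t, ccat y t) ->
 (forall s, 0 < s < d -> cder y s ((- l)%:C * y s + r s) /\ nc (r s) <= B) ->
 forall t, 0 <= t <= d -> l * nc (y t) <= l * nc (y 0) + 2 * B.
move=> l0 B0 cy hy t /andP[t0 td].
move: t0; rewrite le_eqVlt => /orP[/eqP <-|t0]; first by rewrite lerDl mulr_ge0.
pose X (s: R) : R[i] := (expR (l * s))%:C.
have cX: ccont X.
 apply: ccontR => s; apply: (@continuous_comp _ _ _ (fun s=> l * s) expR); last exact: continuous_expR.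
 by apply: contM; [exact: contC|exact: contI].
pose F s := X s * y s.
have cF s : ccat F s by apply: ccatM; [exact: ccont_at|exact: cy].
have dF s : 0 < s < d -> cder F s (X s * r s).
 move=> hs; have [h1 _] := hy s hs.
 have dX := cderR (is_dcomp (is_derive_expR (l * s)) (is_dM (is_dC l s) (is_dI s))).
 have := cderM dX h1; apply: cder_eq.
 rewrite /F /X mul0r add0r mulr1 rmorphM/= rmorphN/=; ring.
have bF s : 0 < s < d -> nc (X s * r s) <= B * expR (l * s).
 move=> hs; have [_ h2] := hy s hs.
 by rewrite ncM nc_real ger0_norm// mulrC ler_wpM2r// expR_ge0.
have [cR cI] := ccat_continuous cF.
have b1 := @expgrow _ (fun s=> cRe (X s * r s)) l B d t l0 B0 t0 td cR _.
have b2 := @expgrow _ (fun s=> cIm (X s * r s)) l B d t l0 B0 t0 td cI _.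
have {}b1 : `|cRe (F t) - cRe (F 0)| <= B / l * (expR (l * t) - 1).
 apply: b1 => s hs; split; first by case: (dF s hs).
 exact: le_trans (Re_le_nc _) (bF s hs).
have {}b2 : `|cIm (F t) - cIm (F 0)| <= B / l * (expR (l * t) - 1).
 apply: b2 => s hs; split; first by case: (dF s hs).
 exact: le_trans (Im_le_nc _) (bF s hs).
have e1: 1 <= expR (l * t) by rewrite -expR0 ler_expR mulr_ge0// ltW.
have b3: nc (F t) <= nc (F 0) + 2 * (B / l * (expR (l * t) - 1)).
 rewrite -{1}(subrK (F 0) (F t)) addrC; apply: (le_trans (ncD _ _)); rewrite lerD2l.
 apply: (le_trans (nc_le_ReIm _)); rewrite ReD ImD ReN ImN; lra.
have EF: nc (F t) = expR (l * t) * nc (y t) by rewrite /F ncM nc_real ger0_norm.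
have E0: nc (F 0) = nc (y 0) by rewrite /F /X mulr0 expR0 mul1r.
rewrite EF E0 in b3.
have eP := expR_gt0 (l * t); rewrite -(ler_pM2l eP) mulrCA.
have n0 := nc_ge0 (y 0).
apply: (le_trans (ler_wpM2l (ltW l0) b3)).
have -> : l * (nc (y 0) + 2 * (B / l * (expR (l * t) - 1))) = l * nc (y 0) + 2 * B * (expR (l * t) - 1).
 by field; rewrite gt_eqF.
have : l * nc (y 0) <= expR (l * t) * (l * nc (y 0)) by rewrite ler_peMl// mulr_ge0// ltW.
have : 0 <= 2 * B by rewrite mulr_ge0.
lra.
Qed.

Lemma cder_rev (y : R -> R[i]) (d s: R) a : cder y (d - s) a -> cder (fun t=> y (d - t)) s (- a).
move=> [h1 h2]; split.
 have := @is_dcomp _ _ (fun t=> d - t) s _ _ h1 (is_dB (is_dC d s) (is_dI s)).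
 by apply: is_dext=> //; rewrite ReN sub0r mulrN1.
have := @is_dcomp _ _ (fun t=> d - t) s _ _ h2 (is_dB (is_dC d s) (is_dI s)).
by apply: is_dext=> //; rewrite ImN sub0r mulrN1.
Qed.

(** Reversing time turns the growing mode into a decaying one, governed by its value at the far end
    [d]. *)
Lemma ode_grow (y r : R -> R[i]) (l B d: R) : 0 < l -> 0 <= B ->
 (forall t, ccat y t) ->
 (forall s, 0 < s < d -> cder y s (l%:C * y s + r s) /\ nc (r s) <= B) ->
 forall t, 0 <= t <= d -> l * nc (y t) <= l * nc (y d) + 2 * B.
move=> l0 B0 cy hy t ht.
have := @ode_decay (fun s=> y (d - s)) (fun s=> - r (d - s)) l B d l0 B0 _ _ (d - t).
rewrite subr0 subKr; apply.
- move=> s; have [h1 h2] := ccat_continuous cy; have cd: continuous (fun s : R => d - s).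
 by apply: contB; [exact: contC|exact: contI].
 split.
 by apply: (@continuous_comp _ _ _ (fun s=> d - s) (fun s=> cRe (y s))); [exact: cd|exact: h1].
 by apply: (@continuous_comp _ _ _ (fun s=> d - s) (fun s=> cIm (y s))); [exact: cd|exact: h2].
- move=> s hs; have [h1 h2] := hy (d - s) ltac:(by apply/andP; split; lra).
 split; last by rewrite ncN.
 by have := cder_rev h1; apply: cder_eq; rewrite rmorphN/=; ring.
by apply/andP; split; lra.
Qed.

Lemma taylor2 (g g' g'' : R -> R) (t h K: R) :
 (forall s : R, minr t (t + h) <= s <= Num.max t (t + h) ->
 [/\ is_derive s 1 g (g' s), is_derive s 1 g' (g'' s) & `|g'' s| <= K]) ->
 `|g (t + h) - g t - h * g' t| <= K * h ^+ 2.
move=> H; pose p s := g s - s * g' t.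
have -> : g (t + h) - g t - h * g' t = p (t + h) - p t by rewrite /p; ring.
have -> : K * h ^+ 2 = K * `|h| * `|t + h - t|.
 by rewrite addrAC subrr add0r -mulrA -expr2 (real_normK (num_real h)).
apply: (@mvt_lip _ p (fun s=> g' s - g' t)) => s hs.
 have [h1 _ _] := H s hs.
 have := is_dB h1 (is_dM (is_dI s) (is_dC (g' t) s)).
 by apply: is_dext=> //; ring.
have K0: 0 <= K by have [_ _ k1] := H s hs; apply: le_trans k1.
apply: (le_via (K * `|s - t|)).
 apply: (@mvt_lip _ g' g'') => v hv.
 suff /H[] : minr t (t + h) <= v <= Num.max t (t + h) by [].
 move: hs hv; rewrite !minEle !maxEle; do 2 case: ifP; lra.
 suff /H[] : minr t (t + h) <= v <= Num.max t (t + h) by [].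
 move: hs hv; rewrite !minEle !maxEle; do 2 case: ifP; lra.
rewrite ler_wpM2l//; move: hs; rewrite !minEle !maxEle ler_norml.
have := ler_norm h; have := ler_norm (- h); rewrite normrN.
by case: ifP => _ h1 h2 /andP[h3 h4]; apply/andP; split; lra.
Qed.

Lemma ts_taylor_loc b C b2 C2 (c : R -> int -> R[i]) (c' : int -> R[i]) (t x r: R) : 0 < r ->
 (forall k, 0 <= b k) -> l1 b C -> (forall k, 0 <= b2 k) -> l1 b2 C2 ->
 (forall s k, `|s - t| < r -> nc (c s k) <= b k) -> (forall k, nc (c' k) <= b k) ->
 (forall h k, `|h| < r -> nc (c (t + h) k - c t k - h%:C * c' k) <= h ^+ 2 * b2 k) ->
 cder (fun s=> ts (c s) x) t (ts c' x).
move=> r0 b0 hb b20 hb2 hc hc' H.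
pose e (s: R) : int -> R[i] := if `|s - t| < r then c s else c t.
have tt: `|t - t| < r by rewrite subrr normr0.
apply: (@cder_near _ (fun s=> ts (e s) x) _ t r _ r0); first by move=> s hs; rewrite /e hs.
pose b3 k := b2 k + r^-1 * b k.
have ri: 0 < r^-1 by rewrite invr_gt0.
apply: (@ts_taylor _ b C b3 (C2 + `|r^-1| * C))=> //.
- by move=> k; rewrite addr_ge0// mulr_ge0// ltW.
- by apply: l1D=> //; exact: l1Z.
- by move=> s k; rewrite /e; case: ifP => hs; apply: hc.
move=> h k; rewrite /e tt; have -> : t + h - t = h by ring.
case: ifPn => hr.
 by apply: (le_trans (H h k hr)); rewrite ler_wpM2l// lerDl mulr_ge0 ?(ltW ri) ?b0.
rewrite subrr sub0r ncN ncM nc_real; rewrite -leNgt in hr.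
apply: (le_via (h ^+ 2 * (r^-1 * b k))).
 rewrite mulrA; apply: ler_pM; rewrite ?nc_ge0//.
 rewrite -(real_normK (num_real h)) expr2 -mulrA ler_peMr//.
 by rewrite ler_pdivlMr// mul1r.
by rewrite ler_wpM2l// lerDr.
Qed.

(* Multipliers of the collar: [prof false] continues a negative frequency
 holomorphically into the fluid; [prof true] has the slope of the growing
 exponential at 0 but decays. *)
Definition prof (s : bool) (y: R) : R := if s then (1 + 2 * y) * expR (- y) else expR (- y).
Definition prof1 (s : bool) (y: R) : R := if s then (1 - 2 * y) * expR (- y) else - expR (- y).
Definition prof2 (s : bool) (y: R) : R := if s then (2 * y - 3) * expR (- y) else expR (- y).
Definition psgn (s : bool) : R := if s then 1 else -1.

Lemma prof_der s (y: R) : is_derive y 1 (prof s) (prof1 s y) /\ is_derive y 1 (prof1 s) (prof2 s y).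
have dE: is_derive y 1 (fun y : R => expR (- y)) (- expR (- y)).
 have := @is_dcomp _ expR (fun y : R => - y) y _ _ (is_derive_expR (- y)) (is_dN (is_dI y)).
 by apply: is_dext=> //; ring.
have dl (a: R) := is_dD (is_dC 1 y) (is_dM (is_dC a y) (is_dI y)).
case: s => /=; split.
- have := is_dM (dl 2) dE; apply: is_dext=> //; rewrite /prof1; ring.
- have := is_dM (dl (-2)) dE; apply: is_dext; last by rewrite /prof2; ring.
 by apply/funext => x; rewrite /prof1 mulNr.
- exact: dE.
by have := is_dN dE; apply: is_dext=> //; rewrite /prof2 opprK.
Qed.

Lemma prof_bd s (y: R) : 0 <= y ->
 [/\ `|prof s y| <= 2, `|prof1 s y| <= 2, `|prof2 s y| <= 3 & 0 <= prof s y].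
move=> y0; have e0 := expR_gt0 (- y).
have h1: expR (- y) <= 1 by rewrite -expR0 ler_expR oppr_le0.
have h2: (1 + y) * expR (- y) <= 1.
 have := expR_ge1Dx y; rewrite -(ler_pM2r e0) -expRD subrr expR0; lra.
have h3: 0 <= y * expR (- y) by rewrite mulr_ge0// ltW.
by case: s; rewrite /prof /prof1 /prof2; split; rewrite ?ler_norml; first [apply/andP; split; lra|lra].
Qed.

Lemma prof_lip s (y: R) : 0 <= y ->
 [/\ `|prof s y - 1| <= 2 * minr 1 y, `|prof1 s y - psgn s| <= 3 * minr 1 y &
 `|prof1 s y - psgn s * prof s y| <= 4 * minr 1 y].
move=> y0; have [b1 b2 b3 b4] := prof_bd s y0.
have mm (K A: R) : 0 <= K -> A <= K -> A <= K * y -> A <= K * minr 1 y.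
 by move=> K0 h1 h2; rewrite minEle; case: ifP => _ //; rewrite mulr1.
have lip (g g' : R -> R) (K: R) : (forall x : R, 0 <= x -> is_derive x 1 g (g' x) /\ `|g' x| <= K) ->
 `|g y - g 0| <= K * y.
 move=> H; have := @mvt_lip _ g g' K 0 y; rewrite subr0 (ger0_norm y0); apply => x.
 by rewrite min_l// => /andP[/H[]].
 by rewrite min_l// => /andP[/H[]].
have p0: prof s 0 = 1 by rewrite /prof oppr0 expR0; case: (s); rewrite ?mulr0 ?addr0 ?mulr1.
have p10: prof1 s 0 = psgn s by rewrite /prof1 /psgn oppr0 expR0; case: (s); rewrite ?mulr0 ?subr0 ?mulr1.
have l1: `|prof s y - 1| <= 2 * y.
 rewrite -[X in _ - X]p0; apply: (lip (prof s) (prof1 s)) => x x0; have [? _] := prof_der s x.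
 by have [_ ? _ _] := prof_bd s x0.
have l2: `|prof1 s y - psgn s| <= 3 * y.
 rewrite -p10; apply: (lip (prof1 s) (prof2 s)) => x x0; have [_ ?] := prof_der s x.
 by have [_ _ ? _] := prof_bd s x0.
split.
- by apply: mm=> //; move: b1 b4; rewrite !ler_norml; lra.
- apply: mm=> //; apply: (le_trans (ler_normB _ _)).
 have : `|psgn s| = 1 by rewrite /psgn; case: (s); rewrite ?normrN normr1.
 lra.
have e0 := expR_gt0 (- y).
have h1: expR (- y) <= 1 by rewrite -expR0 ler_expR oppr_le0.
have h2: (1 + y) * expR (- y) <= 1.
 have := expR_ge1Dx y; rewrite -(ler_pM2r e0) -expRD subrr expR0; lra.
have h3: 0 <= y * expR (- y) by rewrite mulr_ge0// ltW.
have m0: 0 <= minr 1 y by rewrite le_min y0 ler01.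
rewrite /prof /prof1 /psgn; case: (s).
 have -> : (1 - 2 * y) * expR (- y) - 1 * ((1 + 2 * y) * expR (- y)) = - (4 * (y * expR (- y))) by ring.
 rewrite normrN ger0_norm ?mulr_ge0//; apply: mm=> //; first by lra.
 by rewrite ler_wpM2l// ler_piMr.
by rewrite mulN1r opprK addNr normr0 mulr_ge0.
Qed.

Lemma prof_dec s (y: R) : 0 <= y -> `|y * prof1 s y| <= 9 /\ `|y * prof2 s y| <= 11.
move=> y0; have e0 := expR_gt0 (- y).
have h2: (1 + y) * expR (- y) <= 1.
 have := expR_ge1Dx y; rewrite -(ler_pM2r e0) -expRD subrr expR0; lra.
have h1: y * expR (- y) <= 1.
 have : 0 <= expR (- y) by exact: ltW.
 lra.
have h3: 0 <= y * expR (- y) by rewrite mulr_ge0// ltW.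
have h4: y ^+ 2 * expR (- y) <= 4.
 have : (y / 2) ^+ 2 <= expR (y / 2) ^+ 2.
 rewrite lerXn2r ?nnegrE ?divr_ge0 ?expR_ge0//.
 by apply: le_trans (expR_ge1Dx _); rewrite lerDr.
 rewrite -expRM_natl mulr_natl -[y / 2 *+ 2]mulr_natr divfK// -(ler_pM2r e0) -expRD subrr expR0.
 lra.
have h5: 0 <= y ^+ 2 * expR (- y) by rewrite mulr_ge0// ltW.
case: s; rewrite /prof1 /prof2.
 have -> : y * ((1 - 2 * y) * expR (- y)) = y * expR (- y) - 2 * (y ^+ 2 * expR (- y)) by ring.
 have -> : y * ((2 * y - 3) * expR (- y)) = 2 * (y ^+ 2 * expR (- y)) - 3 * (y * expR (- y)) by ring.
 by rewrite !ler_norml; split; apply/andP; split; lra.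
by rewrite mulrN normrN !ger0_norm//; split; lra.
Qed.

Lemma prof_taylor0 s (y: R) : 0 <= y -> `|prof s y - 1 - y * psgn s| <= 3 * y ^+ 2.
move=> y0; have := @taylor2 (prof s) (prof1 s) (prof2 s) 0 y 3; rewrite add0r.
have p0: prof s 0 = 1 by rewrite /prof oppr0 expR0; case: (s); rewrite ?mulr0 ?addr0 ?mulr1.
have p10: prof1 s 0 = psgn s by rewrite /prof1 /psgn oppr0 expR0; case: (s); rewrite ?mulr0 ?subr0 ?mulr1.
rewrite p0 p10; apply => x; rewrite min_l// => /andP[x0 _].
by have [? ?] := prof_der s x; have [_ _ ? _] := prof_bd s x0.
Qed.

(** The [max] freezes the profiles for negative [t]: collar quantities are then continuous for all
    real [t], and only differentiability asks for [t > 0]. *)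
Definition cy k (t: R) : R := `|k%:~R| * Num.max t 0.
Definition ec k (t: R) : R := prof (0 < k) (cy k t).
Definition ec1 k (t: R) : R := `|k%:~R| * prof1 (0 < k) (cy k t).

Lemma cy_ge0 k t : 0 <= cy k t.
by rewrite mulr_ge0// le_max lexx orbT. Qed.

Lemma psgn_k k : `|k%:~R| * psgn (0 < k) = k%:~R :> R.
rewrite /psgn; case: ltP => k0; first by rewrite mulr1 gtr0_norm// ltr0z.
by rewrite ler0_norm ?lerz0// mulrN1 opprK.
Qed.

Lemma ec_bd k t : `|ec k t| <= 2 /\ `|ec1 k t| <= 2 * `|k%:~R : R|.
have [h1 h2 _ _] := prof_bd (0 < k) (cy_ge0 k t).
by split=> //; rewrite /ec1 normrM normr_id mulrC ler_wpM2r.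
Qed.

Lemma ec_lip k t : [/\ `|ec k t - 1| <= 2 * minr 1 (cy k t),
 `|ec1 k t - k%:~R| <= 3 * `|k%:~R| * minr 1 (cy k t) &
 `|ec1 k t - k%:~R * ec k t| <= 4 * `|k%:~R| * minr 1 (cy k t)].
have [h1 h2 h3] := prof_lip (0 < k) (cy_ge0 k t); split=> //.
 have -> : ec1 k t - k%:~R = `|k%:~R| * (prof1 (0 < k) (cy k t) - psgn (0 < k)).
 by have := psgn_k k; rewrite /ec1; set a := `|_| => <-; ring.
 by rewrite normrM normr_id -mulrA [leRHS]mulrCA ler_wpM2l.
have -> : ec1 k t - k%:~R * ec k t =
 `|k%:~R| * (prof1 (0 < k) (cy k t) - psgn (0 < k) * prof (0 < k) (cy k t)).
 by have := psgn_k k; rewrite /ec1 /ec; set a := `|_| => <-; ring.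
by rewrite normrM normr_id -mulrA [leRHS]mulrCA ler_wpM2l.
Qed.

Lemma ec_taylor k t h : `|h| < t ->
 `|ec k (t + h) - ec k t - h * ec1 k t| <= 3 * k%:~R ^+ 2 * h ^+ 2.
move=> ht; have t0: 0 < t by exact: le_lt_trans ht.
set a : R := `|k%:~R|; have a0: 0 <= a by exact: normr_ge0.
have -> : k%:~R ^+ 2 = a ^+ 2 :> R by rewrite /a real_normK// num_real.
have th: 0 <= t + h by move: ht; rewrite ltr_norml; lra.
have cE s : 0 <= s -> cy k s = a * s by move=> s0; rewrite /cy max_l.
rewrite /ec /ec1 !cE ?(ltW t0)// -/a.
pose s0 := 0 < k.
have := @taylor2 (fun s=> prof s0 (a * s)) (fun s=> a * prof1 s0 (a * s)) (fun s=> a ^+ 2 * prof2 s0 (a * s)) t h (3 * a ^+ 2).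
apply=> s hs; have sp: 0 <= s.
 by move: hs; rewrite minEle; case: ifP => _ /andP[]; lra.
have da := is_dM (is_dC a s) (is_dI s).
have [d1 d2] := prof_der s0 (a * s).
split.
- have := @is_dcomp _ (prof s0) (fun s=> a * s) s _ _ d1 da.
 by apply: is_dext=> //; ring.
- have := is_dM (is_dC a s) (@is_dcomp _ (prof1 s0) (fun s=> a * s) s _ _ d2 da).
 by apply: is_dext=> //; ring.
have [_ _ h3 _] := @prof_bd s0 (a * s) (mulr_ge0 a0 sp).
by rewrite normrM (ger0_norm (sqr_ge0 a)) mulrC ler_wpM2r// sqr_ge0.
Qed.

(** With only [k^2 c_k] summable, the remainder for [Z_x] cannot afford a third factor [k]. The
    decay of the second derivative of the profile trades it for [1 / t]. *)
Lemma ec_taylor_k k t h : 0 < t -> `|h| < t / 2 ->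
 `|k%:~R| * `|ec k (t + h) - ec k t - h * ec1 k t| <= 22 / t * k%:~R ^+ 2 * h ^+ 2.
move=> t0 ht.
set a : R := `|k%:~R|; have a0: 0 <= a by exact: normr_ge0.
have -> : k%:~R ^+ 2 = a ^+ 2 :> R by rewrite /a real_normK// num_real.
have th: t / 2 <= t + h by move: ht; rewrite ltr_norml; lra.
have cE s : 0 <= s -> cy k s = a * s by move=> s0; rewrite /cy max_l.
have th0: 0 <= t + h by lra.
rewrite /ec /ec1 !cE ?(ltW t0)// -/a.
pose s0 := 0 < k.
have := @taylor2 (fun s=> a * prof s0 (a * s)) (fun s=> a * (a * prof1 s0 (a * s))) (fun s=> a * (a ^+ 2 * prof2 s0 (a * s))) t h (22 / t * a ^+ 2).
have -> : a * prof s0 (a * (t + h)) - a * prof s0 (a * t) - h * (a * (a * prof1 s0 (a * t))) =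
 a * (prof s0 (a * (t + h)) - prof s0 (a * t) - h * (a * prof1 s0 (a * t))) by ring.
rewrite normrM (ger0_norm a0); apply => s hs; have sp: t / 2 <= s.
 by move: hs; rewrite minEle; case: ifP => _ /andP[]; lra.
have s_gt0: 0 < s by lra.
have da := is_dM (is_dC a s) (is_dI s).
have [d1 d2] := prof_der s0 (a * s).
split.
- have := is_dM (is_dC a s) (@is_dcomp _ (prof s0) (fun s=> a * s) s _ _ d1 da).
 by apply: is_dext=> //; ring.
- have := is_dM (is_dC a s) (is_dM (is_dC a s) (@is_dcomp _ (prof1 s0) (fun s=> a * s) s _ _ d2 da)).
 by apply: is_dext=> //; ring.
have [_ h3] := @prof_dec s0 (a * s) (mulr_ge0 a0 (ltW s_gt0)).
have -> : a * (a ^+ 2 * prof2 s0 (a * s)) = a ^+ 2 * (a * s * prof2 s0 (a * s)) / s by field; rewrite gt_eqF.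
set G := _ * prof2 _ _ in h3 *.
rewrite normrM (normrM (a ^+ 2)) normfV (gtr0_norm s_gt0) (ger0_norm (sqr_ge0 a)) ler_pdivrMr//.
rewrite [leRHS]mulrAC [leRHS]mulrC ler_wpM2l//; apply: (le_trans h3).
by rewrite mulrAC ler_pdivlMr//; lra.
Qed.

Lemma ec1_dec k t : 0 < t -> `|ec1 k t| <= 9 / t.
move=> t0; have [h1 _] := prof_dec (0 < k) (cy_ge0 k t).
rewrite ler_pdivlMr//; apply: le_trans h1.
rewrite /ec1 {2}/cy max_l ?(ltW t0)// !normrM normr_id (gtr0_norm t0).
by rewrite mulrAC.
Qed.

Lemma ec_cont k : continuous (ec k) /\ continuous (ec1 k).
have cc: continuous (cy k).
 apply: contM; first exact: contC.
 by move=> t; apply: continuous_max; [exact: contI|exact: contC].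
have cp s : continuous (prof s) by move=> y; apply: is_dcont; exact: (prof_der s y).1.
have cp1 s : continuous (prof1 s) by move=> y; apply: is_dcont; exact: (prof_der s y).2.
split; last apply: contM; try exact: contC.
 by move=> t; apply: (@continuous_comp _ _ _ (cy k) (prof _)); [exact: cc|exact: cp].
by move=> t; apply: (@continuous_comp _ _ _ (cy k) (prof1 _)); [exact: cc|exact: cp1].
Qed.

Lemma ccont_ts2 b C (c : R -> int -> R[i]) : (forall k, 0 <= b k) -> l1 b C ->
 (forall t k, nc (c t k) <= b k) -> (forall k, ccont (c^~ k)) ->
 ccont (fun p : R * R => ts (c p.1) p.2).
move=> b0 hb hc cc; apply: ccont_unif => e e0.
have [F0 h] := nc_ts_tail b0 hb e0.
exists (fun p : R * R => \sum_(k <- F0) c p.1 k * expi (k%:~R * p.2)).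
 apply: ccont_sum => k; apply: ccontP => p; apply: ccatM.
 case: p => t x; have [c1 c2] := cc k; split => /=.
 by apply: (@continuous_comp _ _ _ fst (fun t=> cRe (c t k))); [exact: cvg_fst|exact: c1].
 by apply: (@continuous_comp _ _ _ fst (fun t=> cIm (c t k))); [exact: cvg_fst|exact: c2].
 exact: (ccat_comp2 p (@ccont_expik R k)).
by move=> p; apply: h=> //; exact: fsubset_refl.
Qed.

Section Surface.
Implicit Types (t x h: R).
Variables (eta : R -> R) (c : int -> R[i]) (C2: R).
Hypothesis hc : l1 (fun k=> jb k ^+ 2 * nc (c k)) C2.
Hypothesis heta : forall x, (eta x)%:C = ts c x.

Let b k : R := 4 * (jb k ^+ 2 * nc (c k)).

Lemma bsurf0 k : 0 <= b k.
by rewrite mulr_ge0// mulr_ge0. Qed.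

Lemma bsurf1 : l1 b (4 * C2).
by have := l1Z 4 hc; rewrite ger0_norm. Qed.

Lemma C2_ge0 : 0 <= C2. exact: l1_ge0 hc. Qed.

Lemma jb_facts k : [/\ 1 <= jb k :> R, `|k%:~R| <= jb k :> R, jb k <= jb k ^+ 2 :> R & 1 <= jb k ^+ 2 :> R].
have j1 := @jb_ge1 R k.
split; [exact: j1|by rewrite /jb lerDr|by rewrite expr2 ler_peMl// (le_trans ler01)|by rewrite exprn_ege1].
Qed.

Lemma bsurf_le k (a K: R) : `|a| <= K * jb k -> K <= 4 -> nc (a%:C * c k) <= b k.
move=> ha K4; rewrite ncM nc_real /b mulrA ler_wpM2r//; apply: (le_trans ha).
have [j1 _ j2 j3] := jb_facts k.
by apply: ler_pM=> //; [move: (le_trans (normr_ge0 _) ha); rewrite pmulr_lge0// (lt_le_trans ltr01)|lra].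
Qed.

Definition Zc (t: R) k : R[i] := (ec k t)%:C * c k.
Definition Zac (t: R) k : R[i] := 'i * k%:~R * Zc t k.
Definition Ztc (t: R) k : R[i] := (ec1 k t)%:C * c k.
(** Coefficients of [Z_t + i Z_x], which would vanish if [Z] were a holomorphic function of
    [x - i t]. They are zero for [k <= 0], where the profile is an exact exponential, and at most of
    size [k^2 t |c_k|] otherwise. *)
Definition nuc (t: R) k : R[i] := 'i * ((ec1 k t - k%:~R * ec k t)%:C * c k).
Definition Z (t x: R) : R[i] := x%:C - 'i * t%:C + 'i * ts (Zc t) x.
Definition Za (t x: R) : R[i] := 1 + 'i * ts (Zac t) x.
Definition Zt (t x: R) : R[i] := - 'i + 'i * ts (Ztc t) x.
Definition nu (t x: R) : R[i] := ts (nuc t) x.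

Lemma Zc_le t k : nc (Zc t k) <= b k.
apply: (@bsurf_le _ _ 2)=> //; last lra.
have [h _] := ec_bd k t; have [j1 _ _ _] := jb_facts k; lra.
Qed.

Lemma Zc_le1 t k : nc (Zc t k) <= 2 * nc (c k).
by rewrite ncM nc_real ler_wpM2r//; have [] := ec_bd k t. Qed.

Lemma Zac_le t k : nc (Zac t k) <= b k.
rewrite ncM [nc ('i * _)]ncM nc_i mul1r nc_int; have := Zc_le1 t k; have [_ j2 j3 _] := jb_facts k.
move=> h; apply: (le_trans (ler_pM _ _ (le_trans j2 j3) h)); rewrite ?nc_ge0//.
rewrite /b mulrCA; have : 0 <= jb k ^+ 2 * nc (c k) by rewrite mulr_ge0.
lra.
Qed.

Lemma Ztc_le t k : nc (Ztc t k) <= b k.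
apply: (@bsurf_le _ _ 2)=> //; last lra.
by have [_ h] := ec_bd k t; have [_ j2 _ _] := jb_facts k; lra.
Qed.

Lemma nuc_le t k : nc (nuc t k) <= 4 * `|k%:~R| * minr 1 (cy k t) * nc (c k).
rewrite ncM nc_i mul1r ncM nc_real ler_wpM2r//.
by have [_ _ h] := ec_lip k t.
Qed.

Lemma nuc_leb t k : nc (nuc t k) <= b k.
apply: (le_trans (nuc_le t k)); rewrite /b mulrA ler_wpM2r//.
have [_ j2 j3 _] := jb_facts k.
apply: (le_via (4 * jb k * 1)); last lra.
apply: ler_pM; rewrite ?mulr_ge0// ?le_min ?ler01 ?cy_ge0 ?ge_min ?lexx//.
by rewrite ler_wpM2l.
Qed.

Lemma cont_c (F : int -> R -> R) (k: int) : continuous (F k) -> ccont (fun t=> (F k t)%:C * c k).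
by move=> cF; apply: ccontM; [exact: ccontR|exact: ccontC]. Qed.

Lemma ccont_Zc k : ccont (Zc^~ k). by apply: cont_c; have [] := ec_cont k. Qed.
Lemma ccont_Ztc k : ccont (Ztc^~ k). by apply: cont_c; have [] := ec_cont k. Qed.

Lemma ccont_fst2 : ccont (fun p : R * R => (p.1)%:C : R[i]).
by apply: ccontP => p; exact: ccat_fst. Qed.

Lemma ccont_snd2 (u : R -> R[i]) : ccont u -> ccont (fun p : R * R => u p.2).
by move=> hu; apply: ccontP => p; exact: ccat_comp2. Qed.

Lemma ccont_Z : ccont (unc Z).
apply: ccontD.
 apply: ccontB; first by apply: (@ccont_snd2 (fun x=> x%:C)); apply: ccontR; exact: contI.
 by apply: ccontM; [exact: ccontC|exact: ccont_fst2].
apply: ccontM; first exact: ccontC.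
exact: (ccont_ts2 bsurf0 bsurf1 Zc_le ccont_Zc).
Qed.

Lemma ccont_Za : ccont (unc Za).
apply: ccontD; first exact: ccontC.
apply: ccontM; first exact: ccontC.
apply: (ccont_ts2 bsurf0 bsurf1 Zac_le) => k.
by apply: ccontM; [exact: ccontC|exact: ccont_Zc].
Qed.

Lemma ccont_Zt : ccont (unc Zt).
apply: ccontD; first exact: ccontC.
by apply: ccontM; [exact: ccontC|exact: (ccont_ts2 bsurf0 bsurf1 Ztc_le ccont_Ztc)].
Qed.

Lemma nuE t x : nu t x = Zt t x + 'i * Za t x.
rewrite /nu (_ : nuc t = (fun k=> (0 + 'i * Ztc t k) + ('i * 'i) * Zac t k)); last first.
 apply/funext => k; rewrite /nuc /Ztc /Zac /Zc RCB (RCM k%:~R (ec k t)) RCint.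
 rewrite mulii.
 ring.
have L := @ts_lin R.
rewrite (ts_lin _ _ bsurf0 bsurf1); last 2 first.
- by move=> k; rewrite add0r ncM nc_i mul1r Ztc_le.
- by move=> k; exact: Zac_le.
rewrite (ts_lin _ _ bsurf0 bsurf1); last 2 first.
- by move=> k; rewrite nc0 bsurf0.
- by move=> k; exact: Ztc_le.
have -> : ts (fun _ : int => 0) x = 0 :> R[i].
 apply/eqP; rewrite -nc_eq0 eq_le nc_ge0 andbT.
 have h0: l1 (fun _ : int => 0 : R) 0.
 by have := l1Z 0 hc; rewrite normr0 mul0r; apply: l1_le => k; rewrite mul0r normr0.
 by apply: (nc_ts _ _ h0)=> // k; rewrite nc0.
rewrite /Zt /Za; ring.
Qed.

Lemma Z_per t x : Z t (x + tau) = Z t x + tau%:C.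
by rewrite /Z ts_per rmorphD/=; ring. Qed.

Lemma Za_per t : periodic (Za t) tau. by move=> x; rewrite /Za ts_per. Qed.
Lemma nu_per t : periodic (nu t) tau. by move=> x; rewrite /nu ts_per. Qed.

Lemma ccont_nu : ccont (unc nu).
rewrite (_ : (fun p=> _) = (fun p : R * R => Zt p.1 p.2 + 'i * Za p.1 p.2)); last by apply/funext => p; rewrite nuE.
apply: ccontD; first exact: ccont_Zt.
by apply: ccontM; [exact: ccontC|exact: ccont_Za].
Qed.

Lemma cder_Zx t x : cder (Z t) x (Za t x).
have hz: l1 (fun k=> jb k ^+ 2 * nc (Zc t k)) (2 * C2).
 have := l1Z 2 hc; rewrite ger0_norm//; apply: l1_le => k.
 have p (w : R[i]) : 0 <= jb k ^+ 2 * nc w by rewrite mulr_ge0.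
 rewrite (ger0_norm (p _)) [leRHS]ger0_norm; last by rewrite mulr_ge0 ?p.
 by rewrite mulrCA ler_wpM2l//; exact: Zc_le1.
have := cderD (cderB (cderR (is_dI x)) (cderC ('i * t%:C) x)) (cderZ 'i (ts_der x hz)).
by apply: cder_eq; rewrite /Za subr0.
Qed.

Lemma cder_Zt t x : 0 < t -> cder (Z^~ x) t (Zt t x).
move=> t0.
have hz: cder (fun s=> ts (Zc s) x) t (ts (Ztc t) x).
 apply: (@ts_taylor_loc b (4 * C2) b (4 * C2) Zc (Ztc t) t x t t0 bsurf0 bsurf1 bsurf0 bsurf1).
 - by move=> s k _; exact: Zc_le.
 - exact: Ztc_le.
 move=> h k ht; rewrite /Zc /Ztc.
 have -> : (ec k (t + h))%:C * c k - (ec k t)%:C * c k - h%:C * ((ec1 k t)%:C * c k) =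
 (ec k (t + h) - ec k t - h * ec1 k t)%:C * c k by rewrite !RCB RCM; ring.
 rewrite ncM nc_real; apply: (le_trans (ler_wpM2r (nc_ge0 _) (ec_taylor k ht))).
 rewrite /b [3 * _ * _]mulrC -mulrA ler_wpM2l// mulrA ler_wpM2r//.
 have [_ j2 _ _] := jb_facts k.
 have : k%:~R ^+ 2 <= jb k ^+ 2 :> R.
 by rewrite -(real_normK (num_real k%:~R)) lerXn2r ?nnegrE// (le_trans _ j2).
 have := sqr_ge0 (jb k: R); lra.
have := cderD (cderB (cderC x%:C t) (cderZ 'i (cderR (is_dI t)))) (cderZ 'i hz).
by apply: cder_eq; rewrite /Zt; ring.
Qed.

Definition Zat (t x: R) : R[i] := 'i * ts (fun k=> 'i * k%:~R * Ztc t k) x.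

Lemma Zatc_le t k : nc ('i * k%:~R * Ztc t k) <= b k.
rewrite ncM [nc ('i * _)]ncM nc_i mul1r nc_int ncM nc_real mulrA.
have [_ j2 _ _] := jb_facts k; have [_ h] := ec_bd k t.
rewrite /b mulrA ler_wpM2r//.
apply: (le_via (jb k * (2 * jb k))).
 by apply: ler_pM=> //; apply: (le_trans h); rewrite ler_wpM2l.
by have := sqr_ge0 (jb k: R); rewrite mulrCA -expr2; lra.
Qed.

Lemma ccont_Zat : ccont (unc Zat).
apply: ccontM; first exact: ccontC.
apply: (ccont_ts2 bsurf0 bsurf1 Zatc_le) => k.
by apply: ccontM; [exact: ccontC|exact: ccont_Ztc].
Qed.

Lemma cder_Ztx t x : 0 < t -> cder (Zt t) x (Zat t x).
move=> t0.
have hz: l1 (fun k=> jb k ^+ 2 * nc (Ztc t k)) (9 / t * C2).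
 have p0: 0 <= 9 / t by rewrite divr_ge0// ltW.
 have := l1Z (9 / t) hc; rewrite (ger0_norm p0); apply: l1_le => k.
 have pn (w : R[i]) : 0 <= jb k ^+ 2 * nc w by rewrite mulr_ge0.
 rewrite (ger0_norm (pn _)) [leRHS]ger0_norm; last by rewrite mulr_ge0 ?pn.
 by rewrite mulrCA ler_wpM2l// ncM nc_real ler_wpM2r// ec1_dec.
have := cderD (cderC (- 'i) x) (cderZ 'i (ts_der x hz)).
by apply: cder_eq; rewrite add0r.
Qed.

Lemma cder_Zat t x : 0 < t -> cder (Za^~ x) t (Zat t x).
move=> t0; have t20: 0 < t / 2 by rewrite divr_gt0.
pose b2 k := 22 / t * b k.
have p0: 0 <= 22 / t by rewrite divr_ge0// ltW.
have b20 k : 0 <= b2 k by rewrite mulr_ge0 ?bsurf0.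
have hb2: l1 b2 (22 / t * (4 * C2)).
 by have := l1Z (22 / t) bsurf1; rewrite (ger0_norm p0).
have hz: cder (fun s=> ts (Zac s) x) t (ts (fun k=> 'i * k%:~R * Ztc t k) x).
 apply: (@ts_taylor_loc b (4 * C2) b2 _ Zac _ t x (t / 2) t20 bsurf0 bsurf1 b20 hb2).
 - by move=> s k _; exact: Zac_le.
 - exact: Zatc_le.
 move=> h k ht; rewrite /Zac /Zc /Ztc.
 have -> : 'i * k%:~R * ((ec k (t + h))%:C * c k) - 'i * k%:~R * ((ec k t)%:C * c k) -
 h%:C * ('i * k%:~R * ((ec1 k t)%:C * c k)) =
 'i * (k%:~R * (ec k (t + h) - ec k t - h * ec1 k t)%:C * c k) by rewrite !RCB RCM; ring.
 rewrite ncM nc_i mul1r ncM [nc (_%:~R * _)]ncM nc_int nc_real.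
 apply: (le_trans (ler_wpM2r (nc_ge0 _) (ec_taylor_k k t0 ht))).
 rewrite /b2 /b; have [_ j2 _ _] := jb_facts k.
 have j: k%:~R ^+ 2 <= jb k ^+ 2 :> R.
 by rewrite -(real_normK (num_real k%:~R)) lerXn2r ?nnegrE// (le_trans _ j2).
 have pp: 0 <= 22 / t * h ^+ 2 * nc (c k) by rewrite mulr_ge0// mulr_ge0.
 have := ler_wpM2l pp j; have : 0 <= 22 / t * h ^+ 2 * nc (c k) * jb k ^+ 2 by rewrite mulr_ge0.
 lra.
have := cderD (cderC 1 t) (cderZ 'i hz).
by apply: cder_eq; rewrite add0r.
Qed.

Lemma ec0 k : ec k 0 = 1.
by rewrite /ec /cy max_l// mulr0 /prof oppr0 expR0; case: ifP; rewrite ?mulr0 ?addr0 ?mulr1. Qed.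

Lemma Z0 x : Z 0 x = x +i* eta x.
have -> : Z 0 x = x%:C + 'i * (eta x)%:C.
 have E: Zc 0 = c by apply/funext => k; rewrite /Zc ec0 mul1r.
 by rewrite /Z E -heta mulr0 subr0.
by apply: cext; rewrite !reim/=; ring.
Qed.

Lemma ts_diff (bb : int -> R) B (u v : int -> R[i]) (x E: R) (e : int -> R) :
 (forall k, 0 <= bb k) -> l1 bb B -> (forall k, nc (u k) <= bb k) -> (forall k, nc (v k) <= bb k) ->
 (forall k, 0 <= e k) -> l1 e E -> (forall k, nc (u k - v k) <= e k) -> nc (ts u x - ts v x) <= E.
move=> bb0 hB hu hv e0 hE he.
have -> : ts u x - ts v x = ts (fun k=> u k + (-1) * v k) x by rewrite (ts_lin _ _ bb0 hB)//; ring.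
by apply: (nc_ts _ e0 hE) => k; rewrite mulN1r.
Qed.

Lemma L2 (K: R) : 0 <= K -> l1 (fun k=> K * (jb k ^+ 2 * nc (c k))) (K * C2).
by move=> K0; have := l1Z K hc; rewrite ger0_norm. Qed.

Lemma pos2 (K: R) k : 0 <= K -> 0 <= K * (jb k ^+ 2 * nc (c k)).
by move=> K0; rewrite mulr_ge0// mulr_ge0 ?nc_ge0. Qed.

Lemma k2_le k : k%:~R ^+ 2 <= jb k ^+ 2 :> R.
have [_ j2 _ _] := jb_facts k.
by rewrite -(real_normK (num_real k%:~R)) lerXn2r ?nnegrE// (le_trans _ j2).
Qed.

Definition eta1 (x: R) : R := cRe (ts (fun k=> 'i * k%:~R * c k) x).

Lemma eta1_coef k : nc ('i * k%:~R * c k) <= b k.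
rewrite ncM ncM nc_i mul1r nc_int /b mulrA ler_wpM2r//.
by have [_ j2 j3 _] := jb_facts k; have := sqr_ge0 (jb k: R); lra.
Qed.

Lemma eta_cder x : cder (fun x=> (eta x)%:C) x (ts (fun k=> 'i * k%:~R * c k) x).
have -> : (fun x=> (eta x)%:C) = ts c by apply/funext => y; rewrite heta.
exact: ts_der hc.
Qed.

Lemma eta1_der (x: R) : is_derive x 1 eta (eta1 x).
by have [h _] := eta_cder x. Qed.

Lemma eta1E x : ts (fun k=> 'i * k%:~R * c k) x = (eta1 x)%:C.
apply: cext=> //=; have [_ h] := eta_cder x.
exact: is_derive_uniq h (is_dC 0 x).
Qed.

Lemma Za0 x : Za 0 x = 1 +i* eta1 x.
have -> : Za 0 x = 1 + 'i * (eta1 x)%:C.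
 have E: Zac 0 = (fun k=> 'i * k%:~R * c k) by apply/funext => k; rewrite /Zac /Zc ec0 mul1r.
 by rewrite -eta1E /Za E.
by apply: cext; rewrite !reim/=; ring.
Qed.

Lemma eta1_bd x : `|eta1 x| <= C2.
apply: (le_trans (Re_le_nc _)); apply: (nc_ts _ _ hc) => k.
 by rewrite mulr_ge0.
rewrite ncM ncM nc_i mul1r nc_int ler_wpM2r//.
by have [_ j2 j3 _] := jb_facts k; apply: le_trans j3.
Qed.

Lemma eta_bd x : `|eta x| <= C2.
rewrite -nc_real heta; apply: (nc_ts _ _ hc) => k; first by rewrite mulr_ge0.
by rewrite ler_peMl//; have [_ _ _ ->] := jb_facts k.
Qed.

Lemma cy_pos k t : 0 <= t -> cy k t = `|k%:~R| * t.
by move=> t0; rewrite /cy max_l. Qed.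

Lemma Za_near t x : 0 <= t -> nc (Za t x - Za 0 x) <= 2 * t * C2.
move=> t0; have E: nc (Za t x - Za 0 x) = nc (ts (Zac t) x - ts (Zac 0) x).
 by rewrite /Za opprD addrACA subrr add0r -mulrBr ncM nc_i mul1r.
rewrite E; have k0: 0 <= 2 * t by rewrite mulr_ge0.
apply: (ts_diff _ bsurf0 bsurf1 (Zac_le t) (Zac_le 0) (fun k=> pos2 k k0) (L2 k0)) => k.
have -> : Zac t k - Zac 0 k = 'i * (k%:~R * (ec k t - 1)%:C * c k) by rewrite /Zac /Zc ec0 RCB; ring.
rewrite ncM nc_i mul1r ncM [nc (_%:~R * _)]ncM nc_int nc_real mulrA ler_wpM2r//.
have [h1 _ _] := ec_lip k t.
apply: (le_via (`|k%:~R| * (2 * (`|k%:~R| * t)))).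
 by rewrite ler_wpM2l//; apply: (le_trans h1); rewrite ler_wpM2l// -cy_pos// ge_min lexx orbT.
have := ler_wpM2l k0 (k2_le k); rewrite -(real_normK (num_real k%:~R)); lra.
Qed.

Lemma Za_low t x : 0 <= t -> 4 * t * C2 <= 1 -> 1 / 2 <= nc (Za t x).
move=> t0 ht; have := Za_near x t0; have : 1 <= nc (Za 0 x).
 by rewrite Za0; have := Re_le_nc (1 +i* eta1 x); rewrite /= normr1.
move=> h1 h2; have := ncB (Za t x) (Za t x - Za 0 x); rewrite subKr => h3.
apply: (le_via (nc (Za 0 x) - nc (Za t x - Za 0 x))); last by rewrite lerBlDr.
apply: (le_via (1 - 2 * t * C2)); last exact: lerB.
clear h1 h2 h3; have : 4 * t * C2 = 2 * (2 * t * C2) by ring.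
move: ht; set u := 4 * t * C2; set v := 2 * t * C2; move: u v => u v; lra.
Qed.

Lemma nu_bd t x : 0 <= t -> nc (nu t x) <= 4 * t * C2.
move=> t0; have k0: 0 <= 4 * t by rewrite mulr_ge0.
apply: (nc_ts _ (fun k=> pos2 k k0) (L2 k0)) => k; apply: (le_trans (nuc_le t k)).
rewrite mulrA ler_wpM2r//.
apply: (le_via (4 * `|k%:~R| * (`|k%:~R| * t))).
 by rewrite ler_wpM2l ?mulr_ge0// -cy_pos// ge_min lexx orbT.
have := ler_wpM2l k0 (k2_le k); rewrite -(real_normK (num_real k%:~R)); lra.
Qed.

(** Both profiles have slope [sgn k] at 0, so the first order term [i t] times the sum of
    [k c_k e^{ikx}] is the real number [t eta']: the collar leaves the surface along the inner
    normal [(eta', -1)]. *)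
Lemma Z_expand t x : 0 <= t ->
 nc (Z t x - ((x +i* eta x) + (t * eta1 x)%:C - 'i * t%:C)) <= 3 * t ^+ 2 * C2.
move=> t0; have k0: 0 <= 3 * t ^+ 2 by rewrite mulr_ge0// sqr_ge0.
have ii := @mulii R.
have bb0 k : 0 <= (1 + t) * b k by rewrite mulr_ge0 ?bsurf0// addr_ge0.
have bb1: l1 (fun k=> (1 + t) * b k) ((1 + t) * (4 * C2)).
 by have := l1Z (1 + t) bsurf1; rewrite ger0_norm// addr_ge0.
have -> : Z t x - ((x +i* eta x) + (t * eta1 x)%:C - 'i * t%:C) =
 'i * (ts (Zc t) x - ts (fun k=> c k + (- ('i * t%:C)) * ('i * k%:~R * c k)) x).
 have cb k : nc (c k) <= b k.
 rewrite /b mulrA ler_peMl//; have [_ _ _] := jb_facts k; lra.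
 rewrite (ts_lin _ _ bsurf0 bsurf1)//; last exact: eta1_coef.
 rewrite eta1E -heta /Z RCM.
 have -> : x +i* eta x = x%:C + 'i * (eta x)%:C.
 by apply: cext; rewrite !reim/=; ring.
 have -> : 'i * (ts (Zc t) x - ((eta x)%:C + - ('i * t%:C) * (eta1 x)%:C)) =
 'i * ts (Zc t) x - 'i * (eta x)%:C + ('i * 'i) * t%:C * (eta1 x)%:C by ring.
 rewrite ii; ring.
rewrite ncM nc_i mul1r.
apply: (ts_diff _ bb0 bb1 _ _ (fun k=> pos2 k k0) (L2 k0)) => k.
- by apply: (le_trans (Zc_le t k)); rewrite ler_peMl ?bsurf0// lerDl.
- have -> : c k + - ('i * t%:C) * ('i * k%:~R * c k) = c k - ('i * 'i) * t%:C * k%:~R * c k by ring.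
 have -> : c k - ('i * 'i) * t%:C * k%:~R * c k = (1 + t * k%:~R)%:C * c k.
 rewrite ii rmorphD rmorphM/= rmorph_int rmorph1; ring.
 rewrite ncM nc_real /b mulrA mulrA ler_wpM2r//.
 have [j1 j2 j3 j4] := jb_facts k.
 apply: (le_trans (ler_normD _ _)); rewrite normr1 normrM (ger0_norm t0).
 have : t * `|k%:~R| <= t * jb k ^+ 2 by rewrite ler_wpM2l//; apply: le_trans j3.
 have : 0 <= t * jb k ^+ 2 by rewrite mulr_ge0.
 lra.
have -> : Zc t k - (c k + - ('i * t%:C) * ('i * k%:~R * c k)) =
 (ec k t)%:C * c k - c k + ('i * 'i) * t%:C * k%:~R * c k by rewrite /Zc; ring.
have -> : (ec k t)%:C * c k - c k + ('i * 'i) * t%:C * k%:~R * c k = (ec k t - 1 - t * k%:~R)%:C * c k.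
 by rewrite ii !RCB (RCM t) RCint; ring.
rewrite ncM nc_real mulrA ler_wpM2r//.
have -> : ec k t - 1 - t * k%:~R = prof (0 < k) (cy k t) - 1 - cy k t * psgn (0 < k).
 by rewrite /ec cy_pos//; have := psgn_k k; set a := `|_| => <-; ring.
apply: (le_trans (prof_taylor0 _ (cy_ge0 k t))); rewrite cy_pos// exprMn.
have := ler_wpM2l k0 (k2_le k); rewrite -(real_normK (num_real k%:~R)); lra.
Qed.

Lemma eta_taylor x h : `|eta (x + h) - eta x - h * eta1 x| <= 4 * h ^+ 2 * C2.
have bb0 k : 0 <= (1 + `|h|) * b k by rewrite mulr_ge0 ?bsurf0// addr_ge0.
have bb1: l1 (fun k=> (1 + `|h|) * b k) ((1 + `|h|) * (4 * C2)).
 have p: 0 <= 1 + `|h| by rewrite addr_ge0.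
 by have := l1Z (1 + `|h|) bsurf1; rewrite (ger0_norm p).
have k0: 0 <= 4 * h ^+ 2 by rewrite mulr_ge0// sqr_ge0.
have cb k : nc (c k) <= b k.
 rewrite /b mulrA ler_peMl//; have [_ _ _] := jb_facts k; lra.
have -> : `|eta (x + h) - eta x - h * eta1 x| =
 nc (ts (fun k=> c k * expi (k%:~R * h)) x - ts (fun k=> c k + h%:C * ('i * k%:~R * c k)) x).
 rewrite (ts_lin _ _ bsurf0 bsurf1)//; last exact: eta1_coef.
 rewrite eta1E -heta.
 have -> : ts (fun k=> c k * expi (k%:~R * h)) x = (eta (x + h))%:C.
 by rewrite heta ts_shift.
 have E: (eta (x + h) - eta x - h * eta1 x)%:C = (eta (x + h))%:C - ((eta x)%:C + h%:C * (eta1 x)%:C) :> R[i].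
 rewrite (RCB (eta (x + h) - eta x)) (RCB (eta (x + h))) (RCM h) opprD addrA.
 by [].
 by rewrite -nc_real E.
apply: (ts_diff _ bb0 bb1 _ _ (fun k=> pos2 k k0) (L2 k0)) => k.
- rewrite ncM nc_expi mulr1; apply: (le_trans (cb k)); rewrite ler_peMl ?bsurf0// lerDl//.
- apply: (le_trans (ncD _ _)); rewrite ncM nc_real mulrDl mul1r; apply: lerD=> //.
 by rewrite ler_wpM2l// eta1_coef.
have -> : c k * expi (k%:~R * h) - (c k + h%:C * ('i * k%:~R * c k)) =
 (expi (k%:~R * h) - 1 - (k%:~R * h)%:C * 'i) * c k by rewrite (RCM k%:~R) RCint; ring.
rewrite ncM mulrA ler_wpM2r//.
have := expi_taylor 0 (k%:~R * h); rewrite add0r expi0 mulr1 => H.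
apply: (le_trans H); rewrite exprMn; have := ler_wpM2l k0 (k2_le k); lra.
Qed.

(** The third condition keeps [|Z_x| >= 1 / 2] in the collar; the fourth makes the quadratic errors
    in [Z_depth] at most [t / 2]. *)
Definition dlt_ok (d: R) : Prop :=
 [/\ 0 < d, d <= 1, 4 * d * C2 <= 1 & d * (3 * C2 * (1 + C2) + 64 * C2 ^+ 3) <= 1 / 2].

Lemma Z_coord t x : 0 <= t -> exists e1 e2 : R,
 [/\ cRe (Z t x) = x + t * eta1 x + e1, cIm (Z t x) = eta x - t + e2,
 `|e1| <= 3 * t ^+ 2 * C2 & `|e2| <= 3 * t ^+ 2 * C2].
move=> t0; have := Z_expand x t0; set E := _ - _ => hE.
have ER: cRe E = cRe (Z t x) - (x + t * eta1 x).
 by rewrite /E !reim/=; ring.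
have EI: cIm E = cIm (Z t x) - (eta x - t).
 by rewrite /E !reim/=; ring.
exists (cRe E), (cIm E); split.
- by rewrite ER; ring.
- by rewrite EI; ring.
- exact: le_trans (Re_le_nc _) hE.
exact: le_trans (Im_le_nc _) hE.
Qed.

(** To first order the depth is [t (1 + eta'^2) >= t]; the remainder is quadratic in [t] and costs
    at most [t / 2]. *)
Lemma Z_depth d t x : dlt_ok d -> 0 < t -> t <= d ->
 t / 2 <= eta (cRe (Z t x)) - cIm (Z t x).
move=> [d0 d1 _ hd] t0 td; have C0 := C2_ge0.
have [e1 [e2 [-> -> h1 h2]]] := Z_coord x (ltW t0).
set m := t * eta1 x + e1; rewrite -(addrA x) -/m.
have := eta_taylor x m; rewrite ler_norml => /andP[h3 _].
have t1: t <= 1 by exact: le_trans d1.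
set E := 3 * t ^+ 2 * C2 in h1 h2.
have E0: 0 <= E by rewrite mulr_ge0// mulr_ge0// sqr_ge0.
have tt: t ^+ 2 <= t by rewrite expr2 ler_piMl// ltW.
have Et: E <= 3 * t * C2 by rewrite /E ler_wpM2r// ler_wpM2l.
have ne := eta1_bd x.
have bm: `|m| <= 4 * (t * C2).
 apply: (le_trans (ler_normD _ _)); rewrite normrM (gtr0_norm t0).
 have : t * `|eta1 x| <= t * C2 by rewrite ler_wpM2l// ltW.
 lra.
have m2: m ^+ 2 <= 16 * (t ^+ 2 * C2 ^+ 2).
 rewrite -(real_normK (num_real m)); have -> : 16 * (t ^+ 2 * C2 ^+ 2) = (4 * (t * C2)) ^+ 2 by ring.
 by rewrite lerXn2r ?nnegrE// mulr_ge0// mulr_ge0// ltW.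
have q1: 0 <= t * eta1 x ^+ 2 by rewrite mulr_ge0// ltW.
have q2: - (E * C2) <= e1 * eta1 x.
 have : `|e1 * eta1 x| <= E * C2 by rewrite normrM ler_pM.
 by rewrite ler_norml => /andP[].
have q3: 4 * m ^+ 2 * C2 <= 64 * (t ^+ 2 * C2 ^+ 3).
 have := ler_wpM2r C0 m2; have -> : C2 ^+ 3 = C2 ^+ 2 * C2 by rewrite exprSr.
 lra.
have q4: t ^+ 2 * (3 * C2 * (1 + C2) + 64 * C2 ^+ 3) <= t / 2.
 rewrite expr2 -mulrA ler_wpM2l ?(ltW t0)//; rewrite -[leRHS]mul1r.
 apply: le_trans hd; rewrite ler_wpM2r// addr_ge0//.
 by rewrite mulr_ge0 ?mulr_ge0 ?addr_ge0.
 by rewrite mulr_ge0// exprn_ge0.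
move: h2; rewrite ler_norml => /andP[_ h2].
have q5: m * eta1 x = t * eta1 x ^+ 2 + e1 * eta1 x by rewrite /m; ring.
rewrite /E in q2 h2 Et; lra.
Qed.

Lemma Z_close t x : 0 <= t -> t <= 1 ->
 `|cRe (Z t x) - x| <= 4 * t * C2 /\ `|cIm (Z t x) - eta x| <= t * (1 + 3 * C2).
move=> t0 t1; have C0 := C2_ge0.
have [e1 [e2 [-> -> h1 h2]]] := Z_coord x t0.
have tt: 3 * t ^+ 2 * C2 <= 3 * t * C2.
 by rewrite ler_wpM2r// ler_wpM2l// expr2 ler_piMl.
split.
 have -> : x + t * eta1 x + e1 - x = t * eta1 x + e1 by ring.
 apply: (le_trans (ler_normD _ _)); rewrite normrM (ger0_norm t0).
 have : t * `|eta1 x| <= t * C2 by rewrite ler_wpM2l// eta1_bd.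
 lra.
have -> : eta x - t + e2 - eta x = e2 - t by ring.
by apply: (le_trans (ler_normB _ _)); rewrite (ger0_norm t0); lra.
Qed.

(* Lipschitz bound in terms of the chord of the circle. *)
Lemma eta_chord x y : `|eta x - eta y| <= C2 * nc (1 - expi (x - y)).
have expik_chord (k: int) (s: R) : nc (expi (k%:~R * s) - 1) <= `|k%:~R| * nc (1 - expi s).
 have nat_case (n: nat) : nc (expi (n%:R * s) - 1) <= n%:R * nc (1 - expi s).
 elim: n => [|n IH]; first by rewrite !mul0r expi0 subrr nc0.
 have -> : expi (n.+1%:R * s) - 1 = expi s * (expi (n%:R * s) - 1) - (1 - expi s).
 by rewrite -addn1 natrD mulrDl mul1r expiD; ring.
 apply: (le_trans (ncB _ _)); rewrite ncM nc_expi mul1r.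
 by rewrite -addn1 natrD mulrDl mul1r lerD2r.
 case: k => n; first by rewrite -[_%:~R]/(n%:R) ger0_norm.
 have E (a: R) : nc (cj (expi a) - 1) = nc (expi a - 1).
 by rewrite -[LHS]ncJ; congr nc; apply: cext; rewrite ?(ReJ, ImJ, ReD, ReN, ImD, ImN)/=; ring.
 rewrite NegzE rmorphN/= normrN mulNr expiN E.
 by rewrite ger0_norm//; exact: nat_case.
have cb k : nc (c k) <= b k.
 rewrite /b mulrA ler_peMl//; have [_ _ _] := jb_facts k; lra.
rewrite -nc_real RCB 2!heta; have -> : x = y + (x - y) by ring.
rewrite -ts_shift [y + _ - y]addrAC subrr add0r mulrC; set s := x - y.
have n0 := nc_ge0 (1 - expi s).
have h1 := l1Z (nc (1 - expi s)) hc; rewrite (ger0_norm n0) in h1.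
apply: (ts_diff _ bsurf0 bsurf1 _ cb _ h1) => k.
- by rewrite ncM nc_expi mulr1.
- by rewrite mulr_ge0// mulr_ge0.
have -> : c k * expi (k%:~R * s) - c k = (expi (k%:~R * s) - 1) * c k by ring.
rewrite ncM mulrA ler_wpM2r//; apply: (le_trans (expik_chord k s)).
rewrite mulrC ler_wpM2l//; have [_ j2 j3 _] := jb_facts k; exact: le_trans j3.
Qed.

End Surface.

End Collar.

(** * Graphs given by Fourier series with summable second derivative *)

Section Curves.
Context {R : realType}.
Implicit Types (t x h: R).
Variables (g : R -> R) (c : int -> R[i]) (C2: R).
Hypothesis hc : l1 (fun k=> jb k ^+ 2 * nc (c k)) C2.
Hypothesis hg : forall x, (g x)%:C = ts c x.

Lemma curve_per : periodic g tau.
move=> x; have : (g (x + tau))%:C = (g x)%:C :> R[i] by rewrite !hg ts_per.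
by case.
Qed.

Lemma curve_cont : continuous g.
by move=> x; exact: (is_dcont (eta1_der hc hg x)). Qed.

Lemma ccont_ts_eta1 : ccont (ts (fun k=> 'i * k%:~R * c k)).
exact: (ccont_ts (bsurf0 c) (bsurf1 hc) (@eta1_coef _ c)). Qed.

Lemma eta1_cont : continuous (eta1 c).
by have [] := ccont_ts_eta1. Qed.

Lemma eta1_per : periodic (eta1 c) tau.
by move=> x; rewrite /eta1 ts_per. Qed.

Lemma curve_lip (x y: R) : `|g x - g y| <= C2 * `|x - y|.
apply: (mvt_lip (p' := eta1 c)) => w _; [exact: (eta1_der hc hg)|exact: (eta1_bd hc)].
Qed.

Lemma nc_1i (a C: R) : `|a| <= C -> nc (1 +i* a) <= 1 + C.
by move=> h; apply: (le_trans (nc_le_ReIm _)); rewrite /= normr1 lerD2l. Qed.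

Lemma kern_bd z x (H D: R) : `|g x - cIm z| <= H -> 0 < D ->
 D <= `|g (cRe z) - cIm z| ->
 nc ((1 - cE (x +i* g x - z))^-1 * (1 +i* eta1 c x)) <= (2 * C2 + expR H) * (1 + C2) / D.
move=> hH D0 hD; have C0 := C2_ge0 hc.
have hk := le_trans hD (graph_kernel (eta_chord hc hg x _) C0 hH).
have E0: 0 < 2 * C2 + expR H by rewrite ltr_wpDl ?expR_gt0// mulr_ge0.
set N := nc (1 - cE _) in hk *.
have N0: 0 < N by move: (lt_le_trans D0 hk); rewrite pmulr_rgt0.
rewrite ncM ncV mulrAC; apply: ler_pM; rewrite ?invr_ge0//; last exact: nc_1i (eta1_bd hc x).
by rewrite ler_pdivlMr// mulrC ler_pdivrMr.
Qed.

End Curves.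

(** * The holomorphic function in the collar: uniform bounds and mode equations *)

Section Base.
Context {R : realType}.
Implicit Types (t x: R).
Variables (eta b : R -> R) (c cb : int -> R[i]) (C2 h0 d S: R) (f f1 : R[i] -> R[i]).
Hypothesis (hc : l1 (fun k=> jb k ^+ 2 * nc (c k)) C2) (heta : forall x, (eta x)%:C = ts c x).
Hypothesis (hcb : l1 (fun k=> jb k ^+ 2 * nc (cb k)) C2) (hb : forall x, (b x)%:C = ts cb x).
Hypothesis (h00 : 0 < h0) (gap : forall x, h0 <= eta x - b x).
Hypothesis (hd : dlt_ok C2 d) (hd2 : d * (1 + 3 * C2 + 4 * C2 ^+ 2) <= h0 / 2).
Hypothesis (hf : hstrip b eta f f1) (S0 : 0 < S).
Hypothesis hS : itor (fun x=> nc (f (x +i* b x)) ^+ 2) + itor (fun x=> nc (f (x +i* eta x)) ^+ 2) <= S ^+ 2.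

Local Notation Z := (Z c).
Local Notation Za := (Za c).
Local Notation Ztc := (Zt c).
Local Notation Zat := (Zat c).
Local Notation nu := (nu c).

Let C0 : 0 <= C2 := C2_ge0 hc.
Hint Resolve C0 : core.

Lemma gap_lt x : b x < eta x.
by rewrite -subr_gt0; exact: lt_le_trans (gap x). Qed.

Lemma d_pos : 0 < d. by have [] := hd. Qed.

(** By [hd2] the descent of the collar, including the variation of the bottom over its horizontal
    displacement, uses at most half of the gap. *)
Lemma Z_bottom t x : 0 <= t -> t <= d ->
 h0 / 2 <= cIm (Z t x) - b (cRe (Z t x)) /\ t <= h0 / 2.
move=> t0 td; have [d0 d1 _ _] := hd.
have [h1] := Z_close hc heta x t0 (le_trans td d1).
rewrite ler_norml => /andP[h2 _].
have h3 := curve_lip hcb hb (cRe (Z t x)) x.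
have h4: b (cRe (Z t x)) - b x <= 4 * C2 ^+ 2 * t.
 apply: (le_trans (ler_norm _)); apply: (le_trans h3).
 by rewrite [leRHS](_ : _ = C2 * (4 * t * C2)); [rewrite ler_wpM2l|ring].
have h5: t * (1 + 3 * C2 + 4 * C2 ^+ 2) <= h0 / 2.
 apply: le_trans hd2; rewrite ler_wpM2r// addr_ge0 ?mulr_ge0//.
 by rewrite addr_ge0// mulr_ge0.
have h6 := gap x; split.
 move: h2 h4 h5 h6; have -> : 4 * C2 ^+ 2 * t = t * (4 * C2 ^+ 2) by ring.
 rewrite !mulrDr; set u := t * (4 * _); set v := t * (3 * _); move: u v => u v; lra.
apply: le_trans h5; rewrite -[leLHS]mulr1 ler_wpM2l//.
by rewrite -addrA lerDl addr_ge0 ?mulr_ge0.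
Qed.

Lemma Z_in t x : 0 < t -> t <= d ->
 [/\ t / 2 <= eta (cRe (Z t x)) - cIm (Z t x),
 t / 2 <= cIm (Z t x) - b (cRe (Z t x)) & instrip b eta (Z t x)].
move=> t0 td; have h1 := Z_depth hc heta x hd t0 td.
have [h2 h3] := Z_bottom x (ltW t0) td.
have h4: t / 2 <= cIm (Z t x) - b (cRe (Z t x)).
 by apply: le_trans h2; rewrite ler_pdivrMr// divfK//; lra.
have t2: 0 < t / 2 by rewrite divr_gt0.
by split=> //; apply/andP; split; rewrite -subr_gt0; [exact: lt_le_trans h4|exact: lt_le_trans h1].
Qed.

(** Bounds the vertical distance from [Z t x] to any point of the two boundaries: [2 C2] between
    boundary heights, [1 + 3 C2] for the displacement along the collar. *)
Definition Hc : R := 1 + 5 * C2.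
Definition K1 : R := 2 * (2 * C2 + expR Hc) * (1 + C2) * (1 + tau).

Lemma eK : 0 < 2 * C2 + expR Hc.
by rewrite ltr_wpDl ?expR_gt0// mulr_ge0. Qed.

Lemma K1_ge0 : 0 <= K1.
by rewrite mulr_ge0 ?mulr_ge0 ?(ltW eK)// ?addr_ge0// ltW// twopi_gt0. Qed.

(** Both boundaries stay at vertical distance [t / 2], so the kernels are [O(1 / t)]. The blow-up at
    the surface is compensated later by [nu = O(t)]. *)
Lemma fZ_bd t x : 0 < t -> t <= d -> nc (f (Z t x)) <= K1 / t * S.
move=> t0 td; have [h1 h2 h3] := Z_in x t0 td.
have t2: 0 < t / 2 by rewrite divr_gt0.
have [d0 d1 _ _] := hd; have t1 := le_trans td d1.
pose k : R := (2 * C2 + expR Hc) * (1 + C2) / (t / 2).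
have hI (g : R -> R) y : `|g y| <= C2 -> `|g y - cIm (Z t x)| <= Hc.
 move=> hg; have [_ h] := Z_close hc heta x (ltW t0) t1.
 have -> : g y - cIm (Z t x) = g y - eta x - (cIm (Z t x) - eta x) by ring.
 apply: (le_trans (ler_normB _ _)); apply: (le_trans (lerD (ler_normB _ _) h)).
 have : t * (1 + 3 * C2) <= 1 + 3 * C2 by rewrite ler_piMl// addr_ge0// mulr_ge0.
 by have := eta_bd hc heta x; rewrite /Hc; lra.
have k1: 1 <= k.
 rewrite /k ler_pdivlMr// mul1r; apply: (le_via 1); first by rewrite ler_pdivrMr//; lra.
 rewrite -[leLHS]mulr1 ler_pM//; last by rewrite lerDl.
 have := expR_ge1Dx Hc; have : 0 <= Hc by rewrite addr_ge0// mulr_ge0.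
 move=> q1 q2; apply: (le_trans _ (le_trans q2 _)); first by rewrite lerDl.
 by rewrite lerDr mulr_ge0.
have H := point_bound hf (eta1_der hcb hb) (eta1_der hc heta) (eta1_cont hcb)
 (eta1_cont hc) (curve_per hb) (curve_per heta) gap_lt h3 S0 k1 hS _ _.
have -> : K1 / t * S = k * S * (1 + tau).
 by rewrite /K1 /k; move: tau => p; field; rewrite ?gt_eqF.
apply: H => y.
- apply: (kern_bd hcb hb)=> //; first by apply: hI; exact: (eta_bd hcb hb).
 by apply: (le_trans h2); rewrite distrC ler_norm.
apply: (kern_bd hc heta)=> //; first by apply: hI; exact: (eta_bd hc heta).
by apply: (le_trans h1); rewrite ler_norm.
Qed.

Lemma ccat_fZ (p : R * R) : ccat (fun p : R * R => f (Z p.1 p.2)) p.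
by apply: ccat_comp; [apply: ccont_at; exact: ccont_Z hc|exact: hs_cat hf _]. Qed.

Lemma ccont_fZ t : ccont (fun x=> f (Z t x)).
by apply: (ccat_sec2 (A := fun t x => f (Z t x))) => p; exact: ccat_fZ. Qed.

Lemma fZ_per t : periodic (fun x=> f (Z t x)) tau.
by move=> x; rewrite Z_per (hs_per hf). Qed.

Lemma ccat_f1Z t x : 0 < t -> t <= d -> ccat (fun p : R * R => f1 (Z p.1 p.2)) (t, x).
move=> t0 td; have [_ _ h] := Z_in x t0 td.
apply: (@ccat_comp _ _ (unc Z)); last exact: hs_cat1 hf _ h.
by apply: ccont_at; exact: ccont_Z hc.
Qed.

Lemma sec_ccont (A : R -> R -> R[i]) t : ccont (unc A) -> ccont (A t).
by move=> h; apply: ccat_sec2 => p; exact: ccont_at. Qed.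

Lemma ccont_Zs t : ccont (Z t). by apply: sec_ccont; exact: ccont_Z hc. Qed.
Lemma ccont_Zas t : ccont (Za t). by apply: sec_ccont; exact: ccont_Za hc. Qed.
Lemma ccont_Zts t : ccont (Ztc t). by apply: sec_ccont; exact: ccont_Zt hc. Qed.
Lemma ccont_nus t : ccont (nu t). by apply: sec_ccont; exact: ccont_nu hc. Qed.
Lemma ccont_Zats t : ccont (Zat t). by apply: sec_ccont; exact: ccont_Zat hc. Qed.

Lemma ccont_f1Z t : 0 < t -> t <= d -> ccont (fun x=> f1 (Z t x)).
move=> t0 td; apply: ccontP => x; have [_ _ h] := Z_in x t0 td.
by apply: ccat_comp; [apply: ccont_at; exact: ccont_Zs|exact: hs_cat1 hf _ h].
Qed.

Lemma cder_fZx t x : 0 < t -> t <= d -> cder (fun x=> f (Z t x)) x (f1 (Z t x) * Za t x).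
move=> t0 td; have [_ _ h] := Z_in x t0 td.
by apply: cder_chain; [exact: cder_Zx hc t x|exact: hs_diff hf _ h].
Qed.

Lemma cder_fZt t x : 0 < t -> t <= d -> cder (fun t=> f (Z t x)) t (f1 (Z t x) * Ztc t x).
move=> t0 td; have [_ _ h] := Z_in x t0 td.
by apply: cder_chain; [exact: cder_Zt hc t x t0|exact: hs_diff hf _ h].
Qed.

Lemma fc_fZx t n : 0 < t -> t <= d ->
 fc (fun x=> f1 (Z t x) * Za t x) n = 'i * (n%:~R * fc (fun x=> f (Z t x)) n).
move=> t0 td; rewrite /fc; rewrite (fourier_der (u := fun x=> f (Z t x))).
- by move: (fourier _ _) => u; ring.
- by apply: ccontM; [exact: ccont_f1Z|exact: ccont_Zas].
- by move=> x; exact: cder_fZx.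
by rewrite -{1}[tau]add0r (fZ_per t 0).
Qed.

(** [f (Z) Z_x] comes from the closed form [f dz]: its [t]-derivative is an [x]-derivative in which
    the defect [nu] multiplies [f] itself. So [om] can be bounded before anything is known of the
    derivative of [f]; the quantity to be bootstrapped is [wc]. *)
Definition om t n : R[i] := fc (fun x=> f (Z t x) * Za t x) n.
Definition wc t n : R[i] := fc (fun x=> f (Z t x)) n.

Lemma fc_citor u n : fc u n = (tau^-1)%:C * citor (fun x=> u x * expi (- (n%:~R * x))) :> R[i].
by rewrite /fc fourierE. Qed.

Lemma cder_fc (A D : R -> R -> R[i]) t n (r: R) : 0 < r ->
 (forall s x, `|s - t| < r -> cder (A^~ x) s (D s x)) ->
 (forall x, ccat (unc D) (t, x)) ->
 (forall s, `|s - t| < r -> ccont (A s)) -> ccont (D t) ->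
 cder (fun s=> fc (A s) n) t (fc (D t) n).
move=> r0 hA hD cA cD; rewrite fc_citor.
rewrite (_ : (fun s=> _) = (fun s=> (tau^-1)%:C * citor (fun x=> A s x * expi (- (n%:~R * x))))); last first.
 by apply/funext => s; rewrite fc_citor.
apply: cderZ.
have ce: ccont (fun x : R => expi (- (n%:~R * x)) : R[i]).
 by apply: ccont_expi; apply: contN; apply: contM; [exact: contC|exact: contI].
apply: (@cder_citor _ (fun s x => A s x * expi (- (n%:~R * x))) (fun s x => D s x * expi (- (n%:~R * x))) t r r0).
- move=> s x hs; have := cderM (hA s x hs) (cderC (expi (- (n%:~R * x))) s).
 by apply: cder_eq; rewrite mulr0 addr0.
- by move=> x; apply: ccatM; [exact: hD|exact: (@ccat_comp2 _ _ _ (fun x=> expi (- (n%:~R * x))))].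
- by move=> s hs; apply: ccontM; [exact: cA|].
by apply: ccontM.
Qed.

Lemma ccat_fc (A : R -> R -> R[i]) t n :
 (forall p : R * R, ccat (unc A) p) -> ccat (fun s=> fc (A s) n) t.
move=> hA.
rewrite (_ : (fun s=> _) = (fun s=> (tau^-1)%:C * citor (fun x=> A s x * expi (- (n%:~R * x))))); last first.
 by apply/funext => s; rewrite fc_citor.
have ce: ccont (fun x : R => expi (- (n%:~R * x)) : R[i]).
 by apply: ccont_expi; apply: contN; apply: contM; [exact: contC|exact: contI].
apply: ccatM; first exact: ccatC.
apply: (ccat_citor (A := fun s x => A s x * expi (- (n%:~R * x)))) => [x|s].
 by apply: ccatM; [exact: hA|exact: (@ccat_comp2 _ _ _ (fun x=> expi (- (n%:~R * x))))].
by apply: ccontM; [exact: ccat_sec2|].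
Qed.

(* Both derivatives of [f (Z t x)] are expressed through [f1]; the tangential
 one is traded for [i n] on the Fourier side. *)
Lemma om_der t n : 0 < t < d ->
 cder (om^~ n) t (n%:~R * om t n + 'i * n%:~R * fc (fun x=> f (Z t x) * nu t x) n).
move=> /andP[t0 td].
pose D t x := f1 (Z t x) * Ztc t x * Za t x + f (Z t x) * Zat t x.
have r0: 0 < minr t (d - t) by rewrite lt_min t0 subr_gt0.
have hr s : `|s - t| < minr t (d - t) -> 0 < s <= d.
 by rewrite lt_min => /andP[]; rewrite !ltr_norml => /andP[h1 _] /andP[_ h2]; apply/andP; split; lra.
have cD s : 0 < s <= d -> ccont (D s).
 move=> /andP[s0 sd]; apply: ccontD; last by apply: ccontM; [exact: ccont_fZ|exact: ccont_Zats].
 apply: ccontM; last exact: ccont_Zas.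
 by apply: ccontM; [exact: ccont_f1Z|exact: ccont_Zts].
have tt: 0 < t <= d by rewrite t0 ltW.
have H: cder (om^~ n) t (fc (D t) n).
 apply: (cder_fc (A := fun t x => f (Z t x) * Za t x) n r0).
 - move=> s1 x hs1; have /andP[s0 sd] := hr _ hs1.
 exact: (cder_eq _ (cderM (cder_fZt x s0 sd) (cder_Zat hc x s0))).
 - move=> x; apply: ccatD; apply: ccatM.
 + apply: ccatM; first by apply: ccat_f1Z=> //; exact: ltW.
 by apply: ccont_at; exact: ccont_Zt hc.
 + by apply: ccont_at; exact: ccont_Za hc.
 + exact: ccat_fZ.
 + by apply: ccont_at; exact: ccont_Zat hc.
 - by move=> s _; apply: ccontM; [exact: ccont_fZ|exact: ccont_Zas].
 - exact: cD.
apply: cder_eq H.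
have E1: fc (D t) n = 'i * (n%:~R * fc (fun x=> f (Z t x) * Ztc t x) n).
 rewrite /fc (fourier_der (u := fun x=> f (Z t x) * Ztc t x)).
 - by move: (fourier _ _) => u; ring.
 - exact: cD.
 - move=> x; apply: (cder_eq _ (cderM (cder_fZx x t0 (ltW td)) (cder_Ztx hc x t0))).
 by rewrite /D; ring.
 - have Zt_per: periodic (Ztc t) tau by move=> x; rewrite /Zt ts_per.
 by rewrite -[tau]add0r (fZ_per t 0) (Zt_per 0).
rewrite E1 (_ : (fun x=> f (Z t x) * Ztc t x) = (fun x=> f (Z t x) * nu t x - 'i * (f (Z t x) * Za t x))); last first.
 by apply/funext => x; rewrite (nuE hc); ring.
have c1: ccont (fun x=> f (Z t x) * nu t x) by apply: ccontM; [exact: ccont_fZ|exact: ccont_nus].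
have c2: ccont (fun x=> f (Z t x) * Za t x) by apply: ccontM; [exact: ccont_fZ|exact: ccont_Zas].
rewrite fcB//; last by apply: ccontM; [exact: ccontC|].
have -> : fc (fun x=> 'i * (f (Z t x) * Za t x)) n = 'i * om t n.
 by rewrite /om /fc fourierZ// mulrCA.
have ii := @mulii R.
have -> : 'i * (n%:~R * (fc (fun x=> f (Z t x) * nu t x) n - 'i * om t n)) =
 'i * n%:~R * fc (fun x=> f (Z t x) * nu t x) n - ('i * 'i) * (n%:~R * om t n) by ring.
rewrite ii; ring.
Qed.

(** The summands are the surface data, the data at depth [d] and the forcing, namely four times the
    bound of [fnu_bd]. *)
Definition K2 : R := (1 + C2) + K1 / d * (1 + 4 * C2) + 16 * K1 * C2.

Lemma K2_terms : [/\ 0 <= K1 / d * (1 + 4 * C2), 0 <= 16 * K1 * C2, 0 <= K2 & 1 <= K2].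
have h1: 0 <= K1 / d * (1 + 4 * C2).
 have hk: 0 <= K1 / d by rewrite divr_ge0 ?K1_ge0// ltW// d_pos.
 by rewrite mulr_ge0// addr_ge0// mulr_ge0.
have h2: 0 <= 16 * K1 * C2 by have h := K1_ge0; rewrite mulr_ge0// mulr_ge0.
have h3: 1 <= K2 by rewrite /K2 -!addrA lerDl !addr_ge0.
by split=> //; rewrite (le_trans _ h3).
Qed.

Lemma nc_fc_l2 u n (M: R) : 0 <= M -> ccont u -> itor (fun x=> nc (u x) ^+ 2) <= M ^+ 2 -> nc (fc u n) <= M.
move=> M0 cu hu; have tp := @twopi_gt0 R; have := bessel [fset n]%fset cu; rewrite big_seq_fset1 => h.
have : nc (fc u n) ^+ 2 <= M ^+ 2.
 rewrite /fc nc_2piV exprMn; apply: (le_trans (ler_wpM2l (sqr_ge0 _) h)).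
 rewrite mulrA (_ : _ ^+ 2 * tau = tau^-1); last first.
 by rewrite expr2 -mulrA mulVf ?mulr1// gt_eqF.
 rewrite ler_pdivrMl//; apply: (le_trans hu); rewrite ler_peMl//.
 have := @pi_ge2 R; lra.
by rewrite ler_pXn2r// nnegrE nc_ge0.
Qed.

Lemma W_l2 : itor (fun x=> nc (f (x +i* eta x)) ^+ 2) <= S ^+ 2.
by apply: le_trans hS; rewrite lerDr itor_ge0// => x; rewrite sqr_ge0. Qed.

Lemma Za_up t x : 0 <= t -> t <= d -> nc (Za t x) <= 1 + 4 * C2.
move=> t0 td; have [d0 d1 _ _] := hd.
rewrite -(subrK (Za 0 x) (Za t x)); apply: (le_trans (ncD _ _)).
have := Za_near hc x t0; rewrite (Za0 hc heta); have := nc_1i (eta1_bd hc x).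
have : 2 * t * C2 <= 2 * C2 by rewrite ler_wpM2r// -[leRHS]mulr1 ler_wpM2l//; exact: le_trans d1.
have := C0; lra.
Qed.

Lemma om0_bd n : nc (om 0 n) <= (1 + C2) * S.
have c1: 0 <= 1 + C2 by rewrite addr_ge0.
apply: nc_fc_l2; first by rewrite mulr_ge0// ltW.
 by apply: ccontM; [exact: ccont_fZ|exact: ccont_Zas].
rewrite exprMn; apply: (le_via (itor (fun x=> (1 + C2) ^+ 2 * nc (f (x +i* eta x)) ^+ 2))).
 have cf: continuous (fun x=> nc (f (x +i* eta x)) ^+ 2).
 by apply: contX; apply: contnc; apply: (ccont_curve hf); exact: curve_cont hc heta.
 apply: le_itor.
 - by apply: contX; apply: contnc; apply: ccontM; [exact: ccont_fZ|exact: ccont_Zas].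
 - by apply: contM; [exact: contC|exact: cf].
 move=> x _; rewrite ncM exprMn mulrC (Z0 heta) (Za0 hc heta) ler_wpM2r//.
 by rewrite lerXn2r ?nnegrE//; exact: nc_1i (eta1_bd hc x).
rewrite itorZ; last first.
 by apply: contX; apply: contnc; apply: (ccont_curve hf); exact: curve_cont hc heta.
by rewrite ler_wpM2l//; exact: W_l2.
Qed.

Lemma omd_bd n : nc (om d n) <= K1 / d * (1 + 4 * C2) * S.
apply: nc_fc; first by apply: ccontM; [exact: ccont_fZ|exact: ccont_Zas].
move=> x _; rewrite ncM [leRHS]mulrAC; apply: ler_pM; rewrite ?nc_ge0//.
 by apply: fZ_bd=> //; exact: d_pos.
by apply: Za_up=> //; exact: ltW d_pos.
Qed.

Lemma fnu_bd t n : 0 < t -> t <= d -> nc (fc (fun x=> f (Z t x) * nu t x) n) <= 4 * K1 * C2 * S.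
move=> t0 td; apply: nc_fc; first by apply: ccontM; [exact: ccont_fZ|exact: ccont_nus].
move=> x _; rewrite ncM; apply: (le_trans (ler_pM (nc_ge0 _) (nc_ge0 _) (fZ_bd x t0 td) (nu_bd hc x (ltW t0)))).
by apply: le_of_eq; field; rewrite gt_eqF.
Qed.

Lemma ccat_om t n : ccat (om^~ n) t.
apply: (ccat_fc (A := fun t x => f (Z t x) * Za t x)) => p.
by apply: ccatM; [exact: ccat_fZ|apply: ccont_at; exact: ccont_Za hc].
Qed.

Lemma ccat_wc t n : ccat (wc^~ n) t.
by apply: (ccat_fc (A := fun t x => f (Z t x))) => p; exact: ccat_fZ. Qed.

Lemma cancel2 (a x y z B Y: R) : 0 < a -> a * x <= a * y + 2 * (a * B) -> y <= Y -> 0 <= z -> 0 <= B ->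
 x <= z + Y + 4 * B /\ x <= Y + z + 4 * B.
move=> a0; rewrite mulrCA -mulrDr ler_pM2l// => h1 h2 h3 h4; split; lra.
Qed.

(** Each mode is integrated from its stable end: from depth [d] for [n > 0], from the surface for
    [n < 0]. The factor [|n|] in the forcing cancels against the rate [|n|], so the bound is uniform
    in [n]. *)
Lemma om_bd t n : 0 <= t -> t <= d -> nc (om t n) <= K2 * S.
move=> t0 td; have dp := d_pos.
have [k1 k2 _ _] := K2_terms; have k3: 0 <= 1 + C2 by rewrite addr_ge0.
have S00 := ltW S0.
have B0: 0 <= 4 * K1 * C2 * S.
 have hk := K1_ge0; have hk2: 0 <= 4 * K1 by rewrite mulr_ge0.
 by rewrite mulr_ge0// mulr_ge0.
have E: K2 * S = (1 + C2) * S + K1 / d * (1 + 4 * C2) * S + 4 * (4 * K1 * C2 * S).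
 by rewrite /K2; ring.
have k1S := mulr_ge0 k1 S00; have k3S := mulr_ge0 k3 S00.
have [-> |n0] := eqVneq n 0.
 have [->|tn0] := eqVneq t 0; first by have := om0_bd 0; rewrite E; lra.
 have tp: 0 < t by rewrite lt_neqAle eq_sym tn0.
 (* The mean mode has no rate; it is conserved, by Cauchy's theorem between the levels 0 and [t]. *)
 suff -> : om t 0 = om 0 0 by have := om0_bd 0; rewrite E; lra.
 have EE s : om s 0 = (tau^-1)%:C * citor (fun x=> f (Z s x) * Za s x).
 rewrite /om fc_citor; apply: f_equal; apply: f_equal.
 by apply/funext => x; rewrite mul0r oppr0 expi0 mulr1.
 have eqA: citor (fun x=> f (Z 0 x) * Za 0 x) = citor (fun x=> f (Z t x) * Za t x).
 apply: (contour_inv (A := fun t x => f (Z t x) * Za t x) (B := fun t x => f (Z t x) * Ztc t x)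
 (D := fun t x => f1 (Z t x) * Ztc t x * Za t x + f (Z t x) * Zat t x) tp).
 - by move=> s x; apply: ccatM; [exact: ccat_fZ|apply: ccont_at; exact: ccont_Za hc].
 - by move=> s; apply: ccontM; [exact: ccont_fZ|exact: ccont_Zas].
 move=> s /andP[s0 st]; have sd: s <= d by apply: (le_trans (ltW st)).
 split.
 - move=> x; exact: (cder_eq _ (cderM (cder_fZt x s0 sd) (cder_Zat hc x s0))).
 - move=> x; apply: ccatD; apply: ccatM.
 + apply: ccatM; first exact: ccat_f1Z.
 by apply: ccont_at; exact: ccont_Zt hc.
 + by apply: ccont_at; exact: ccont_Za hc.
 + exact: ccat_fZ.
 + by apply: ccont_at; exact: ccont_Zat hc.
 - move=> x; apply: (cder_eq _ (cderM (cder_fZx x s0 sd) (cder_Ztx hc x s0))).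
 by ring.
 - apply: ccontD; last by apply: ccontM; [exact: ccont_fZ|exact: ccont_Zats].
 apply: ccontM; last exact: ccont_Zas.
 by apply: ccontM; [exact: ccont_f1Z|exact: ccont_Zts].
 - by move=> x; rewrite (fZ_per s) /Zt ts_per.
 exact: (etrans (EE t) (etrans (f_equal (fun z=> (tau^-1)%:C * z) (esym eqA)) (esym (EE 0)))).
pose r t := 'i * n%:~R * fc (fun x=> f (Z t x) * nu t x) n.
have hr s : 0 < s < d -> nc (r s) <= `|n%:~R| * (4 * K1 * C2 * S).
 move=> /andP[s0 sd]; rewrite ncM ncM nc_i mul1r nc_int ler_wpM2l//.
 by apply: fnu_bd=> //; exact: ltW.
have nn: 0 < `|n%:~R : R| by rewrite normr_gt0 intr_eq0.
have tt: 0 <= t <= d by rewrite t0.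
have nB: 0 <= `|n%:~R : R| * (4 * K1 * C2 * S) by rewrite mulr_ge0.
have [np|nm] := ltP 0 n.
 have En: `|n%:~R : R| = n%:~R by rewrite ger0_norm// ler0z ltW.
 have hs (s: R) : 0 < s < d -> cder (om^~ n) s (`|n%:~R|%:C * om s n + r s) /\ nc (r s) <= `|n%:~R| * (4 * K1 * C2 * S).
 move=> hs; split; last exact: hr.
 apply: (cder_eq _ (om_der n hs)).
 by rewrite /r En RCint.
 have H := @ode_grow _ (om^~ n) r `|n%:~R| _ d nn nB (fun t=> ccat_om t n) hs t tt.
 by rewrite E; have [] := cancel2 nn H (omd_bd n) k3S B0.
have En: `|n%:~R : R| = - n%:~R by rewrite ler0_norm// lerz0.
have hs (s: R) : 0 < s < d -> cder (om^~ n) s ((- `|n%:~R|)%:C * om s n + r s) /\ nc (r s) <= `|n%:~R| * (4 * K1 * C2 * S).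
 move=> hs; split; last exact: hr.
 apply: (cder_eq _ (om_der n hs)).
 by rewrite /r En opprK RCint.
have H := @ode_decay _ (om^~ n) r `|n%:~R| _ d nn nB (fun t=> ccat_om t n) hs t tt.
by rewrite E; have [] := cancel2 nn H (om0_bd n) k1S B0.
Qed.

(** [Z_t = (muq - i) Z_x]: a Beltrami-type coefficient of the collar map. *)
Definition muq t x : R[i] := nu t x * (Za t x)^-1.

Lemma Za_neq0 t x : 0 <= t -> t <= d -> Za t x != 0.
move=> t0 td; have [d0 d1 d2 _] := hd; rewrite -nc_eq0 gt_eqF//.
apply: (lt_le_trans _ (Za_low hc heta x t0 _)); first by rewrite divr_gt0.
by apply: le_trans d2; rewrite ler_wpM2r// ler_wpM2l.
Qed.

Lemma ccont_P t : 0 <= t -> t <= d -> ccont (fun x=> (Za t x)^-1).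
by move=> t0 td; apply: ccontV; [move=> x; exact: Za_neq0|exact: ccont_Zas]. Qed.

Section Weights.
Variables (P m : int -> R) (PP MM: R).
Hypothesis (P0 : forall k, 0 <= P k) (hP : l1 P PP).
Hypothesis (hPb : forall t k, 0 <= t -> t <= d -> nc (fc (fun x=> (Za t x)^-1) k) <= P k).
Hypothesis (m0 : forall k, 0 <= m k) (hm : l1 m MM).
Hypothesis (hmb : forall t k, 0 <= t -> t <= d -> nc (fc (muq t) k) <= m k).

Lemma Zainv_per t : periodic (fun x=> (Za t x)^-1) tau.
by move=> x; rewrite Za_per. Qed.

(** Dividing by [Z_x] is a convolution with a summable sequence, under which bounded coefficients
    stay bounded. *)
Lemma w_bd t n : 0 <= t -> t <= d -> nc (wc t n) <= PP * (K2 * S).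
move=> t0 td.
have -> : wc t n = fc (fun x=> (Za t x)^-1 * (f (Z t x) * Za t x)) n.
 congr (fc _ n); apply/funext => x; rewrite mulrCA mulVf ?mulr1//.
 exact: Za_neq0.
apply: (le_trans (mul_maj (b := fun _=> K2 * S) (B := K2 * S) n P0 hP (ccont_P t0 td) (Zainv_per t)
 (ccontM (ccont_fZ t) (ccont_Zas t)) (fun k=> hPb k t0 td) _ _))=> //.
 by move=> k; exact: om_bd.
apply: cv_pt hP _ => k; rewrite ger0_norm//.
by have [_ _ h _] := K2_terms; rewrite mulr_ge0// ltW.
Qed.

(** Since [Z_t = (muq - i) Z_x], the [t]-derivative of [f (Z)] is [muq - i] times its
    [x]-derivative. The part [- i] produces [n w_n], the part [muq] a convolution with [|k| w_k]. *)
Lemma w_der t n : 0 < t < d -> exists2 r : R[i], cder (wc^~ n) t (n%:~R * wc t n + r) &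
 nc r <= cv m (fun k=> `|k%:~R| * nc (wc t k)) n.
move=> /andP[t0 td]; have t0' := ltW t0; have td' := ltW td.
exists (fc (fun x=> muq t x * (f1 (Z t x) * Za t x)) n); last first.
 have cw: ccont (fun x=> f1 (Z t x) * Za t x) by apply: ccontM; [exact: ccont_f1Z|exact: ccont_Zas].
 have [C hC] := cont_bddP (contnc cw).
 have hk k : nc (fc (fun x=> f1 (Z t x) * Za t x) k) = `|k%:~R| * nc (wc t k).
 by rewrite fc_fZx// ncM ncM nc_i mul1r nc_int.
 apply: (mul_maj (B := C) n m0 hm).
 - by apply: ccontM; [exact: ccont_nus|exact: ccont_P].
 - by move=> x; rewrite /muq (nu_per c t) Za_per.
 - exact: cw.
 - by move=> k; exact: hmb.
 - by move=> k; rewrite hk.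
 - move=> k; rewrite -hk; apply: nc_fc=> // x hx.
 by have := hC x hx; rewrite ger0_norm ?nc_ge0.
have r0: 0 < minr t (d - t) by rewrite lt_min t0 subr_gt0.
have hr s : `|s - t| < minr t (d - t) -> 0 < s <= d.
 by rewrite lt_min => /andP[]; rewrite !ltr_norml => /andP[h1 _] /andP[_ h2]; apply/andP; split; lra.
have H: cder (wc^~ n) t (fc (fun x=> f1 (Z t x) * Ztc t x) n).
 apply: (cder_fc (A := fun t x => f (Z t x)) (D := fun t x => f1 (Z t x) * Ztc t x) n r0).
 - by move=> s1 x hs1; have /andP[s0 sd] := hr _ hs1; exact: cder_fZt.
 - move=> x; apply: ccatM; first exact: ccat_f1Z.
 by apply: ccont_at; exact: ccont_Zt hc.
 - by move=> s _; exact: ccont_fZ.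
 - by apply: ccontM; [exact: ccont_f1Z|exact: ccont_Zts].
apply: cder_eq H.
rewrite (_ : (fun x=> f1 (Z t x) * Ztc t x) =
 (fun x=> muq t x * (f1 (Z t x) * Za t x) - 'i * (f1 (Z t x) * Za t x))); last first.
 apply/funext => x; rewrite /muq (nuE hc); have := Za_neq0 x t0' td'.
 move: (Za t x) (Ztc t x) (f1 (Z t x)) => u v w u0; field; exact: u0.
have c2: ccont (fun x=> f1 (Z t x) * Za t x) by apply: ccontM; [exact: ccont_f1Z|exact: ccont_Zas].
have c1: ccont (fun x=> muq t x * (f1 (Z t x) * Za t x)).
 by apply: ccontM=> //; apply: ccontM; [exact: ccont_nus|exact: ccont_P].
rewrite fcB//; last by apply: ccontM; [exact: ccontC|].
have -> : fc (fun x=> 'i * (f1 (Z t x) * Za t x)) n = 'i * fc (fun x=> f1 (Z t x) * Za t x) n.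
 by rewrite /fc fourierZ// mulrCA.
rewrite fc_fZx// /wc.
have ii := @mulii R.
rewrite mulrA ii; ring.
Qed.

End Weights.

End Base.

Ltac nonneg := repeat first [assumption | done | apply: powR_ge0 | apply: mulr_ge0 | apply: addr_ge0 | apply: ltW; assumption].

(** * Sequences of polynomial growth, negative orders, inequalities for [cv] *)

Section MoreSequences.
Context {R : realType}.
Implicit Types (x y a b m M D : int -> R) (A B C X T d: R) (n k: int).
Lemma nk_jb k : `|k%:~R| <= jb k :> R. by rewrite /jb lerDr. Qed.

(** Reaching [n > 0] from a frequency [n - k <= 0] takes a jump [k >= n], so the weight of the
    output can be charged to the jump. *)
Lemma jb_mono n k : 0 < n -> ~~ (0 < n - k) -> jb n <= jb k :> R.
by move=> n0 hk; rewrite /jb lerD2l -!intr_norm ler_int; lia. Qed.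

Lemma nk_ge1 k : k != 0 -> 1 <= `|k%:~R : R|.
by move=> k0; rewrite -intr_norm ler1z; lia. Qed.

Lemma jbp_shift (r: R) n k : jbp (- r) n <= jbp `|r| (n - k) * jbp (- r) k.
have [r0|r0] := leP 0 r.
 rewrite (ger0_norm r0) !jbpN -[X in X <= _]mul1r ler_pdivrMr// mulrAC ler_pdivlMr// mul1r.
 have := jbp_sub k n r0.
 by rewrite -{1}[k - n]opprB /jbp jbN.
by rewrite ltr0_norm//; apply: jbp_sub; rewrite oppr_ge0 ltW.
Qed.

Lemma jbp_shift' (r: R) n k : jbp r n <= jbp `|r| (n - k) * jbp r k.
by have := jbp_shift (- r) n k; rewrite opprK normrN. Qed.

Lemma grow_bd (a b: R) u x A C n (F : {fset int}) : 0 <= b -> a <= b ->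
 l1 (fun k=> jbp b k * u k) A -> (forall k, `|x k| <= C * jbp a k) ->
 \sum_(k <- F) `|u (n - k) * x k| <= A * C * jbp b n.
move=> b0 ab hu hx.
have C0: 0 <= C by rewrite -(pmulr_lge0 _ (jbp_gt0 a 0)) (le_trans _ (hx 0)).
have hF: \sum_(k <- F) `|jbp b (n - k) * u (n - k)| <= A.
 have : (asum (fun k=> jbp b (n - k) * u (n - k))%R <= A%:E)%E by rewrite (asum_refl n (fun k=> jbp b k * u k)).
 exact: asum_fin_ge.
apply: (le_via (\sum_(k <- F) `|jbp b (n - k) * u (n - k)| * (C * jbp b n))).
 apply: ler_sum => k _; rewrite !normrM (ger0_norm (jbp_ge0 _ _)).
 have h1: `|x k| <= C * (jbp b (n - k) * jbp b n).
 apply: (le_trans (hx k)); rewrite ler_wpM2l//; apply: (le_trans (jbp_le k ab)).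
 by have := jbp_sub k n b0; rewrite -{1}[k - n]opprB /jbp jbN.
 apply: (le_trans (ler_wpM2l (normr_ge0 _) h1)).
 by apply: le_of_eq; ring.
by rewrite -mulr_suml -mulrA ler_wpM2r// mulr_ge0.
Qed.

Lemma grow_summable (a b: R) u x A C n : 0 <= b -> a <= b ->
 l1 (fun k=> jbp b k * u k) A -> (forall k, `|x k| <= C * jbp a k) ->
 (asum (fun k=> u (n - k) * x k)%R < +oo)%E.
move=> b0 ab hu hx; apply: (@le_lt_trans _ _ (A * C * jbp b n)%:E); last exact: ltey.
by apply: asum_fin_le => F; exact: grow_bd hu hx.
Qed.

Lemma cv_grow (a b: R) u x A C n : 0 <= b -> a <= b ->
 l1 (fun k=> jbp b k * u k) A -> (forall k, `|x k| <= C * jbp a k) ->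
 cv u x n <= A * C * jbp b n.
by move=> b0 ab hu hx; apply: cv_fin_le => F; exact: grow_bd hu hx. Qed.

Lemma cv_hnw (r: R) u x A X : l1 (fun k=> jbp `|r| k * u k) A -> hn r x X ->
 hn r (cv u x) (A * X).
move=> hu hx; have := young2 hu hx; apply: l2_le => n.
rewrite normrM (ger0_norm (jbp_ge0 r n)) !(ger0_norm (cv_ge0 _ _ _)); apply: cv_le1=> // [k|].
 rewrite !normrM !(ger0_norm (jbp_ge0 _ _)).
 have := jbp_shift' r n k; have : 0 <= `|u (n - k)| * `|x k| by rewrite mulr_ge0.
 nra.
exact: l1_summable hu (l2_bdd hx).
Qed.

Lemma cv_l1w (b: R) u v A B : 0 <= b -> l1 (fun k=> jbp b k * u k) A ->
 l1 (fun k=> jbp b k * v k) B -> l1 (fun k=> jbp b k * cv u v k) (A * B).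
move=> b0 hu hv; have := young1 hu hv; apply: l1_le => n.
rewrite !ger0_norm ?mulr_ge0//; apply: cv_le1=> // [k|].
 rewrite !normrM !(ger0_norm (jbp_ge0 _ _)).
 have := jbp_sub n k b0; have : 0 <= `|u (n - k)| * `|v k| by rewrite mulr_ge0.
 nra.
by apply: l1_summable hu _; exact: l2_bdd (l1_l2 hv).
Qed.

(** The weights [min(1, N / jb)^b] equal 1 up to [N] and decay like [jb^(-b)] beyond. As
    [a + 1/2 < b], they make a sequence of growth [a] square summable, and as [N] grows they exhaust
    the plain l2 norm. *)
Lemma absorb_grow (a b: R) x D M d C : 0 <= b -> a + 1 / 2 < b ->
 (forall n, `|x n| <= C * jbp a n) ->
 l1 (fun k=> jbp b k * M k) (1 / 2) -> l2 D d ->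
 (forall n, 0 <= D n) -> (forall n, `|x n| <= D n + cv M x n) -> l2 x (2 * d).
move=> b0 hb hx hM hD D0 h.
have C0: 0 <= C by rewrite -(pmulr_lge0 _ (jbp_gt0 a 0)) (le_trans _ (hx 0)).
apply (proj1 (hn0 x (2 * d))).
pose p (N: R) (k: int) := (minr 1 (N / jb k)) `^ b.
apply: (@trunc_lim _ 0 x (2 * d) p).
- by rewrite mulr_ge0// (l2_ge0 hD).
- move=> N k hN; rewrite jbp0 /p min_l ?powR1//.
 by rewrite ler_pdivlMr ?mul1r.
move=> N N1; have N0: 0 < N by apply: lt_le_trans N1.
have m0 k : 0 <= minr 1 (N / jb k).
 by rewrite le_min ler01 divr_ge0// ltW.
have [K hK] := @jbp_summable R (b - a) ltac:(lra).
apply: (@absorb_w _ (p N) (jbp b) x D M d (C * N `^ b * K)).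
- by move=> n; exact: powR_ge0.
- move=> n k; rewrite /p /jbp -powRM//; last exact: ltW.
 apply: powR_mono=> //; rewrite minr_pMr ?mulr1; last exact: ltW.
 rewrite le_min ge_min (le_trans (_ : 1 <= 1))//= ?jb_ge1//.
 rewrite ge_min; apply/orP; right.
 rewrite mulrCA ler_wpM2l ?(ltW N0)// ler_pdivlMr// ler_pdivrMl//.
 by have := @jb_subM R k n; rewrite -opprB jbN mulrC.
- by [].
- by move=> n; exact: jbp_gt0.
- apply: l2_le hD => k; rewrite normrM ger0_norm ?powR_ge0//.
 rewrite ler_piMl// /p -[X in _ <= X](congr1 (@^~ b) (@powR1 R)); apply: powR_mono=> //.
 by rewrite ge_min lexx.
- have := l2Z (C * N `^ b) hK; rewrite ger0_norm ?mulr_ge0//.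
 apply: l2_le => k.
 rewrite normrM ger0_norm ?powR_ge0// [X in _ <= X]ger0_norm; last first.
 by rewrite !mulr_ge0.
 apply: (le_via ((N / jb k) `^ b * (C * jbp a k))).
 rewrite ler_pM ?powR_ge0//; apply: powR_mono=> //.
 by rewrite ge_min lexx orbT.
 rewrite powRM ?invr_ge0 ?(ltW (jb_gt0 _)) ?(ltW N0)// -powR_inv1 ?(ltW (jb_gt0 _))// -powRrM mulN1r.
 rewrite opprB addrC jbpD -/(jbp _ _).
 by apply: le_of_eq; ring.
- exact: D0.
- exact: h.
Qed.

(** [absorb_grow] for [x] damped by [jbp (- c)]; moving the damping across the convolution costs [c]
    further units of weight on [M]. *)
Lemma absorb_neg (a b c: R) x D M d C : 0 <= b -> 0 <= c -> a - c + 1 / 2 < b ->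
 (forall n, `|x n| <= C * jbp a n) ->
 l1 (fun k=> jbp (b + c) k * M k) (1 / 2) -> hn (- c) D d ->
 (forall n, 0 <= D n) -> (forall n, `|x n| <= D n + cv M x n) -> hn (- c) x (2 * d).
move=> b0 c0 hb hx hM hD D0 h.
have hy n : `|jbp (- c) n * x n| <= C * jbp (a - c) n.
 by rewrite normrM ger0_norm// -[(a - c)%R]/(a + - c) [a + _]addrC jbpD mulrCA ler_wpM2l.
have hM': l1 (fun k=> jbp b k * (jbp c k * M k)) (1 / 2).
 by apply: l1_le hM => k; rewrite mulrA -jbpD.
apply: (absorb_grow b0 hb hy hM' hD) => [n|n]; first by rewrite mulr_ge0.
rewrite normrM ger0_norm//; apply: (le_trans (ler_wpM2l (jbp_ge0 _ _) (h n))).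
rewrite mulrDr lerD2l; apply: cv_le1=> // [k|].
 rewrite !normrM !(ger0_norm (jbp_ge0 _ _)).
 have := jbp_shift c n k; rewrite (ger0_norm c0).
 have : 0 <= `|M (n - k)| * `|x k| by rewrite mulr_ge0.
 nra.
by apply: (grow_summable _ b0 _ hM' hy); lra.
Qed.

Lemma summable_le u v x y n : (asum (fun k=> v (n - k) * y k)%R < +oo)%E ->
 (forall k, `|u k| <= `|v k|) -> (forall k, `|x k| <= `|y k|) ->
 (asum (fun k=> u (n - k) * x k)%R < +oo)%E.
by move=> hf hu hx; apply: le_lt_trans hf; apply: le_asum => k; rewrite !normrM ler_pM.
Qed.

Lemma cvZr_le c u x n : 0 <= c -> (asum (fun k=> u (n - k) * x k)%R < +oo)%E ->
 cv u (fun k=> c * x k) n <= c * cv u x n.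
move=> c0 hf; apply: cv_fin_le => F.
rewrite (eq_bigr (fun k=> c * `|u (n - k) * x k|)); last first.
 by move=> k _; rewrite mulrCA normrM ger0_norm.
by rewrite -mulr_sumr ler_wpM2l// cv_ge_fin.
Qed.

Lemma cvZl_ge c u x n : 0 <= c -> (asum (fun k=> u (n - k) * x k)%R < +oo)%E ->
 c * cv u x n <= cv (fun k=> c * u k) x n.
rewrite le_eqVlt => /orP[/eqP<-|c0] hf; first by rewrite mul0r cv_ge0.
apply: cv_le1=> // [k|]; first by rewrite -mulrA [leRHS]normrM (gtr0_norm c0).
apply: (@le_lt_trans _ _ (asum (fun k=> c * (u (n - k) * x k)))).
 by apply: le_asum => k; rewrite mulrA.
by rewrite asumZ lte_mul_pinfty// ?lee_fin.
Qed.

Lemma cvDr_le u x y n : (asum (fun k=> u (n - k) * x k)%R < +oo)%E ->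
 (asum (fun k=> u (n - k) * y k)%R < +oo)%E ->
 cv u (fun k=> x k + y k) n <= cv u x n + cv u y n.
move=> hx hy; apply: cv_fin_le => F.
apply: (le_via (\sum_(k <- F) (`|u (n - k) * x k| + `|u (n - k) * y k|))).
 by apply: ler_sum => k _; rewrite mulrDr ler_normD.
by rewrite big_split/= lerD// cv_ge_fin.
Qed.

Lemma cvDl_ge u v x n : (forall k, 0 <= u k) -> (forall k, 0 <= v k) ->
 (asum (fun k=> (u (n - k) + v (n - k)) * x k)%R < +oo)%E ->
 cv u x n + cv v x n <= cv (fun k=> u k + v k) x n.
move=> u0 v0 hf.
have E: (asum (fun k=> (u (n - k) + v (n - k)) * x k)%R =
 asum (fun k=> u (n - k) * x k)%R + asum (fun k=> v (n - k) * x k)%R)%E.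
 rewrite /asum -esumD; [|by move=> *; rewrite lee_fin..].
 apply: eq_esum => k _; rewrite -EFinD !normrM -mulrDl; congr (_ * _)%:E.
 by rewrite !ger0_norm// addr_ge0.
have h1: (asum (fun k=> u (n - k) * x k)%R \is a fin_num)%E.
 rewrite ge0_fin_numE ?asum_ge0//; apply: le_lt_trans hf.
 by rewrite E leeDl// asum_ge0.
have h2: (asum (fun k=> v (n - k) * x k)%R \is a fin_num)%E.
 rewrite ge0_fin_numE ?asum_ge0//; apply: le_lt_trans hf.
 by rewrite E leeDr// asum_ge0.
by rewrite /cv E fineD.
Qed.

Lemma cv_refl u x n : cv u x (- n) = cv (fun k=> u (- k)) (fun k=> x (- k)) n.
rewrite /cv; congr fine.
rewrite -(asum_refl 0 (fun k=> u (- n - k) * x k)%R); apply: eq_esum => k _.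
by rewrite sub0r opprB opprK addrC.
Qed.

Lemma cv_assoc (b: R) u v x A B C n : 0 <= b -> l1 (fun k=> jbp b k * u k) A ->
 l1 (fun k=> jbp b k * v k) B -> (forall k, `|x k| <= C * jbp b k) ->
 cv u (cv v x) n <= cv (cv u v) x n.
move=> b0 hu hv hx.
have fuv: (asum (fun k=> cv u v (n - k) * x k)%R < +oo)%E.
 exact: (grow_summable n b0 (lexx b) (cv_l1w b0 hu hv) hx).
have fv k : (asum (fun l=> v (k - l) * x l)%R < +oo)%E by exact: (grow_summable k b0 (lexx b) hv hx).
have hb0 k : jbp 0 k <= jbp b k :> R by apply: jbp_le.
have hu0: l1 u A.
 apply: l1_le hu => k; rewrite normrM ler_peMl//; have := hb0 k; rewrite jbp0 => h.
 by rewrite ger0_norm.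
have hv0: l1 v B.
 apply: l1_le hv => k; rewrite normrM ler_peMl//; have := hb0 k; rewrite jbp0 => h.
 by rewrite ger0_norm.
apply: cv_fin_le => F; rewrite -lee_fin.
have -> : (cv (cv u v) x n)%:E = asum (fun k=> cv u v (n - k) * x k)%R by rewrite /cv asum_finE.
apply: (le_via (asum (fun k=> u (n - k) * cv v x k)%R)).
 have [->|] := eqVneq (asum (fun k=> u (n - k) * cv v x k)%R) +oo%E; first exact: leey.
 rewrite -ltey => fin; rewrite -(asum_finE fin) lee_fin; apply: asum_fin_ge.
 by rewrite asum_finE.
rewrite /asum; apply: (le_via (\esum_(k in [set: int]) \esum_(l in [set: int]) (`|u (n - k) * (v (k - l) * x l)|)%:E)).
 apply: le_esum => k _; have := asumZ (u (n - k)) (fun l=> v (k - l) * x l).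
 rewrite /asum => ->; rewrite normrM EFinM (ger0_norm (cv_ge0 _ _ _)) lee_wpmul2l ?lee_fin//.
 by rewrite /cv asum_finE.
rewrite esum_swap => [|i j]; last by rewrite lee_fin.
apply: le_esum => l _.
rewrite normrM mulrC EFinM (ger0_norm (cv_ge0 _ _ _)) /cv asum_finE; last first.
 by apply: l1_summable hu0 _; exact: l2_bdd (l1_l2 hv0).
have := asumZ (x l) (fun k=> u (n - l - k) * v k); rewrite /asum => <-.
rewrite -/(asum _) -/(asum (fun k=> x l * (u (n - l - k) * v k))) -(asum_shift l (fun k=> x l * (u (n - l - k) * v k))).
apply: (@le_asum _ (fun k=> u (n - k) * (v (k - l) * x l))) => k.
have -> : n - l - (k - l) = n - k by lia.
by rewrite [x l * _]mulrC -mulrA.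
Qed.

Lemma hn_divn (r: R) x X : hn r x X -> hn (r + 1) (fun k=> x k / `|k%:~R|) (2 * X).
move=> hx; have := l2Z 2 hx; rewrite ger0_norm//; apply: l2_le => k.
(* The inverse of 0 is 0, so the quotient has no mean mode and nothing is claimed about [x 0]. *)
have [->|k0] := eqVneq k 0; first by rewrite mulr0z normr0 invr0 !mulr0 normr0 normr_ge0.
have nk: 1 <= `|k%:~R : R| by rewrite -intr_norm ler1z; lia.
rewrite jbpD jbp1 !normrM !normfV normr_id (ger0_norm (jbp_ge0 _ _)) (gtr0_norm (jb_gt0 _)) (ger0_norm (ler0n _ 2)).
have : jb k / `|k%:~R| <= 2 :> R.
 by rewrite ler_pdivrMr ?(lt_le_trans ltr01)// /jb; lra.
have : 0 <= jbp r k * `|x k| by rewrite mulr_ge0.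
set z := _ / _; set w := _ * `|x k| => w0 hz.
by rewrite (_ : _ * _ * _ = z * w); [rewrite ler_wpM2r|rewrite /z /w; ring].
Qed.

Lemma hn_mulk (r: R) x X : hn (r + 1) x X -> hn r (fun k=> `|k%:~R| * x k) X.
apply: l2_le => k; rewrite jbpD jbp1 !normrM normr_id (gtr0_norm (jb_gt0 _)) -mulrA.
by rewrite ler_wpM2l// ler_wpM2r// /jb lerDr.
Qed.

End MoreSequences.

(** * One step of the bootstrap: from the level [U0] to the level [U1] *)

(* [U0], [U1] are two consecutive levels; [y0], [y1] their symmetrizations. *)
Section Level.
Context {R : realType}.
Variables (m rho W a0 U0 U1 : int -> R) (Lm Lr T C dd J N: R).
Hypothesis (m0 : forall k, 0 <= m k) (ms : forall k, m (- k) = m k) (hm : l1 (fun k=> jbp 1 k * m k) Lm).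
Hypothesis (r0 : forall k, 0 <= rho k) (rs : forall k, rho (- k) = rho k).
Hypothesis (hr : l1 (fun k=> jbp 1 k * rho k) Lr).
Hypothesis (W0 : forall k, 0 <= W k) (hW : l2 W T).
Hypothesis (a00 : forall k, 0 <= a0 k) (a0s : forall k, a0 (- k) = a0 k).
Hypothesis (dd0 : 0 < dd) (J0 : 0 <= J) (N0 : 0 < N).
Hypothesis (U00 : forall k, 0 <= U0 k) (U10 : forall k, 0 <= U1 k) (U1z : U1 0 = 0).
Hypothesis (hU0 : forall k, U0 k <= C * jb k) (hU1 : forall k, U1 k <= C * jb k).
Hypothesis hrel : forall n : int, 0 < n -> W (- n) <= a0 n + cv rho W n.
Hypothesis hWU : forall n, dd * (`|n%:~R| * W n) <= U1 n.
Hypothesis hpos : forall n : int, 0 < n -> U1 n <= 2 * cv m U1 n + J * (U0 n / `|n%:~R|).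
Hypothesis hneg : forall n : int, n < 0 ->
 U1 n <= dd * (`|n%:~R| * W n) + 2 * cv m U1 n + J * (U0 n / `|n%:~R|).

Definition rj k : R := `|k%:~R| * rho k.
(** The surface relation ties [-n] to positive frequencies and their neighbours; the system of
    inequalities closes for the sum over both signs. *)
Definition sm (x : int -> R) k : R := x k + x (- k).
Definition y0n k : R := sm U0 k / `|k%:~R|.
Definition Wlow k : R := if `|k%:~R| <= N then sm W k else 0.
Definition DD (w : int -> R) n : R := dd * (`|n%:~R| * a0 n) + dd * cv rj w n + J * (y0n n + cv rho y0n n).
(** [4 m] collects [hpos] at [n] and [hneg] at [-n]. [2 cv rho m] arises when [hpos] is inserted for
    the positive frequencies of [W] in the surface relation. Both parts contain the small kernel
    [m]. *)
Definition M0 k : R := 4 * m k + 2 * cv rho m k.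
Definition MM k : R := M0 k + N^-1 * rj k.

Let nk0 (k: int) : 0 <= `|k%:~R| :> R := normr_ge0 _.
Hint Resolve nk0 : core.

Lemma sm_ge0 (x : int -> R) : (forall k, 0 <= x k) -> forall k, 0 <= sm x k.
by move=> x0 k; rewrite addr_ge0. Qed.

Lemma smN (x : int -> R) k : sm x (- k) = sm x k.
by rewrite /sm opprK addrC. Qed.

Lemma sm_grow (x : int -> R) : (forall k, x k <= C * jb k) -> forall k, sm x k <= 2 * C * jb k.
by move=> h k; have := h k; have := h (- k); rewrite jbN /sm; lra. Qed.

Lemma C_ge0 : 0 <= C.
by rewrite -(pmulr_lge0 _ (jb_gt0 0)) (le_trans (U00 0)). Qed.

Lemma nkN (k: int) : `|(- k)%:~R : R| = `|k%:~R|. by rewrite rmorphN normrN. Qed.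

Lemma y0n_bd k : 0 <= y0n k <= 4 * C.
have y00: 0 <= y0n k by rewrite divr_ge0// sm_ge0.
rewrite y00/=; rewrite /y0n.
have [->|kz] := eqVneq k 0; first by rewrite mulr0z normr0 invr0 mulr0 mulr_ge0// C_ge0.
have n1 := @nk_ge1 R k kz; rewrite ler_pdivrMr ?(lt_le_trans ltr01)//.
apply: (le_trans (sm_grow hU0 k)).
have : C * jb k <= C * (2 * `|k%:~R|) by rewrite ler_wpM2l ?C_ge0// /jb; lra.
lra.
Qed.

Lemma y0nN k : y0n (- k) = y0n k. by rewrite /y0n smN nkN. Qed.

Lemma rj0 k : 0 <= rj k. by rewrite mulr_ge0. Qed.
Lemma rjN k : rj (- k) = rj k. by rewrite /rj rs nkN. Qed.

Lemma l1_jbp1 (x : int -> R) A : l1 (fun k=> jbp 1 k * x k) A -> l1 x A.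
by apply: l1_le => k; rewrite jbp1 normrM gtr0_norm// ler_peMl. Qed.

Lemma hrj : l1 rj Lr.
apply: l1_le hr => k; rewrite jbp1 /rj !normrM normr_id (gtr0_norm (jb_gt0 k)).
by rewrite ler_wpM2r// nk_jb.
Qed.

Lemma W_bdd k : W k <= T. by have := l2_pt k hW; rewrite ger0_norm. Qed.
Lemma T_ge0 : 0 <= T. exact: l2_ge0 hW. Qed.

Definition Wp k : R := if 0 < k then `|k%:~R| * W k else 0.

Lemma Wp_bd k : 0 <= Wp k <= T * jb k.
rewrite /Wp; case: ifP => _; last by rewrite lexx mulr_ge0 ?T_ge0// ltW.
by rewrite mulr_ge0//= mulrC ler_pM// ?W_bdd ?nk_jb.
Qed.

(** In the convolution, [|n| <= |n - k| + |k|] if [k > 0], and [|n| <= |n - k|] if [k <= 0 < n]. So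
    a derivative falls on [W] at positive frequencies only; otherwise it falls on [rho]. *)
Lemma rel1 (n: int) : 0 < n -> `|n%:~R| * W (- n) <= `|n%:~R| * a0 n + (cv rj W n + cv rho Wp n).
move=> n0; have np: 0 < `|n%:~R : R| by rewrite (lt_le_trans ltr01)// nk_ge1 ?gt_eqF.
apply: (le_trans (ler_wpM2l (nk0 n) (hrel n0))); rewrite mulrDr lerD2l.
apply: cv_le2=> //.
- move=> k; rewrite /rj /Wp !normrM normr_id (ger0_norm (r0 _)) (ger0_norm (W0 _)).
 have p0: 0 <= rho (n - k) * W k by rewrite mulr_ge0.
 case: ifPn => k0.
 rewrite normrM normr_id (ger0_norm (W0 _)).
 have : `|n%:~R : R| <= `|(n - k)%:~R| + `|k%:~R|.
 by apply: le_trans (ler_normD _ _); rewrite -intrD subrK.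
 move=> h; have := ler_wpM2r p0 h.
 have -> : (`|(n - k)%:~R| + `|k%:~R|) * (rho (n - k) * W k) =
 `|(n - k)%:~R| * rho (n - k) * W k + rho (n - k) * (`|k%:~R| * W k) by ring.
 exact.
 rewrite normr0 mulr0 addr0 -mulrA ler_wpM2r//.
 by rewrite -!intr_norm ler_int; move: k0 n0; lia.
- exact: l1_summable hrj (l2_bdd hW).
apply: (grow_summable (a := 1) (C := T) n ler01 (lexx 1) hr) => k.
by have /andP[h1 h2] := Wp_bd k; rewrite jbp1 ger0_norm.
Qed.

Let y1 := sm U1.

Lemma y1_0 k : 0 <= y1 k. exact: sm_ge0. Qed.
Lemma y1_bd k : `|y1 k| <= 2 * C * jbp 1 k.
by rewrite ger0_norm ?y1_0// jbp1 sm_grow. Qed.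

Lemma smm n : (asum (fun k=> m (n - k) * y1 k)%R < +oo)%E.
exact: (grow_summable n ler01 (lexx 1) hm y1_bd). Qed.

Lemma U1_y1 k : U1 k <= y1 k. by rewrite lerDl. Qed.

Lemma cvU1 n : cv m U1 n <= cv m y1 n.
apply: cv_mono => [|k|k]; [exact: smm|by []|].
by rewrite !ger0_norm ?y1_0// U1_y1.
Qed.

Lemma cvU1N n : cv m U1 (- n) <= cv m y1 n.
rewrite cv_refl; apply: cv_mono => [|k|k]; [exact: smm|by rewrite ms|].
by rewrite !ger0_norm ?y1_0// lerDr.
Qed.

Definition vv k : R := 2 * cv m y1 k + J * y0n k.

Lemma cvm_bd k : `|cv m y1 k| <= Lm * (2 * C) * jbp 1 k.
by rewrite ger0_norm//; exact: (cv_grow k ler01 (lexx 1) hm y1_bd). Qed.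

Lemma Wp_vv k : dd * Wp k <= vv k.
have [h1 h2] := andP (y0n_bd k).
rewrite /Wp; case: ifP => k0; last by rewrite mulr0 addr_ge0// mulr_ge0.
apply: (le_trans (hWU k)); apply: (le_trans (hpos k0)); apply: lerD.
 by rewrite ler_wpM2l// cvU1.
by rewrite ler_wpM2l// /y0n ler_wpM2r ?invr_ge0// lerDl.
Qed.

(** Positive frequencies of [W] are bounded without surface data; inserting that bound replaces the
    kernel [rho], which is not small, by [cv rho m], which is. *)
Lemma cv_vv n : dd * cv rho Wp n <= 2 * cv (cv rho m) y1 n + J * cv rho y0n n.
have h1: (asum (fun k=> rho (n - k) * (2 * cv m y1 k))%R < +oo)%E.
 apply: (grow_summable (a := 1) (C := 2 * (Lm * (2 * C))) n ler01 (lexx 1) hr) => k.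
 by rewrite normrM ger0_norm// -mulrA ler_wpM2l//; exact: cvm_bd.
have h1': (asum (fun k=> rho (n - k) * cv m y1 k)%R < +oo)%E.
 exact: (grow_summable n ler01 (lexx 1) hr cvm_bd).
have y0b k : `|y0n k| <= 4 * C by have /andP[? ?] := y0n_bd k; rewrite ger0_norm.
have h2': (asum (fun k=> rho (n - k) * y0n k)%R < +oo)%E.
 by apply: l1_bdd_summable (l1_jbp1 hr) y0b.
have h2: (asum (fun k=> rho (n - k) * (J * y0n k))%R < +oo)%E.
 apply: (l1_bdd_summable (B := J * (4 * C)) _ (l1_jbp1 hr)) => k.
 by rewrite normrM (ger0_norm J0) ler_wpM2l.
apply: (le_via (cv rho (fun k=> 2 * cv m y1 k) n + cv rho (fun k=> J * y0n k) n)).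
 apply: cv_le2=> // k; have [p1 _] := andP (Wp_bd k); have [p2 _] := andP (y0n_bd k).
 rewrite (ger0_norm (mulr_ge0 (r0 _) p1)).
 have q1: 0 <= 2 * cv m y1 k by rewrite mulr_ge0.
 have q2: 0 <= J * y0n k by rewrite mulr_ge0.
 rewrite (ger0_norm (mulr_ge0 (r0 _) q1)) (ger0_norm (mulr_ge0 (r0 _) q2)) -mulrDr mulrCA.
 by rewrite ler_wpM2l// Wp_vv.
apply: lerD; last exact: cvZr_le.
apply: (le_trans (cvZr_le (ler0n _ 2) h1')); rewrite ler_wpM2l//.
exact: (cv_assoc n ler01 hr hm y1_bd).
Qed.

Lemma Wlow0 k : 0 <= Wlow k. by rewrite /Wlow; case: ifP=> // _; exact: sm_ge0. Qed.
Lemma Wlow_bdd k : `|Wlow k| <= 2 * T.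
rewrite ger0_norm ?Wlow0// /Wlow; case: ifP => _; last by rewrite mulr_ge0// T_ge0.
by rewrite /sm; have := W_bdd k; have := W_bdd (- k); lra.
Qed.

Lemma hM0 : l1 (fun k=> jbp 1 k * M0 k) (4 * Lm + 2 * (Lr * Lm)).
have := l1D (l1Z 4 hm) (l1Z 2 (cv_l1w ler01 hr hm)); rewrite !ger0_norm//; apply: l1_le => k.
by rewrite /M0 mulrDr (mulrCA _ 4) (mulrCA _ 2).
Qed.

Lemma M0_ge0 k : 0 <= M0 k.
by rewrite addr_ge0 ?mulr_ge0. Qed.

Lemma cvM0 n : 4 * cv m y1 n + 2 * cv (cv rho m) y1 n <= cv M0 y1 n.
have hcv := cv_l1w ler01 hr hm.
have h1 := smm n.
have h2: (asum (fun k=> cv rho m (n - k) * y1 k)%R < +oo)%E.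
 exact: (grow_summable n ler01 (lexx 1) hcv y1_bd).
apply: (le_trans (lerD (cvZl_ge (ler0n _ 4) h1) (cvZl_ge (ler0n _ 2) h2))).
apply: (@cvDl_ge _ (fun k=> 4 * m k) (fun k=> 2 * cv rho m k)) => [k|k|]; [by rewrite mulr_ge0|by rewrite mulr_ge0|].
exact: (grow_summable n ler01 (lexx 1) hM0 y1_bd).
Qed.

Lemma y1_pos n : 0 < n -> y1 n <= dd * (`|n%:~R| * W (- n)) + 4 * cv m y1 n + J * y0n n.
move=> n0; have nm: - n < 0 by lia.
have h1 := hpos n0; have h2 := hneg nm; rewrite nkN in h2.
have h3 := cvU1 n; have h4 := cvU1N n.
have E: J * y0n n = J * (U0 n / `|n%:~R|) + J * (U0 (- n) / `|n%:~R|).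
 by rewrite /y0n /sm mulrDl mulrDr.
rewrite E /y1 /sm -/y1; lra.
Qed.

Lemma y1_level_pos n : 0 < n -> y1 n <= DD (sm W) n + cv M0 y1 n.
move=> n0; apply: (le_trans (y1_pos n0)).
have h1 := ler_wpM2l (ltW dd0) (rel1 n0); rewrite !mulrDr in h1.
have h2 := cv_vv n; have h3 := cvM0 n.
have h4: dd * cv rj W n <= dd * cv rj (sm W) n.
 rewrite ler_wpM2l ?(ltW dd0)//; apply: cv_mono=> // [|k].
 apply: (l1_bdd_summable (B := 2 * T) _ hrj) => k.
 by rewrite ger0_norm ?sm_ge0// /sm; have := W_bdd k; have := W_bdd (- k); lra.
 by rewrite !ger0_norm ?sm_ge0// lerDl.
rewrite /DD mulrDr; lra.
Qed.

Lemma cvN (a x : int -> R) n : (forall k, a (- k) = a k) -> (forall k, x (- k) = x k) -> cv a x (- n) = cv a x n.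
move=> ha hx; rewrite cv_refl (_ : (fun k=> a (- k)) = a); last by apply/funext.
by rewrite (_ : (fun k=> x (- k)) = x)//; apply/funext.
Qed.

Lemma M0N k : M0 (- k) = M0 k.
by rewrite /M0 ms cvN. Qed.

Lemma DDN w n : (forall k, w (- k) = w k) -> DD w (- n) = DD w n.
by move=> hw; rewrite /DD nkN a0s y0nN !cvN//; [exact: y0nN|exact: rjN].
Qed.

Lemma DD_ge0 w n : 0 <= DD w n.
rewrite /DD !addr_ge0 ?mulr_ge0 ?(ltW dd0)//; have [h _] := andP (y0n_bd n).
by rewrite addr_ge0.
Qed.

Lemma y1_level n : y1 n <= DD (sm W) n + cv M0 y1 n.
have [n0|n0] := ltP 0 n; first exact: y1_level_pos.
have [->|nz] := eqVneq n 0.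
 by rewrite {1}/y1 /sm oppr0 U1z addr0 addr_ge0// DD_ge0.
have := @y1_level_pos (- n) ltac:(lia).
by rewrite [y1 (- n)]smN (DDN _ (smN W)) (cvN _ M0N (smN U1)).
Qed.

(** Above [N] the factor [|k|] contained in [U1] yields a gain [N^-1], which supplies the smallness
    missing from [rj]. *)
Lemma W_split k : dd * sm W k <= dd * Wlow k + N^-1 * y1 k.
rewrite /Wlow; case: ifPn => hk.
 by rewrite lerDl mulr_ge0 ?y1_0// invr_ge0 ltW.
rewrite mulr0 add0r ler_pdivlMl//; rewrite -ltNge in hk.
have h1 := hWU k; have h2 := hWU (- k); rewrite nkN in h2.
apply: (le_via (`|k%:~R| * (dd * sm W k))).
 by rewrite ler_wpM2r ?(ltW hk)// mulr_ge0 ?(ltW dd0)// sm_ge0.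
rewrite mulrCA /sm mulrDr mulrDr /y1 /sm; lra.
Qed.

(* Once [y1] is bounded, the frequencies of [W] above [N] can be absorbed too. *)
Lemma y1_level_low B n : (forall k, y1 k <= B) -> y1 n <= DD Wlow n + cv MM y1 n.
move=> hB; apply: (le_trans (y1_level n)); rewrite /DD.
have Ni0: 0 <= N^-1 by rewrite invr_ge0 ltW.
have yB k : `|y1 k| <= B by rewrite ger0_norm ?y1_0.
have hy: (asum (fun k=> rj (n - k) * y1 k)%R < +oo)%E by exact: l1_bdd_summable hrj yB.
have hl: (asum (fun k=> rj (n - k) * Wlow k)%R < +oo)%E by exact: l1_bdd_summable hrj Wlow_bdd.
have hZ c (x : int -> R) : 0 <= c -> (asum (fun k=> rj (n - k) * x k)%R < +oo)%E ->
 (asum (fun k=> rj (n - k) * (c * x k))%R < +oo)%E.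
 move=> c0 hx; apply: (@le_lt_trans _ _ (asum (fun k=> c * (rj (n - k) * x k)))).
 by apply: le_asum => k; rewrite mulrCA.
 rewrite asumZ (ger0_norm c0) -(asum_finE hx) -EFinM; exact: ltey.
have h1: dd * cv rj (sm W) n <= dd * cv rj Wlow n + N^-1 * cv rj y1 n.
 apply: (le_via (cv rj (fun k=> dd * Wlow k) n + cv rj (fun k=> N^-1 * y1 k) n)).
 apply: cv_le2=> //; last 2 first.
 - by apply: hZ=> //; exact: ltW.
 - exact: hZ.
 move=> k; have w0 := Wlow0 k; have z0 := y1_0 k; have s0 := sm_ge0 W0 k; have q0 := rj0 (n - k).
 rewrite !ger0_norm ?mulr_ge0 ?(ltW dd0)// -mulrDr mulrCA ler_wpM2l//; exact: W_split.
 by apply: lerD; apply: cvZr_le=> //; exact: ltW.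
have h2: cv M0 y1 n + N^-1 * cv rj y1 n <= cv MM y1 n.
 apply: (le_trans (lerD (lexx _) (cvZl_ge Ni0 hy))).
 have hM: l1 (fun k=> M0 k + N^-1 * rj k) (4 * Lm + 2 * (Lr * Lm) + N^-1 * Lr).
 by have := l1D (l1_jbp1 hM0) (l1Z N^-1 hrj); rewrite (ger0_norm Ni0).
 apply: (@cvDl_ge _ M0 (fun k=> N^-1 * rj k)) => [k|k|]; [exact: M0_ge0|by rewrite mulr_ge0 ?rj0|].
 exact: l1_bdd_summable hM yB.
lra.
Qed.

End Level.

(** * The bootstrap over all levels *)

Section Chain.
Context {R : realType}.
(** What the bootstrap needs to know of the fluid. [W] is the surface trace, [U j] the supremum over
    the collar of [(d - t)^j |n| |w_n|], [T] the size of the data. The only bound assumed on the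
    levels is the linear growth [ch_Ug]. *)
Record chain (s kap Lr Rr Rm em d T: R) (m rho W a0 : int -> R) (U : nat -> int -> R) : Prop := Chain {
 ch_m0 : forall k, 0 <= m k; ch_ms : forall k, m (- k) = m k;
 ch_mh : hn (s - 1 / 2) m Rm; ch_m1 : l1 (fun k=> jbp (3 / 2 + kap) k * m k) em;
 ch_r0 : forall k, 0 <= rho k; ch_rs : forall k, rho (- k) = rho k;
 ch_rh : hn (s - 1 / 2) rho Rr; ch_r1 : l1 (fun k=> jbp (3 / 2 + kap) k * rho k) Lr;
 ch_W0 : forall k, 0 <= W k; ch_W : l2 W T;
 ch_a0 : forall k, 0 <= a0 k; ch_as : forall k, a0 (- k) = a0 k; ch_a : hn (s - 1) a0 T;
 ch_U0 : forall j k, 0 <= U j k; ch_Uz : forall j, U j 0 = 0; ch_Ug : forall k, U 0%N k <= T * jb k;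
 ch_Ud : forall j k, U j.+1 k <= U j k;
 ch_rel : forall n : int, 0 < n -> W (- n) <= a0 n + cv rho W n;
 ch_WU : forall j n, d ^+ j * (`|n%:~R| * W n) <= U j n;
 ch_pos : forall j (n: int), 0 < n ->
 U j.+1 n <= 2 * cv m (U j.+1) n + 2 * j.+1%:R * (U j n / `|n%:~R|);
 ch_neg : forall j (n: int), n < 0 ->
 U j.+1 n <= d ^+ j.+1 * (`|n%:~R| * W n) + 2 * cv m (U j.+1) n + 2 * j.+1%:R * (U j n / `|n%:~R|) }.

Lemma l2_refl (x : int -> R) X : l2 x X -> l2 (fun k=> x (- k)) X.
move=> [h1 h2]; split=> //; apply: le_trans h2.
by rewrite -(asum_refl 0 (fun k=> x k ^+ 2)); apply: le_asum => k; rewrite sub0r.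
Qed.

Lemma hn_refl r (x : int -> R) X : hn r x X -> hn r (fun k=> x (- k)) X.
by move=> /l2_refl; apply: l2_le => k; rewrite /jbp jbN. Qed.

Lemma hn_l2 r (x : int -> R) X : 0 <= r -> hn r x X -> l2 x X.
move=> r0 hx; exact: (proj1 (hn0 x X) (hnW r0 (lexx X) hx)). Qed.

Variables (s kap: R).
Hypothesis (k0 : 0 < kap) (k1 : 4 * kap <= s - 5 / 2) (k2 : kap <= 1 / 8).
Let b := 3 / 2 + kap.
(** Small enough that [2^r * e0 <= 1 / 8] for every order [r <= s], as the tame absorption lemmas
    require. *)
Definition e0 : R := (8 * 2 `^ s)^-1.

Lemma e0_gt0 : 0 < e0. by rewrite invr_gt0 mulr_gt0// powR_gt0. Qed.

Lemma two_pow (r: R) : r <= s -> 2 `^ r * e0 <= 1 / 8.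
move=> hr; have h: 2 `^ r <= 2 `^ s by apply: ler_powR=> //; rewrite ler1n.
have p0: 0 < 2 `^ s :> R by rewrite powR_gt0.
rewrite /e0 invfM mulrCA div1r -[leRHS]mulr1 ler_wpM2l ?invr_ge0//.
by rewrite ler_pdivrMr// mul1r.
Qed.

Lemma e0_le : e0 <= 1 / 8.
by have := @two_pow 0; rewrite powRr0 mul1r; apply; have := k0; have := k1; lra. Qed.

Section Data.
Variables (Lr Rr Rm d: R).
Hypothesis (d0 : 0 < d) (d1 : d <= 1).

(** The order of quantifiers makes [K] depend on [Lr], [Rr], [Rm] and [d] only, while the bound
    stays linear in [T]. *)
Definition conc (P : R -> R -> (int -> R) -> (nat -> int -> R) -> Prop) : Prop :=
 exists2 K : R, 0 <= K & forall em T m rho W a0 U, chain s kap Lr Rr Rm em d T m rho W a0 U ->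
 (4 + 2 * Lr) * em <= e0 -> P K T W U.

Section One.
Variables (em T: R) (m rho W a0 : int -> R) (U : nat -> int -> R).
Hypothesis (H : chain s kap Lr Rr Rm em d T m rho W a0 U) (hem : (4 + 2 * Lr) * em <= e0).

Lemma b_ge0 : 0 <= b. by have := k0; rewrite /b; lra. Qed.

Lemma l1w (r: R) (x : int -> R) A : r <= b -> l1 (fun k=> jbp b k * x k) A -> l1 (fun k=> jbp r k * x k) A.
by move=> rb; apply: l1_le => k; rewrite !normrM ler_wpM2r// !ger0_norm// jbp_le. Qed.

Lemma b_ge1 : 1 <= b. by have := k0; rewrite /b; lra. Qed.
Let h1m : l1 (fun k=> jbp 1 k * m k) em := l1w b_ge1 (ch_m1 H).
Let h1r : l1 (fun k=> jbp 1 k * rho k) Lr := l1w b_ge1 (ch_r1 H).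
Let T0 : 0 <= T := l2_ge0 (ch_W H).
Let Lr0 : 0 <= Lr := l1_ge0 h1r.
Let em0 : 0 <= em := l1_ge0 h1m.

Lemma U_grow j k : U j k <= T * jb k.
by elim: j => [|j IH]; [exact: (ch_Ug H)|exact: (le_trans (ch_Ud H j k))]. Qed.

Lemma sm_dec j k : sm (U j.+1) k <= sm (U j) k.
by apply: lerD; exact: (ch_Ud H). Qed.

Lemma sm_dec2 j k : sm (U j.+3) k <= sm (U 2%N) k.
by elim: j => [|j IH]; [exact: sm_dec|exact: (le_trans (sm_dec _ _) IH)]. Qed.

Lemma smU0 j k : 0 <= sm (U j) k. by apply: sm_ge0 => i; exact: (ch_U0 H). Qed.

Lemma smU_bd j k : `|sm (U j) k| <= 2 * T * jbp 1 k.
by rewrite ger0_norm ?smU0// jbp1; apply: sm_grow => i; exact: U_grow. Qed.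

Lemma em_le : em <= e0.
by apply: le_trans hem; rewrite ler_peMl//; have := Lr0; lra. Qed.

Lemma M0_w : l1 (fun k=> jbp b k * M0 m rho k) (1 / 2).
apply: (@l1W _ _ (4 * em + 2 * (Lr * em))); first by have := e0_le; have := hem; lra.
have := l1D (l1Z 4 (ch_m1 H)) (l1Z 2 (cv_l1w b_ge0 (ch_r1 H) (ch_m1 H))).
rewrite !ger0_norm//; apply: l1_le => k.
by rewrite /M0 mulrDr (mulrCA _ 4) (mulrCA _ 2).
Qed.

Lemma level j n : sm (U j.+1) n <= DD rho a0 (U j) (d ^+ j.+1) (2 * j.+1%:R) (sm W) n + cv (M0 m rho) (sm (U j.+1)) n.
apply: (y1_level (m := m) (Lm := em) (Lr := Lr) (T := T) (C := T) (N := 1)); try exact: h1m; try exact: h1r; try by case: H.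
- by rewrite exprn_gt0.
- exact: U_grow.
- exact: U_grow.
- exact: (ch_pos H).
- exact: (ch_neg H).
Qed.

Lemma level_low N B j n : 0 < N -> (forall k, sm (U j.+1) k <= B) ->
 sm (U j.+1) n <= DD rho a0 (U j) (d ^+ j.+1) (2 * j.+1%:R) (Wlow W N) n + cv (MM m rho N) (sm (U j.+1)) n.
move=> N0; apply: (@y1_level_low _ m rho W a0 (U j) (U j.+1) em Lr T T (d ^+ j.+1) (2 * j.+1%:R) N); try exact: h1m; try exact: h1r; try by case: H.
- by rewrite exprn_gt0.
- exact: U_grow.
- exact: U_grow.
- exact: (ch_pos H).
- exact: (ch_neg H).
Qed.

Lemma DD0 j w n : 0 <= DD rho a0 (U j) (d ^+ j.+1) (2 * j.+1%:R) w n.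
have dj: 0 < d ^+ j.+1 by rewrite exprn_gt0.
have jj: 0 <= 2 * j.+1%:R :> R by rewrite mulr_ge0.
exact: (DD_ge0 rho (ch_a0 H) dj jj (ch_U0 H j) (U_grow j) w n).
Qed.

Lemma Uy0n j k : 0 <= y0n (U j) k <= 4 * T.
exact: (y0n_bd (ch_U0 H j) (U_grow j) k). Qed.

Lemma DD_hn r j w A2 A3 : r <= s - 2 -> hn r (cv (rj rho) w) A2 ->
 hn r (fun n=> y0n (U j) n + cv rho (y0n (U j)) n) A3 ->
 hn r (DD rho a0 (U j) (d ^+ j.+1) (2 * j.+1%:R) w) (T + A2 + 2 * j.+1%:R * A3).
move=> hr h2 h3.
have hd: `|d ^+ j.+1| <= 1.
 by rewrite ger0_norm; [apply: exprn_ile1=> //; exact: ltW|apply: exprn_ge0; exact: ltW].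
have h1: hn (s - 2) (fun n=> `|n%:~R| * a0 n) T.
 by apply: hn_mulk; rewrite (_ : s - 2 + 1 = s - 1)//; [exact: (ch_a H)|ring].
have h1' := hnZ (d ^+ j.+1) (hnW hr (lexx T) h1).
have h2' := hnZ (d ^+ j.+1) h2; have h3' := hnZ (2 * j.+1%:R) h3.
have := hnD (hnD h1' h2') h3'.
have JJ: 0 <= 2 * j.+1%:R :> R by rewrite mulr_ge0.
rewrite (ger0_norm JJ); apply: hnW=> //.
rewrite lerD2r lerD//; first by rewrite ler_piMl.
by rewrite ler_piMl// (l2_ge0 h2).
Qed.

Lemma rj_l1 : l1 (rj rho) Lr.
exact: (hrj h1r). Qed.

Lemma smW_l2 : l2 (sm W) (2 * T).
by have := l2D (ch_W H) (l2_refl (ch_W H)); apply: l2W; lra. Qed.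

Lemma rjW_l2 : l2 (cv (rj rho) (sm W)) (Lr * (2 * T)).
exact: young2 rj_l1 smW_l2. Qed.

Lemma rho_l1 : l1 rho Lr. exact: (l1_jbp1 h1r). Qed.

End One.

(** Level 0 is only [O(|n|)], so [y0n] is merely bounded and square summable in order
    [-(1/2 + kap)]. The weight [3/2 + kap] of the kernel pays 1 for the growth and [1/2 + kap] for
    the negative order. *)
Lemma chain1 : conc (fun K T W U => hn (- (1 / 2 + kap)) (sm (U 1%N)) (K * T)).
have k0' := k0; have k1' := k1; have k2' := k2.
have [K0 hK0] := @jbp_summable R (1 / 2 + kap) ltac:(lra).
have K00 := l2_ge0 hK0.
have [Lp|Lm] := leP 0 Lr; last first.
 exists 0=> // em T m rho W a0 U H; have := l1_ge0 (ch_r1 H); lra.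
exists (2 * (1 + 2 * Lr + 2 * (4 * (1 + Lr) * K0))).
 by rewrite mulr_ge0// addr_ge0 ?mulr_ge0// ?addr_ge0// mulr_ge0.
move=> em T m rho W a0 U H hem; have T0 := l2_ge0 (ch_W H).
pose D := DD rho a0 (U 0%N) (d ^+ 1) (2 * 1%:R) (sm W).
have h3: hn (- (1 / 2 + kap)) (fun n=> y0n (U 0%N) n + cv rho (y0n (U 0%N)) n) (4 * (1 + Lr) * K0 * T).
 have C0: 0 <= 4 * (1 + Lr) * T by rewrite mulr_ge0// mulr_ge0// addr_ge0.
 have := l2Z (4 * (1 + Lr) * T) hK0; rewrite (ger0_norm C0) (mulrAC _ T).
 have yb k := Uy0n H 0%N k.
 apply: l2_le => n; rewrite [X in _ <= X]normrM (ger0_norm C0) normrM mulrC ler_wpM2r//.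
 have [y0 y4] := andP (yb n); rewrite ger0_norm; last by rewrite addr_ge0.
 have : cv rho (y0n (U 0%N)) n <= Lr * (4 * T).
 by apply: (cv_pt _ (rho_l1 H)) => k; have [? ?] := andP (yb k); rewrite ger0_norm.
 lra.
have h2: hn (- (1 / 2 + kap)) (cv (rj rho) (sm W)) (Lr * (2 * T)).
 by apply: (@hnW _ 0 _ _ (Lr * (2 * T))); [lra|by []|apply/hn0; exact: rjW_l2 H].
have hrs: - (1 / 2 + kap) <= s - 2 by lra.
have hD := DD_hn (j := 0%N) (T := T) H hrs h2 h3.
have hA := @absorb_neg _ 1 1 (1 / 2 + kap) (sm (U 1%N)) D (M0 m rho) _ (2 * T) ler01 ltac:(lra) ltac:(lra).
have q2: l1 (fun k=> jbp (1 + (1 / 2 + kap)) k * M0 m rho k) (1 / 2).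
 by have := M0_w H hem; rewrite /b (_ : 1 + (1 / 2 + kap) = 3 / 2 + kap)//; field.
have q4 n : `|sm (U 1%N) n| <= D n + cv (M0 m rho) (sm (U 1%N)) n.
 by rewrite ger0_norm ?(smU0 H)//; exact: (level H).
have := hA _ (smU_bd H 1%N) q2 hD (DD0 H 0%N _) q4; apply: hnW=> //.
by apply: le_of_eq; ring.
Qed.

Lemma y0n_hn r (V : int -> R) X : hn r (sm V) X -> hn (r + 1) (y0n V) (2 * X).
exact: hn_divn. Qed.

Lemma sumrho_hn r (rho y : int -> R) A X : l1 (fun k=> jbp `|r| k * rho k) A -> hn r y X ->
 hn r (fun n=> y n + cv rho y n) (X + A * X).
by move=> hr hy; apply: hnD hy (cv_hnw hr hy). Qed.

(** Dividing by [|n|] raises the order to [1/2 - kap >= 0], so the source is now in l2. *)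
Lemma chain_l2 : conc (fun K T W U => l2 (sm (U 2%N)) (K * T)).
have k0' := k0; have k1' := k1; have k2' := k2.
have [K1 K10 h1] := chain1.
have [Lp|Lm] := leP 0 Lr; last first.
 exists 0=> // em T m rho W a0 U H; have := l1_ge0 (ch_r1 H); lra.
exists (2 * (1 + 2 * Lr + 4 * (2 * K1 + Lr * (2 * K1)))).
 by rewrite mulr_ge0// addr_ge0 ?mulr_ge0// ?addr_ge0// ?mulr_ge0.
move=> em T m rho W a0 U H hem; have T0 := l2_ge0 (ch_W H).
have hy: hn 0 (y0n (U 1%N)) (2 * (K1 * T)).
 by apply: (@hnW _ (- (1 / 2 + kap) + 1) 0 _ _ _ _ (lexx _) (y0n_hn (h1 _ _ _ _ _ _ _ H hem))); lra.
have hr0: l1 (fun k=> jbp `|0 : R| k * rho k) Lr.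
 by apply: l1_le (rho_l1 H) => k; rewrite normr0 jbp0 mul1r.
have h3 := sumrho_hn hr0 hy.
have h2: hn 0 (cv (rj rho) (sm W)) (Lr * (2 * T)) by apply/hn0; exact: rjW_l2 H.
have hrs: 0 <= s - 2 by lra.
have hD := DD_hn (j := 1%N) (T := T) H hrs h2 h3.
apply: (@l2W _ _ (2 * (T + Lr * (2 * T) + 2 * 2%:R * (2 * (K1 * T) + Lr * (2 * (K1 * T)))))).
 by apply: le_of_eq; ring.
apply: (@absorb_grow _ 1 b (sm (U 2%N)) _ (M0 m rho) _ (2 * T)); last first.
- by move=> n; rewrite ger0_norm ?(smU0 H)//; exact: (level H).
- exact: DD0 H 1%N _.
- exact: (proj1 (hn0 _ _) hD).
- exact: M0_w H hem.
- exact: (smU_bd H 2%N).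
- by rewrite /b; lra.
exact: b_ge0.
Qed.

Lemma hn_low (r N T: R) (W : int -> R) : 0 <= r -> 0 <= N -> l2 (sm W) T ->
 hn r (Wlow W N) ((1 + N) `^ r * T).
move=> r0 N0 hW; have := l2Z ((1 + N) `^ r) hW; rewrite (ger0_norm (powR_ge0 _ _)).
apply: l2_le => k; rewrite /Wlow; case: ifP => hk; last by rewrite mulr0 normr0.
rewrite !normrM ler_wpM2r// !ger0_norm//; apply: powR_mono=> //; first exact: ltW.
by rewrite /jb lerD2l.
Qed.

(** Each level gains the derivative hidden in [U j n / |n|]. The cap [s - 2] is the regularity of
    [|n| a0] with [a0] of order [s - 1]. *)
Lemma chain_low (j: nat) : conc (fun K T W U => hn (minr j%:R (s - 2)) (sm (U j.+2)) (K * T)).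
have k0' := k0; have k1' := k1; have k2' := k2; have s0: 5 / 2 < s by lra.
have [Lp|Lm] := leP 0 Lr; last first.
 exists 0=> // em T m rho W a0 U H; have := l1_ge0 (ch_r1 H); lra.
have [K2 K20 h2] := chain_l2.
elim: j => [|j [Kj Kj0 IH]].
 exists K2=> // em T m rho W a0 U H hem; rewrite min_l; last lra.
 by apply/hn0; apply: h2 H hem.
have jE: j.+1%:R = j%:R + 1 :> R by rewrite -addn1 natrD.
pose r : R := minr j.+1%:R (s - 2); rewrite -/r.
have rs2: r <= s - 2 by rewrite /r ge_min lexx orbT.
have r1: 1 / 2 + kap <= r.
 have j0 := ler0n R j; rewrite /r le_min jE; apply/andP; split; lra.
have rj1: r <= minr j%:R (s - 2) + 1.
 by rewrite /r jE !minEle; do 2 case: ifPn; rewrite -?ltNge => *; lra.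
have [KA KA0 hA] := @cv_algebra R r ltac:(lra).
have [Ks Ks0 hs] := @cv_algebra R (s - 2) ltac:(lra).
have [Kt Kt0 ht] := @cv_algebra R (s - 1 / 2) ltac:(lra).
have [KF KF0 hF] := @absorb_full R (1 / 2 + kap) r ltac:(lra) r1.
(* Makes the l1 weight of [N^-1 * rj] at most [e0], the same smallness as for the part of the kernel
   proportional to [em]. *)
pose N := 8 * 2 `^ s * (Lr + 1).
have p2: 0 < 2 `^ s :> R by rewrite powR_gt0.
have N0: 0 < N by rewrite !mulr_gt0//; lra.
have Ni0: 0 < N^-1 by rewrite invr_gt0.
have hN: N^-1 * Lr <= e0.
 rewrite ler_pdivrMl// /N mulrAC /e0 divff ?mul1r ?gt_eqF ?mulr_gt0//; lra.
have [Rr0|Rrm] := leP 0 Rr; last first.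
 exists 0=> // em T m rho W a0 U H; have := l2_ge0 (ch_rh H); lra.
have [Rm0|Rmm] := leP 0 Rm; last first.
 exists 0=> // em T m rho W a0 U H; have := l2_ge0 (ch_mh H); lra.
pose A' := 4 * Rm + 2 * (Kt * (Rr * Rm)) + N^-1 * Rr.
pose D1 := Ks * (Rr * ((1 + N) `^ (s - 2) * 2)).
pose D2 := 2 * j.+3%:R * (2 * Kj + KA * (Rr * (2 * Kj))).
have A'0: 0 <= A' by rewrite /A' !addr_ge0 ?mulr_ge0// ltW.
exists (KF * ((1 + A') * (1 + D1 + D2))).
 by rewrite /D1 /D2; nonneg.
move=> em T m rho W a0 U H hem; have T0 := l2_ge0 (ch_W H).
have em0 := l1_ge0 (ch_m1 H).
have hx2: l2 (sm (U j.+3)) (K2 * T).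
 apply: l2_le (h2 _ _ _ _ _ _ _ H hem) => k; rewrite !ger0_norm ?(smU0 H)//.
 exact: (sm_dec2 H).
have hw c : c <= 1 / 2 + kap -> l1 (fun k=> jbp c k * MM m rho N k) ((4 + 2 * Lr) * em + N^-1 * Lr).
 move=> hc; have h1 := l1D (l1Z 4 (ch_m1 H)) (l1Z 2 (cv_l1w b_ge0 (ch_r1 H) (ch_m1 H))).
 have := l1D h1 (l1Z N^-1 (ch_r1 H)); rewrite (gtr0_norm Ni0) !(ger0_norm (ler0n _ _)) => h4.
 have h5: 4 * em + 2 * (Lr * em) + N^-1 * Lr <= (4 + 2 * Lr) * em + N^-1 * Lr by lra.
 apply: (l1W h5); apply: l1_le h4 => k.
 have cb: jbp c k <= jbp b k :> R by apply: jbp_le; rewrite /b; lra.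
 have cb1: jbp c k * `|k%:~R| <= jbp b k.
 apply: (le_via (jbp c k * jbp 1 k)); first by rewrite jbp1 ler_wpM2l// nk_jb.
 by rewrite -jbpD jbp_le// /b; lra.
 have -> : jbp c k * MM m rho N k = 4 * (jbp c k * m k) + 2 * (jbp c k * cv rho m k) + N^-1 * (jbp c k * `|k%:~R| * rho k).
 by rewrite /MM /M0 /rj; ring.
 have p1: 0 <= m k by exact: (ch_m0 H). have p3: 0 <= rho k by exact: (ch_r0 H).
 have p4: 0 <= `|k%:~R : R| by []. have p5 := ltW Ni0.
 rewrite ger0_norm; last by rewrite !(addr_ge0, mulr_ge0).
 rewrite [leRHS]ger0_norm; last by rewrite !(addr_ge0, mulr_ge0).
 by apply: lerD; [apply: lerD|]; rewrite ler_wpM2l// ler_wpM2r.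
have hsum: (4 + 2 * Lr) * em + N^-1 * Lr <= 2 * e0 by lra.
have ee := e0_le; have ee0 := e0_gt0.
have hMM1: l1 (fun k=> jbp (1 / 2 + kap) k * MM m rho N k) (1 / 2) by apply: (l1W _ (hw _ (lexx _))); lra.
have hMM2: l1 (MM m rho N) (2 * e0).
 by apply: (l1W hsum); apply: l1_le (hw 0 _) => [k|]; [rewrite jbp0 mul1r|lra].
have hrs: r <= s by apply: (le_trans rs2); rewrite lerBlDr lerDl.
have hMM3: 2 `^ r * (2 * e0) <= 1 / 2.
 by rewrite mulrCA (le_trans (ler_wpM2l (ler0n _ 2) (two_pow hrs)))//; lra.
have rs3: r <= s - 1 / 2 by lra.
have rs4: s - 2 <= s - 1 / 2 - 1 by lra.
have hrj: hn (s - 2) (rj rho) Rr.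
 by apply: (hnW rs4 (lexx _)); apply: hn_mulk; rewrite subrK; exact: (ch_rh H).
have hMM4: hn r (MM m rho N) A'.
 have h1 := hnD (hnZ 4 (ch_mh H)) (hnZ 2 (ht _ _ _ _ (ch_rh H) (ch_mh H))).
 have := hnD (hnW rs3 (lexx _) h1) (hnZ N^-1 (hnW rs2 (lexx _) hrj)).
 by rewrite (gtr0_norm Ni0) !(ger0_norm (ler0n _ _)).
have hs0: 0 <= s - 2 by lra.
have hlow := hn_low hs0 (ltW N0) (smW_l2 H).
have h2' := hnW rs2 (lexx _) (hs _ _ _ _ hrj hlow).
have hy := hnW rj1 (lexx _) (y0n_hn (IH _ _ _ _ _ _ _ H hem)).
have h3' := hnD hy (hA _ _ _ _ (hnW rs3 (lexx _) (ch_rh H)) hy).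
have hD := DD_hn (j := j.+2) (T := T) H rs2 h2' h3'.
have hB k : sm (U j.+3) k <= K2 * T by have := l2_pt k hx2; rewrite ger0_norm ?(smU0 H).
have := hF _ _ _ _ _ _ _ hx2 hMM1 hMM2 hMM3 hMM4 hD (DD0 H j.+2 _).
have hL n : `|sm (U j.+3) n| <= DD rho a0 (U j.+2) (d ^+ j.+3) (2 * j.+3%:R) (Wlow W N) n + cv (MM m rho N) (sm (U j.+3)) n.
 by rewrite ger0_norm ?(smU0 H)//; exact: (level_low H n N0 hB).
move=> /(_ hL); apply: hnW=> //.
apply: le_of_eq; rewrite /D1 /D2; ring.
Qed.

Lemma chain_W : conc (fun K T W U => hn (s - 1) W (K * T)).
have k0' := k0; have k1' := k1; have k2' := k2; have s0: 5 / 2 < s by lra.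
(* Enough levels for the order to reach its cap [s - 2]; dividing by [d^j |n|] then returns to [W]
   with one more derivative. *)
pose j := (Num.truncn s).+1.
have hj: minr j%:R (s - 2) = s - 2.
 rewrite min_r//; have s1: 0 <= s by lra.
 have := truncnS_gt s; rewrite -/j; lra.
have [K K0 hK] := chain_low j; rewrite hj in hK.
have dj0: 0 < d ^+ j.+2 by rewrite exprn_gt0.
have e0': 0 <= (d ^+ j.+2)^-1 by rewrite invr_ge0 ltW.
exists (1 + (d ^+ j.+2)^-1 * (2 * K)); first by rewrite addr_ge0// !mulr_ge0.
move=> em T m rho W a0 U H hem; have T0 := l2_ge0 (ch_W H).
have h1 := hn_divn (hK _ _ _ _ _ _ _ H hem).
rewrite (_ : s - 2 + 1 = s - 1) in h1; last ring.
have h2 := hnZ (d ^+ j.+2)^-1 h1; rewrite (ger0_norm e0') in h2.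
have h3: hn (s - 1) (fun k=> if k == 0 then W 0 else 0) T.
 apply: l2_le (ch_W H) => k; case: eqP => [->|_]; last by rewrite mulr0 normr0.
 by rewrite /jbp /jb mulr0z normr0 addr0 powR1 mul1r.
have := hnD h3 h2; rewrite (_ : T + _ = (1 + (d ^+ j.+2)^-1 * (2 * K)) * T); last ring.
apply: hn_le => k; rewrite (ger0_norm (ch_W0 H k)) ger0_norm; last first.
 by rewrite addr_ge0 ?mulr_ge0 ?divr_ge0 ?(smU0 H)//; case: ifP=> // _; exact: (ch_W0 H).
have [->|kz] := eqVneq k 0; first by rewrite lerDl mulr_ge0// divr_ge0// (smU0 H).
rewrite add0r ler_pdivlMl// ler_pdivlMr; last by rewrite (lt_le_trans ltr01)// nk_ge1.
apply: le_trans (ler_wpDr _ (lexx (U j.+2 k))); last exact: (ch_U0 H).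
by apply: le_trans (ch_WU H j.+2 k); rewrite mulrAC -mulrA.
Qed.

Definition pos (x : int -> R) k : R := if 0 < k then x k else 0.

Lemma chain_pos (r: R) (j: nat) : 0 <= r -> r + 1 <= s - 1 / 2 -> (1 / 2 + kap <= r + 1) ->
 conc (fun K T W U => hn (s - 2) (sm (U j.+3)) (K * T)) ->
 conc (fun K T W U => hn r (pos (U j.+2)) (K * T)) ->
 conc (fun K T W U => hn (r + 1) (pos (U j.+3)) (K * T)).
move=> r0 rs rk [Ka Ka0 ha] [Kb Kb0 hb].
have k0' := k0; have k1' := k1; have k2' := k2; have s0: 5 / 2 < s by lra.
have [Lp|Lm] := leP 0 Lr; last first.
 exists 0=> // em T m rho W a0 U H; have := l1_ge0 (ch_r1 H); lra.
have [Rm0|Rmm] := leP 0 Rm; last first.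
 exists 0=> // em T m rho W a0 U H; have := l2_ge0 (ch_mh H); lra.
have [KF KF0 hF] := @absorb_full R (1 / 2 + kap) (r + 1) ltac:(lra) rk.
have [Kl Kl0 hl] := @hn_l1 R (s - 2) ltac:(lra).
exists (KF * ((1 + 2 * Rm) * (2 * (Kl * Ka * Rm) + 2 * j.+3%:R * (2 * Kb)))).
 by nonneg.
move=> em T m rho W a0 U H hem; have T0 := l2_ge0 (ch_W H).
have em0 := l1_ge0 (ch_m1 H); have eml := em_le H hem.
have ee := e0_le; have ee0 := e0_gt0.
have hU := ha _ _ _ _ _ _ _ H hem.
(* Only l1 is needed of this part, which the order [s - 2 > 1/2] provides. *)
pose un k : R := if 0 < k then 0 else U j.+3 k.
have un0 k : 0 <= un k by rewrite /un; case: ifP=> // _; exact: (ch_U0 H).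
have up0 k : 0 <= pos (U j.+3) k by rewrite /pos; case: ifP=> // _; exact: (ch_U0 H).
have hun: l1 un (Kl * (Ka * T)).
 apply: l1_le (hl _ _ hU) => k; rewrite ger0_norm// (ger0_norm (smU0 H _ _)).
 by rewrite /un; case: ifP => _; [exact: (smU0 H)|rewrite lerDl (ch_U0 H)].
have hmr: l2 (fun k=> jbp (r + 1) k * m k) Rm by exact: (hnW rs (lexx _) (ch_mh H)).
pose D n : R := if 0 < n then 2 * cv m un n + 2 * j.+3%:R * (U j.+2 n / `|n%:~R|) else 0.
have D0 n : 0 <= D n.
 rewrite /D; case: ifP=> // _; rewrite addr_ge0 ?mulr_ge0// ?invr_ge0//; exact: (ch_U0 H).
have hD: hn (r + 1) D (2 * (Kl * Ka * Rm) * T + 2 * j.+3%:R * (2 * Kb) * T).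
 have h1 := young2 hun hmr.
 have h2 := hn_divn (hb _ _ _ _ _ _ _ H hem).
 have := l2D (l2Z 2 h1) (hnZ (2 * j.+3%:R) h2); rewrite !ger0_norm// ?mulr_ge0// => h3.
 have h4: 2 * (Kl * (Ka * T) * Rm) + 2 * j.+3%:R * (2 * (Kb * T)) <= 2 * (Kl * Ka * Rm) * T + 2 * j.+3%:R * (2 * Kb) * T.
 by apply: le_of_eq; ring.
 apply: (l2W h4); apply: l2_le h3 => n; rewrite /D /pos; case: ifPn => n0; last by rewrite mulr0 normr0.
 have q1: 0 <= U j.+2 n / `|n%:~R| by rewrite divr_ge0// (ch_U0 H).
 rewrite ger0_norm; last by nonneg.
 rewrite [X in _ <= X]ger0_norm; last by nonneg.
 rewrite mulrDr lerD//.
 rewrite mulrCA ler_wpM2l// cvC; apply: cv_le1=> // [k|].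
 rewrite !normrM !(ger0_norm (jbp_ge0 _ _)) (ger0_norm (ch_m0 H _)) (ger0_norm (un0 _)).
 rewrite /un; case: ifPn => hk; first by rewrite !mul0r mulr0.
 rewrite mulrCA ler_wpM2l ?(ch_U0 H)// ler_wpM2r ?(ch_m0 H)//.
 apply: powR_mono; rewrite ?addr_ge0// ?(ltW (jb_gt0 _))//.
 exact: jb_mono n0 hk.
 exact: l1_summable hun (l2_bdd hmr).
have hx: l2 (pos (U j.+3)) (Ka * T).
 have hs0: 0 <= s - 2 by lra.
 apply: l2_le (hn_l2 hs0 hU) => k; rewrite ger0_norm// (ger0_norm (smU0 H _ _)).
 by rewrite /pos; case: ifP => _; [rewrite lerDl (ch_U0 H)|exact: (smU0 H)].
have hkb: 1 / 2 + kap <= b by rewrite /b; lra.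
have hM1: l1 (fun k=> jbp (1 / 2 + kap) k * (2 * m k)) (1 / 2).
 have h2e: 2 * em <= 1 / 2 by lra.
 have := l1Z 2 (l1w hkb (ch_m1 H)); rewrite (ger0_norm (ler0n _ _)) => h.
 by apply: (l1W h2e); apply: l1_le h => k; rewrite mulrCA.
have hm1: l1 (fun k=> jbp 1 k * m k) em by exact: l1w b_ge1 (ch_m1 H).
have hM2: l1 (fun k=> 2 * m k) (2 * em).
 by have := l1Z 2 (l1_jbp1 hm1); rewrite (ger0_norm (ler0n _ _)).
have hM3: 2 `^ (r + 1) * (2 * em) <= 1 / 2.
 have h8 := @two_pow (r + 1) ltac:(lra).
 have : 2 `^ (r + 1) * em <= 2 `^ (r + 1) * e0 by rewrite ler_wpM2l.
 lra.
have hM4: hn (r + 1) (fun k=> 2 * m k) (2 * Rm).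
 by have := hnZ 2 hmr; rewrite (ger0_norm (ler0n _ _)).
have := hF _ _ _ _ _ _ _ hx hM1 hM2 hM3 hM4 hD D0.
have hL n : `|pos (U j.+3) n| <= D n + cv (fun k=> 2 * m k) (pos (U j.+3)) n.
 rewrite ger0_norm// /D {1}/pos; case: ifPn => n0; last by rewrite add0r.
 apply: (le_trans (ch_pos H j.+2 n0)).
 have hg (x : int -> R) : (forall k, 0 <= x k <= U j.+3 k) -> (asum (fun k=> m (n - k) * x k)%R < +oo)%E.
 move=> hx'; apply: (grow_summable (a := 1) (C := T) n ler01 (lexx 1) hm1) => k.
 by have /andP[x0 xu] := hx' k; rewrite ger0_norm// jbp1 (le_trans xu)// (U_grow H).
 have s1: (asum (fun k=> m (n - k) * pos (U j.+3) k)%R < +oo)%E.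
 by apply: hg => k; apply/andP; split; [exact: up0|rewrite /pos; case: ifP => _; [by []|exact: (ch_U0 H)]].
 have s2: (asum (fun k=> m (n - k) * un k)%R < +oo)%E.
 by apply: hg => k; apply/andP; split; [exact: un0|rewrite /un; case: ifP => _; [exact: (ch_U0 H)|by []]].
 have EU: (fun k=> pos (U j.+3) k + un k) = U j.+3.
 by apply/funext => k; rewrite /pos /un; case: ifP => _; [exact: addr0|exact: add0r].
 have h1 := cvDr_le s1 s2; rewrite EU in h1.
 have h2 := cvZl_ge (ler0n R 2) s1.
 move: h1 h2; set c1 := cv m _ n; set c2 := cv m _ n; set c3 := cv m _ n; set c4 := cv _ _ n.
 set q := 2 * j.+3%:R * _; move: c1 c2 c3 c4 q => c1 c2 c3 c4 q; lra.
move=> /(_ hL); apply: hnW=> //.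
by apply: le_of_eq; ring.
Qed.

(* The gain of half a derivative for positive frequencies is limited only by
 the regularity of [m]. *)
Lemma chain_Wpos : conc (fun K T W U => hn (s + 1 / 2) (pos W) (K * T)).
have k0' := k0; have k1' := k1; have k2' := k2; have s0: 5 / 2 < s by lra.
pose j := (Num.truncn s).+1.
have hall i : conc (fun K T W U => hn (s - 2) (sm (U (j + i).+2)) (K * T)).
 have hj: minr (j + i)%:R (s - 2) = s - 2.
 rewrite min_r//; have s1: 0 <= s by lra.
 have h1 := truncnS_gt s; have h2: j%:R <= (j + i)%:R :> R by rewrite ler_nat leq_addr.
 rewrite -/j in h1; lra.
 by have := chain_low (j + i); rewrite hj.
have hp0: conc (fun K T W U => hn (s - 2) (pos (U j.+2)) (K * T)).
 have [K K0 hK] := hall 0%N; rewrite addn0 in hK; exists K=> // em T m rho W a0 U H hem.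
 apply: hn_le (hK _ _ _ _ _ _ _ H hem) => k; rewrite (ger0_norm (smU0 H _ _)) /pos.
 by case: ifP => _; rewrite ?normr0 ?(smU0 H)// (ger0_norm (ch_U0 H _ _)) lerDl (ch_U0 H).
(* From order [s - 2] to [s - 1]. *)
have hp1: conc (fun K T W U => hn (s - 2 + 1) (pos (U j.+3)) (K * T)).
 by apply: chain_pos=> //; [lra|lra|lra|have := hall 1%N; rewrite addn1].
(* The start is lowered to [s - 3/2] so as to end at [s - 1/2], the regularity of [m]; the final
   division by [|n|] gives [s + 1/2]. *)
have hp2: conc (fun K T W U => hn (s - 3 / 2 + 1) (pos (U j.+4)) (K * T)).
 apply: chain_pos=> //; [lra|lra|lra|by have := hall 2%N; rewrite addn2|].
 have [K K0 hK] := hp1; exists K=> // em T m rho W a0 U H hem.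
 by apply: (hnW _ (lexx _) (hK _ _ _ _ _ _ _ H hem)); lra.
have [K K0 hK] := hp2.
have dj0: 0 < d ^+ j.+4 by rewrite exprn_gt0.
have e0': 0 <= (d ^+ j.+4)^-1 by rewrite invr_ge0 ltW.
exists ((d ^+ j.+4)^-1 * (2 * K)); first by nonneg.
move=> em T m rho W a0 U H hem; have T0 := l2_ge0 (ch_W H).
have h1 := hn_divn (hK _ _ _ _ _ _ _ H hem).
rewrite (_ : s - 3 / 2 + 1 + 1 = s + 1 / 2) in h1; last by field.
have := hnZ (d ^+ j.+4)^-1 h1; rewrite (ger0_norm e0').
rewrite (_ : _ * (2 * (K * T)) = (d ^+ j.+4)^-1 * (2 * K) * T); last ring.
apply: hn_le => k; rewrite /pos; case: ifPn => kp; last by rewrite normr0.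
have kz: k != 0 by rewrite gt_eqF.
rewrite (ger0_norm (ch_W0 H k)) ger0_norm; last by rewrite mulr_ge0// divr_ge0// (ch_U0 H).
rewrite ler_pdivlMl// ler_pdivlMr; last by rewrite (lt_le_trans ltr01)// nk_ge1.
by apply: le_trans (ch_WU H j.+4 k); rewrite mulrAC -mulrA.
Qed.

End Data.

End Chain.

(** * Coefficients of products and of inverses *)

Section Products.
Context {R : realType}.
Implicit Types (u v g : R -> R[i]) (k n: int) (x: R).

Lemma fc_bdd u : ccont u -> exists B : R, forall k, nc (fc u k) <= B.
move=> cu; have [C hC] := cont_bddP (contnc cu); exists C => k.
by apply: nc_fc=> // x hx; have := hC x hx; rewrite ger0_norm ?nc_ge0.
Qed.

Lemma mul_fc u v n (A: R) : l1 (fun k=> nc (fc u k)) A -> ccont u -> periodic u tau -> ccont v ->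
 nc (fc (fun x=> u x * v x) n) <= cv (fun k=> nc (fc u k)) (fun k=> nc (fc v k)) n.
move=> hu cu pu cv'; have [B hB] := fc_bdd cv'.
by apply: (mul_maj n _ hu cu pu cv' _ _ hB)=> // k; exact: nc_ge0.
Qed.

Lemma bessel_l2 u (B: R) : 0 <= B -> ccont u -> itor (fun x=> nc (u x) ^+ 2) <= tau * B ^+ 2 ->
 l2 (fun k=> nc (fc u k)) B.
move=> B0 cu hB; apply: l2_fin=> // F; have tp := @twopi_gt0 R.
have -> : \sum_(k <- F) nc (fc u k) ^+ 2 = (tau^-1) ^+ 2 * \sum_(k <- F) nc (fourier u k) ^+ 2.
 by rewrite mulr_sumr; apply: eq_bigr => k _; rewrite /fc nc_2piV exprMn.
rewrite exprVn ler_pdivrMl ?exprn_gt0//; apply: (le_trans (bessel F cu)).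
have -> : tau ^+ 2 * B ^+ 2 = tau * (tau * B ^+ 2) by move: tau => p; ring.
by rewrite ler_wpM2l// ltW.
Qed.

Lemma bessel_sup u (B: R) : 0 <= B -> ccont u -> (forall x, nc (u x) <= B) ->
 l2 (fun k=> nc (fc u k)) B.
move=> B0 cu hB; apply: bessel_l2=> //; rewrite -itor_cst; apply: le_itor.
- by apply: contX; exact: contnc.
- exact: contC.
by move=> x _; rewrite lerXn2r// nnegrE// (le_trans (nc_ge0 _) (hB x)).
Qed.

Lemma hn_up (r: R) (x : int -> R) X Y : hn r x X -> hn r (fun k=> `|k%:~R| * x k) Y -> hn (r + 1) x (X + Y).
move=> hX hY.
have hX': hn r (fun k=> `|x k|) X by apply: hn_le hX => k; rewrite normr_id.
have hY': hn r (fun k=> `|k%:~R| * `|x k|) Y by apply: hn_le hY => k; rewrite !normrM !normr_id.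
have := hnD hX' hY'; apply: l2_le => k.
rewrite jbpD jbp1 -mulrA !normrM !(ger0_norm (jbp_ge0 _ _)) ler_wpM2l//.
by rewrite (gtr0_norm (jb_gt0 k)) [leRHS]ger0_norm ?addr_ge0 ?mulr_ge0// /jb mulrDl mul1r.
Qed.

Lemma fc_der u u1 k : ccont u1 -> (forall x, cder u x (u1 x)) -> periodic u tau ->
 fc u1 k = 'i * (k%:~R * fc u k).
move=> c1 hu pu; rewrite /fc (fourier_der (u := u))//; last by rewrite -[tau]add0r (pu 0).
by move: (fourier _ _) => z; ring.
Qed.

Lemma nc_fc_der u u1 k : ccont u1 -> (forall x, cder u x (u1 x)) -> periodic u tau ->
 nc (fc u1 k) = `|k%:~R| * nc (fc u k).
by move=> c1 hu pu; rewrite (fc_der k c1 hu pu) ncM ncM nc_i mul1r nc_int. Qed.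

Lemma cder_ccont u u1 : (forall x, cder u x (u1 x)) -> ccont u.
by move=> h; split=> x; have [h1 h2] := cder_cont (h x). Qed.

Variable s : R.
Hypothesis hs : 5 / 2 < s.

(* [1/g] is bootstrapped through [(1/g)' = - g' (1/g)^2]. *)
Lemma inv_reg (Mz: R) : 0 <= Mz -> exists2 K : R, 0 <= K & forall g g1 (z : int -> R),
 ccont g1 -> (forall x, cder g x (g1 x)) -> periodic g tau -> periodic g1 tau ->
 (forall x, 1 / 2 <= nc (g x)) -> (forall k, 0 <= z k) -> (forall k, nc (fc g1 k) <= z k) ->
 hn (s - 3 / 2) z Mz -> hn (s - 1 / 2) (fun k=> nc (fc (fun x=> (g x)^-1) k)) K.
move=> M0; have hs' := hs.
have [Kl Kl0 hl] := @hn_l1 R (s - 3 / 2) ltac:(lra).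
(* Order 1 follows from sup bounds on [1/g] and on its derivative; each step adds one derivative
   until the cap [s - 1/2]. *)
suff H (j: nat) : exists2 K : R, 0 <= K & forall g g1 (z : int -> R),
 ccont g1 -> (forall x, cder g x (g1 x)) -> periodic g tau -> periodic g1 tau ->
 (forall x, 1 / 2 <= nc (g x)) -> (forall k, 0 <= z k) -> (forall k, nc (fc g1 k) <= z k) ->
 hn (s - 3 / 2) z Mz -> hn (minr (j%:R + 1) (s - 1 / 2)) (fun k=> nc (fc (fun x=> (g x)^-1) k)) K.
 have [K K0 hK] := H (Num.truncn s).+1; exists K=> // g g1 z h1 h2 h3 h4 h5 h6 h7 h8.
 have := hK g g1 z h1 h2 h3 h4 h5 h6 h7 h8; rewrite min_r//.
 by have := truncnS_gt s; lra.
have gen g g1 : ccont g1 -> (forall x, cder g x (g1 x)) -> periodic g tau -> periodic g1 tau ->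
 (forall x, 1 / 2 <= nc (g x)) ->
 [/\ ccont (fun x=> (g x)^-1), periodic (fun x=> (g x)^-1) tau, (forall x, nc ((g x)^-1) <= 2) &
 forall k, `|k%:~R| * nc (fc (fun x=> (g x)^-1) k) = nc (fc (fun x=> g1 x * ((g x)^-1 * (g x)^-1)) k)].
 move=> c1 hg pg p1 low.
 have g0 x : g x != 0 by rewrite -nc_eq0 gt_eqF// (lt_le_trans _ (low x)).
 have cA: ccont (fun x=> (g x)^-1) by apply: ccontV=> //; exact: cder_ccont hg.
 have pA: periodic (fun x=> (g x)^-1) tau by move=> x; rewrite pg.
 split=> // [x|k].
 by rewrite ncV -[leRHS]invrK lef_pV2 ?posrE ?invr_gt0// ?(lt_le_trans _ (low x))//; have := low x; lra.
 pose A1 x := - (g1 x * ((g x)^-1 * (g x)^-1)).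
 have cA1: ccont A1 by apply: ccontN; apply: ccontM=> //; apply: ccontM.
 rewrite -(@nc_fc_der _ A1) //; last first.
 move=> x; apply: cder_eq (cder_inv (g0 x) (hg x)).
 by rewrite /A1 expr2 invfM mulNr.
 rewrite /A1 -[in RHS]ncN; congr nc; rewrite /fc fourierN ?mulrN//.
 by apply: ccontM=> //; apply: ccontM.
elim: j => [|j [K K0 IH]].
 exists (2 + Kl * Mz * 4); first by nonneg.
 move=> g g1 z c1 hg pg p1 low z0 hz hM; have [cA pA A2 Ad] := gen g g1 c1 hg pg p1 low.
 have hzl := hl _ _ hM.
 have gb x : nc (g1 x) <= Kl * Mz.
 by rewrite (fc_inversion z0 hzl hz c1 p1 x); exact: nc_ts hz.
 have B0: 0 <= Kl * Mz * 4 by nonneg.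
 have h1: l2 (fun k=> `|k%:~R| * nc (fc (fun x=> (g x)^-1) k)) (Kl * Mz * 4).
 rewrite (_ : (fun k=> _) = (fun k=> nc (fc (fun x=> g1 x * ((g x)^-1 * (g x)^-1)) k))); last first.
 by apply/funext => k; exact: Ad.
 apply: bessel_sup=> // [|x]; first by apply: ccontM=> //; apply: ccontM.
 rewrite ncM ler_pM// ncM (_ : 4 = 2 * 2); last by ring.
 by rewrite ler_pM.
 have h0: l2 (fun k=> nc (fc (fun x=> (g x)^-1) k)) 2 by apply: bessel_sup.
 have := hn_up (proj2 (hn0 _ _) h0) (proj2 (hn0 _ _) h1).
 by rewrite add0r => h2; rewrite min_l ?add0r//; lra.
pose r : R := minr (j%:R + 1) (s - 3 / 2).
have j0 := ler0n R j.
have r1: 1 <= r by rewrite /r le_min; apply/andP; split; lra.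
have rle: r <= minr (j%:R + 1) (s - 1 / 2).
 by rewrite /r !minEle; do 2 case: ifPn; rewrite -?ltNge => *; lra.
have rup: r + 1 = minr (j.+1%:R + 1) (s - 1 / 2).
 have E: j.+1%:R = j%:R + 1 :> R by rewrite -addn1 natrD.
 by rewrite /r E !minEle; do 2 case: ifPn; rewrite -?ltNge => *; lra.
have rs: r <= s - 3 / 2 by rewrite /r ge_min lexx orbT.
have [KA KA0 hA] := @cv_algebra R r ltac:(lra).
have [Kr Kr0 hr] := @hn_l1 R r ltac:(lra).
exists (K + KA * (Mz * (KA * (K * K)))); first by nonneg.
move=> g g1 z c1 hg pg p1 low z0 hz hM; have [cA pA A2 Ad] := gen g g1 c1 hg pg p1 low.
have hK := IH g g1 z c1 hg pg p1 low z0 hz hM.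
have hKr := hnW rle (lexx _) hK.
rewrite -rup; apply: (hn_up hKr).
have hzr := hnW rs (lexx _) hM.
have h2 := hA _ _ _ _ hKr hKr.
have := hA _ _ _ _ hzr h2; apply: hn_le => k.
rewrite Ad [leRHS]ger0_norm// ger0_norm//.
have r0: 0 <= r by lra.
apply: (mul_maj (B := KA * (K * K)) k z0 (hr _ _ hzr))=> //; first by apply: ccontM.
- by move=> i; apply: (mul_fc i (hr _ _ hKr)).
by move=> i; have := hn_pt i r0 h2; rewrite ger0_norm ?cv_ge0.
Qed.

End Products.

(** * Suprema of coefficients over the collar *)

Section Sup.
Context {R : realType}.
Implicit Types (F : R -> int -> R) (t: R) (k: int).
Variable d : R.
Hypothesis d0 : 0 <= d.

(** The supremum is taken coefficient by coefficient, before summation: convolution inequalities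
    then hold between fixed sequences, which bounds uniform in [t] would not give. *)
Definition supn F k : R := sup [set F t k | t in [set t : R | 0 <= t <= d]].

Lemma supn_le F k X : (forall t, 0 <= t -> t <= d -> F t k <= X) -> supn F k <= X.
move=> h; apply: ge_sup.
 by exists (F 0 k); exists 0=> //=; rewrite lexx d0.
by move=> y [t /= /andP[t0 td] <-]; exact: h.
Qed.

Lemma supn_ub F k X : (forall t, 0 <= t -> t <= d -> F t k <= X) ->
 forall t, 0 <= t -> t <= d -> F t k <= supn F k.
move=> h t t0 td; apply: ub_le_sup; last by exists t=> //=; rewrite t0 td.
by exists X => y [s /= /andP[s0 sd] <-]; exact: h.
Qed.

End Sup.

(** * Regularity and smallness of the collar multipliers *)

Section Coefs.
Context {R : realType}.
Implicit Types (t x d M: R) (k n: int) (c : int -> R[i]) (eta : R -> R).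

Lemma prof_mul b (y: R) : 0 <= y -> `|y * prof b y| <= 9.
move=> y0; have e0 := expR_gt0 (- y).
have h: (1 + y / 2) ^+ 2 * expR (- y) <= 1.
 have : (1 + y / 2) ^+ 2 <= expR (y / 2) ^+ 2.
 by rewrite lerXn2r ?nnegrE ?addr_ge0 ?divr_ge0 ?expR_ge0// expR_ge1Dx.
 by rewrite -expRM_natl mulr_natl -[y / 2 *+ 2]mulr_natr divfK// -(ler_pM2r e0) -expRD subrr expR0.
have h0: 0 <= y * expR (- y) by rewrite mulr_ge0// ltW.
have h2: 0 <= y ^+ 2 * expR (- y) by rewrite mulr_ge0// ltW.
have E: (1 + y / 2) ^+ 2 * expR (- y) = expR (- y) + y * expR (- y) + y ^+ 2 * expR (- y) / 4 by field.
rewrite E in h.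
case: b; rewrite /prof; last by rewrite ger0_norm//; move: e0 h0 h2 h; lra.
have -> : y * ((1 + 2 * y) * expR (- y)) = y * expR (- y) + 2 * (y ^+ 2 * expR (- y)) by ring.
by rewrite ger0_norm; move: e0 h0 h2 h; lra.
Qed.

Lemma kec_dec k t : 0 < t -> `|k%:~R| * `|ec k t| <= 9 / t.
move=> t0; have h1 := prof_mul (0 < k) (cy_ge0 k t).
rewrite ler_pdivlMr//; apply: le_trans h1.
rewrite /ec {2}/cy max_l ?(ltW t0)// !normrM normr_id (gtr0_norm t0).
by rewrite mulrAC.
Qed.

(** Common majorant, up to a factor 4, of the coefficients of [nu] and of the variation of [Z_x]
    between two depths up to [d]. *)
Definition zeta c d k : R := `|k%:~R| * minr 1 (`|k%:~R| * d) * nc (c k).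

Lemma zeta_ge0 c d k : 0 <= d -> 0 <= zeta c d k.
by move=> d0; rewrite !mulr_ge0// le_min ler01 mulr_ge0. Qed.

Lemma zeta_hn (s M d: R) c : 0 <= d -> hn (s + 1 / 2) (fun k=> nc (c k)) M -> hn (s - 1 / 2) (zeta c d) M.
move=> d0 hc.
have h1: hn (s - 1 / 2) (fun k=> `|k%:~R| * nc (c k)) M.
 by apply: hn_mulk; rewrite (_ : s - 1 / 2 + 1 = s + 1 / 2)//; field.
apply: hn_le h1 => k; rewrite (ger0_norm (zeta_ge0 _ _ d0)) ger0_norm ?mulr_ge0//.
by rewrite /zeta ler_wpM2r// ler_piMr// ge_min lexx.
Qed.

Lemma min1_pow (kap y: R) : 0 <= kap -> kap <= 1 -> 0 <= y -> minr 1 y <= y `^ kap.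
move=> k0 k1 y0; have [y1|y1] := leP 1 y.
 by apply: (le_via (1 `^ kap)); [rewrite powR1|apply: powR_mono].
have [->|yn] := eqVneq y 0; first exact: powR_ge0.
have yp: 0 < y by rewrite lt0r yn y0.
rewrite -[X in X <= _](@powRr1 R y)// -{1}(subrK kap 1) powRD; last by rewrite yn implybT.
rewrite ler_piMl//; apply: (le_via (1 `^ (1 - kap))); last by rewrite powR1.
by apply: powR_mono; rewrite ?subr_ge0// ltW.
Qed.

(** [min(1, y) <= y^kap] turns a small depth into the factor [d^kap] at the cost of [kap]
    derivatives. With the weight [3/2 + kap] and the factor [|k|] this makes [5/2 + 2 kap], which is
    summable since [s > 5/2 + 2 kap]. *)
Lemma zeta_l1 (s kap: R) : 0 < kap -> kap <= 1 / 8 -> 4 * kap <= s - 5 / 2 ->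
 exists2 K : R, 0 <= K & forall M d c, 0 < d -> hn (s + 1 / 2) (fun k=> nc (c k)) M ->
 l1 (fun k=> jbp (3 / 2 + kap) k * zeta c d k) (d `^ kap * (K * M)).
move=> k0 k1 k2; have [K K0 hK] := @hn_l1w R (s + 1 / 2) (5 / 2 + 2 * kap) ltac:(lra).
exists K=> // M d c d0 hc; have := l1Z (d `^ kap) (hK _ _ hc).
rewrite (ger0_norm (powR_ge0 _ _)); apply: l1_le => k.
have p0: 0 <= jbp (3 / 2 + kap) k :> R by exact: jbp_ge0.
rewrite ger0_norm; last by rewrite mulr_ge0// zeta_ge0// ltW.
rewrite ger0_norm; last by rewrite !mulr_ge0.
rewrite /zeta !mulrA ler_wpM2r//.
have h1: minr 1 (`|k%:~R| * d) <= d `^ kap * jbp kap k.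
 apply: (le_trans (min1_pow (ltW k0) _ _)); [lra|by rewrite mulr_ge0// ltW|].
 by rewrite powRM ?(ltW d0)// mulrC ler_wpM2l//; apply: powR_mono; rewrite ?(ltW k0)// nk_jb.
have h2: `|k%:~R : R| <= jbp 1 k by rewrite jbp1 nk_jb.
have -> : 5 / 2 + 2 * kap = (3 / 2 + kap) + (1 + kap) :> R by field.
rewrite (jbpD (3 / 2 + kap) (1 + kap)) (jbpD 1 kap) [d `^ kap * _]mulrCA -mulrA; apply: ler_wpM2l=> //.
rewrite mulrCA; apply: ler_pM=> //.
by rewrite le_min ler01 mulr_ge0// ltW.
Qed.

Section Deep.
Variables (eta : R -> R) (c : int -> R[i]) (C2: R).
Hypothesis (hc : l1 (fun k=> jb k ^+ 2 * nc (c k)) C2) (heta : forall x, (eta x)%:C = ts c x).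

Lemma cder_Zaxd t x : 0 < t -> cder (Za c t) x ('i * ts (fun k=> 'i * k%:~R * Zac c t k) x).
move=> t0; have p0: 0 <= 9 / t by rewrite divr_ge0// ltW.
have hz: l1 (fun k=> jb k ^+ 2 * nc (Zac c t k)) (9 / t * C2).
 have := l1Z (9 / t) hc; rewrite (ger0_norm p0); apply: l1_le => k.
 have pn (w : R[i]) : 0 <= jb k ^+ 2 * nc w by rewrite mulr_ge0.
 rewrite (ger0_norm (pn _)) [leRHS]ger0_norm; last by rewrite mulr_ge0 ?pn.
 rewrite mulrCA ler_wpM2l// /Zac /Zc ncM [nc ('i * _)]ncM nc_i mul1r nc_int ncM nc_real mulrA.
 by rewrite ler_wpM2r// kec_dec.
by apply: (cder_eq _ (cderD (cderC 1 x) (cderZ 'i (ts_der x hz)))); rewrite add0r.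
Qed.

Let b2 t k : R := 9 / t * (jb k ^+ 2 * nc (c k)).

Lemma zaxd_le t k : 0 < t -> nc ('i * k%:~R * Zac c t k) <= b2 t k.
move=> t0; rewrite ncM [nc ('i * k%:~R)]ncM nc_i mul1r nc_int /Zac /Zc ncM [nc ('i * _)]ncM nc_i mul1r nc_int ncM nc_real.
have [j1 j2 j3 j4] := @jb_facts R k.
have -> : `|k%:~R| * (`|k%:~R| * (`|ec k t| * nc (c k))) = (`|k%:~R| * `|ec k t|) * (`|k%:~R| * nc (c k)).
 by move: `|_| `|ec _ _| (nc _) => x y z; ring.
rewrite /b2; apply: ler_pM; rewrite ?mulr_ge0 ?kec_dec//.
by rewrite ler_wpM2r//; apply: le_trans j3.
Qed.

Lemma b2_l1 t : 0 < t -> (forall k, 0 <= b2 t k) /\ l1 (b2 t) (9 / t * C2).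
move=> t0; have p0: 0 <= 9 / t by rewrite divr_ge0// ltW.
split=> [k|]; first by rewrite /b2 mulr_ge0// mulr_ge0.
by have := l1Z (9 / t) hc; rewrite (ger0_norm p0).
Qed.

Lemma zaxd_fc t k : 0 < t -> nc (fc (fun x=> 'i * ts (fun k=> 'i * k%:~R * Zac c t k) x) k) <= 2 * (jb k ^+ 2 * nc (c k)).
move=> t0; have [q1 q2] := b2_l1 t0.
have cts: ccont (ts (fun k=> 'i * k%:~R * Zac c t k)) by exact: (ccont_ts q1 q2 (fun k=> zaxd_le k t0)).
have -> : fc (fun x=> 'i * ts (fun k=> 'i * k%:~R * Zac c t k) x) k = 'i * fc (ts (fun k=> 'i * k%:~R * Zac c t k)) k.
 by rewrite /fc fourierZ// mulrCA.
rewrite (fc_ts k q1 q2 (fun k=> zaxd_le k t0)) ncM nc_i mul1r ncM [nc ('i * k%:~R)]ncM nc_i mul1r nc_int.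
rewrite /Zac ncM [nc ('i * _)]ncM nc_i mul1r nc_int.
have h := Zc_le1 c t k; have [j1 j2 j3 j4] := @jb_facts R k.
rewrite mulrA -expr2 mulrCA; apply: ler_pM=> //; rewrite ?nc_ge0//.
by rewrite real_normK ?num_real// k2_le.
Qed.

Lemma zaxd_ccont t : 0 < t -> ccont (fun x=> 'i * ts (fun k=> 'i * k%:~R * Zac c t k) x).
move=> t0; have [q1 q2] := b2_l1 t0; apply: ccontM; first exact: ccontC.
exact: (ccont_ts q1 q2 (fun k=> zaxd_le k t0)).
Qed.

Lemma fc_Za_diff t d k : 0 <= t -> t <= d -> nc (fc (fun x=> Za c t x - Za c d x) k) <= 4 * zeta c d k.
move=> t0 td; have d0 := le_trans t0 td.
have q1 := @bsurf0 R c; have q2 := bsurf1 hc.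
have ct a : ccont (ts (Zac c a)) by exact: (ccont_ts q1 q2 (Zac_le c a)).
have -> : (fun x=> Za c t x - Za c d x) = (fun x=> 'i * (ts (Zac c t) x - ts (Zac c d) x)).
 by apply/funext => x; rewrite /Za opprD addrACA subrr add0r -mulrBr.
have -> : fc (fun x=> 'i * (ts (Zac c t) x - ts (Zac c d) x)) k = 'i * (Zac c t k - Zac c d k).
 rewrite -(fc_ts k q1 q2 (Zac_le c t)) -(fc_ts k q1 q2 (Zac_le c d)) -fcB// /fc fourierZ 1?mulrCA//.
 by apply: ccontB.
rewrite ncM nc_i mul1r; have -> : Zac c t k - Zac c d k = 'i * k%:~R * ((ec k t - ec k d)%:C * c k).
 by rewrite /Zac /Zc RCB; ring.
rewrite ncM [nc ('i * _)]ncM nc_i mul1r nc_int ncM nc_real /zeta.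
have E1 (x y z: R) : x * (y * z) = (x * z) * y by ring.
have E2 (x y z: R) : 4 * (x * y * z) = (x * z) * (4 * y) by ring.
rewrite E1 E2 ler_wpM2l ?mulr_ge0//.
have [h1 _ _] := ec_lip k t; have [h2 _ _] := ec_lip k d.
have -> : ec k t - ec k d = (ec k t - 1) - (ec k d - 1) by ring.
apply: (le_trans (ler_normB _ _)).
have h3: minr 1 (cy k t) <= minr 1 (`|k%:~R| * d).
 by rewrite cy_pos// le_min !ge_min lexx/= ler_wpM2l ?orbT.
rewrite (cy_pos k d0) in h2; lra.
Qed.

Lemma nu_zeta t d k : 0 <= t -> t <= d -> nc (fc (nu c t) k) <= 4 * zeta c d k.
move=> t0 td; rewrite (fc_ts k (bsurf0 c) (bsurf1 hc) (nuc_leb c t)).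
apply: (le_trans (nuc_le c t k)); rewrite /zeta [leRHS]mulrA ler_wpM2r//.
rewrite -!mulrA ler_wpM2l// ler_wpM2l//.
by rewrite cy_pos// le_min !ge_min lexx/= ler_wpM2l ?orbT.
Qed.

End Deep.

Section Multipliers.
Variables (s kap: R).
Hypothesis (k0 : 0 < kap) (k1 : 4 * kap <= s - 5 / 2) (k2 : kap <= 1 / 8).

Lemma s52 : 5 / 2 < s. by have := k0; have := k1; lra. Qed.

Record surf (M C2: R) (eta : R -> R) (c : int -> R[i]) : Prop := Surf {
 su_eta : forall x, (eta x)%:C = ts c x;
 su_c2 : l1 (fun k=> jb k ^+ 2 * nc (c k)) C2;
 su_hn : hn (s + 1 / 2) (fun k=> nc (c k)) M }.

Lemma Za_low' M C2 eta c d t x : surf M C2 eta c -> dlt_ok C2 d -> 0 <= t -> t <= d -> 1 / 2 <= nc (Za c t x).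
move=> H [d0 d1 d2 _] t0 td; apply: (Za_low (su_c2 H) (su_eta H))=> //.
by apply: le_trans d2; rewrite ler_wpM2r ?(C2_ge0 (su_c2 H))// ler_wpM2l.
Qed.

(** At the positive depth [d] the series of [Z_xx] converges absolutely, so [inv_reg] applies; the
    bound [2 (1 + |k|)^2 |c_k|] used for its coefficients does not depend on [d]. *)
Lemma Zad_reg M : 0 <= M -> exists2 K : R, 0 <= K & forall C2 eta c d, surf M C2 eta c -> dlt_ok C2 d ->
 hn (s - 1 / 2) (fun k=> nc (fc (fun x=> (Za c d x)^-1) k)) K.
move=> M0; have [K K0 hK] := @inv_reg R s s52 (2 * M) ltac:(by rewrite mulr_ge0).
exists K=> // C2 eta c d H hd; have [d0 d1 d2 _] := hd.
apply: (hK (Za c d) (fun x=> 'i * ts (fun k=> 'i * k%:~R * Zac c d k) x) (fun k=> 2 * (jb k ^+ 2 * nc (c k)))).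
- exact: zaxd_ccont (su_c2 H) d d0.
- by move=> x; exact: cder_Zaxd (su_c2 H) d x d0.
- exact: Za_per.
- by move=> x; rewrite ts_per.
- by move=> x; apply: (Za_low' x H hd)=> //; exact: ltW.
- by move=> k; rewrite mulr_ge0// mulr_ge0 ?nc_ge0.
- by move=> k; exact: zaxd_fc (su_c2 H) d k d0.
have h2: hn (s - 3 / 2) (fun k=> jb k ^+ 2 * nc (c k)) M.
 apply: l2_le (su_hn H) => k; rewrite (_ : s + 1 / 2 = (s - 3 / 2) + (1 + 1)); last by field.
 by rewrite !jbpD !jbp1 expr2 mulrA.
by have := hnZ 2 h2; rewrite ger0_norm.
Qed.

Definition Pc c t k : R := nc (fc (fun x=> (Za c t x)^-1) k).

Lemma Pc_bd M C2 eta c d t k : surf M C2 eta c -> dlt_ok C2 d -> 0 <= t -> t <= d -> 0 <= Pc c t k <= 2.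
move=> H hd t0 td; rewrite nc_ge0/=.
have n0 x : Za c t x != 0.
 by rewrite -nc_eq0 gt_eqF// (lt_le_trans _ (Za_low' x H hd t0 td)).
apply: nc_fc => [|x _].
 by apply: ccontV=> //; apply: (sec_ccont (A := Za c)); exact: ccont_Za (su_c2 H).
rewrite ncV -[leRHS]invrK lef_pV2 ?posrE ?invr_gt0//.
 by apply: le_trans (Za_low' x H hd t0 td); rewrite div1r.
by rewrite (lt_le_trans _ (Za_low' x H hd t0 td)).
Qed.

(** Resolvent identity around depth [d]: the inverse of [Z_x] at [t] equals that at [d] minus the
    relative variation times the inverse at [t]. The kernel contains [zeta], hence is small. *)
Lemma Pc_ineq M C2 eta c d (a : int -> R) n : surf M C2 eta c -> dlt_ok C2 d -> 0 <= M ->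
 (forall k, a k = Pc c d k) -> (exists A : R, l1 a A) -> (exists A : R, l1 (zeta c d) A) ->
 supn d (Pc c) n <= a n + cv (cv (fun k=> 4 * zeta c d k) a) (supn d (Pc c)) n.
move=> H hd M0 ha [A hA] [Zt hZt]; have [d0 d1 d2 _] := hd; have d0' := ltW d0.
have hz: l1 (fun k=> 4 * zeta c d k) (4 * Zt) by have := l1Z 4 hZt; rewrite ger0_norm.
have hM := young1 hz hA.
have ub k t : 0 <= t -> t <= d -> Pc c t k <= supn d (Pc c) k.
 by apply: (@supn_ub _ d (Pc c) k 2) => u u0 ud; have /andP[] := Pc_bd k H hd u0 ud.
have sup0 k : 0 <= supn d (Pc c) k by apply: le_trans (ub k 0 (lexx _) d0'); exact: nc_ge0.
have sup2 k : supn d (Pc c) k <= 2.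
 by apply: supn_le=> // t t0 td; have /andP[] := Pc_bd k H hd t0 td.
apply: supn_le=> // t t0 td.
have nz u x : 0 <= u -> u <= d -> Za c u x != 0.
 by move=> u0 ud; rewrite -nc_eq0 gt_eqF// (lt_le_trans _ (Za_low' x H hd u0 ud)).
have cZ u : ccont (Za c u) by apply: (sec_ccont (A := Za c)); exact: ccont_Za (su_c2 H).
have cP u : 0 <= u -> u <= d -> ccont (fun x=> (Za c u x)^-1).
 by move=> u0 ud; apply: ccontV=> // x; exact: nz.
have pP u : periodic (fun x=> (Za c u x)^-1) tau by move=> x; rewrite Za_per.
have cdf: ccont (fun x=> Za c t x - Za c d x) by apply: ccontB.
have pdf: periodic (fun x=> Za c t x - Za c d x) tau by move=> x; rewrite !Za_per.
pose u x := (Za c t x - Za c d x) * (Za c d x)^-1.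
have cu: ccont u by apply: ccontM=> //; exact: cP.
have pu: periodic u tau by move=> x; rewrite /u !Za_per.
have z0 k : 0 <= 4 * zeta c d k by rewrite mulr_ge0// zeta_ge0.
have hu k : nc (fc u k) <= cv (fun k=> 4 * zeta c d k) a k.
 apply: (mul_maj (B := 2) k z0 hz cdf pdf (cP _ d0' (lexx _))).
 - by move=> i; exact: fc_Za_diff (su_c2 H) t d i t0 td.
 - by move=> i; rewrite ha.
 by move=> i; rewrite ha; have /andP[] := Pc_bd i H hd d0' (lexx d).
have E: Pc c t n = nc (fc (fun x=> (Za c d x)^-1 - u x * (Za c t x)^-1) n).
 rewrite /Pc; congr (nc (fc _ n)); apply/funext => x; rewrite /u.
 have h1 := nz t x t0 td; have h2 := nz d x d0' (lexx d).
 by move: (Za c t x) (Za c d x) h1 h2 => y w h1 h2; field; rewrite h1 h2.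
rewrite E fcB; [|exact: cP|by apply: ccontM=> //; exact: cP].
apply: (le_trans (ncB _ _)); apply: lerD; first by rewrite ha.
apply: (le_via (cv (cv (fun k=> 4 * zeta c d k) a) (Pc c t) n)).
 apply: (mul_maj (B := 2) n _ hM cu pu (cP _ t0 td) hu)=> //.
 by move=> i; have /andP[] := Pc_bd i H hd t0 td.
apply: cv_mono=> // [|k].
 by apply: (l1_bdd_summable (B := 2) n hM) => k; rewrite ger0_norm.
by rewrite !ger0_norm ?nc_ge0//; apply: ub.
Qed.

Lemma pow_small (e: R) : 0 < e -> exists2 r : R, 0 < r & forall d, 0 <= d -> d <= r -> d `^ kap <= e.
move=> e_gt0; have k0' := k0; exists (e `^ kap^-1); first exact: powR_gt0.
move=> d d0 dr; apply: (le_via ((e `^ kap^-1) `^ kap)); first by apply: powR_mono=> //; exact: ltW.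
by rewrite -powRrM mulVf ?gt_eqF// powRr1// ltW.
Qed.

Lemma p_pt M C2 eta c d t k : surf M C2 eta c -> dlt_ok C2 d -> 0 <= t -> t <= d -> Pc c t k <= supn d (Pc c) k.
by move=> H hd; apply: (@supn_ub _ d (Pc c) k 2) => u u0 ud; have /andP[] := Pc_bd k H hd u0 ud.
Qed.

Lemma p_bd M C2 eta c d k : surf M C2 eta c -> dlt_ok C2 d -> 0 <= supn d (Pc c) k <= 2.
move=> H hd; have [d0 _ _ _] := hd; have d0' := ltW d0.
rewrite (le_trans (nc_ge0 _) (p_pt k H hd (lexx 0) d0'))/=.
by apply: supn_le=> // t t0 td; have /andP[] := Pc_bd k H hd t0 td.
Qed.

(** A bound for each [t] would not control the coefficientwise supremum; [Pc_ineq] does, by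
    absorption from the single depth [d]. *)
Lemma p_reg M : 0 <= M -> exists2 K : R, 0 <= K & exists2 r : R, 0 < r &
 forall C2 eta c d, surf M C2 eta c -> dlt_ok C2 d -> d <= r -> hn (s - 1 / 2) (supn d (Pc c)) K.
move=> M0; have k0' := k0; have k1' := k1; have k2' := k2; have s0 := s52.
have [KA KA0 hA] := Zad_reg M0.
have [Kz Kz0 hz] := zeta_l1 k0 k2 k1.
have [Kw Kw0 hw] := @hn_l1w R (s - 1 / 2) (3 / 2 + kap) ltac:(lra).
have [Kg Kg0 hg] := @cv_algebra R (s - 1 / 2) ltac:(lra).
have [KF KF0 hF] := @absorb_full R (1 / 2 + kap) (s - 1 / 2) ltac:(lra) ltac:(lra).
pose L := 4 * (Kz * M) * (Kw * KA).
have L0: 0 <= L by rewrite /L; nonneg.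
(* Chosen so that [e * L] is at most [(2 * 2^(s - 1/2))^-1], the smallness asked by [absorb_full] at
   order [s - 1/2]. *)
pose e : R := (2 * 2 `^ (s - 1 / 2))^-1 / (L + 1).
have p2: 0 < 2 `^ (s - 1 / 2) :> R by rewrite powR_gt0.
have e_gt0: 0 < e by rewrite divr_gt0 ?invr_gt0 ?mulr_gt0//; lra.
have [r r0 hr] := pow_small e_gt0.
exists (KF * ((1 + Kg * (4 * M * KA)) * KA)); first by nonneg.
exists r=> // C2 eta c d H hd dr; have [d0 _ _ _] := hd; have d0' := ltW d0.
pose a k := Pc c d k; have ha: hn (s - 1 / 2) a KA := hA _ _ _ _ H hd.
have hzl := hz _ _ _ d0 (su_hn H).
have b0: 0 <= 3 / 2 + kap by lra.
have haw := hw _ _ ha.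
have h4z: l1 (fun k=> jbp (3 / 2 + kap) k * (4 * zeta c d k)) (4 * (d `^ kap * (Kz * M))).
 by have := l1Z 4 hzl; rewrite ger0_norm//; apply: l1_le => k; rewrite mulrCA.
have hML := cv_l1w b0 h4z haw.
have small: 4 * (d `^ kap * (Kz * M)) * (Kw * KA) <= (2 * 2 `^ (s - 1 / 2))^-1.
 have -> : 4 * (d `^ kap * (Kz * M)) * (Kw * KA) = d `^ kap * L by rewrite /L; ring.
 apply: (le_via (e * L)); first by rewrite ler_wpM2r// hr.
 rewrite /e mulrAC ler_pdivrMr; last lra.
 by rewrite ler_wpM2l ?invr_ge0 ?mulr_ge0 ?(ltW p2)//; lra.
have p21: 1 <= 2 `^ (s - 1 / 2) :> R.
 by apply: (le_via (2 `^ 0)); [rewrite powRr0|apply: ler_powR; [rewrite ler1n|lra]].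
have small2: 4 * (d `^ kap * (Kz * M)) * (Kw * KA) <= 1 / 2.
 have q1: (2 `^ (s - 1 / 2))^-1 <= 1 :> R by rewrite invf_le1.
 apply: (le_trans small).
 have -> : (2 * 2 `^ (s - 1 / 2))^-1 = (2 `^ (s - 1 / 2))^-1 / 2 :> R by rewrite invfM mulrC.
 by rewrite ler_wpM2r// invr_ge0.
have M1 := l1W small2 hML.
have l1w' (q: R) (x : int -> R) (A: R) : q <= 3 / 2 + kap -> l1 (fun k=> jbp (3 / 2 + kap) k * x k) A -> l1 (fun k=> jbp q k * x k) A.
 by move=> qb; apply: l1_le => k; rewrite !normrM ler_wpM2r// !ger0_norm// jbp_le.
have pb k := p_bd k H hd.
have hz0: l1 (zeta c d) (d `^ kap * (Kz * M)).
 by have := l1w' 0 _ _ b0 hzl; apply: l1_le => k; rewrite jbp0 mul1r.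
have ha0: l1 a (Kw * KA) by have := l1w' 0 _ _ b0 haw; apply: l1_le => k; rewrite jbp0 mul1r.
have ineq n := Pc_ineq n H hd M0 (fun k=> erefl (a k)) (ex_intro _ _ ha0) (ex_intro _ _ hz0).
have ineq' n : `|supn d (Pc c) n| <= a n + cv (cv (fun k=> 4 * zeta c d k) a) (supn d (Pc c)) n.
 by rewrite ger0_norm; [exact: ineq|have /andP[] := pb n].
have aa n : 0 <= a n by exact: nc_ge0.
have hs12: 0 <= s - 1 / 2 by lra.
(* The a priori information is only that the coefficients are at most 2, that is, growth of order
   0. *)
have hx: l2 (supn d (Pc c)) (2 * KA).
 apply: (@absorb_grow _ 0 (3 / 2 + kap) _ a _ _ 2 b0 _ _ M1 (hn_l2 hs12 ha) aa ineq'); first lra.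
 by move=> k; rewrite jbp0 mulr1 ger0_norm; have /andP[] := pb k.
have M2 := l1w' (1 / 2 + kap) _ _ ltac:(lra) M1.
have M3: l1 (cv (fun k=> 4 * zeta c d k) a) (2 * 2 `^ (s - 1 / 2))^-1.
 by have := l1w' 0 _ _ b0 (l1W small hML); apply: l1_le => k; rewrite jbp0 mul1r.
have M4: 2 `^ (s - 1 / 2) * (2 * 2 `^ (s - 1 / 2))^-1 <= 1 / 2.
 by rewrite invfM mulrCA divff ?gt_eqF// mulr1 div1r.
have M5: hn (s - 1 / 2) (cv (fun k=> 4 * zeta c d k) a) (Kg * (4 * M * KA)).
 by apply: hg ha; have := hnZ 4 (zeta_hn d0' (su_hn H)); rewrite ger0_norm.
exact: hF _ _ _ _ _ _ _ hx M2 M3 M4 M5 ha aa ineq'.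
Qed.

(** [p], [m], [rho] majorise the coefficients of [1 / Z_x], of [muq] (both for all [t] up to [d])
    and of [cj Z_x / Z_x] at the surface. [m] and [rho] are symmetric because they are used at [n]
    and at [-n]; [em] is the small parameter. *)
Record mults (Lr Rr Rm Rp em d: R) (c : int -> R[i]) (p m rho : int -> R) : Prop := Mults {
 mu_p : forall t k, 0 <= t -> t <= d -> nc (fc (fun x=> (Za c t x)^-1) k) <= p k;
 mu_p0 : forall k, 0 <= p k; mu_ph : hn (s - 1 / 2) p Rp;
 mu_m : forall t k, 0 <= t -> t <= d -> nc (fc (muq c t) k) <= m k;
 mu_m0 : forall k, 0 <= m k; mu_ms : forall k, m (- k) = m k;
 mu_mh : hn (s - 1 / 2) m Rm; mu_m1 : l1 (fun k=> jbp (3 / 2 + kap) k * m k) em;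
 mu_r : forall k, nc (fc (fun x=> (Za c 0 x)^-1 * cj (Za c 0 x)) k) <= rho k;
 mu_r0 : forall k, 0 <= rho k; mu_rs : forall k, rho (- k) = rho k;
 mu_rh : hn (s - 1 / 2) rho Rr; mu_r1 : l1 (fun k=> jbp (3 / 2 + kap) k * rho k) Lr }.

Lemma sm_hn r (x : int -> R) X : hn r x X -> hn r (sm x) (2 * X).
by move=> hx; have := hnD hx (hn_refl hx); rewrite mulr2n mulrDl !mul1r. Qed.

Lemma sm_l1 r (x : int -> R) X : l1 (fun k=> jbp r k * x k) X -> l1 (fun k=> jbp r k * sm x k) (2 * X).
move=> hx; have h2: l1 (fun k=> jbp r k * x (- k)) X.
 apply: le_trans hx; rewrite -(asum_refl 0 (fun k=> jbp r k * x k)); apply: le_asum => k.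
 by rewrite sub0r /jbp jbN.
have := l1D hx h2; rewrite mulr2n mulrDl !mul1r; apply: l1_le => k.
by rewrite /sm mulrDr.
Qed.

Lemma delta_hn r : hn r (fun k=> if k == 0 then 1 else 0 : R) 1.
apply: l2_fin=> // F; rewrite expr1n.
have E k : (jbp r k * (if k == 0 then 1 else 0)) ^+ 2 = (k == 0)%:R :> R.
 case: eqP => [->|_]; last by rewrite mulr0 expr0n.
 by rewrite /jbp /jb mulr0z normr0 addr0 powR1 mulr1 expr1n.
under eq_bigr do rewrite E.
have [F0|F0] := boolP (0 \in F).
 rewrite (big_fsetD1 0)//= big_seq big1 ?addr0// => k; rewrite !inE => /andP[/negbTE -> _].
 by [].
rewrite big_seq big1// => k kF; case: eqP=> // k0'; move: F0; rewrite -k0' kF.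
by [].
Qed.

Lemma conjZa_hn M C2 eta c : surf M C2 eta c ->
 hn (s - 1 / 2) (fun k=> nc (fc (fun x=> cj (Za c 0 x)) k)) (1 + M).
move=> H; have q1 := @bsurf0 R c; have q2 := bsurf1 (su_c2 H).
have ct: ccont (ts (Zac c 0)) by exact: (ccont_ts q1 q2 (Zac_le c 0)).
have cZ: ccont (Za c 0) by apply: (sec_ccont (A := Za c)); exact: ccont_Za (su_c2 H).
have h1 k : nc (fc (Za c 0) k) <= (if k == 0 then 1 else 0) + `|k%:~R| * nc (c k).
 have -> : fc (Za c 0) k = (if k == 0 then 1 else 0) + 'i * Zac c 0 k.
 have ci: ccont (fun x=> 'i * ts (Zac c 0) x) by apply: ccontM=> //; exact: ccontC.
 rewrite /fc /Za fourierD//; last exact: ccontC.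
 rewrite fourierZ// mulrDr mulrCA; congr (_ + 'i * _); last exact: (fc_ts k q1 q2 (Zac_le c 0)).
 have := @fourier_expi R 0 k; rewrite (_ : (fun x=> expi (0%:~R * x)) = (fun=> 1)); last first.
 by apply/funext => x; rewrite mul0r expi0.
 move=> ->; case: eqP => _; last by rewrite mulr0.
 by rewrite -RCM mulVf// gt_eqF// twopi_gt0.
 apply: (le_trans (ncD _ _)); apply: lerD; first by case: ifP; rewrite ?nc1 ?nc0.
 by rewrite ncM nc_i mul1r ncM ncM nc_i mul1r nc_int /Zc ec0 mul1r.
have h2: hn (s - 1 / 2) (fun k=> `|k%:~R| * nc (c k)) M.
 by apply: hn_mulk; rewrite (_ : s - 1 / 2 + 1 = s + 1 / 2)//; [exact: su_hn H|field].
have h3 := hn_refl (hnD (delta_hn (s - 1 / 2)) h2); apply: hn_le h3 => k.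
rewrite ger0_norm//; apply: le_trans (ler_norm _).
have -> : fc (fun x=> cj (Za c 0 x)) k = cj (fc (Za c 0) (- k)).
 by rewrite /fc fourierJ// cJM; congr (_ * _); apply: cext; rewrite /= ?oppr0.
by rewrite ncJ; exact: h1.
Qed.

(** The order of quantifiers matters: [Lr] is fixed before [e], since the bootstrap asks for
    [(4 + 2 Lr) * em <= e0]. *)
Lemma mult_reg M : 0 <= M -> exists Lr Rr Rm Rp : R, [/\ 0 <= Lr, 0 <= Rr, 0 <= Rm & 0 <= Rp] /\
 forall e : R, 0 < e -> exists2 r : R, 0 < r & forall C2 eta c d, surf M C2 eta c -> dlt_ok C2 d -> d <= r ->
 exists m rho, mults Lr Rr Rm Rp e d c (supn d (Pc c)) m rho.
move=> M0; have k0' := k0; have k1' := k1; have k2' := k2; have s0 := s52.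
have [Kp Kp0 [rp rp0 hp]] := p_reg M0.
have [Kz Kz0 hz] := zeta_l1 k0 k2 k1.
have [Kw Kw0 hw] := @hn_l1w R (s - 1 / 2) (3 / 2 + kap) ltac:(lra).
have [Kg Kg0 hg] := @cv_algebra R (s - 1 / 2) ltac:(lra).
have [Kl Kl0 hl] := @hn_l1 R (s - 1 / 2) ltac:(lra).
exists (Kw * (2 * (Kg * (Kp * (1 + M))))), (2 * (Kg * (Kp * (1 + M)))), (2 * (Kg * (4 * M * Kp))), Kp.
split; first by split; nonneg.
move=> e e_gt0; pose L := 2 * (4 * (Kz * M) * (Kw * Kp)).
have L0: 0 <= L by rewrite /L; nonneg.
have [r r0 hr] := pow_small (divr_gt0 e_gt0 (ltr_wpDl L0 ltr01)).
exists (minr r rp); first by rewrite lt_min r0.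
move=> C2 eta c d H hd; rewrite le_min => /andP[dr drp].
have [d0 _ _ _] := hd; have d0' := ltW d0.
have hpp := hp _ _ _ _ H hd drp; set p := supn d (Pc c) in hpp *.
have pb k : 0 <= p k <= 2 by exact: p_bd H hd.
have p0 k : 0 <= p k by have /andP[] := pb k.
have b0: 0 <= 3 / 2 + kap by lra.
have hzl := hz _ _ _ d0 (su_hn H).
have h4z: l1 (fun k=> jbp (3 / 2 + kap) k * (4 * zeta c d k)) (4 * (d `^ kap * (Kz * M))).
 by have := l1Z 4 hzl; rewrite ger0_norm//; apply: l1_le => k; rewrite mulrCA.
have h4z1: l1 (fun k=> 4 * zeta c d k) (4 * (d `^ kap * (Kz * M))).
 apply: l1_le h4z => k; rewrite [leRHS]normrM ler_peMl// ger0_norm//; exact: jbp_ge1.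
have z0 k : 0 <= 4 * zeta c d k by rewrite mulr_ge0// zeta_ge0.
have hmm := cv_l1w b0 h4z (hw _ _ hpp).
have hmh: hn (s - 1 / 2) (cv (fun k=> 4 * zeta c d k) p) (Kg * (4 * M * Kp)).
 by apply: hg hpp; have := hnZ 4 (zeta_hn d0' (su_hn H)); rewrite ger0_norm.
pose zb k := nc (fc (fun x=> cj (Za c 0 x)) k).
have hzb: hn (s - 1 / 2) zb (1 + M) := conjZa_hn H.
have hrh := hg _ _ _ _ hpp hzb.
have nz u x : 0 <= u -> u <= d -> Za c u x != 0.
 by move=> u0 ud; rewrite -nc_eq0 gt_eqF// (lt_le_trans _ (Za_low' x H hd u0 ud)).
have cZ u : ccont (Za c u) by apply: (sec_ccont (A := Za c)); exact: ccont_Za (su_c2 H).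
have cP u : 0 <= u -> u <= d -> ccont (fun x=> (Za c u x)^-1).
 by move=> u0 ud; apply: ccontV=> // x; exact: nz.
have pP u : periodic (fun x=> (Za c u x)^-1) tau by move=> x; rewrite Za_per.
have smle (x : int -> R) k : (forall k, 0 <= x k) -> x k <= sm x k by move=> x0; rewrite lerDl.
exists (sm (cv (fun k=> 4 * zeta c d k) p)), (sm (cv p zb)); split.
- by move=> t k t0 td; exact: p_pt H hd t0 td.
- exact: p0.
- exact: hpp.
- move=> t k t0 td; apply: le_trans (smle _ _ _); last by move=> i; exact: cv_ge0.
 apply: (mul_maj (B := 2) k z0 h4z1 _ (nu_per c t) (cP t t0 td)).
 + by apply: (sec_ccont (A := nu c)); exact: ccont_nu (su_c2 H).
 + by move=> i; exact: nu_zeta (su_c2 H) t d i t0 td.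
 + by move=> i; exact: p_pt H hd t0 td.
 + by move=> i; have /andP[] := pb i.
- by move=> k; apply: sm_ge0 => i; exact: cv_ge0.
- exact: smN.
- exact: sm_hn hmh.
- apply: (l1W _ (sm_l1 hmm)).
 have -> : 2 * (4 * (d `^ kap * (Kz * M)) * (Kw * Kp)) = d `^ kap * L by rewrite /L; ring.
 apply: (le_via (e / (L + 1) * L)); first by rewrite ler_wpM2r// hr.
 rewrite mulrAC ler_pdivrMr; last lra.
 by rewrite ler_wpM2l ?(ltW e_gt0)//; lra.
- move=> k; apply: le_trans (smle _ _ _); last by move=> i; exact: cv_ge0.
 have cc: ccont (fun x=> cj (Za c 0 x)) by apply: ccontJ.
 have [B hB] := fc_bdd cc.
 apply: (mul_maj (B := B) k p0 (hl _ _ hpp) (cP _ (lexx _) d0') (pP 0) cc)=> // i.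
 exact: p_pt H hd (lexx _) d0'.
- by move=> k; apply: sm_ge0 => i; exact: cv_ge0.
- exact: smN.
- exact: sm_hn hrh.
exact: hw _ _ (sm_hn hrh).
Qed.

End Multipliers.

End Coefs.

Section Alg.
Variable R : realFieldType.
Implicit Types l x y z m u D w : R.

Lemma alg_pos l y m u (j: R) : 0 <= l -> y <= 0 -> l * y + 2 * (m + j * u) <= 2 * m + 2 * j * u.
move=> l0 y0; have h: l * y <= 0 by rewrite mulr_ge0_le0.
rewrite mulrDr mulrA; lra.
Qed.

Lemma alg_neg x z m u (j: R) : x <= z -> x + 2 * (m + j * u) <= z + 2 * m + 2 * j * u.
by move=> h; rewrite mulrDr mulrA; lra. Qed.

End Alg.

(** * The mode equations of the fluid satisfy the hypotheses of the bootstrap *)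

Section Build.
Context {R : realType}.
Implicit Types (t x: R) (k n: int).
Variables (s kap: R).
Hypothesis (k0 : 0 < kap) (k1 : 4 * kap <= s - 5 / 2) (k2 : kap <= 1 / 8).
Variables (eta b : R -> R) (c cb : int -> R[i]) (M C2 h0 d S: R) (f f1 : R[i] -> R[i]).
Hypothesis (hsurf : surf s M C2 eta c).
Hypothesis (hcb : l1 (fun k=> jb k ^+ 2 * nc (cb k)) C2) (hb : forall x, (b x)%:C = ts cb x).
Hypothesis (h00 : 0 < h0) (gap : forall x, h0 <= eta x - b x).
Hypothesis (hd : dlt_ok C2 d) (hd2 : d * (1 + 3 * C2 + 4 * C2 ^+ 2) <= h0 / 2).
Hypothesis (hf : hstrip b eta f f1) (S0 : 0 < S).
Hypothesis hS : itor (fun x=> nc (f (x +i* b x)) ^+ 2) + itor (fun x=> nc (f (x +i* eta x)) ^+ 2) <= S ^+ 2.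
Variables (Lr Rr Rm Rp em: R) (p m rho : int -> R).
Hypothesis hmu : mults s kap Lr Rr Rm Rp em d c p m rho.
Variables (psi1 : R -> R) (Tps: R).
Hypothesis (cpsi : continuous psi1) (hpsi : forall x, cRe (f (x +i* eta x) * (1 +i* eta1 c x)) = psi1 x).
Hypothesis hps : hn (s - 1) (fun k=> nc (fc (ofreal psi1) k)) Tps.

Local Notation wcf := (wc c f).
Local Notation Za := (Za c).

Let hc := su_c2 hsurf.
Let heta := su_eta hsurf.

Lemma bd0 : 0 < d. by have [] := hd. Qed.
Lemma bd1 : d <= 1. by have [] := hd. Qed.
Let d0 : 0 <= d := ltW bd0.

Definition ps k : R := nc (fc (ofreal psi1) k).
Definition Wn k : R := nc (wcf 0 k).
Definition an k : R := sm (fun k=> 2 * cv p ps k) k.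
(** The weight removes the unknown value at depth [d]. Its derivative is a multiple of the previous
    power, which leads back to the preceding level. *)
Definition Ut (j: nat) t n : R := `|n%:~R| * ((d - t) ^+ j * nc (wcf t n)).
Definition Un (j: nat) n : R := supn d (Ut j) n.

Variable PP : R.
Hypothesis (hPP : l1 p PP).

Lemma ww_bd t n : 0 <= t -> t <= d -> nc (wcf t n) <= PP * (K2 C2 d * S).
move=> t0 td.
exact: (w_bd hc heta hcb hb h00 gap hd hd2 hf S0 hS (mu_p0 hmu) hPP (mu_p hmu) n t0 td).
Qed.

Lemma Ut_bd j t n : 0 <= t -> t <= d -> 0 <= Ut j t n <= `|n%:~R| * (PP * (K2 C2 d * S)).
move=> t0 td; have dt: 0 <= d - t by rewrite subr_ge0.
have dt1: (d - t) ^+ j <= 1 by apply: exprn_ile1=> //; have := bd1; lra.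
rewrite mulr_ge0 ?mulr_ge0 ?exprn_ge0//= ler_wpM2l//.
by apply: le_trans (ww_bd n t0 td); rewrite ler_piMl ?nc_ge0.
Qed.

Lemma Un_ub j t n : 0 <= t -> t <= d -> Ut j t n <= Un j n.
by apply: (@supn_ub _ d (Ut j) n (`|n%:~R| * (PP * (K2 C2 d * S)))) => u u0 ud; have /andP[] := Ut_bd j n u0 ud.
Qed.

Lemma Un_le j n X : (forall t, 0 <= t -> t <= d -> Ut j t n <= X) -> Un j n <= X.
exact: (supn_le d0). Qed.

Lemma Un_ge0 j n : 0 <= Un j n.
by apply: le_trans (Un_ub j n (lexx 0) d0); have /andP[] := Ut_bd j n (lexx 0) d0. Qed.

(** The boundary condition [2 psi_x = f Z_x + cj (f Z_x)], solved for [f]. *)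
Lemma w_rel x : f (x +i* eta x) = 2 * ((Za 0 x)^-1 * (psi1 x)%:C) - ((Za 0 x)^-1 * cj (Za 0 x)) * cj (f (x +i* eta x)).
have nz: Za 0 x != 0 by exact: (Za_neq0 hc heta hd x (lexx 0) d0).
have h: 2 * (psi1 x)%:C = f (x +i* eta x) * Za 0 x + cj (Za 0 x) * cj (f (x +i* eta x)).
 rewrite -hpsi (Za0 hc heta); apply: cext; rewrite !(ReD, ReM, ReJ, ImD, ImM, ImJ)/=; ring.
rewrite mulrCA h; move: (f _) (Za 0 x) (cj (Za 0 x)) (cj (f _)) nz => u z z' u' nz.
by rewrite -mulrA -mulrBr addrK mulrCA mulVf ?mulr1.
Qed.

Lemma ccont_W : ccont (fun x=> f (x +i* eta x)).
have := ccont_fZ hc hf 0; rewrite (_ : (fun x=> f (Z c 0 x)) = (fun x=> f (x +i* eta x)))//.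
by apply/funext => x; rewrite (Z0 heta).
Qed.

Lemma wc0 : wcf 0 = fc (fun x=> f (x +i* eta x)).
apply/funext => n; rewrite /wc; congr (fc _ n); apply/funext => x.
by rewrite (Z0 heta).
Qed.

Lemma cP0 : ccont (fun x=> (Za 0 x)^-1).
exact: (ccont_P hc heta hd (lexx 0) d0). Qed.

Lemma rho_l1' : l1 rho Lr.
have h := k0; have b0: 0 <= 3 / 2 + kap by lra.
by apply: l1_le (mu_r1 hmu) => k; rewrite normrM ler_peMl// ger0_norm ?jbp_ge1// jbp_ge0.
Qed.

(** Conjugation reverses frequencies: in [w_rel] the coefficient of [W] at [-n] is thereby a
    [rho]-average of coefficients around [n]. *)
Lemma an_rel n : 0 < n -> Wn (- n) <= an n + cv rho Wn n.
move=> n0; have cW := ccont_W; have cq := cP0.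
have cpc: ccont (ofreal psi1) by exact: ccontR.
have cZ: ccont (Za 0) by exact: (ccont_Zas hc 0).
have cr: ccont (fun x=> (Za 0 x)^-1 * cj (Za 0 x)) by apply: ccontM=> //; apply: ccontJ.
have cjW: ccont (fun x=> cj (f (x +i* eta x))) by apply: ccontJ.
have cqp: ccont (fun x=> (Za 0 x)^-1 * (psi1 x)%:C) by apply: ccontM.
have cqp2: ccont (fun x=> 2 * ((Za 0 x)^-1 * (psi1 x)%:C)) by apply: ccontM=> //; exact: ccontC.
have crw: ccont (fun x=> (Za 0 x)^-1 * cj (Za 0 x) * cj (f (x +i* eta x))) by apply: ccontM.
have E: wcf 0 (- n) = fc (fun x=> 2 * ((Za 0 x)^-1 * (psi1 x)%:C) - ((Za 0 x)^-1 * cj (Za 0 x)) * cj (f (x +i* eta x))) (- n).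
 rewrite wc0; apply: (f_equal (fun u=> fc u (- n))); apply/funext => x; exact: w_rel.
rewrite {1}/Wn E {E}.
rewrite fcB//; apply: (le_trans (ncB _ _)); apply: lerD.
 have -> : fc (fun x=> 2 * ((Za 0 x)^-1 * (psi1 x)%:C)) (- n) = 2 * fc (fun x=> (Za 0 x)^-1 * (psi1 x)%:C) (- n).
 by rewrite /fc fourierZ// mulrCA.
 rewrite ncM (_ : nc 2 = 2); last first.
 have E: 2 = (2: R)%:C :> R[i] by rewrite rmorph_nat.
 by rewrite E nc_real ger0_norm.
 apply: (le_via (2 * cv p ps (- n))); last by rewrite /an /sm lerDr mulr_ge0.
 rewrite ler_wpM2l//; have [B hB] := fc_bdd cpc.
 apply: (mul_maj (B := B) (- n) (mu_p0 hmu) hPP cq (Zainv_per c 0) cpc)=> // k.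
 exact: (mu_p hmu k (lexx 0) d0).
have [B hB] := fc_bdd cjW.
apply: (le_via (cv rho (fun k=> nc (fc (fun x=> cj (f (x +i* eta x))) k)) (- n))).
 apply: (mul_maj (B := B) (- n) (mu_r0 hmu) rho_l1' cr _ cjW)=> //; last exact: mu_r hmu.
 by move=> x; rewrite !Za_per.
rewrite cv_refl (_ : (fun k=> rho (- k)) = rho); last by apply/funext => k; rewrite (mu_rs hmu).
suff -> : (fun k=> nc (fc (fun x=> cj (f (x +i* eta x))) (- k))) = Wn by exact: lexx.
apply/funext => k; rewrite /Wn wc0 /fc fourierJ// opprK.
have -> : (tau^-1)%:C * cj (fourier (fun x=> f (x +i* eta x)) k) = cj ((tau^-1)%:C * fourier (fun x=> f (x +i* eta x)) k) :> R[i].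
 by rewrite cJM; congr (_ * _); apply: cext; rewrite /= ?oppr0.
by rewrite ncJ.
Qed.

Lemma hm1 : l1 (fun k=> jbp 1 k * m k) em.
have h := k0; apply: l1_le (mu_m1 hmu) => k.
by rewrite !normrM ler_wpM2r// !ger0_norm// jbp_le//; lra.
Qed.

Lemma Un_grow j k : `|Un j k| <= PP * (K2 C2 d * S) * jbp 1 k.
rewrite ger0_norm ?Un_ge0// jbp1; apply: Un_le => t t0 td.
have /andP[_ h] := Ut_bd j k t0 td; apply: (le_trans h); rewrite mulrC ler_wpM2l ?nk_jb//.
by apply: le_trans (ww_bd 0 (lexx 0) d0); exact: nc_ge0.
Qed.

Definition ut (j: nat) n t : R[i] := ((d - t) ^+ j)%:C * wcf t n.

Lemma ut_der j n t : n != 0 -> 0 < t < d -> exists2 r : R[i], cder (ut j.+1 n) t (n%:~R * ut j.+1 n t + r) &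
 nc r <= cv m (Un j.+1) n + j.+1%:R * (Un j n / `|n%:~R|).
move=> n0 /andP[t0 td]; have t0' := ltW t0; have td' := ltW td.
have dt: 0 < d - t by rewrite subr_gt0.
have tt: 0 < t < d by rewrite t0.
have [r hr1 hr2] := w_der hc heta hcb hb gap hd hd2 hf (mu_m0 hmu) (l1_jbp1 hm1) (mu_m hmu) n tt.
exists (((d - t) ^+ j.+1)%:C * r - (j.+1%:R * (d - t) ^+ j)%:C * wcf t n).
 have hp: is_derive t 1 (fun t=> (d - t) ^+ j.+1) (- (j.+1%:R * (d - t) ^+ j)).
 have h1 := is_dB (is_dC d t) (is_dI t).
 elim: {n n0 r hr1 hr2} j => [|j IH].
 by apply: is_dext h1; [apply/funext => u; rewrite expr1|rewrite expr0; ring].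
 have h2 := is_dM h1 IH; apply: is_dext h2; first by apply/funext => u; rewrite [in RHS]exprS.
 by rewrite -[in RHS]addn1 natrD exprS; ring.
 have h := cderM (cderR hp) hr1; apply: cder_eq h.
 by rewrite /ut rmorphN/=; ring.
apply: (le_trans (ncB _ _)); apply: lerD.
 have dj: 0 < (d - t) ^+ j.+1 by rewrite exprn_gt0.
 rewrite ncM nc_real (gtr0_norm dj); apply: (le_trans (ler_wpM2l (ltW dj) hr2)).
 apply: cv_le1=> // [k|]; last exact: (grow_summable n ler01 (lexx 1) hm1 (Un_grow j.+1)).
 rewrite !normrM mulrCA ler_wpM2l// normr_id (ger0_norm (Un_ge0 _ _)) (ger0_norm (nc_ge0 _)).
 by rewrite mulrCA; exact: (Un_ub j.+1 k t0' td').
rewrite ncM nc_real ger0_norm; last by rewrite mulr_ge0 ?exprn_ge0// ltW.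
rewrite -mulrA ler_wpM2l//.
rewrite ler_pdivlMr; last by rewrite (lt_le_trans ltr01)// nk_ge1.
by rewrite mulrC; exact: (Un_ub j n t0' td').
Qed.

Lemma ccat_ut j n t : ccat (ut j n) t.
apply: ccatM; last exact: (ccat_wc hc hf).
by apply: ccatR; apply: contX; apply: contB; [exact: contC|exact: contI].
Qed.

Lemma ut_nc j n t : 0 <= t -> t <= d -> `|n%:~R| * nc (ut j n t) = Ut j t n.
by move=> t0 td; rewrite /ut ncM nc_real (ger0_norm (exprn_ge0 j _))// subr_ge0. Qed.

Lemma ut_ncW j n t : 0 <= t -> t <= d -> Ut j t n <= `|n%:~R| * nc (ut j n t).
by move=> t0 td; apply: le_of_eq; exact: (esym (ut_nc j n t0 td)). Qed.

Lemma ut_nc0 j n : `|n%:~R| * nc (ut j n 0) <= d ^+ j * (`|n%:~R| * Wn n).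
apply: le_of_eq; apply: (etrans (ut_nc j n (lexx 0) d0)).
by rewrite /Ut subr0 mulrCA.
Qed.

Lemma ut_ncd j n : nc (ut j.+1 n d) <= 0.
by rewrite /ut subrr exprS mul0r rmorph0 mul0r nc0. Qed.

Local Opaque ut Ut Wn.

Lemma ut_choice j n : n != 0 -> exists r : R -> R[i], forall t, 0 < t < d ->
 cder (ut j.+1 n) t (n%:~R * ut j.+1 n t + r t) /\ nc (r t) <= cv m (Un j.+1) n + j.+1%:R * (Un j n / `|n%:~R|).
move=> n0; have H t : exists r : R[i], 0 < t < d ->
 cder (ut j.+1 n) t (n%:~R * ut j.+1 n t + r) /\ nc r <= cv m (Un j.+1) n + j.+1%:R * (Un j n / `|n%:~R|).
 have [tt|tt] := boolP (0 < t < d); last by exists 0.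
 by have [r h1 h2] := ut_der j n0 tt; exists r.
by have [r hr] := choice H; exists r.
Qed.

Lemma Bn_ge0 j n : 0 <= cv m (Un j.+1) n + j.+1%:R * (Un j n / `|n%:~R|).
by rewrite addr_ge0// mulr_ge0// divr_ge0// Un_ge0. Qed.

(** For [n > 0] the equation is integrated from [t = d], where the weight vanishes: no boundary data
    appear. *)
Lemma Un_pos j n : 0 < n -> Un j.+1 n <= 2 * cv m (Un j.+1) n + 2 * j.+1%:R * (Un j n / `|n%:~R|).
move=> n0; have nz: n != 0 by rewrite gt_eqF.
have [r hr] := ut_choice j nz.
have nk: 0 < `|n%:~R : R| by rewrite (lt_le_trans ltr01)// nk_ge1.
have hr' (t: R) : 0 < t < d -> cder (ut j.+1 n) t (`|n%:~R|%:C * ut j.+1 n t + r t) /\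
 nc (r t) <= cv m (Un j.+1) n + j.+1%:R * (Un j n / `|n%:~R|).
 by move=> /hr; rewrite ger0_norm ?ler0z ?(ltW n0)// RCint.
apply: Un_le => t t0 td; have tt: 0 <= t <= d by rewrite t0.
have h := @ode_grow _ (ut j.+1 n) r `|n%:~R| _ d nk (Bn_ge0 j n) (ccat_ut j.+1 n) hr' t tt.
apply: (le_trans (ut_ncW j.+1 n t0 td)); apply: (le_trans h).
exact: alg_pos (ltW nk) (ut_ncd j n).
Qed.

Lemma Un_neg j n : n < 0 -> Un j.+1 n <= d ^+ j.+1 * (`|n%:~R| * Wn n) + 2 * cv m (Un j.+1) n +
 2 * j.+1%:R * (Un j n / `|n%:~R|).
move=> n0; have nz: n != 0 by rewrite lt_eqF.
have [r hr] := ut_choice j nz.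
have nk: 0 < `|n%:~R : R| by rewrite (lt_le_trans ltr01)// nk_ge1.
have hr' (t: R) : 0 < t < d -> cder (ut j.+1 n) t ((- `|n%:~R|)%:C * ut j.+1 n t + r t) /\
 nc (r t) <= cv m (Un j.+1) n + j.+1%:R * (Un j n / `|n%:~R|).
 by move=> /hr; rewrite ltr0_norm ?ltrz0// opprK RCint.
apply: Un_le => t t0 td; have tt: 0 <= t <= d by rewrite t0.
have h := @ode_decay _ (ut j.+1 n) r `|n%:~R| _ d nk (Bn_ge0 j n) (ccat_ut j.+1 n) hr' t tt.
apply: (le_trans (ut_ncW j.+1 n t0 td)); apply: (le_trans h).
exact: alg_neg (ut_nc0 j.+1 n).
Qed.

Local Transparent ut Ut Wn.

Lemma W_l2' : l2 Wn S.
have S0' := ltW S0.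
have := bessel_l2 S0' ccont_W; rewrite /Wn wc0; apply.
apply: (le_trans (W_l2 hS)); rewrite ler_peMl//.
have := @pi_ge2 R; lra.
Qed.

(** The three summands of the data size are the L2 norm of [W], the contribution of [psi_x], and the
    uniform bound on [w] that gives level 0 its linear growth. *)
Lemma build_chain (Kg: R) : 0 <= Kg -> 0 <= Rp -> hn (s - 1) (cv p ps) (Kg * (Rp * Tps)) ->
 chain s kap Lr Rr Rm em d (S + 4 * (Kg * (Rp * Tps)) + PP * (K2 C2 d * S)) m rho Wn an Un.
move=> Kg0 Rp0 hg; have S0' := ltW S0.
have PP0: 0 <= PP by exact: l1_ge0 hPP.
have [_ _ K20 _] := K2_terms hc hd.
have T0: 0 <= Tps := l2_ge0 hps.
have t1: 0 <= 4 * (Kg * (Rp * Tps)) by nonneg.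
have t2: 0 <= PP * (K2 C2 d * S) by nonneg.
split.
- exact: mu_m0 hmu.
- exact: mu_ms hmu.
- exact: mu_mh hmu.
- exact: mu_m1 hmu.
- exact: mu_r0 hmu.
- exact: mu_rs hmu.
- exact: mu_rh hmu.
- exact: mu_r1 hmu.
- by move=> k; exact: nc_ge0.
- by apply: (l2W _ W_l2'); rewrite -addrA lerDl addr_ge0.
- by move=> k; apply: sm_ge0 => i; rewrite mulr_ge0// cv_ge0.
- by move=> k; exact: smN.
- have h := sm_hn (hnZ 2 hg); rewrite ger0_norm// in h.
 have E: 2 * (2 * (Kg * (Rp * Tps))) = 4 * (Kg * (Rp * Tps)) by ring.
 by apply: (hnW (lexx _) _ h); rewrite E addrAC lerDr addr_ge0.
- exact: Un_ge0.
- move=> j; apply/eqP; rewrite eq_le Un_ge0 andbT; apply: Un_le => t t0 td.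
 by rewrite /Ut mulr0z normr0 mul0r.
- move=> k; apply: Un_le => t t0 td; have /andP[_ h] := Ut_bd 0 k t0 td; apply: (le_trans h).
 by rewrite mulrC; apply: ler_pM=> //; rewrite ?nk_jb// lerDr addr_ge0.
- move=> j k; apply: Un_le => t t0 td; apply: le_trans (Un_ub j k t0 td).
 have dt: 0 <= d - t by rewrite subr_ge0.
 rewrite /Ut ler_wpM2l// ler_wpM2r// exprS ler_piMl ?exprn_ge0//.
 by have := bd1; lra.
- exact: an_rel.
- move=> j n; apply: le_trans (Un_ub j n (lexx 0) d0).
 by rewrite /Ut subr0 mulrCA.
- exact: Un_pos.
exact: Un_neg.
Qed.

End Build.

(** * Choice of the collar and the estimate of the surface trace *)

Section Estimate.
Context {R : realType}.
Variables (s kap: R).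
Hypothesis (k0 : 0 < kap) (k1 : 4 * kap <= s - 5 / 2) (k2 : kap <= 1 / 8).

Lemma dlt_exists (C2 h0 r: R) : 0 <= C2 -> 0 < h0 -> 0 < r -> exists2 d : R, dlt_ok C2 d &
 d * (1 + 3 * C2 + 4 * C2 ^+ 2) <= h0 / 2 /\ d <= r.
move=> C0 h00 r0.
pose A := 3 * C2 * (1 + C2) + 64 * C2 ^+ 3; pose B := 1 + 3 * C2 + 4 * C2 ^+ 2.
have A0: 0 <= A by rewrite /A addr_ge0 ?mulr_ge0 ?addr_ge0 ?exprn_ge0.
have B0: 0 < B by rewrite /B ltr_wpDr ?mulr_ge0// ltr_wpDr ?mulr_ge0.
(* One entry for each smallness condition; the [+ 1] in the denominators avoids a division by zero
   for a flat surface. *)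
pose d := minr (minr 1 r) (minr (1 / (4 * C2 + 1)) (minr (1 / (2 * A + 1)) (h0 / 2 / B))).
have c1: 0 < 4 * C2 + 1 by rewrite ltr_wpDl// mulr_ge0.
have c2: 0 < 2 * A + 1 by rewrite ltr_wpDl// mulr_ge0.
have d0: 0 < d by rewrite /d !lt_min ltr01 r0 !divr_gt0.
have : d <= d by [].
rewrite {2}/d !le_min => /andP[/andP[d1 dr] /andP[dc /andP[da db]]].
rewrite ler_pdivlMr// in dc; rewrite ler_pdivlMr// in da; rewrite ler_pdivlMr// in db.
exists d; last by [].
have E1: d * (4 * C2 + 1) = 4 * (d * C2) + d by ring.
have E2: d * (2 * A + 1) = 2 * (d * A) + d by ring.
rewrite E1 in dc; rewrite E2 in da.
have p1: 0 <= d * C2 by rewrite mulr_ge0// ltW.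
have p2: 0 <= d * A by rewrite mulr_ge0// ltW.
by split=> //; [rewrite -mulrA|rewrite -/A]; lra.
Qed.

(** Order of the choices: the multiplier constants depend on [M]; they fix the smallness of [em],
    hence the depth [d]; the bootstrap constants come last, as they depend on [d]. *)
Lemma W_estimate (M C2 h0: R) : 0 <= M -> 0 <= C2 -> 0 < h0 -> exists2 K : R, 0 <= K &
 forall eta b c cb f f1 S psi1 Tps, surf s M C2 eta c ->
 l1 (fun k=> jb k ^+ 2 * nc (cb k)) C2 -> (forall x : R, (b x)%:C = ts cb x) ->
 (forall x : R, h0 <= eta x - b x) -> hstrip b eta f f1 -> 0 < S ->
 itor (fun x=> nc (f (x +i* b x)) ^+ 2) + itor (fun x=> nc (f (x +i* eta x)) ^+ 2) <= S ^+ 2 ->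
 continuous psi1 -> (forall x, cRe (f (x +i* eta x) * (1 +i* eta1 c x)) = psi1 x) ->
 hn (s - 1) (fun k=> nc (fc (ofreal psi1) k)) Tps ->
 let W k := nc (fc (fun x=> f (x +i* eta x)) k) in
 hn (s - 1) W (K * (S + Tps)) /\ hn (s + 1 / 2) (pos W) (K * (S + Tps)).
move=> M0 C0 h00; have s0 := s52 k0 k1; have k0' := k0; have k2' := k2.
have [Lr [Rr [Rm [Rp [[Lr0 Rr0 Rm0 Rp0] hmult]]]]] := mult_reg k0 k1 k2 M0.
have c4: 0 < 4 + 2 * Lr by rewrite ltr_wpDr// mulr_ge0.
have [r r0 hr] := hmult (e0 s / (4 + 2 * Lr)) (divr_gt0 (e0_gt0 s) c4).
have [d hd [hd2 dr]] := dlt_exists C0 h00 r0.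
have [d0 d1 _ _] := hd.
have [KW KW0 hW] := chain_W k0 k1 k2 Lr Rr Rm d0 d1.
have [KV KV0 hV] := chain_Wpos k0 k1 k2 Lr Rr Rm d0 d1.
have [Kg Kg0 hg] := @cv_algebra R (s - 1) ltac:(lra).
have [Kl Kl0 hl] := @hn_l1 R (s - 1 / 2) ltac:(lra).
(* [K2_terms] speaks about some curve; the zero curve gives [0 <= K2 C2 d] before any surface is
   introduced. *)
have [c0 [q1 q2]] : exists c0 : int -> R[i], l1 (fun k=> jb k ^+ 2 * nc (c0 k)) C2 /\ True.
 exists (fun=> 0); split=> //; apply: (@l1W _ _ 0)=> //.
 by apply: asum_fin_le => F; rewrite big1// => k _; rewrite nc0 mulr0 normr0.
have [_ _ K20 _] := K2_terms q1 hd.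
pose Q : R := 1 + 4 * (Kg * Rp) + Kl * Rp * K2 C2 d.
have Q0: 0 <= Q by rewrite /Q; nonneg.
exists ((KW + KV) * Q); first by nonneg.
move=> eta b c cb f f1 S psi1 Tps hs hcb hb gap hf S0 hS cpsi hpsi hps.
have [m [rho hmu]] := hr C2 eta c d hs hd dr.
have T0 := l2_ge0 hps; have S0' := ltW S0.
have hPP := hl _ _ (mu_ph hmu).
have hpp: hn (s - 1) (supn d (Pc c)) Rp by apply: (hnW _ (lexx _) (mu_ph hmu)); lra.
have hch := build_chain k0 hs hcb hb h00 gap hd hd2 hf S0 hS hmu cpsi hpsi hps hPP Kg0 Rp0 (hg _ _ _ _ hpp hps).
have hsm: (4 + 2 * Lr) * (e0 s / (4 + 2 * Lr)) <= e0 s by rewrite mulrC divfK ?gt_eqF.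
have E1 := wc0 f hs.
have hT: S + 4 * (Kg * (Rp * Tps)) + Kl * Rp * (K2 C2 d * S) <= Q * (S + Tps).
 have : 0 <= 4 * (Kg * (Rp * S)) by nonneg.
 have : 0 <= Kl * Rp * (K2 C2 d * Tps) by nonneg.
 rewrite /Q; lra.
have hW' := hW _ _ _ _ _ _ _ hch hsm; have hV' := hV _ _ _ _ _ _ _ hch hsm.
have QT: 0 <= Q * (S + Tps) by nonneg.
have kwv1: KW * (Q * (S + Tps)) <= (KW + KV) * Q * (S + Tps) by rewrite -mulrA ler_wpM2r// lerDl.
have kwv2: KV * (Q * (S + Tps)) <= (KW + KV) * Q * (S + Tps) by rewrite -mulrA ler_wpM2r// lerDr.
move: hW' hV'; rewrite /Wn E1 => hW' hV'; split.
 by apply: (hnW (lexx _) _ hW'); apply: le_trans kwv1; rewrite ler_wpM2l.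
by apply: (hnW (lexx _) _ hV'); apply: le_trans kwv2; rewrite ler_wpM2l.
Qed.

End Estimate.

(** * Sobolev norms and the sequence norms [hn] *)

Section Conversion.
Context {R : realType}.
Implicit Types (c : int -> R[i]) (r X: R) (k: int).
Lemma twopiV_le1 : 0 <= (2 * (pi: R))^-1 <= 1.
have p2 := @pi_ge2 R; have p0: 0 < tau :> R by lra.
by rewrite invr_ge0 ltW//= invf_le1//; lra.
Qed.

Lemma sobolev_sqE r c : sobolev_sq r c =
 asum (fun k=> tau^-1 * ((1 + k%:~R ^+ 2) `^ r * nc (c k) ^+ 2)).
have /andP[p0 _] := twopiV_le1.
rewrite /sobolev_sq /asum; apply: eq_esum => k _; congr EFin; rewrite ger0_norm//.
by rewrite mulr_ge0// mulr_ge0.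
Qed.

Lemma sobolev_norm_ge0 r c : 0 <= sobolev_norm r c.
exact: sqrtr_ge0. Qed.

Lemma sobolev_norm_sqr r c : in_sobolev r c -> sobolev_sq r c = (sobolev_norm r c ^+ 2)%:E.
rewrite /in_sobolev /sobolev_norm sobolev_sqE => h.
by rewrite sqr_sqrtr ?asum_finE// fine_ge0 ?asum_ge0.
Qed.

Lemma jbp_sqr r k : jbp r k ^+ 2 = (jb k ^+ 2) `^ r :> R.
by rewrite /jbp !expr2 powRM// ltW. Qed.

Lemma jb_sqr_le k : 1 + k%:~R ^+ 2 <= jb k ^+ 2 :> R /\ jb k ^+ 2 <= 2 ^+ 2 * (1 + k%:~R ^+ 2) :> R.
have E: k%:~R ^+ 2 = `|k%:~R| ^+ 2 :> R by rewrite real_normK ?num_real.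
rewrite E /jb; have h: 0 <= `|k%:~R : R| by []; move: `|_| h => a a0; split; first nra.
by have := sqr_ge0 (a - 1); nra.
Qed.

(** [2^r] comes from [(1 + |k|)^2 <= 4 (1 + k^2)]. The squared factor [tau^-2] of [fc] is bounded by
    the [tau^-1] of [sobolev_sq]. *)
Lemma sob_hn r c : 0 <= r -> in_sobolev r c ->
 hn r (fun k=> nc ((tau^-1)%:C * c k)) (2 `^ r * sobolev_norm r c).
move=> r0 hc; have /andP[p0 p1] := twopiV_le1.
split; first by rewrite mulr_ge0 ?sobolev_norm_ge0.
have E: ((2 `^ r * sobolev_norm r c) ^+ 2)%:E = (((2 `^ r) ^+ 2)%:E * sobolev_sq r c)%E.
 by rewrite (sobolev_norm_sqr hc) -EFinM exprMn.
rewrite E sobolev_sqE.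
have := asumZ ((2 `^ r) ^+ 2) (fun k=> tau^-1 * ((1 + k%:~R ^+ 2) `^ r * nc (c k) ^+ 2) : R).
rewrite (ger0_norm (sqr_ge0 _)) => <-; apply: le_asum => k.
have h1: 0 <= (1 + k%:~R ^+ 2) `^ r :> R := powR_ge0 _ _.
rewrite ger0_norm// ger0_norm; last first.
 by rewrite mulr_ge0// mulr_ge0// mulr_ge0.
rewrite ncM nc_real (ger0_norm p0) !exprMn jbp_sqr.
have h2: (jb k ^+ 2) `^ r <= (2 `^ r) ^+ 2 * (1 + k%:~R ^+ 2) `^ r :> R.
 have [_ h] := jb_sqr_le k.
 have -> : (2 `^ r) ^+ 2 = (2 ^+ 2) `^ r :> R by rewrite !expr2 powRM.
 rewrite -powRM ?addr_ge0//; apply: powR_mono=> //; exact: sqr_ge0.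
have h3: (tau^-1) ^+ 2 <= tau^-1 :> R by rewrite expr2 ler_piMl.
have n0 := sqr_ge0 (nc (c k)); have h4: 0 <= (jb k ^+ 2) `^ r :> R := powR_ge0 _ _.
rewrite [leRHS](_ : _ = ((2 `^ r) ^+ 2 * (1 + k%:~R ^+ 2) `^ r) * (tau^-1 * nc (c k) ^+ 2)); last first.
 by move: (_ `^ r) (tau^-1) (nc _) ((1 + _) `^ r) => a b d e; ring.
apply: ler_pM=> //; first by rewrite mulr_ge0// sqr_ge0.
by rewrite ler_wpM2r.
Qed.

Lemma hn_sob r c X : 0 <= r -> hn r (fun k=> nc (c k)) X -> in_sobolev r c /\ sobolev_norm r c <= X.
move=> r0 [X0 hX]; have /andP[p0 p1] := twopiV_le1.
have h: (sobolev_sq r c <= (X ^+ 2)%:E)%E.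
 rewrite sobolev_sqE; apply: le_trans hX; apply: le_asum => k.
 have h1: 0 <= (1 + k%:~R ^+ 2) `^ r :> R := powR_ge0 _ _.
 rewrite !ger0_norm//; last by rewrite mulr_ge0// mulr_ge0.
 rewrite exprMn jbp_sqr; have n0 := sqr_ge0 (nc (c k)).
 apply: (le_via ((1 + k%:~R ^+ 2) `^ r * nc (c k) ^+ 2)).
 by rewrite ler_piMl// mulr_ge0.
 rewrite ler_wpM2r//; have [h2 _] := jb_sqr_le k.
 by apply: powR_mono=> //; rewrite addr_ge0 ?sqr_ge0.
have hi: in_sobolev r c by apply: (le_lt_trans h); rewrite ltry.
split=> //; rewrite (sobolev_norm_sqr hi) lee_fin in h.
by rewrite -ler_sqr ?nnegrE ?sobolev_norm_ge0.
Qed.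

End Conversion.

(** * Curves and data given by Sobolev functions *)

Section SobolevFunctions.
Context {R : realType}.
Implicit Types (f : R -> R) (r: R) (k: int).

Lemma sob_coef r f : 0 <= r -> sobolev_fun r f ->
 hn r (fun k=> nc (fc (ofreal f) k)) (2 `^ r * sobolev_fun_norm r f).
by move=> r0 [_ _ h]; exact: sob_hn. Qed.

Lemma curve_inv (C: R) f : continuous f -> periodic f tau ->
 l1 (fun k=> jb k ^+ 2 * nc (fc (ofreal f) k)) C -> forall x, (f x)%:C = ts (fc (ofreal f)) x.
move=> cf pf hl x; have := @fc_inversion R (fun k=> jb k ^+ 2 * nc (fc (ofreal f) k)) C (ofreal f); apply=> //.
- by move=> k; rewrite mulr_ge0 ?nc_ge0.
- by move=> k; rewrite ler_peMl// exprn_ege1// jb_ge1.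
- exact: ccontR.
by move=> y; rewrite /ofreal pf.
Qed.

Lemma sob_curve r : 5 / 2 < r -> exists2 K : R, 0 <= K & forall f, sobolev_fun r f ->
 l1 (fun k=> jb k ^+ 2 * nc (fc (ofreal f) k)) (K * sobolev_fun_norm r f).
move=> r0; have r1: 1 / 2 < r - 2 by lra.
have [K K0 hK] := hn_l1w r1.
exists (K * 2 `^ r); first by rewrite mulr_ge0.
move=> f hf; have r2: 0 <= r by lra.
have := hK _ _ (sob_coef r2 hf); rewrite mulrA; apply: l1_le => k.
by rewrite /jbp -(@powR_mulrn _ (jb k))// (le_trans _ (jb_ge1 k)).
Qed.

Lemma derive1_curve (C: R) f c : l1 (fun k=> jb k ^+ 2 * nc (c k)) C -> (forall x, (f x)%:C = ts c x) ->
 derive1 f = eta1 c.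
move=> hc hf; apply/funext => x; rewrite derive1E; have := eta1_der hc hf x.
by move=> h; exact: derive_val.
Qed.

Lemma fc_cst (a: R) k : fc (fun _=> a%:C) k = if k == 0 then a%:C else 0.
have p0: tau%:C != 0 :> R[i].
 by have := @twopi_gt0 R; move=> h; apply/negP => /eqP[] /eqP; rewrite gt_eqF.
rewrite /fc; have -> : fourier (fun _ : R => a%:C) k = a%:C * fourier (fun x=> expi ((0: int)%:~R * x)) k.
 rewrite -fourierZ; last exact: ccont_expik.
 by apply: (f_equal (fun u=> fourier u k)); apply/funext => x; rewrite mul0r expi0 mulr1.
rewrite fourier_expi; case: ifP => _; last by rewrite !mulr0.
by rewrite mulrCA RCV mulVf// mulr1.
Qed.

Lemma bottom_l1 (h C: R) f : continuous f -> 0 <= h ->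
 l1 (fun k=> jb k ^+ 2 * nc (fc (ofreal f) k)) C ->
 l1 (fun k=> jb k ^+ 2 * nc (fc (ofreal (fun x=> - h + f x)) k)) (h + C).
move=> cf h0 hl.
have hd: l1 (fun k : int => if k == 0 then h else 0 : R) h.
 apply: asum_fin_le => F; have [Fi|Fi] := boolP ((0: int) \in F).
 rewrite (big_fsetD1 0)//= ger0_norm// big1_fset ?addr0// => k.
 by rewrite !inE => /andP[/negPf -> _] _; rewrite normr0.
 rewrite big1_fset// => k kF _; case: eqP => [E|_]; last by rewrite normr0.
 by rewrite E (negPf Fi) in kF.
apply: l1_le (l1D hd hl) => k.
have E: fc (ofreal (fun x=> - h + f x)) k = fc (ofreal f) k - fc (fun _=> h%:C) k.
 rewrite -fcB; [|exact: ccontR|exact: ccontC].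
 by apply: (f_equal (fun u=> fc u k)); apply/funext => x; rewrite /ofreal rmorphD/= rmorphN addrC.
have j0: 0 <= jb k ^+ 2 * nc (fc (ofreal f) k) by rewrite mulr_ge0.
rewrite !ger0_norm; last 2 first.
- by rewrite addr_ge0//; case: ifP.
- by rewrite mulr_ge0.
rewrite E fc_cst; case: (eqVneq k 0) => [->|_]; last by rewrite subr0 add0r.
have -> : jb 0 = 1 :> R by rewrite /jb normr0 addr0.
rewrite expr1n !mul1r; have := ncB (fc (ofreal f) 0) h%:C.
by rewrite nc_real (ger0_norm h0) [leRHS]addrC.
Qed.

End SobolevFunctions.

Local Opaque sobolev_fun_norm.

(** * From the Dirichlet-Neumann map to the trace [V - i B] *)

Section Traces.
Context {R : realType}.
Implicit Types (eta beta psi G : R -> R) (s h M gamma N: R) (k: int).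

(** With [G = - eta_x phi_x + phi_y] and [psi_x = phi_x + phi_y eta_x], the quotient defining [B] is
    [phi_y] on the surface. *)
Lemma DN_alg (p q e: R) : ((- e * p + q) + e * (p + q * e)) / (1 + e ^+ 2) = q.
have h: 0 < 1 + e ^+ 2 by rewrite ltr_wpDr.
by rewrite (_ : - e * p + q + e * (p + q * e) = q * (1 + e ^+ 2)) ?mulfK ?gt_eqF//; ring.
Qed.

Lemma itor_sqr_le (f : R -> R) (C: R) : continuous f -> (forall x, `|f x| <= C) ->
 itor (fun x=> f x ^+ 2) <= tau * C ^+ 2.
move=> cf hf; rewrite -itor_cst; apply: le_itor; [exact: contX|exact: contC|].
move=> x _; rewrite -(real_normK (num_real (f x))) ler_sqr ?nnegrE//.
exact: le_trans (hf x).
Qed.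

Definition WB eta psi G : R -> R[i] := fun x=> DN_V eta psi G x +i* - DN_B eta psi G x.

(** The trace estimate is proved for strictly positive [S]; a margin [e] is added to [S] and removed
    afterwards. *)
Lemma hn_small r (x : int -> R) (X K: R) : 0 <= X -> 0 <= K ->
 (forall e, 0 < e -> hn r x (X + K * e)) -> hn r x X.
move=> X0 K0 H; apply: l2_small=> // e e0.
have K1: 0 < K + 1 by rewrite ltr_wpDl.
apply: hnW (lexx _) _ (H (e / (K + 1)) (divr_gt0 e0 K1)).
rewrite lerD2l mulrCA ler_piMr ?(ltW e0)// ler_pdivrMr// mul1r lerDl.
exact: ler01.
Qed.

Lemma trace_holo h gamma eta beta psi G (C2 P: R) :
 continuous eta -> continuous beta -> continuous psi ->
 periodic eta tau -> periodic beta tau -> periodic psi tau ->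
 l1 (fun k=> jb k ^+ 2 * nc (fc (ofreal eta) k)) C2 ->
 l1 (fun k=> jb k ^+ 2 * nc (fc (ofreal (fun x=> - h + beta x)) k)) C2 ->
 l1 (fun k=> jb k ^+ 2 * nc (fc (ofreal psi) k)) P ->
 (forall x, - h + beta x < eta x) -> is_DN h eta beta gamma psi G ->
 exists f f1, [/\ hstrip (fun x=> - h + beta x) eta f f1,
 (fun x=> f (x +i* eta x)) = WB eta psi G,
 (forall x, cRe (f (x +i* eta x) * (1 +i* eta1 (fc (ofreal eta)) x)) = derive1 psi x),
 itor (fun x=> nc (f (x +i* (- h + beta x))) ^+ 2) + itor (fun x=> nc (f (x +i* eta x)) ^+ 2) <=
 (5 + 4 * C2 ^+ 2) * tau * (P + `|gamma| * C2 ^+ 2) ^+ 2 &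
 (forall x, G x = DN_B eta psi G x - derive1 eta x * DN_V eta psi G x)].
move=> ceta cbeta cpsi peta pbeta ppsi hce hcb hcp gap0 [phi [p [q [sol hG]]]].
pose b x := - h + beta x; pose c := fc (ofreal eta); pose cb := fc (ofreal b).
have cob: continuous b by apply: contD=> //; exact: contC.
have pb: periodic b tau by move=> x; rewrite /b pbeta.
have ec := curve_inv ceta peta hce; have bc := curve_inv cob pb hcb; have pc := curve_inv cpsi ppsi hcp.
have [f [f1 [hf ht]]] : exists f f1, hstrip b eta f f1 /\
 forall x y, b x <= y <= eta x -> f (x +i* y) = p x y +i* - q x y.
 eexists; eexists; split; first exact: (solves_hstrip sol ceta cbeta peta pbeta gap0).
 exact: sol_trace.
have De := derive1_curve hce ec; have Dp := derive1_curve hcp pc.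
have db (x: R) : is_derive x 1 b (eta1 cb x) by exact: (eta1_der hcb bc).
have de (x: R) : is_derive x 1 eta (eta1 c x) by exact: (eta1_der hce ec).
have dp (x: R) : is_derive x 1 psi (eta1 (fc (ofreal psi)) x) by exact: (eta1_der hcp pc).
have top: forall x, eta1 (fc (ofreal psi)) x = p x (eta x) + q x (eta x) * eta1 c x.
 apply: (sol_top sol)=> //; exact: (eta1_cont hce).
have fe x : f (x +i* eta x) = p x (eta x) +i* - q x (eta x) by apply: ht; rewrite lexx andbT; apply: ltW; exact: gap0.
have fb x : f (x +i* b x) = p x (b x) +i* - q x (b x) by apply: ht; rewrite lexx /=; apply: ltW; exact: gap0.
have Bq x : DN_B eta psi G x = q x (eta x).
 by rewrite /DN_B hG De Dp top DN_alg.
have Vp x : DN_V eta psi G x = p x (eta x) by rewrite /DN_V Bq De Dp top addrK.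
have Dbeta x : derive1 beta x = eta1 cb x.
 rewrite derive1E; suff h1 : is_derive x 1 beta (eta1 cb x) by exact: derive_val.
 have h2 := is_dD (is_dC h x) (db x); rewrite add0r in h2.
 by apply: is_dext h2=> //; apply/funext => t; rewrite /b addrA addrN add0r.
exists f, f1; split=> //.
- by apply/funext => x; rewrite fe /WB Bq Vp.
- by move=> x; rewrite fe Dp top ReM /=; ring.
- have C0 := C2_ge0 hce.
 have cW g : continuous g -> ccont (fun x=> f (x +i* g x)) by exact: (ccont_curve hf).
 have cW1 g (g1 : R -> R) : continuous g -> continuous g1 -> ccont (fun x=> f (x +i* g x) * (1 +i* g1 x)).
 by move=> hg hg1; apply: ccontM; [exact: cW|split=> //=; exact: contC].
 have [ct1 ct2] := cW1 _ _ ceta (eta1_cont hce).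
 have [cb1 cb2] := cW1 _ _ cob (eta1_cont hcb).
 pose T x := cRe (f (x +i* eta x) * (1 +i* eta1 c x)).
 pose Nn x := - cIm (f (x +i* eta x) * (1 +i* eta1 c x)).
 pose t x := cRe (f (x +i* b x) * (1 +i* eta1 cb x)).
 pose n x := - cIm (f (x +i* b x) * (1 +i* eta1 cb x)).
 have cn: continuous n := contN cb2.
 have cN: continuous Nn := contN ct2.
 have := rellich (T := T) (N := Nn) (t := t) (n := n) (L := C2) hf db de (eta1_cont hcb) (eta1_cont hce) pb peta gap0 ct1 cN cb1 cn (eta1_bd hce) (eta1_bd hcb) _ _.
 have ext (z : R[i]) : z = cRe z +i* - - cIm z by rewrite opprK; case: z.
 move=> /(_ (fun x=> ext _) (fun x=> ext _)) H; apply: (le_trans H).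
 have hT x : `|T x| <= P.
 have -> : T x = eta1 (fc (ofreal psi)) x by rewrite /T fe top ReM /=; ring.
 exact: (eta1_bd hcp).
 (* The bottom condition says that the normal component is [gamma y beta_x] up to sign; this is how
    [gamma] enters the estimate. *)
 have hn x : `|n x| <= `|gamma| * C2 ^+ 2.
 have E := solves_bottom sol x; rewrite /= Dbeta in E.
 have -> : n x = - (gamma * (b x * eta1 cb x)).
 rewrite /n fb ImM /=; move: E; rewrite -/(b x).
 by move: (p _ _) (q _ _) (eta1 _ _) => u v w; lra.
 rewrite normrN !normrM ler_wpM2l// expr2; apply: ler_pM=> //; first exact: (eta_bd hcb bc).
 exact: (eta1_bd hcb).
 have g0: 0 <= `|gamma| * C2 ^+ 2 by rewrite mulr_ge0.
 have P0: 0 <= P := l1_ge0 hcp.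
 have h1 := itor_sqr_le ct1 hT; have h2 := itor_sqr_le cn hn.
 rewrite -mulrA ler_wpM2l//; first by have := sqr_ge0 C2; lra.
 apply: (le_trans (lerD h1 h2)); rewrite -mulrDr ler_wpM2l//.
 by rewrite sqrrD -addrA lerD2l lerDr mulrn_wge0 ?mulr_ge0.
by move=> x; rewrite hG Bq Vp De; ring.
Qed.

Lemma lin_bd1 (K a M1 u: R) : 0 <= K -> 0 <= u -> a <= M1 -> K * a <= u + K * M1.
by move=> K0 u0 h; rewrite ler_wpDl// ler_wpM2l. Qed.

Lemma lin_bd2 (K a M1 u: R) : 0 <= K -> a <= M1 -> u + K * a <= u + K * M1.
by move=> K0 h; rewrite lerD2l ler_wpM2l. Qed.

Lemma coef_le r M1 (g : R -> R) : 0 <= r -> sobolev_fun r g -> sobolev_fun_norm r g <= M1 ->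
 hn r (fun k=> nc (fc (ofreal g) k)) (2 `^ r * M1).
by move=> r0 hg hM; apply: (hnW (lexx _) _ (sob_coef r0 hg)); rewrite ler_wpM2l ?powR_ge0.
Qed.

Lemma der_coef r (C: R) (g : R -> R) : 0 <= r -> sobolev_fun r g ->
 l1 (fun k=> jb k ^+ 2 * nc (fc (ofreal g) k)) C ->
 continuous (derive1 g) /\ hn (r - 1) (fun k=> nc (fc (ofreal (derive1 g)) k)) (2 `^ r * sobolev_fun_norm r g).
move=> r0 hg hcp; have [pg cg _] := hg; have pc := curve_inv cg pg hcp.
have Dp := derive1_curve hcp pc.
have cg1: continuous (derive1 g) by rewrite Dp; exact: (eta1_cont hcp).
split=> //; have E: (fun k=> nc (fc (ofreal (derive1 g)) k)) = (fun k=> `|k%:~R| * nc (fc (ofreal g) k)).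
 apply/funext => k; apply: nc_fc_der; [exact: ccontR| |by move=> y; rewrite /ofreal pg].
 by move=> y; apply: cderR; rewrite Dp; exact: (eta1_der hcp pc).
by rewrite E; apply: hn_mulk; rewrite subrK; exact: sob_coef.
Qed.

Lemma trace_estimate s h (h0: R) M : 5 / 2 < s -> 0 < h -> 0 < h0 -> 0 <= M -> exists2 K : R, 0 <= K &
 forall eta beta gamma psi G, sobolev_fun (s + 1 / 2) eta -> sobolev_fun (s + 1 / 2) beta ->
 sobolev_fun_norm (s + 1 / 2) eta <= M -> sobolev_fun_norm (s + 1 / 2) beta <= M ->
 (forall x, h0 <= h - beta x + eta x) -> sobolev_fun s psi -> is_DN h eta beta gamma psi G ->
 let T := K * (sobolev_fun_norm s psi + `|gamma|) in let W := WB eta psi G in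
 [/\ ccont W, periodic W tau,
 (forall x, G x = DN_B eta psi G x - derive1 eta x * DN_V eta psi G x),
 hn (s - 1) (fun k=> nc (fc W k)) T & hn (s + 1 / 2) (pos (fun k=> nc (fc W k))) T].
move=> s5 h_gt h00 M0.
(* The cap 1/8 leaves room for the numerical inequalities between orders; the other entry keeps
   [5/2 + 2 kap] below [s]. *)
pose kap := minr ((s - 5 / 2) / 4) (1 / 8).
have k0: 0 < kap by rewrite lt_min; apply/andP; split; lra.
have k1: 4 * kap <= s - 5 / 2.
 have : kap <= (s - 5 / 2) / 4 by rewrite ge_min lexx.
 by lra.
have k2: kap <= 1 / 8 by rewrite ge_min lexx orbT.
have s6: 5 / 2 < s + 1 / 2 by lra.
have s60: 0 <= s + 1 / 2 by lra.
have s00: 0 <= s by lra.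
have [Ke Ke0 hKe] := sob_curve s6.
have [Kp Kp0 hKp] := sob_curve s5.
pose C2 := h + Ke * M.
have KM: 0 <= Ke * M by rewrite mulr_ge0.
have C20: 0 <= C2 by rewrite /C2 addr_ge0// ltW.
pose M1 := 2 `^ (s + 1 / 2) * M.
have M10: 0 <= M1 by rewrite mulr_ge0.
have [K1 K10 hW] := W_estimate k0 k1 k2 M10 C20 h00.
pose A : R := (5 + 4 * C2 ^+ 2) * tau.
(* As [A >= 1], its root is at most [A], and no square root is needed in [S1]. *)
have A1: 1 <= A.
 have c1: 1 <= 5 + 4 * C2 ^+ 2 by have := sqr_ge0 C2; lra.
 by have p2 := @pi_ge2 R; apply: mulr_ege1=> //; lra.
have A0: 0 <= A := le_trans ler01 A1.
have B0: 0 <= Kp + C2 ^+ 2 by rewrite addr_ge0.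
have P0: 0 <= 2 `^ s by rewrite powR_ge0.
have Q0: 0 <= A * (Kp + C2 ^+ 2) + 2 `^ s by rewrite addr_ge0// mulr_ge0.
exists (K1 * (A * (Kp + C2 ^+ 2) + 2 `^ s)); first by rewrite mulr_ge0.
move=> eta beta gamma psi G heta hbeta neta nbeta gap hpsi hDN.
have [peta ceta _] := heta; have [pbeta cbeta _] := hbeta; have [ppsi cpsi _] := hpsi.
pose c := fc (ofreal eta); pose N := sobolev_fun_norm s psi.
have N0: 0 <= N := sobolev_norm_ge0 s (fourier (ofreal psi)).
have hC1: Ke * sobolev_fun_norm (s + 1 / 2) eta <= C2 := lin_bd1 Ke0 (ltW h_gt) neta.
have hC2: h + Ke * sobolev_fun_norm (s + 1 / 2) beta <= C2 := lin_bd2 h Ke0 nbeta.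
have hce: l1 (fun k=> jb k ^+ 2 * nc (c k)) C2 := l1W hC1 (hKe _ heta).
have ec := curve_inv ceta peta hce.
pose b x := - h + beta x.
have cb: continuous b by apply: contD=> //; exact: contC.
have pb: periodic b tau by move=> x; rewrite /b pbeta.
have hcb: l1 (fun k=> jb k ^+ 2 * nc (fc (ofreal b) k)) C2 := l1W hC2 (bottom_l1 cbeta (ltW h_gt) (hKe _ hbeta)).
have bc := curve_inv cb pb hcb.
have hcp := hKp _ hpsi.
have pc := curve_inv cpsi ppsi hcp.
have gap' x : h0 <= eta x - b x.
 by apply: (le_trans (gap x)); rewrite /b opprD opprK addrC.
have gap0 x : - h + beta x < eta x := gap_lt h00 gap' x.
have [f [f1 [hf fW hRe hS hG]]] := trace_holo ceta cbeta cpsi peta pbeta ppsi hce hcb hcp gap0 hDN.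
move=> T W.
have cW: ccont W by rewrite /W -fW; exact: (ccont_curve hf).
have pW: periodic W tau.
 move=> x; rewrite /W -fW peta -(hs_per hf (x +i* eta x)); congr f.
 by apply: cext => /=; rewrite ?addr0.
have hsu: surf s M1 C2 eta c := Surf ec hce (coef_le s60 heta neta).
have [cpsi1 hps] := der_coef s00 hpsi hcp.
pose S1 := A * (Kp * N + `|gamma| * C2 ^+ 2).
have S10: 0 <= S1 by rewrite mulr_ge0// addr_ge0 ?mulr_ge0.
have S1T: S1 + 2 `^ s * N <= (A * (Kp + C2 ^+ 2) + 2 `^ s) * (N + `|gamma|).
 rewrite /S1 mulrDl; apply: lerD; last by rewrite ler_wpM2l// lerDl.
 rewrite -mulrA ler_wpM2l// mulrDl; apply: lerD; first by rewrite ler_wpM2l// lerDl.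
 by rewrite mulrC ler_wpM2l// lerDr.
have key (e: R) : 0 < e -> hn (s - 1) (fun k=> nc (fc W k)) (T + K1 * e) /\
 hn (s + 1 / 2) (pos (fun k=> nc (fc W k))) (T + K1 * e).
 move=> e0; have Se: 0 < S1 + e by rewrite ltr_wpDl.
 have hSe: itor (fun x=> nc (f (x +i* b x)) ^+ 2) + itor (fun x=> nc (f (x +i* eta x)) ^+ 2) <= (S1 + e) ^+ 2.
 apply: (le_trans hS); apply: (le_via (S1 ^+ 2)); last first.
 by rewrite ler_sqr ?nnegrE ?(ltW Se)// lerDl ltW.
 rewrite /S1 exprMn ler_wpM2r//.
 by rewrite expr2 ler_peMr.
 have [r1 r2] := hW _ _ _ _ _ _ _ _ _ hsu hcb bc gap' hf Se hSe cpsi1 hRe hps.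
 rewrite fW in r1 r2.
 have hT: K1 * (S1 + e + 2 `^ s * N) <= T + K1 * e.
 rewrite addrAC mulrDr lerD2r /T -mulrA ler_wpM2l//.
 by split; [apply: hnW (lexx _) hT r1|apply: hnW (lexx _) hT r2].
have T0: 0 <= T by rewrite /T mulr_ge0 ?addr_ge0// mulr_ge0.
split=> //.
- by apply: (hn_small T0 K10) => e /key[].
- by apply: (hn_small T0 K10) => e /key[].
Qed.

End Traces.

(** * Paraproducts and the remainder at frequencies of one sign *)

Section Cutoff.
Context {R : realType}.
Implicit Types (x y: R) (n k m: int) (a d : int -> R[i]) (u : R -> R[i]).
Variables (eps1 eps2: R) (chi : R -> R -> R).
Hypothesis (e10 : 0 < eps1) (e12 : eps1 < eps2) (e2 : eps2 < 1 / 2) (hchi : cutoff eps1 eps2 chi).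
Lemma pair_neq0 x y : (x != 0) || (y != 0) -> (x, y) != (0, 0) :> R * R.
by rewrite xpair_eqE negb_and. Qed.

Lemma chi_slice_cont : continuous (fun x=> chi x 1).
move=> x; have nz: [set p | p != (0, 0)] (x, (1: R)) by apply: pair_neq0; rewrite oner_neq0 orbT.
have [h _] := cutoff_smooth hchi 0 [::] nz; have := h isT.
move=> /cont2_eps hc; apply/cvgrPdist_lt => e e0.
have [r r0 hr] := hc e e0; near=> y; rewrite distrC; apply: hr; last by rewrite subrr normr0.
by rewrite distrC; near: y; apply: cvgr_dist_lt=> //; exact: cvg_id.
Unshelve. all: by end_near. Qed.

(** Homogeneity and parity reduce to the line [y = 1], on which [chi] is continuous and vanishes for
    [|x| >= eps2]; on [y = 0] it vanishes. *)
Lemma chi_bdd : exists2 C : R, 0 <= C & forall x y, (x, y) != (0, 0) -> `|chi x y| <= C.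
have [K hK] := cont_bddP chi_slice_cont.
have e1 := e10; have ee := e12; have h2 := e2; have p2 := @pi_ge2 R.
have K0: 0 <= K by apply: le_trans (hK 0 _); rewrite ?lexx//=; lra.
have slice x : `|chi x 1| <= K.
 wlog x0 : x / 0 <= x => [hw|].
 have [x0|x0] := leP 0 x; first exact: hw.
 rewrite (cutoff_oppl hchi); last by apply: pair_neq0; rewrite oner_neq0 orbT.
 by apply: hw; rewrite oppr_ge0 ltW.
 have [x1|x1] := leP x 1; first by apply: hK; rewrite x0/=; lra.
 rewrite (cutoff_zero hchi) ?normr0//; first by apply: pair_neq0; rewrite oner_neq0 orbT.
 by rewrite normr1 mulr1 ger0_norm//; lra.
exists K=> // x y nz; have [y0|y0|y0] := ltrgtP y 0.
- have E := cutoff_homog hchi (t := (- y)^-1) (x1 := x) (x2 := y).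
 rewrite -E ?invr_gt0 ?oppr_gt0//.
 have -> : (- y)^-1 * y = - 1 by rewrite invrN mulNr mulVf// lt_eqF.
 rewrite (cutoff_opp hchi); last by apply: pair_neq0; rewrite oppr_eq0 oner_neq0 orbT.
 by rewrite opprK.
- have E := cutoff_homog hchi (t := y^-1) (x1 := x) (x2 := y).
 by rewrite -E ?invr_gt0// mulVf ?gt_eqF.
rewrite (cutoff_zero hchi) ?normr0//; subst y; by rewrite normr0 mulr0.
Qed.

Definition X k n : R := chi (n - k)%:~R k%:~R.

Lemma X_supp n k : k != 0 -> X k n != 0 -> `|(n - k)%:~R| <= `|k%:~R| / 2 :> R.
move=> k0 /eqP hx; rewrite leNgt; apply/negP => h; apply: hx.
apply: (cutoff_zero hchi); first by apply: pair_neq0; rewrite !intr_eq0 k0 orbT.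
apply: ltW; apply: le_lt_trans h; rewrite mulrC ler_wpM2l//.
by have := e2; lra.
Qed.

Lemma X_one n k : (n != 0) || (k != 0) -> X k n != 1 -> eps1 * `|k%:~R| < `|(n - k)%:~R|.
move=> nz /eqP hx; rewrite ltNge; apply/negP => h; apply: hx; apply: (cutoff_one hchi)=> //.
apply: pair_neq0; rewrite !intr_eq0 subr_eq0; case: (eqVneq k 0) nz => [->|_ _]; rewrite ?orbT ?orbF//.
Qed.

Lemma X_diag n : n != 0 -> X n n = 1.
move=> n0; rewrite /X subrr; apply: (cutoff_one hchi); first by apply: pair_neq0; rewrite !intr_eq0 n0 orbT.
by rewrite normr0 mulr_ge0// ltW.
Qed.

Definition Fseq n : seq int := [seq Posz i - Posz (2 * `|n|)%N | i <- iota 0 (4 * `|n|).+1].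

Lemma Fseq_mem n k : (k \in Fseq n) = (`|k| <= 2 * `|n|)%N.
apply/mapP/idP => [[j hj Ej]|h]; first by move: hj; rewrite mem_iota Ej; lia.
by exists (absz (k + Posz (2 * `|n|)%N)); [rewrite mem_iota; lia|lia].
Qed.

Definition Fn n : {fset int} := [fset k in Fseq n | k != 0]%fset.

Lemma Fn_mem n k : (k \in Fn n) = (k != 0) && (`|k| <= 2 * `|n|)%N.
by rewrite /Fn in_fset andbC -Fseq_mem.
Qed.

Lemma X_out n k : k != 0 -> k \notin Fn n -> X k n = 0.
move=> k0; rewrite Fn_mem k0 /= => h; apply/eqP; apply: contraT => hx.
have := X_supp k0 hx; rewrite -!intr_norm -[in X in X -> _](_ : (2%:Z)%:~R = 2 :> R)//.
rewrite ler_pdivlMr// -intrM ler_int; lia.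
Qed.

Definition TT a d n : R[i] := \sum_(k <- Fn n) (X k n)%:C * a (n - k) * d k.

Lemma para_TT (f : R -> R) c n : paraproduct chi f c n = TT (fc (ofreal f)) c n.
rewrite /paraproduct /paradiff (fsbigE (Fn n)) ?fset_uniq//.
- rewrite big_distrr/= big_mkcond/= /TT; apply: eq_big_seq => k; rewrite Fn_mem => /andP[k0 _].
 by rewrite mem_set// /X /fc; move: (chi _ _)%:C (fourier _ _) => u v; ring.
- by move=> k /=; rewrite Fn_mem => /andP[].
by move=> k /= k0 kF; rewrite -/(X k n) X_out// !mul0r.
Qed.

Lemma TT_lin a b (z : R[i]) d n : TT (fun m=> a m + z * b m) d n = TT a d n + z * TT b d n.
rewrite /TT big_distrr/= -big_split/=; apply: eq_bigr => k _; ring.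
Qed.

Lemma TT_der a d n : 'i * n%:~R * TT a d n =
 TT (fun m=> 'i * m%:~R * a m) d n + TT a (fun k=> 'i * k%:~R * d k) n.
rewrite /TT big_distrr/= -big_split/=; apply: eq_bigr => k _.
have -> : n%:~R = (n - k)%:~R + k%:~R :> R[i] by rewrite -intrD subrK.
ring.
Qed.

Lemma TTZ (z : R[i]) a d n : TT a (fun k=> z * d k) n = z * TT a d n.
by rewrite /TT big_distrr/=; apply: eq_bigr => k _; ring. Qed.

Lemma Fn0 a d : TT a d 0 = 0.
rewrite /TT big1_seq// => k /andP[_]; rewrite Fn_mem => /andP[k0 kn].
by move: kn; rewrite muln0 leqn0 absz_eq0 (negPf k0).
Qed.

(** On the support of the cutoff [|n - k| <= |k| / 2], so [n] is dominated by [k] and the whole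
    weight falls on [d]. *)
Lemma TT_bd (C r: R) a d n : 0 <= r -> (forall x y, (x, y) != (0, 0) -> `|chi x y| <= C) ->
 (asum (fun k=> nc (a (n - k)%R) * (jbp r k * nc (d k)))%R < +oo)%E ->
 jbp r n * nc (TT a d n) <= C * 2 `^ r * cv (fun m=> nc (a m)) (fun k=> jbp r k * nc (d k)) n.
move=> r0 hC hs; have C0: 0 <= C.
 by apply: le_trans (hC 1 0 _); rewrite ?normr_ge0//; apply: pair_neq0; rewrite oner_neq0.
apply: (le_via (C * 2 `^ r * \sum_(k <- Fn n) `|nc (a (n - k)) * (jbp r k * nc (d k))|)); last first.
 by rewrite ler_wpM2l ?mulr_ge0//; exact: cv_ge_fin.
apply: (le_via (jbp r n * \sum_(k <- Fn n) nc ((X k n)%:C * a (n - k) * d k))).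
 by rewrite ler_wpM2l//; exact: nc_sum.
rewrite !big_distrr/= big_seq [leRHS]big_seq; apply: ler_sum => k.
rewrite Fn_mem => /andP[k0 _].
have n1 := nc_ge0 (a (n - k)); have n2 := nc_ge0 (d k).
rewrite ger0_norm ?mulr_ge0// !ncM nc_real.
have [->|hx] := eqVneq (X k n) 0; first by rewrite normr0 !mul0r mulr0 !mulr_ge0.
have hj: jb n <= 2 * jb k :> R.
 have h1 := X_supp k0 hx; have h2 := @jb_sub R n k; move: h2; rewrite /jb.
 by have := normr_ge0 (k%:~R : R); lra.
have hp: jbp r n <= 2 `^ r * jbp r k by rewrite /jbp -powRM ?(ltW (jb_gt0 _))//; apply: powR_mono=> //; exact: ltW.
have hcx: `|X k n| <= C by apply: hC; apply: pair_neq0; rewrite !intr_eq0 k0 orbT.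
rewrite [leLHS](_ : _ = (jbp r n * `|X k n|) * (nc (a (n - k)) * nc (d k))); last by ring.
rewrite [leRHS](_ : _ = (2 `^ r * jbp r k * C) * (nc (a (n - k)) * nc (d k))); last by ring.
by rewrite ler_wpM2r ?mulr_ge0//; apply: ler_pM.
Qed.

Lemma fc_mul_fsum (F : {fset int}) d u n : ccont u ->
 fc (fun x=> (\sum_(j <- F) d j * expi (j%:~R * x)) * u x) n = \sum_(j <- F) d j * fc u (n - j).
move=> cu; rewrite /fc.
have -> : (fun x=> (\sum_(j <- F) d j * expi (j%:~R * x)) * u x) =
 (fun x=> \sum_(j <- F) d j * (u x * expi (j%:~R * x))).
 by apply/funext => x; rewrite big_distrl/=; apply: eq_bigr => j _; ring.
rewrite fourier_sum; last by move=> j; apply: ccontM; [exact: ccontC|apply: ccontM=> //; exact: ccont_expik].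
rewrite big_distrr/=; apply: eq_bigr => j _.
rewrite fourierZ; last by apply: ccontM=> //; exact: ccont_expik.
by rewrite fourier_mulE; ring.
Qed.

(** For fixed [n] the cutoff weights define a trigonometric polynomial [g], and the paraproduct at
    [n] is the coefficient of [g u]. The difference is a coefficient of [(v - g) u], to which
    [mul_maj] applies. Since the paraproduct omits [k = 0], [v] is taken of mean zero. *)
Lemma prod_rem (A B C: R) u v n : (forall x y, (x, y) != (0, 0) -> `|chi x y| <= C) ->
 l1 (fun k=> nc (fc v k)) A -> fc v 0 = 0 -> ccont v -> periodic v tau ->
 ccont u -> (forall k, nc (fc u k) <= B) ->
 nc (fc (fun x=> v x * u x) n - TT (fc u) (fc v) n) <=
 cv (fun k=> `|1 - X k n| * nc (fc v k)) (fun k=> nc (fc u k)) n.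
move=> hC hA v0 cvv pv cu hB.
pose D k := (X k n)%:C * fc v k.
pose g x := \sum_(j <- Fn n) D j * expi (j%:~R * x).
have cg: ccont g by exact: ccont_tsum.
have pg: periodic g tau by move=> x; apply: eq_bigr => j _; rewrite expi_per.
have -> : fc (fun x=> v x * u x) n - TT (fc u) (fc v) n = fc (fun x=> (v x - g x) * u x) n.
 have -> : TT (fc u) (fc v) n = fc (fun x=> g x * u x) n.
 by rewrite fc_mul_fsum//; apply: eq_bigr => k _; rewrite /D; ring.
 rewrite -fcB; [|exact: ccontM|exact: ccontM].
 by apply: (f_equal (fun w=> fc w n)); apply/funext => x; ring.
have hF k : fc (fun x=> v x - g x) k = (1 - X k n)%:C * fc v k.
 rewrite fcB// fc_fsum; case: ifPn => kF; first by rewrite /D RCB mulrBl mul1r.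
 have [->|k0] := eqVneq k 0; first by rewrite v0 mulr0 subr0.
 by rewrite X_out// !subr0 mul1r.
have C0: 0 <= C.
 by apply: le_trans (hC 1 0 _); rewrite ?normr_ge0//; apply: pair_neq0; rewrite oner_neq0.
apply: (mul_maj (A := (1 + C) * A) (B := B))=> //.
- by move=> k; rewrite mulr_ge0 ?nc_ge0.
- have := l1Z (1 + C) hA; rewrite ger0_norm ?addr_ge0//; apply: l1_le => k.
 rewrite !normrM (ger0_norm (nc_ge0 _)) normr_id.
 have [->|k0] := eqVneq k 0; first by rewrite v0 nc0 !mulr0.
 rewrite ler_wpM2r// ger0_norm ?addr_ge0//.
 apply: (le_trans (ler_normB _ _)); rewrite normr1 lerD2l; apply: hC; apply: pair_neq0.
 by rewrite !intr_eq0 k0 orbT.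
- exact: ccontB.
- by move=> x; rewrite pv pg.
by move=> k; rewrite hF ncM nc_real.
Qed.

Lemma nc_fc_Re u k : ccont u -> nc (fc (ofreal (fun x=> cRe (u x))) k) <= sm (fun m=> nc (fc u m)) k.
move=> cu; rewrite /fc ofreal_Re// nc_2piV /sm !nc_2piV ncM nc_real -mulrDr.
have /andP[p0 _] := @twopiV_le1 R; rewrite ler_wpM2l// ger0_norm ?invr_ge0//.
have h := ncD (fourier u k) (cj (fourier u (- k))); rewrite ncJ in h.
have := nc_ge0 (fourier u k + cj (fourier u (- k))); lra.
Qed.

Lemma nc_fc_Im u k : ccont u -> nc (fc (ofreal (fun x=> cIm (u x))) k) <= sm (fun m=> nc (fc u m)) k.
move=> cu; rewrite /fc ofreal_Im// nc_2piV /sm !nc_2piV !ncM ncN nc_i mul1r nc_real -mulrDr.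
have /andP[p0 _] := @twopiV_le1 R; rewrite ler_wpM2l// ger0_norm ?invr_ge0//.
have h := ncB (fourier u k) (cj (fourier u (- k))); rewrite ncJ in h.
have := nc_ge0 (fourier u k - cj (fourier u (- k))); lra.
Qed.

Section Remainder.
Variables (B V et1 G : R -> R) (e ps : int -> R[i]) (W : R -> R[i]).
Hypothesis (hW : forall x, W x = V x +i* - B x) (cW : ccont W) (pW : periodic W tau).
Hypothesis (ce : continuous et1) (pe : periodic et1 tau).
Hypothesis hG : forall x, G x = B x - et1 x * V x.
Hypothesis hps : forall n, 'i * n%:~R * ps n = fc (ofreal (fun x=> V x + B x * et1 x)) n.
Hypothesis he : forall n, fc (ofreal et1) n = 'i * n%:~R * e n.

Let om m : R := nc (fc W m).
Let e1 := fc (ofreal et1).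

Definition REM n : R[i] := fc (ofreal G) n - `|n%:~R|%:C * (ps n - TT (fc (ofreal B)) e n) +
 TT (fc (ofreal V)) e1 n.

Lemma V_Re : V = (fun x=> cRe (W x)).
by apply/funext => x; rewrite hW. Qed.

Lemma B_Im : B = (fun x=> - cIm (W x)).
by apply/funext => x; rewrite hW opprK. Qed.

Lemma cV : continuous V. by rewrite V_Re; case: cW. Qed.

Lemma cB : continuous B. by rewrite B_Im; apply: contN; case: cW. Qed.

Lemma V_coef k : nc (fc (ofreal V) k) <= sm om k.
by rewrite V_Re; exact: nc_fc_Re. Qed.

Lemma B_coef k : nc (fc (ofreal B) k) <= sm om k.
rewrite B_Im; apply: le_trans (nc_fc_Im k cW).
have -> : ofreal (fun x=> - cIm (W x)) = (fun x=> - ofreal (fun x=> cIm (W x)) x).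
 by apply/funext => x; rewrite /ofreal rmorphN.
rewrite /fc fourierN; last by apply: ccontR; case: cW.
by rewrite mulrN ncN.
Qed.

Definition uz (z : R[i]) x : R[i] := (B x)%:C + z * (V x)%:C.

Lemma ccont_uz z : ccont (uz z).
apply: ccontD; first exact: (ccontR cB).
by apply: ccontM; [exact: ccontC|exact: (ccontR cV)].
Qed.

Lemma fc_lin u v z n : ccont u -> ccont v -> fc (fun x=> u x + z * v x) n = fc u n + z * fc v n.
move=> cu cv'; rewrite /fc fourierD//; last by apply: ccontM=> //; exact: ccontC.
by rewrite fourierZ//; ring.
Qed.

Lemma fcZ z u n : ccont u -> fc (fun x=> z * u x) n = z * fc u n.
by move=> cu; rewrite /fc fourierZ// mulrCA. Qed.

Lemma alg_rem (b v ev eb t1 t2 t3 z : R[i]) : z * z = - 1 ->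
 b - ev - - z * (v + eb - (t3 + t2)) + t1 = b + z * v + z * (eb + z * ev - (t2 + z * t1)) - z * t3.
move=> zz; rewrite [RHS](_ : _ = b + z * v + z * eb + z * z * ev - z * t2 - z * z * t1 - z * t3); last by ring.
by rewrite zz; ring.
Qed.

(** With [z = i] for [n > 0] and [z = - i] for [n < 0], multiplication by [|n|] is the derivation
    [- z * (i n)]. All terms then combine into the single function [B + z V]; the derivation leaves
    behind the paraproduct of [B_x] with [eta]. *)
Lemma rem_id z n : z * z = - 1 -> `|n%:~R|%:C = - z * ('i * n%:~R) ->
 REM n = fc (uz z) n + z * (fc (fun x=> (et1 x)%:C * uz z x) n - TT (fc (uz z)) e1 n) -
 z * TT (fun m=> 'i * m%:~R * fc (ofreal B) m) e n.
move=> zz hn; have cbB: ccont (ofreal B) := ccontR cB.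
have cvV: ccont (ofreal V) := ccontR cV.
have cee: ccont (ofreal et1) := ccontR ce.
have E1: fc (ofreal G) n = fc (ofreal B) n - fc (fun x=> (et1 x)%:C * ofreal V x) n.
 rewrite -fcB//; last by apply: ccontM.
 by apply: (f_equal (fun u=> fc u n)); apply/funext => x; rewrite /ofreal hG RCB RCM.
have E2: fc (ofreal (fun x=> V x + B x * et1 x)) n = fc (ofreal V) n + fc (fun x=> (et1 x)%:C * ofreal B x) n.
 have := @fc_lin (ofreal V) (fun x=> (et1 x)%:C * ofreal B x) 1 n cvV (ccontM cee cbB).
 rewrite mul1r => <-; apply: (f_equal (fun u=> fc u n)); apply/funext => x.
 by rewrite /ofreal mul1r rmorphD/= RCM [(B x)%:C * _]mulrC.
have E3 m : fc (uz z) m = fc (ofreal B) m + z * fc (ofreal V) m by exact: fc_lin.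
have E4: fc (fun x=> (et1 x)%:C * uz z x) n =
 fc (fun x=> (et1 x)%:C * ofreal B x) n + z * fc (fun x=> (et1 x)%:C * ofreal V x) n.
 rewrite -fc_lin; [|exact: ccontM|exact: ccontM].
 by apply: (f_equal (fun u=> fc u n)); apply/funext => x; rewrite /uz /ofreal; ring.
have E5: TT (fc (uz z)) e1 n = TT (fc (ofreal B)) e1 n + z * TT (fc (ofreal V)) e1 n.
 by rewrite -TT_lin; apply: (f_equal (fun a=> TT a e1 n)); apply/funext => m; rewrite E3.
have E6 := TT_der (fc (ofreal B)) e n.
have E7: (fun k=> 'i * k%:~R * e k) = e1 by apply/funext => k; rewrite /e1 he.
rewrite E7 in E6.
have E8: `|n%:~R|%:C * (ps n - TT (fc (ofreal B)) e n) = - z * ('i * n%:~R * ps n - 'i * n%:~R * TT (fc (ofreal B)) e n).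
 by rewrite hn; ring.
rewrite /REM E8 hps E1 E2 E3 E4 E5 E6.
exact: alg_rem.
Qed.

Definition wp : int -> R := sm (pos om).

Lemma wp_ge0 k : 0 <= wp k.
by apply: sm_ge0 => m; rewrite /pos; case: ifP=> // _; exact: nc_ge0. Qed.

(** [B + i V = i W] and [B - i V = - i cj W]: in both cases the frequencies with the sign of [n]
    come from the positive frequencies of [W], the smooth ones. *)
Lemma uz_bd n : n != 0 -> exists z : R[i], [/\ z * z = - 1, nc z = 1, `|n%:~R|%:C = - z * ('i * n%:~R),
 forall k, nc (fc (uz z) k) <= sm om k & forall k, 0 < n * k -> nc (fc (uz z) k) <= wp k].
move=> n0; have i2 := @mulii R.
have p0 j : 0 <= pos om j by rewrite /pos; case: ifP=> // _; exact: nc_ge0.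
have [np|np] := ltrP 0 n.
 exists 'i; split; [exact: i2|exact: nc_i| | |].
 - by rewrite gtr0_norm ?ltr0z// RCint mulNr mulrA i2; ring.
 - move=> j; have -> : fc (uz 'i) j = 'i * fc W j.
 rewrite -fcZ//; apply: (f_equal (fun u=> fc u j)); apply/funext => x.
 by rewrite hW /uz; apply: cext; rewrite !reim/=; ring.
 by rewrite ncM nc_i mul1r /sm lerDl nc_ge0.
 move=> j; rewrite pmulr_rgt0// => j0; have -> : fc (uz 'i) j = 'i * fc W j.
 rewrite -fcZ//; apply: (f_equal (fun u=> fc u j)); apply/funext => x.
 by rewrite hW /uz; apply: cext; rewrite !reim/=; ring.
 by rewrite ncM nc_i mul1r /wp /sm {1}/pos j0 lerDl.
have nn: n < 0 by rewrite lt_neqAle n0.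
have cJW: ccont (fun x=> cj (W x)) by exact: ccontJ.
have E j : nc (fc (uz (- 'i)) j) = om (- j).
 have -> : fc (uz (- 'i)) j = - 'i * fc (fun x=> cj (W x)) j.
 rewrite -fcZ//; apply: (f_equal (fun u=> fc u j)); apply/funext => x.
 by rewrite hW /uz; apply: cext; rewrite !reim/=; ring.
 by rewrite ncM ncN nc_i mul1r /fc fourierJ// !nc_2piV ncJ /om /fc nc_2piV.
exists (- 'i); split; [by rewrite mulrNN| by rewrite ncN nc_i| | |].
- by rewrite ltr0_norm ?ltrz0// rmorphN/= RCint opprK mulrA i2; ring.
- by move=> j; rewrite E /sm lerDr nc_ge0.
move=> j; rewrite nmulr_rgt0// => j0; rewrite E /wp /sm.
have -> : pos om (- j) = om (- j) by rewrite /pos oppr_gt0 j0.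
by rewrite lerDr.
Qed.

Variables (r C: R).
Hypothesis (r0 : 0 <= r) (hC : forall x y, (x, y) != (0, 0) -> `|chi x y| <= C).

Let D : R := eps1^-1.
Let E : R := (1 + C) * ((1 + D) `^ r + D).

Lemma D_gt0 : 0 < D. by rewrite invr_gt0. Qed.

Lemma C_ge0' : 0 <= C.
by apply: le_trans (hC (x := 1) (y := 0) _); rewrite ?normr_ge0//; apply: pair_neq0; rewrite oner_neq0. Qed.

Lemma prod_alg (x p q a b c g: R) : 0 <= x -> x <= 1 + C -> 0 <= p -> 0 <= a -> a <= c -> 0 <= b -> b <= g -> p <= (1 + D) `^ r * q -> 0 <= q ->
 p * (x * a * b) <= E * c * (q * g).
move=> x0 xC p0 a0 ac b0 bg pq q0; have D0 := D_gt0; have C0 := C_ge0'.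
rewrite [leLHS](_ : _ = x * p * (a * b)); last by ring.
rewrite [leRHS](_ : _ = (E * q) * (c * g)); last by ring.
apply: ler_pM=> //; rewrite ?mulr_ge0//; last exact: ler_pM.
rewrite /E -mulrA; apply: ler_pM=> //; apply: (le_trans pq).
by rewrite ler_wpM2r// lerDl ltW.
Qed.

Lemma prod_alg2 (x p q a b m g: R) : 0 <= x -> x <= 1 + C -> 0 <= p -> 0 <= a -> 0 <= m -> 0 <= b -> b <= g -> p <= q ->
 p * (x * (D * m * a) * b) <= E * (q * a) * (m * g).
move=> x0 xC p0 a0 m0 b0 bg pq; have D0 := ltW D_gt0; have C0 := C_ge0'.
rewrite [leLHS](_ : _ = (x * D) * (p * (a * m * b))); last by ring.
rewrite [leRHS](_ : _ = E * (q * (a * m * g))); last by ring.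
apply: ler_pM; rewrite ?mulr_ge0//.
 by rewrite /E; apply: ler_pM=> //; rewrite lerDr powR_ge0.
by apply: ler_pM=> //; rewrite ?mulr_ge0// ler_wpM2l// mulr_ge0.
Qed.

Lemma tri_alg (a u v m dk: R) : u <= dk -> v <= u + m -> 0 <= m -> 0 < a -> 1 + v <= 1 + a + m + dk.
lra. Qed.

Lemma add_alg (p x y a b c d f: R) : p * x <= y -> p * a <= b + c -> p * d <= f -> p * (x + a + d) <= y + b + c + f.
by rewrite !mulrDr; lra. Qed.

(** Where the cutoff is not 1, the jump satisfies [|n - k| <= |k| / eps1]. If [k] has the sign of
    [n], the factor at [k] is smooth enough to take the weight; otherwise [|n| <= |n - k|] and [eta]
    takes it, its derivative being charged to [k]. *)
Lemma jump_pt (b : int -> R) n k : n != 0 -> (forall k, 0 <= b k) -> (forall k, b k <= sm om k) ->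
 (forall k, 0 < n * k -> b k <= wp k) ->
 jbp r n * `|(`|1 - X (n - k) n| * nc (e1 (n - k))) * b k| <=
 `|E * nc (e1 (n - k)) * (jbp r k * wp k)| + `|E * (jbp r (n - k) * nc (e (n - k))) * (`|k%:~R| * sm om k)|.
move=> n0 b0 bs bw; have D0 := D_gt0; have C0 := C_ge0'.
have E0: 0 <= E by rewrite /E mulr_ge0 ?addr_ge0 ?(ltW D0).
have a1 := nc_ge0 (e1 (n - k)); have a2 := nc_ge0 (e (n - k)); have a3 := b0 k; have a4 := wp_ge0 k.
have a5: 0 <= sm om k by apply: le_trans (bs k).
have w0: 0 <= `|k%:~R : R| by []; have w1: 0 <= `|1 - X (n - k) n| by [].
have w2: 0 <= jbp r k by []; have w3: 0 <= jbp r (n - k) by [].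
have t1: 0 <= E * nc (e1 (n - k)) * (jbp r k * wp k) by nonneg.
have t2: 0 <= E * (jbp r (n - k) * nc (e (n - k))) * (`|k%:~R| * sm om k) by nonneg.
have t0: 0 <= (`|1 - X (n - k) n| * nc (e1 (n - k))) * b k by nonneg.
rewrite (ger0_norm t0) (ger0_norm t1) (ger0_norm t2).
have [->|hx] := eqVneq (X (n - k) n) 1; first by rewrite subrr normr0 !mul0r mulr0 addr_ge0.
have nz: (n != 0) || (n - k != 0) by rewrite n0.
have hk := X_one nz hx; rewrite opprB addrCA subrr addr0 in hk.
have hj: `|(n - k)%:~R| <= D * `|k%:~R| :> R.
 by rewrite /D mulrC ler_pdivlMr// mulrC; exact: ltW.
have hX: `|1 - X (n - k) n| <= 1 + C.
 apply: (le_trans (ler_normB _ _)); rewrite normr1 lerD2l; apply: hC.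
 by rewrite opprB addrCA subrr addr0; apply: pair_neq0; rewrite !intr_eq0 -negb_and; apply: contra n0 => /andP[/eqP -> /eqP]; rewrite subr0 => ->.
have [nk|nk] := ltrP 0 (n * k).
 apply: (le_via (E * nc (e1 (n - k)) * (jbp r k * wp k))); last by rewrite lerDl.
 apply: prod_alg=> //; first exact: bw.
 rewrite /jbp -powRM ?(ltW (jb_gt0 _)) ?addr_ge0 ?(ltW D0)//; apply: powR_mono=> //; first exact: ltW.
 have tri: `|n%:~R| <= `|(n - k)%:~R| + `|k%:~R| :> R 
 by have := ler_normD ((n - k)%:~R : R) k%:~R; rewrite -intrD subrK.
 have EE: (1 + D) * jb k = 1 + D + `|k%:~R| + D * `|k%:~R| by rewrite /jb; ring.
 move: hj tri w0 D0; rewrite EE /jb.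
 exact: tri_alg.
apply: (le_via (E * (jbp r (n - k) * nc (e (n - k))) * (`|k%:~R| * sm om k))); last by rewrite lerDr.
have e1le: nc (e1 (n - k)) <= D * `|k%:~R| * nc (e (n - k)).
 by rewrite /e1 he !ncM nc_i mul1r nc_int ler_wpM2r.
apply: (le_via (jbp r n * (`|1 - X (n - k) n| * (D * `|k%:~R| * nc (e (n - k))) * b k))).
 by rewrite ler_wpM2l// ler_wpM2r// ler_wpM2l.
apply: prod_alg2=> //; rewrite /jbp; apply: powR_mono=> //; first exact: ltW.
rewrite /jb lerD2l -!intr_norm ler_int.
by move: nk n0; clear; nia.
Qed.

Variables (A M1 T T1 Tw: R).
Hypothesis (hA : l1 (fun k=> nc (e1 k)) A) (hM : hn r (fun k=> nc (e k)) M1) (hT : forall k, om k <= T).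
Hypothesis (hw : hn r wp Tw) (hs1 : l1 (fun k=> `|k%:~R| * sm om k) T1).

Let Z0 : R := 2 * T + A * (2 * T).
(** In this order: [B + z V] itself, jumps between frequencies of equal sign, jumps between opposite
    signs, the paraproduct of [B_x] with [eta], and frequency 0. *)
Definition major n : R := jbp r n * wp n + cv (fun k=> E * nc (e1 k)) (fun k=> jbp r k * wp k) n +
 cv (fun k=> `|k%:~R| * sm om k) (fun k=> E * (jbp r k * nc (e k))) n +
 C * 2 `^ r * cv (fun k=> `|k%:~R| * sm om k) (fun k=> jbp r k * nc (e k)) n +
 Z0 * (if n == 0 then 1 else 0).

Lemma sm_om_le k : 0 <= sm om k <= 2 * T.
rewrite /sm addr_ge0 ?nc_ge0//=; have := hT k; have := hT (- k); lra.
Qed.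

Lemma T_pos : 0 <= T. by apply: le_trans (hT 0); exact: nc_ge0. Qed.

Lemma rem_major n : jbp r n * nc (REM n) <= major n.
have D0 := D_gt0; have C0 := C_ge0'; have T0 := T_pos.
have E0: 0 <= E by rewrite /E mulr_ge0 ?addr_ge0 ?(ltW D0).
have A0: 0 <= A := l1_ge0 hA.
have cvs (a b : int -> R) m : 0 <= cv a b m by exact: cv_ge0.
have z1: 0 <= jbp r n * wp n by rewrite mulr_ge0 ?wp_ge0.
have z2: 0 <= C * 2 `^ r by rewrite mulr_ge0.
(* Frequency 0 has no sign and no paraproduct terms; there the coefficient of [G] is bounded
   directly. *)
have [n0|n0] := eqVneq n 0.
 rewrite n0 in z1 *.
 have -> : jbp r 0 = 1 :> R by rewrite /jbp /jb normr0 addr0 powR1.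
 rewrite /major eqxx mulr1 mul1r.
 apply: (le_via Z0); last by rewrite lerDr !addr_ge0// mulr_ge0// cvs.
 rewrite /REM !Fn0 addr0 normr0 mul0r subr0.
 have -> : fc (ofreal G) 0 = fc (ofreal B) 0 - fc (fun x=> (et1 x)%:C * ofreal V x) 0.
 rewrite -fcB; [|exact: (ccontR cB)|apply: ccontM; [exact: (ccontR ce)|exact: (ccontR cV)]].
 by apply: (f_equal (fun u=> fc u 0)); apply/funext => x; rewrite /ofreal hG RCB RCM.
 apply: (le_trans (ncB _ _)); rewrite /Z0; apply: lerD.
 by apply: (le_trans (B_coef 0)); have /andP[] := sm_om_le 0.
 have hV2 k : nc (fc (ofreal V) k) <= 2 * T by apply: (le_trans (V_coef k)); have /andP[] := sm_om_le k.
 apply: (le_via (cv (fun k=> nc (e1 k)) (fun k=> nc (fc (ofreal V) k)) 0)).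
 apply: (mul_fc 0 hA); [exact: (ccontR ce)| |exact: (ccontR cV)].
 by move=> x; rewrite /ofreal pe.
 by apply: (cv_pt _ hA) => k; rewrite ger0_norm ?nc_ge0.
have [z [zz nz hz zs zw]] := uz_bd n0.
rewrite (rem_id zz hz) /major (negPf n0) mulr0 addr0.
have s1: (asum (fun k=> (E * nc (e1 (n - k)) * (jbp r k * wp k)))%R < +oo)%E.
 have h1: l1 (fun k=> E * nc (e1 k)) (`|E| * A) by exact: l1Z.
 exact: (l1l2_summable n (l1_l2 h1) hw).
have s2: (asum (fun k=> (E * (jbp r (n - k) * nc (e (n - k))) * (`|k%:~R| * sm om k)))%R < +oo)%E.
 have h1: l2 (fun k=> E * (jbp r k * nc (e k))) (`|E| * M1) by exact: l2Z.
 exact: (l1l2_summable n h1 (l1_l2 hs1)).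
have J: jbp r n * cv (fun k=> `|1 - X k n| * nc (e1 k)) (fun k=> nc (fc (uz z) k)) n <=
 cv (fun k=> E * nc (e1 k)) (fun k=> jbp r k * wp k) n +
 cv (fun k=> `|k%:~R| * sm om k) (fun k=> E * (jbp r k * nc (e k))) n.
 rewrite [X in _ <= _ + X]cvC; apply: cv_le2=> // k.
 exact: (@jump_pt (fun k=> nc (fc (uz z) k)) n k n0 (fun j=> nc_ge0 _) zs zw).
have P := prod_rem (A := A) (B := 2 * T) (C := C) (u := uz z) (v := ofreal et1) n hC hA.
have e10': fc (ofreal et1) 0 = 0 by rewrite he mulr0 mul0r.
have peo: periodic (ofreal et1) tau by move=> x; rewrite /ofreal pe.
have hB2 k : nc (fc (uz z) k) <= 2 * T by apply: (le_trans (zs k)); have /andP[] := sm_om_le k.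
have {}P := P e10' (ccontR ce) peo (ccont_uz z) hB2.
have s3: (asum (fun k=> (`|(n - k)%:~R| * sm om (n - k) * (jbp r k * nc (e k))))%R < +oo)%E.
 exact: (l1l2_summable n (l1_l2 hs1) hM).
have le3 k : `|nc ('i * k%:~R * fc (ofreal B) k)| <= Num.norm (`|k%:~R| * sm om k).
 have /andP[q1 _] := sm_om_le k.
 rewrite (ger0_norm (nc_ge0 _)) (ger0_norm (mulr_ge0 (normr_ge0 _) q1)).
 rewrite ncM ncM nc_i mul1r nc_int.
 apply: ler_wpM2l=> //.
 exact: (B_coef k).
have s4 := summable_le s3 le3 (fun k=> lexx _).
have Q := TT_bd (a := fun m=> 'i * m%:~R * fc (ofreal B) m) r0 hC s4.
have Q2: C * 2 `^ r * cv (fun m=> nc ('i * m%:~R * fc (ofreal B) m)) (fun k=> jbp r k * nc (e k)) n <=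
 C * 2 `^ r * cv (fun k=> `|k%:~R| * sm om k) (fun k=> jbp r k * nc (e k)) n.
 by rewrite ler_wpM2l//; apply: cv_mono.
set t1 := fc (uz z) n; set t2 := _ - TT _ _ _ in P *; set t3 := TT _ _ _ in Q *.
have hn: nc (t1 + z * t2 - z * t3) <= nc t1 + nc t2 + nc t3.
 apply: (le_trans (ncB _ _)); rewrite ncM nz mul1r lerD2r.
 by apply: (le_trans (ncD _ _)); rewrite ncM nz mul1r.
apply: (le_trans (ler_wpM2l (jbp_ge0 r n) hn)).
have h1: jbp r n * nc t1 <= jbp r n * wp n.
 by rewrite ler_wpM2l//; apply: zw; move: n0; clear; nia.
have h2 := le_trans (ler_wpM2l (jbp_ge0 r n) P) J.
exact: add_alg h1 h2 (le_trans Q Q2).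
Qed.

Lemma rem_hn : hn r (fun n=> nc (REM n))
 (Tw + E * A * Tw + T1 * (E * M1) + C * 2 `^ r * (T1 * M1) + Z0).
have D0 := D_gt0; have C0 := C_ge0'; have T0 := T_pos.
have E0: 0 <= E by rewrite /E mulr_ge0 ?addr_ge0 ?(ltW D0).
have A0: 0 <= A := l1_ge0 hA.
have Z00: 0 <= Z0 by rewrite /Z0 addr_ge0 ?mulr_ge0.
have h1: l1 (fun k=> E * nc (e1 k)) (E * A) by have := l1Z E hA; rewrite ger0_norm.
have h2: l2 (fun k=> E * (jbp r k * nc (e k))) (E * M1) by have := l2Z E hM; rewrite ger0_norm.
have h3 := young2 h1 hw.
have h4 := young2 hs1 h2.
have h5 := l2Z (C * 2 `^ r) (young2 hs1 hM).
rewrite ger0_norm in h5; last by rewrite mulr_ge0.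
have h6: l2 (fun n : int => Z0 * (if n == 0 then 1 else 0)) Z0.
 have /hn0 := @delta_hn R 0; move=> h; have := l2Z Z0 h; rewrite mulr1 ger0_norm//.
apply: l2_le (l2D (l2D (l2D (l2D hw h3) h4) h5) h6) => n.
rewrite ger0_norm ?mulr_ge0//; apply: le_trans (ler_norm _).
exact: rem_major.
Qed.

End Remainder.

End Cutoff.

(** * Assembly of the remainder estimate and the theorem *)

Section Main.
Context {R : realType}.
Implicit Types (eta beta psi G : R -> R) (s h M gamma: R) (n k: int).

Lemma l1_jb_der (c : int -> R[i]) (C: R) : l1 (fun k=> jb k ^+ 2 * nc (c k)) C ->
 l1 (fun k=> nc ('i * k%:~R * c k)) C.
apply: l1_le => k; have j1 := @jb_ge1 R k; have n0 := nc_ge0 (c k).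
rewrite (ger0_norm (nc_ge0 _)) (ger0_norm (mulr_ge0 (sqr_ge0 _) n0)).
rewrite ncM ncM nc_i mul1r nc_int ler_wpM2r//; apply: (le_trans (nk_jb k)).
by rewrite expr2 ler_peMr// (le_trans ler01).
Qed.

Lemma nc_2pi (z : R[i]) : nc (tau%:C * z) = tau * nc z.
by rewrite ncM nc_real ger0_norm// twopi_ge0. Qed.

Lemma hn_fourier r (u : R -> R[i]) (X: R) : hn r (fun k=> nc (fc u k)) X ->
 hn r (fun k=> nc (fourier u k)) (tau * X).
move=> h; have := hnZ tau h; rewrite ger0_norm ?twopi_ge0//.
by apply: hn_le => k; rewrite fourier_fc nc_2pi.
Qed.

Section Para.
Variables (eps1 eps2: R) (chi : R -> R -> R).
Hypothesis (e10 : 0 < eps1) (e12 : eps1 < eps2) (e2 : eps2 < 1 / 2) (hchi : cutoff eps1 eps2 chi).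

(** A symbol independent of [x] has only its mean, so the sum reduces to [k = n], where the cutoff
    is 1. The omission of [k = 0] agrees with [|0| = 0]. *)
Lemma para_norm (c : int -> R[i]) n :
 paradiff chi (fun x xi => `|xi|%:C + 0) c n = `|n%:~R|%:C * c n.
have E k m : fourier (fun _ : R => `|k%:~R|%:C + 0) m = if m == 0 then tau%:C * `|k%:~R|%:C else 0 :> R[i].
 by rewrite fourier_fc addr0 fc_cst; case: ifP=> // _; rewrite mulr0.
rewrite /paradiff; have [->|n0] := eqVneq n 0.
 rewrite fsbig1 ?mulr0 ?normr0 ?mul0r// => k /= k0.
 by rewrite E sub0r oppr_eq0 (negPf k0) mulr0 mul0r.
rewrite (fsbigE [:: n])//=.
- rewrite big_cons big_nil mem_set// E subrr eqxx addr0.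
 have := X_diag e10 hchi n0; rewrite /X subrr => ->.
 by rewrite mul1r RCV !mulrA mulVf ?mul1r//; apply/negP => /eqP[] /eqP; rewrite gt_eqF ?twopi_gt0.
- by move=> k /=; rewrite inE => /eqP ->.
move=> k /= k0; rewrite inE => kn; rewrite E subr_eq0 eq_sym (negPf kn).
by rewrite mulr0 mul0r.
Qed.

Definition remainder eta psi G n : R[i] :=
 fourier (ofreal G) n - paradiff chi (fun x xi => `|xi|%:C + 0) (DN_omega chi eta psi G) n +
 paraproduct chi (DN_V eta psi G) (fourier (ofreal (derive1 eta))) n.

Lemma DN_omegaE eta psi G n : DN_omega chi eta psi G n =
 tau%:C * (fc (ofreal psi) n - TT chi (fc (ofreal (DN_B eta psi G))) (fc (ofreal eta)) n).
rewrite /DN_omega (para_TT e10 e12 e2 hchi) mulrBr -TTZ -fourier_fc; congr (_ - _).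
by apply: (f_equal (fun d=> TT chi _ d n)); apply/funext => k; rewrite fourier_fc.
Qed.

Lemma remainderE eta psi G n : remainder eta psi G n = tau%:C *
 REM chi (DN_B eta psi G) (DN_V eta psi G) (derive1 eta) G (fc (ofreal eta)) (fc (ofreal psi)) n.
rewrite /remainder para_norm DN_omegaE (para_TT e10 e12 e2 hchi) /REM fourier_fc.
have -> : fourier (ofreal (derive1 eta)) = (fun k=> tau%:C * fc (ofreal (derive1 eta)) k).
 by apply/funext => k; rewrite fourier_fc.
rewrite TTZ; ring.
Qed.

(** Only l1 bounds on the coefficients of [B] are used, so the paraproduct keeps the regularity of
    [eta]. *)
Lemma omega_hn s (C X Y Z: R) eta psi G : 0 <= s -> (forall x y, (x, y) != (0, 0) -> `|chi x y| <= C) ->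
 l1 (fun k=> nc (fc (ofreal (DN_B eta psi G)) k)) X -> hn s (fun k=> nc (fc (ofreal eta) k)) Y ->
 hn s (fun k=> nc (fc (ofreal psi) k)) Z ->
 hn s (fun n=> nc (DN_omega chi eta psi G n)) (tau * (Z + C * 2 `^ s * (X * Y))).
move=> s0 hC hX hY hZ; have pp0: 0 <= tau := @twopi_ge0 R.
have C0: 0 <= C by exact: (@C_ge0' R chi C hC).
have c0: 0 <= C * 2 `^ s by rewrite mulr_ge0.
have h1 := l2Z (C * 2 `^ s) (young2 hX hY); rewrite (ger0_norm c0) in h1.
have h2 := l2Z tau (l2D hZ h1); rewrite (ger0_norm pp0) in h2.
apply: l2_le h2 => n; have j0 := @jbp_ge0 R s n.
rewrite ger0_norm ?mulr_ge0//; apply: le_trans (ler_norm _).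
rewrite DN_omegaE nc_2pi mulrCA ler_wpM2l//.
apply: (le_trans (ler_wpM2l j0 (ncB _ _))); rewrite mulrDr lerD2l.
apply: (TT_bd e10 e12 e2 hchi s0 hC).
exact: (l1l2_summable n (l1_l2 hX) hY).
Qed.

Lemma main_alg (E A K M C p T: R) :
 (2 + E * A * 2 + 2 * K * (E * M) + C * p * (2 * K * M) + (2 + A * 2)) * T =
 2 * T + E * A * (2 * T) + K * (2 * T) * (E * M) + C * p * (K * (2 * T) * M) + (2 * T + A * (2 * T)).
ring. Qed.

Lemma bound_split (K C x y: R) : K <= C -> 0 <= x -> 0 <= y -> K * (x + y) <= C * x + y * C.
by move=> KC x0 y0; rewrite mulrDr [y * C]mulrC; apply: lerD; exact: ler_wpM2r. Qed.

Lemma remainder_split (f p q : R[i]) : f = p - q + (f - p + q).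
ring. Qed.

Lemma main_estimate s h (h0: R) M : 5 / 2 < s -> 0 < h -> 0 < h0 -> 0 <= M -> exists2 K : R, 0 <= K &
 forall eta beta gamma psi G, sobolev_fun (s + 1 / 2) eta -> sobolev_fun (s + 1 / 2) beta ->
 sobolev_fun_norm (s + 1 / 2) eta <= M -> sobolev_fun_norm (s + 1 / 2) beta <= M ->
 (forall x, h0 <= h - beta x + eta x) -> sobolev_fun s psi -> is_DN h eta beta gamma psi G ->
 [/\ in_sobolev s (DN_omega chi eta psi G), sobolev_fun (s - 1) (DN_V eta psi G),
 sobolev_fun (s - 1) (DN_B eta psi G), in_sobolev (s + 1 / 2) (remainder eta psi G) &
 sobolev_norm (s + 1 / 2) (remainder eta psi G) <= K * (sobolev_fun_norm s psi + `|gamma|)].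
move=> s5 h_gt h00 M0.
have r0: 0 <= s + 1 / 2 by lra.
have s0: 0 <= s by lra.
have s1: 0 <= s - 1 by lra.
have sr: s <= s + 1 / 2 by lra.
have s6: 5 / 2 < s + 1 / 2 by lra.
have s7: 1 / 2 < s - 1 - 1 by lra.
have s8: 1 / 2 < s - 1 by lra.
have [K0 K00 hK] := trace_estimate s5 h_gt h00 M0.
have [Ke Ke0 hKe] := sob_curve s6.
have [Kp Kp0 hKp] := sob_curve s5.
have [C C0 hC] := chi_bdd e10 e12 e2 hchi.
have [K4 K40 hK4] := hn_l1w s7.
have [K5 K50 hK5] := hn_l1 s8.
pose A := Ke * M; pose M1 := 2 `^ (s + 1 / 2) * M.
pose E : R := (1 + C) * ((1 + eps1^-1) `^ (s + 1 / 2) + eps1^-1).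
have A0: 0 <= A by rewrite mulr_ge0.
have M10: 0 <= M1 by rewrite mulr_ge0.
have i0: 0 <= eps1^-1 by rewrite invr_ge0 ltW.
have E0: 0 <= E by rewrite /E mulr_ge0 ?addr_ge0.
have P0: 0 <= 2 `^ (s + 1 / 2) by rewrite powR_ge0.
have pp0: 0 <= tau := @twopi_ge0 R.
pose Q := 2 + E * A * 2 + 2 * K4 * (E * M1) + C * 2 `^ (s + 1 / 2) * (2 * K4 * M1) + (2 + A * 2).
have Q0: 0 <= Q by rewrite /Q; nonneg.
exists (tau * (Q * K0)); first by nonneg.
move=> eta beta gamma psi G heta hbeta neta nbeta gap hpsi hDN.
have [cW pW hG hw1 hw2] := hK _ _ _ _ _ heta hbeta neta nbeta gap hpsi hDN.
set T := K0 * _ in hw1 hw2; set W := WB eta psi G in cW pW hw1 hw2.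
set B := DN_B eta psi G; set V := DN_V eta psi G.
have T0: 0 <= T := l2_ge0 hw1.
have [peta ceta _] := heta; have [ppsi cpsi _] := hpsi.
have hce := hKe _ heta; have ec := curve_inv ceta peta hce; have De := derive1_curve hce ec.
have hcp := hKp _ hpsi; have pc := curve_inv cpsi ppsi hcp; have Dp := derive1_curve hcp pc.
have ce1: continuous (derive1 eta) by rewrite De; exact: (eta1_cont hce).
have pe1: periodic (derive1 eta) tau by rewrite De; exact: eta1_per.
have he n : fc (ofreal (derive1 eta)) n = 'i * n%:~R * fc (ofreal eta) n.
 rewrite -mulrA; apply: fc_der; [exact: ccontR| |by move=> x; rewrite /ofreal peta].
 by move=> x; apply: cderR; rewrite De; exact: (eta1_der hce ec).
have hps n : 'i * n%:~R * fc (ofreal psi) n = fc (ofreal (fun x=> V x + B x * derive1 eta x)) n.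
 have -> : (fun x=> V x + B x * derive1 eta x) = derive1 psi.
 by apply/funext => x; rewrite /V /DN_V -/B subrK.
 rewrite -mulrA; symmetry; apply: fc_der; [|  |by move=> x; rewrite /ofreal ppsi].
 by apply: ccontR; rewrite Dp; exact: (eta1_cont hcp).
 by move=> x; apply: cderR; rewrite Dp; exact: (eta1_der hcp pc).
have hW x : W x = V x +i* - B x by [].
have hsm: hn (s - 1) (sm (fun k=> nc (fc W k))) (2 * T) := sm_hn hw1.
have hA: l1 (fun k=> nc (fc (ofreal (derive1 eta)) k)) A.
 have hk: Ke * sobolev_fun_norm (s + 1 / 2) eta <= A := ler_wpM2l Ke0 neta.
 by apply: (l1W hk); apply: l1_le (l1_jb_der hce) => k; rewrite he.
have hM := coef_le r0 heta neta.
have hT k : nc (fc W k) <= T.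
 by have := l2_pt k (hn_l2 s1 hw1); rewrite ger0_norm ?nc_ge0.
have hwp: hn (s + 1 / 2) (wp W) (2 * T) := sm_hn hw2.
have hs1: l1 (fun k=> `|k%:~R| * sm (fun m=> nc (fc W m)) k) (K4 * (2 * T)).
 apply: l1_le (hK4 _ _ hsm) => k; rewrite !normrM ler_wpM2r// normr_id jbp1.
 by rewrite ger0_norm ?nk_jb// (le_trans ler01 (jb_ge1 k)).
have hR := rem_hn e10 e12 e2 hchi hW cW ce1 pe1 hG hps he r0 hC hA hM hT hwp hs1.
have cB': continuous B := cB hW cW.
have cV': continuous V := cV hW cW.
have hBc: hn (s - 1) (fun k=> nc (fc (ofreal B) k)) (2 * T).
 apply: hn_le hsm => k; rewrite ger0_norm//; apply: le_trans (ler_norm _).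
 exact: (B_coef hW cW k).
have hVc: hn (s - 1) (fun k=> nc (fc (ofreal V) k)) (2 * T).
 apply: hn_le hsm => k; rewrite ger0_norm//; apply: le_trans (ler_norm _).
 exact: (V_coef hW cW k).
have hrem: hn (s + 1 / 2) (fun n=> nc (remainder eta psi G n)) (tau * (Q * T)).
 have := hnZ tau hR; rewrite ger0_norm// => h1.
 have -> : Q * T = 2 * T + E * A * (2 * T) + K4 * (2 * T) * (E * M1) +
 C * 2 `^ (s + 1 / 2) * (K4 * (2 * T) * M1) + (2 * T + A * (2 * T)).
 exact: main_alg.
 by apply: hn_le h1 => k; rewrite remainderE nc_2pi.
split.
- have hBl := hK5 _ _ hBc.
 have hes: hn s (fun k=> nc (fc (ofreal eta) k)) M1 := hnW sr (lexx _) hM.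
 by have [] := hn_sob s0 (omega_hn s0 hC hBl hes (sob_coef s0 hpsi)).
- split=> //.
 + by move=> x; have := pW x; rewrite !hW => -[].
 + by have [] := hn_sob s1 (hn_fourier hVc).
- split=> //.
 + by move=> x; have := pW x; rewrite !hW => -[_ /oppr_inj].
 + by have [] := hn_sob s1 (hn_fourier hBc).
- by have [] := hn_sob r0 hrem.
have [_ h1] := hn_sob r0 hrem; apply: (le_trans h1).
by rewrite /T !mulrA lexx.
Qed.

End Para.

Lemma derive1n_zero (j: nat) : derive1n j (fun _ : R => 0 : R) = (fun _=> 0).
elim: j => [|j IH]; first by [].
by rewrite derive1nS IH; apply/funext => x; rewrite derive1E; exact: derive_cst.
Qed.

Lemma symbol_zero : symbol_of_order 0 (fun _ _ : R => 0 : R[i]).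
have dz (j: nat) (xi: R) : derivable (derive1n j (fun _ : R => 0 : R)) xi 1.
 by rewrite derive1n_zero; exact: derivable_cst.
exists 0=> //; split; first by move=> x; split=> j xi _; exact: dz.
move=> j; exists 1=> // xi _; rewrite /Winf_le truncn0; exists (fun _ x => dxi j (fun _ _ => 0) x xi).
split=> //; last by rewrite subrr ltxx.
move=> i _; have E: (fun x : R => dxi j (fun _ _ => 0 : R[i]) x xi) = (fun _=> 0).
 by apply/funext => x; rewrite /dxi /= derive1n_zero.
rewrite E; split; [by [] | exact: measurable_cst | exact: measurable_cst|].
apply: aeW => x; rewrite Normc.normc0 mul1r; exact: powR_ge0.
Qed.

(* A bound on every ball yields a bound monotone in the radii. *)
Lemma monotone_majorant (K : nat -> R) : (forall i, 0 <= K i) -> exists C : R -> R -> R,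
 (forall a a' b b', a <= a' -> b <= b' -> C a b <= C a' b') /\
 forall a b, exists i : nat, [/\ a <= i%:R, b <= i%:R & K i <= C a b].
move=> K0; pose N (a b: R) := (Num.truncn (Num.max a b)).+1.
exists (fun a b => \sum_(0 <= i < (N a b).+1) K i); split.
 move=> a a' b b' ha hb; have hN: (N a b <= N a' b')%N.
 by rewrite ltnS; apply: le_truncn; rewrite ge_max !le_max ha hb orbT.
 rewrite [leRHS](big_cat_nat _ (n := (N a b).+1))//= lerDl.
 by apply: sumr_ge0 => i _.
move=> a b; exists (N a b).
have h: Num.max a b <= (N a b)%:R by apply: ltW; exact: truncnS_gt.
move: (h); rewrite ge_max => /andP[-> ->]; split=> //.
by rewrite big_nat_recr//= lerDr; apply: sumr_ge0 => i _.
Qed.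

End Main.

Theorem theorem2 (R : realType) :
  exists eps0 : R, 0 < eps0 /\
  forall (eps1 eps2 : R) (chi : R -> R -> R),
    0 < eps1 -> eps1 < eps2 -> eps2 < eps0 -> cutoff eps1 eps2 chi ->
  forall h h0 s : R, 0 < h -> 0 < h0 -> 5 / 2 < s ->
  exists C1 C2 : R -> R -> R,
    (forall a a' b b', a <= a' -> b <= b' -> C1 a b <= C1 a' b') /\
    (forall a a' b b', a <= a' -> b <= b' -> C2 a b <= C2 a' b') /\
  forall eta : R -> R, sobolev_fun (s + 1 / 2) eta ->
  exists lambda0 : R -> R -> R[i], symbol_of_order 0 lambda0 /\
  forall (beta : R -> R) (gamma : R) (psi G : R -> R),
    sobolev_fun (s + 1 / 2) beta ->
    (forall x, h0 <= h - beta x + eta x) ->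
    sobolev_fun s psi ->
    is_DN h eta beta gamma psi G ->
    let B := DN_B eta psi G in
    let V := DN_V eta psi G in
    let omega := DN_omega chi eta psi G in
    let lambda := fun x xi : R => `|xi|%:C + lambda0 x xi in
    [/\ in_sobolev s omega,
        sobolev_fun (s - 1) V,
        sobolev_fun (s - 1) B &
    exists Rem : int -> R[i],
      [/\ forall n : int,
            fourier (ofreal G) n =
              paradiff chi lambda omega n
              - paraproduct chi V (fourier (ofreal (derive1 eta))) n
              + Rem n,
          in_sobolev (s + 1 / 2) Rem &
          sobolev_norm (s + 1 / 2) Rem <=
            C1 (sobolev_fun_norm (s + 1 / 2) eta)
               (sobolev_fun_norm (s + 1 / 2) beta)
              * sobolev_fun_norm s psi
            + `|gamma| * C2 (sobolev_fun_norm (s + 1 / 2) eta)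
                            (sobolev_fun_norm (s + 1 / 2) beta)]].
Proof.
(* With [eps2 < 1 / 2] the cutoff forces [|n - k| <= |k| / 2], so [|k| <= 2 |n|] and the sums are
   finite. *)
exists (1 / 2); split; first by [].
move=> eps1 eps2 chi e10 e12 e2 hchi h h0 s h_gt h00 s5.
(* Integer radii allow one constant per ball to be chosen as a sequence. *)
have ex (i : nat) := main_estimate e10 e12 e2 hchi s5 h_gt h00 (ler0n R i).
have [K hK] := choice (fun i => let: ex_intro2 K k0 hk := ex i in ex_intro _ K (conj k0 hk)).
have [C [Cmono hC]] := monotone_majorant (fun i => (hK i).1).
(* One function serves twice because [main_estimate] bounds the remainder by a multiple of the sum
   of the norm of [psi] and [|gamma|]. *)
exists C, C; split => //; split => // eta heta.
exists (fun _ _ => 0); split; first exact: symbol_zero.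
move=> beta gamma psi G hbeta gap hpsi hDN B V omega lambda.
have [i [ia ib iK]] := hC (sobolev_fun_norm (s + 1 / 2) eta) (sobolev_fun_norm (s + 1 / 2) beta).
have [r1 r2 r3 r4 r5] := (hK i).2 _ _ _ _ _ heta hbeta ia ib gap hpsi hDN.
split; [exact: r1|exact: r2|exact: r3|exists (remainder chi eta psi G)].
split; [move=> n; exact: remainder_split|exact: r4|].
apply: (le_trans r5); apply: bound_split iK _ _; last exact: normr_ge0.
exact: sobolev_norm_ge0.
Qed.
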